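(* Let $h_{i,n}\to h_i$ in $C^1(\mathbb{S}^2)$ as $n\to\infty$, $i=1,2$, with $0<m_i\le h_{i,n}(x)\le M_i$ for all $x\in\mathbb{S}^2$, all $n$, and $i=1,2$, where $m_i,M_i$ are constants. Let $(u_n,\psi_n)\in H^1(\mathbb{S}^2)\times H^{1/2}(\mathcal{S}\mathbb{S}^2)$ be a sequence of weak solutions of $$\begin{cases} -\Delta u_n = h_{1,n}e^{2u_n} - 1 + h_{2,n}e^{u_n}|\psi_n|^2, & \text{on } \mathbb{S}^2,\\ D\psi_n = h_{2,n}e^{u_n}\psi_n, & \text{on } \mathbb{S}^2.\end{cases}$$ If $u_n\in\mathscr{S}$ for all $n$ and $\|\psi_n\|_{L^{32/7}(\mathcal{S}\mathbb{S}^2)}$ is bounded uniformly in $n$, then there is a constant $C$ independent of $n$ such that $$\|(u_n,\psi_n)\|_{H^1(\mathbb{S}^2)\times H^{1/2}(\mathcal{S}\mathbb{S}^2)}\le C .$$ In particular, (i) $u_n\ge -C$ and (ii) $\int_{\mathbb{S}^2}|\nabla u_n|^2\,dv_{g_0}\le C$.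
   Context: $\mathbb{S}^2\subset\mathbb{R}^3$ has its standard round metric $g_0$, volume form $dv_{g_0}$, and its unique spin structure; $\mathcal{S}\mathbb{S}^2$ is the spinor bundle, $\Delta$ the (nonpositive) Laplace–Beltrami operator, and $D\psi=\sum_{\alpha=1}^2 e_\alpha\cdot\nabla_{e_\alpha}\psi$ the Dirac operator (with $X\cdot Y+Y\cdot X=-2g_0(X,Y)$). The $u_n$ are real-valued. $H^{1/2}(\mathcal{S}\mathbb{S}^2)$ is the domain in $L^2$ of $|D|^{1/2}$ with norm $\|\psi\|_{H^{1/2}}^2=\|\psi\|_{L^2}^2+\||D|^{1/2}\psi\|_{L^2}^2$. With $x_1,x_2,x_3$ the coordinate functions of $\mathbb{R}^3$ restricted to $\mathbb{S}^2$, $$\mathscr{S}=\left\{u\in H^1(\mathbb{S}^2):\ \frac{1}{4\pi}\int_{\mathbb{S}^2}e^{2u}x_j\,dv_{g_0}=0,\ j=1,2,3\right\}.$$ *)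

(* Defs.v *)
From HB Require Import structures.
From mathcomp Require Import all_boot all_order all_algebra.
From mathcomp Require Import all_classical all_reals all_analysis.
From mathcomp Require Import measurable_realfun complex ring.

Set Implicit Arguments.
Unset Strict Implicit.
Unset Printing Implicit Defensive.

Import Order.TTheory GRing.Theory Num.Theory.
Import numFieldNormedType.Exports.

Local Open Scope classical_set_scope.
Local Open Scope ring_scope.
Local Open Scope complex_scope.

Definition dot (R : realType) (v w : 'rV[R]_3) : R := \sum_i v 0 i * w 0 i.

Definition vec3 (R : realType) (a b c : R) : 'rV[R]_3 :=
  \row_i [:: a; b; c]`_i.

Lemma dot_vec3 (R : realType) (a b c a' b' c' : R) :
  dot (vec3 a b c) (vec3 a' b' c') = a * a' + b * b' + c * c'.
Proof.
by rewrite /dot !big_ord_recl big_ord0 !mxE /= addr0 addrA.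
Qed.

Definition S2 (R : realType) := {x : 'rV[R]_3 | dot x x == 1}.

Definition pt (R : realType) (x : S2 R) : 'rV[R]_3 := val x.

HB.instance Definition _ (R : realType) := Choice.on (S2 R).

Lemma pole_subproof (R : realType) :
  dot (vec3 0 0 1 : 'rV[R]_3) (vec3 0 0 1) == 1.
Proof. by rewrite dot_vec3 !mul0r !add0r mulr1. Qed.

Definition pole (R : realType) : S2 R := exist _ (vec3 0 0 1) (pole_subproof R).

HB.instance Definition _ (R : realType) := isPointed.Build (S2 R) (pole R).

Section measurable_sphere.
Variable R : realType.

Definition coord (i : 'I_3) (x : S2 R) : R := pt x 0 i.

Let S2_set0 : g_sigma_preimage coord set0.
Proof. exact: sigma_algebra0. Qed.

Let S2_setC A : g_sigma_preimage coord A -> g_sigma_preimage coord (~` A).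
Proof. exact: sigma_algebraC. Qed.

Let S2_bigcup (F : _^nat) : (forall i, g_sigma_preimage coord (F i)) ->
  g_sigma_preimage coord (\bigcup_i (F i)).
Proof. exact: sigma_algebra_bigcup. Qed.

(* The sigma-algebra generated by the coordinates is the Borel one of S^2. *)
HB.instance Definition _ := @isMeasurable.Build
  (sigma_display (g_sigma_preimage coord)) (S2 R) (g_sigma_preimage coord) S2_set0 S2_setC S2_bigcup.

End measurable_sphere.

Lemma measurable_to_S2 d (T : measurableType d) (R : realType) (f : T -> S2 R) :
  (forall i, measurable_fun [set: T] (fun t => val (f t) 0 i)) ->
  measurable_fun [set: T] f.
Proof.
move=> mf _ A mA.
have : g_sigma_preimage (fun i => coord i \o f) `<=` @measurable _ T.
  apply: smallest_sub; first exact: sigma_algebra_measurable.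
  rewrite -bigcup_mkord_ord; apply: bigcup_sub => i Ii.
  by move=> B [C mC <-]; exact: mf.
rewrite g_sigma_preimage_comp; apply.
by exists A.
Qed.

(* The chart (z, t) |-> (sqrt (1 - z^2) cos t, sqrt (1 - z^2) sin t, z) of the
   sphere, where g_0 = dz^2 / (1 - z^2) + (1 - z^2) dt^2 has determinant 1. *)
Definition cyl_vec (R : realType) (p : R * R) : 'rV[R]_3 :=
  vec3 (Num.sqrt (1 - p.1 ^+ 2) * cos p.2) (Num.sqrt (1 - p.1 ^+ 2) * sin p.2) p.1.

Definition cyl (R : realType) (p : R * R) : S2 R := insubd (pole R) (cyl_vec p).

Lemma measurable_cyl (R : realType) : measurable_fun [set: R * R] (@cyl R).
Proof.
have ms : measurable_fun [set: R * R] (fun p => Num.sqrt (1 - p.1 ^+ 2) : R).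
  apply: (@measurableT_comp _ _ _ _ _ _ (@Num.sqrt R)).
    by apply: continuous_measurable_fun; exact: sqrt_continuous.
  by apply: measurable_funB => //; apply: measurable_funX.
have mc : forall i, measurable_fun [set: R * R] (fun p : R * R => cyl_vec p 0 i).
  case=> [[|[|[|//]]] ?]; rewrite /cyl_vec /vec3.
  - under eq_fun do rewrite mxE /=.
    apply: measurable_funM => //; apply: (@measurableT_comp _ _ _ _ _ _ (@cos R)) => //.
    by apply: continuous_measurable_fun; exact: continuous_cos.
  - under eq_fun do rewrite mxE /=.
    apply: measurable_funM => //; apply: (@measurableT_comp _ _ _ _ _ _ (@sin R)) => //.
    by apply: continuous_measurable_fun; exact: continuous_sin.
  - by apply: eq_measurable_fun (measurable_fst) => p _; rewrite mxE.
apply: measurable_to_S2 => i.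
under eq_fun do rewrite val_insubd (fun_if (fun v : 'rV[R]_3 => v 0 i)).
apply: measurable_fun_ifT => //.
apply: measurable_fun_eqr => //.
rewrite /dot; apply: measurable_sum => j; exact: measurable_funM.
Qed.

Definition cyl_dom (R : realType) : set (R * R) := `[-1, 1] `*` `[0, 2 * pi].

Lemma measurable_cyl_dom (R : realType) : measurable (@cyl_dom R).
Proof. exact: measurableX. Qed.

(* The Riemannian volume of g_0, which is dz dt in the chart cyl. *)
Definition dv (R : realType) : set (S2 R) -> \bar R :=
  pushforward
    (mrestr (@lebesgue_measure R \x @lebesgue_measure R)%E (@measurable_cyl_dom R))
    (@cyl R).

Section dv_measure.
Variable R : realType.

Let dv0 : @dv R set0 = 0%E.
Proof. by rewrite /dv /pushforward preimage_set0 measure0. Qed.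

Let dv_ge0 A : (0 <= @dv R A)%E.
Proof. by rewrite /dv /pushforward measure_ge0. Qed.

Let dv_sigma_additive : semi_sigma_additive (@dv R).
Proof.
move=> F mF tF mUF; rewrite /dv /pushforward preimage_bigcup.
have mcyl A : measurable A -> measurable (@cyl R @^-1` A).
  by move=> mA; rewrite -[X in measurable X]setTI; exact: measurable_cyl.
apply: measure_semi_sigma_additive.
- by move=> n; exact: mcyl.
- apply/trivIsetP => i j _ _ ij; rewrite -preimage_setI.
  by move/trivIsetP : tF => /(_ _ _ _ _ ij) -> //; rewrite preimage_set0.
- by rewrite -preimage_bigcup; exact: mcyl.
Qed.

HB.instance Definition _ := isMeasure.Build _ _ _ (@dv R)
  dv0 dv_ge0 dv_sigma_additive.

End dv_measure.

(* The extension of f that is constant along rays. *)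
Definition ext (R : realType) (f : S2 R -> R) (y : 'rV[R]_3) : R :=
  f (insubd (pole R) ((Num.sqrt (dot y y))^-1 *: y)).

(* For v tangent at x this is the derivative of f in the direction v. *)
Definition dirder (R : realType) (f : S2 R -> R) (x : S2 R) (v : 'rV[R]_3) : R :=
  'D_v (ext f) (pt x).

(* The radial derivative of ext f vanishes, so that its Euclidean gradient on
   the sphere is the Riemannian gradient of f, viewed as a vector of R^3. *)
Definition grad (R : realType) (f : S2 R -> R) (x : S2 R) : 'rV[R]_3 :=
  \row_i dirder f x (delta_mx 0 i).

Fixpoint Ck (R : realType) (k : nat) (f : S2 R -> R) : Prop :=
  if k is k'.+1 then
    (forall x, differentiable (ext f) (pt x)) /\
    (forall i, Ck k' (fun x => grad f x 0 i))
  else forall x, {for pt x, continuous (ext f)}.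

Definition smooth (R : realType) (f : S2 R -> R) := forall k, Ck k f.

Definition vnorm (R : realType) (v : 'rV[R]_3) : R := Num.sqrt (dot v v).

Definition C1norm (R : realType) (f : S2 R -> R) : \bar R :=
  (ereal_sup (range (fun x => `|f x|%:E)) +
   ereal_sup (range (fun x => (vnorm (grad f x))%:E)))%E.

Definition cvg_C1 (R : realType) (f_ : nat -> S2 R -> R) (f : S2 R -> R) :=
  (forall n, Ck 1 (f_ n)) /\ Ck 1 f /\
  (fun n => C1norm (f_ n \- f)) @ \oo --> 0%E.

Definition tangent (R : realType) (V : S2 R -> 'rV[R]_3) :=
  forall x, dot (V x) (pt x) = 0.

Definition smooth_field (R : realType) (V : S2 R -> 'rV[R]_3) :=
  tangent V /\ forall i, smooth (fun x => V x 0 i).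

(* The Riemannian divergence when V is tangent. *)
Definition div (R : realType) (V : S2 R -> 'rV[R]_3) (x : S2 R) : R :=
  \sum_i grad (fun y => V y 0 i) x 0 i.

Definition L2norm (R : realType) (f : S2 R -> R) : \bar R :=
  ('N[@dv R]_2%:E [EFin \o f])%E.

Definition L2 (R : realType) (f : S2 R -> R) :=
  measurable_fun [set: S2 R] f /\ (L2norm f < +oo)%E.

Definition is_weak_grad (R : realType) (u : S2 R -> R) (G : S2 R -> 'rV[R]_3) :=
  [/\ forall i, L2 (fun x => G x 0 i), tangent G &
      forall V, smooth_field V ->
        \int[@dv R]_x (u x * div V x) = - \int[@dv R]_x dot (G x) (V x)].

Definition H1 (R : realType) (u : S2 R -> R) :=
  L2 u /\ exists G, is_weak_grad u G.

(* A weak gradient is unique up to a null set. *)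
Definition wgrad (R : realType) (u : S2 R -> R) : S2 R -> 'rV[R]_3 :=
  xget (fun=> 0) [set G | is_weak_grad u G].

Definition H1norm (R : realType) (u : S2 R -> R) : \bar R :=
  ((L2norm u ^+ 2 + L2norm (fun x => vnorm (wgrad u x)) ^+ 2) `^ 2^-1)%E.

Definition centered (R : realType) (u : S2 R -> R) :=
  H1 u /\ forall j, (4 * pi)^-1 * \int[@dv R]_x (expR (2 * u x) * pt x 0 j) = 0.

(* The Clifford multiplication of R^3 on C^2: gamma v is i times the Pauli
   matrix of v. *)
Definition gamma (R : realType) (v : 'rV[R]_3) : 'M[R[i]]_2 :=
  let v1 := v 0 0 in let v2 := v 0 1 in let v3 := v 0 2%:R in
  \matrix_(a, b) (nth [::] [:: [:: 0 +i* v3; v2 +i* v1];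
                               [:: - v2 +i* v1; 0 -i* v3]] a)`_b.

Lemma gammaD (R : realType) (v w : 'rV[R]_3) :
  gamma v *m gamma w + gamma w *m gamma v = (- 2 * dot v w)%:C%:M.
Proof.
have -> : dot v w = v 0 0 * w 0 0 + v 0 1 * w 0 1 + v 0 2%:R * w 0 2%:R.
  rewrite /dot !big_ord_recl big_ord0 addr0 addrA.
  by congr (v 0 _ * w 0 _ + v 0 _ * w 0 _ + v 0 _ * w 0 _); apply/val_inj.
apply/matrixP => a b; rewrite !mxE !big_ord_recl !big_ord0 !mxE !addr0.
by case: a => [[|[|//]] ?]; case: b => [[|[|//]] ?] /=; rewrite ?mulr1n ?mulr0n;
  apply/eqP; rewrite eq_complex /=; apply/andP; split; apply/eqP; ring.
Qed.

(* The spinor bundle of S^2 is the restriction of the trivial spinor bundle of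
   R^3, so that a spinor is a map to C^2. *)
Definition spinor (R : realType) := S2 R -> 'cV[R[i]]_2.

(* X . phi at x, the product of X and of the unit normal x in the Clifford
   algebra of R^3 acting on C^2. *)
Definition cliff (R : realType) (x : S2 R) (X : 'rV[R]_3) (phi : 'cV[R[i]]_2) :
    'cV[R[i]]_2 :=
  gamma X *m (gamma (pt x) *m phi).

Lemma cliffD (R : realType) (x : S2 R) (X Y : 'rV[R]_3) (phi : 'cV[R[i]]_2) :
  dot X (pt x) = 0 -> dot Y (pt x) = 0 ->
  cliff x X (cliff x Y phi) + cliff x Y (cliff x X phi) =
  (- 2 * dot X Y)%:C *: phi.
Proof.
rewrite /cliff => Xx Yx; set N := gamma (pt x).
have NN : N *m N = - 1%:M.
  have := gammaD (pt x) (pt x); rewrite (eqP (valP x)) -/N => NN.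
  have two0 : 2%:R != 0 :> R[i] by rewrite pnatr_eq0.
  apply: (scalerI two0); rewrite scaler_nat mulr2n NN mulr1.
  apply/matrixP => a b; rewrite !mxE mulrN mulr_natr rmorphN rmorph_nat.
  by rewrite mulNrn.
have NX Z : dot Z (pt x) = 0 -> N *m gamma Z = - (gamma Z *m N).
  move=> Zx; apply/eqP; rewrite -addr_eq0 addrC gammaD Zx mulr0.
  by apply/eqP/matrixP => a b; rewrite !mxE mul0rn.
have E Z W : dot W (pt x) = 0 ->
    gamma Z *m (N *m (gamma W *m (N *m phi))) = gamma Z *m gamma W *m phi.
  move=> Wx; rewrite [N *m (gamma W *m _)]mulmxA NX // mulNmx -!mulmxA.
  by rewrite [N *m (N *m _)]mulmxA NN mulNmx mul1mx !mulmxN opprK mulmxA.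
by rewrite !E // -mulmxDl gammaD mul_scalar_mx.
Qed.

Definition spinor_dirder (R : realType) (psi : spinor R) (x : S2 R)
    (v : 'rV[R]_3) : 'cV[R[i]]_2 :=
  \col_a (dirder (fun y => complex.Re (psi y a 0)) x v +i*
          dirder (fun y => complex.Im (psi y a 0)) x v).

(* The spin connection, by the Gauss formula: the second fundamental form of the
   outward unit normal of S^2 is the identity. With this factor 1/2 one has
   nabla_X (Y . psi) = (nabla_X Y) . psi + Y . nabla_X psi. *)
Definition nabla (R : realType) (psi : spinor R) (x : S2 R) (X : 'rV[R]_3) :
    'cV[R[i]]_2 :=
  spinor_dirder psi x X + (2^-1)%:C *: cliff x X (psi x).

Definition orthoframe (R : realType) (x : S2 R) : set ('I_2 -> 'rV[R]_3) :=
  [set e | (forall a b, dot (e a) (e b) = (a == b)%:R) /\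
           (forall a, dot (e a) (pt x) = 0)].

(* The sum does not depend on the orthonormal frame. *)
Definition dirac (R : realType) (psi : spinor R) : spinor R := fun x =>
  let e := xget (fun=> 0) (orthoframe x) in
  \sum_a cliff x (e a) (nabla psi x (e a)).

Definition smooth_spinor (R : realType) (psi : spinor R) :=
  forall a, smooth (fun x => complex.Re (psi x a 0)) /\
            smooth (fun x => complex.Im (psi x a 0)).

Definition herm (R : realType) (a b : 'cV[R[i]]_2) : R[i] :=
  \sum_j a j 0 * (b j 0)^*.

Definition snorm (R : realType) (a : 'cV[R[i]]_2) : R :=
  Num.sqrt (complex.Re (herm a a)).

Definition cintegral (R : realType) (f : S2 R -> R[i]) : R[i] :=
  (\int[@dv R]_x complex.Re (f x)) +i* (\int[@dv R]_x complex.Im (f x)).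

Definition measurable_spinor (R : realType) (psi : spinor R) :=
  forall a, measurable_fun [set: S2 R] (fun x => complex.Re (psi x a 0)) /\
            measurable_fun [set: S2 R] (fun x => complex.Im (psi x a 0)).

Definition Lpnorm_spinor (R : realType) (p : R) (psi : spinor R) : \bar R :=
  ('N[@dv R]_p%:E [EFin \o (@snorm R \o psi)])%E.

Definition L2_spinor (R : realType) (psi : spinor R) :=
  measurable_spinor psi /\ (Lpnorm_spinor 2 psi < +oo)%E.

(* eta = |D|^{1/2} psi: eta has coefficient |l|^{1/2} <psi, phi> on each
   eigenspinor phi of eigenvalue l. The eigenspinors are smooth and span
   L^2, which makes eta unique up to a null set. *)
Definition is_absdirac_half (R : realType) (psi eta : spinor R) :=
  L2_spinor eta /\
  forall (l : R) (phi : spinor R), smooth_spinor phi ->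
    (forall x, dirac phi x = l%:C *: phi x) ->
    cintegral (fun x => herm (eta x) (phi x)) =
    (Num.sqrt `|l|)%:C * cintegral (fun x => herm (psi x) (phi x)).

Definition H12 (R : realType) (psi : spinor R) :=
  L2_spinor psi /\ exists eta, is_absdirac_half psi eta.

Definition absdirac_half (R : realType) (psi : spinor R) : spinor R :=
  xget (fun=> 0) [set eta | is_absdirac_half psi eta].

Definition H12norm (R : realType) (psi : spinor R) : \bar R :=
  ((Lpnorm_spinor 2 psi ^+ 2 + Lpnorm_spinor 2 (absdirac_half psi) ^+ 2) `^ 2^-1)%E.

Definition weak_solution (R : realType) (h1 h2 u : S2 R -> R) (psi : spinor R) :=
  (forall phi, smooth phi ->
     \int[@dv R]_x dot (wgrad u x) (grad phi x) =
     \int[@dv R]_x ((h1 x * expR (2 * u x) - 1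
                     + h2 x * expR (u x) * snorm (psi x) ^+ 2) * phi x)) /\
  (forall phi, smooth_spinor phi ->
     cintegral (fun x => herm (psi x) (dirac phi x)) =
     cintegral (fun x => (h2 x * expR (u x))%:C * herm (psi x) (phi x))).

(* Main.v *)
Require Import Defs.
From HB Require Import structures.
From mathcomp Require Import all_boot all_order all_algebra.
From mathcomp Require Import all_classical all_reals all_analysis.
From mathcomp Require Import measurable_realfun complex ring lra.

(* Write P = h1 e^{2u} + h2 e^u |psi|^2. Integrating the first equation against logarithms shows that P has
   total mass 4 pi and that u(y) is a constant c plus the average of ln (2 / (1 - x.y)) against P / (4 pi).
   If every ball of some fixed radius carries at most a quarter of the mass, then Jensen's inequality bounds
   e^{3 (u - c)} in L^1, and Young's inequality bounds the potential itself. Otherwise consider the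
   smallest scale rho at which a ball carries a quarter of the mass. The bound on psi in L^{32/7} makes the
   spinor part of P negligible there, so e^{2u} is at least of order rho^{-2} near the ball; pushing this lower
   bound outwards through the potential, the finiteness of the mass of e^{2u} on an annulus forces definitely more
   than half of the mass to concentrate, and then e^{2c} must be small in terms of rho. But in that case u is close to c
   away from the ball, so e^{2u} has little mass there, which is incompatible with its vanishing centre of mass unless
   rho is bounded below.

   Once u is bounded, its Laplacian is bounded in L^2, hence so is its gradient. For the spinor,
   the eigenspinors of D that are restrictions of polynomials have nonzero integer eigenvalues and span all
   polynomial spinors, by Euler's identity; as D is symmetric and polynomials are dense in L^2, this
   gives | |D|^{1/2} psi |_2 <= | D psi |_2 = | h2 e^u psi |_2. *)

Set Implicit Arguments.
Unset Strict Implicit.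
Unset Printing Implicit Defensive.

Import Order.TTheory GRing.Theory Num.Theory.
Import numFieldNormedType.Exports.

Local Open Scope classical_set_scope.
Local Open Scope ring_scope.

(** Distances are measured by [sd x y] = 1 - x.y, half the squared chord, for which the area of a
    cap is proportional to its radius. In this scale Jensen's inequality makes the exponential of b
    times the potential of a mass fraction m integrable as soon as b m < 1. A quarter therefore
    allows the exponent 3 used for [u], and one half is critical for e^{2u}: once a ball carries
    strictly more, the rest of the mass is harmless. The smallest scale never appears as an infimum:
    absolute continuity gives each solution some scale without concentration, and below a threshold
    depending only on the data such a scale can be doubled. Rotation invariance of the measure comes
    from the divergence theorem, which makes the moments of x.y obey a recursion free of y. Test
    functions are smooth, so the equation is not tested with [u], nor is [psi] expanded in
    eigenspinors: the gradient and |D|^{1/2} psi are approximated in L^2 by polynomials, and these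
    are paired with the equation. A divergent real integral has the value 0, so integrability of the
    source has to be proved before the equation can be exploited. *)

(** * Calculus on the sphere through the extension constant along rays *)

Section calculus.
Variable R : realType.
Implicit Types (f g : S2 R -> R) (x y : S2 R).

Lemma dot_pt x : dot (pt x) (pt x) = 1.
Proof. exact/eqP/(valP x). Qed.

Lemma ext_pt f x : ext f (pt x) = f x.
Proof. by rewrite /ext dot_pt sqrtr1 invr1 scale1r valKd. Qed.

Lemma gradE f x i : grad f x 0 i = 'D_(delta_mx 0 i) (ext f) (pt x).
Proof. by rewrite mxE. Qed.

Definition dff f x := differentiable (ext f) (pt x).

Lemma dff_derivable f x v : dff f x -> derivable (ext f) (pt x) v.
Proof. by move=> df; apply: diff_derivable. Qed.

Lemma ext_cst c : ext (cst c : S2 R -> R) = cst c.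
Proof. by []. Qed.

Lemma dff_cst c x : dff (cst c) x.
Proof. exact: differentiable_cst. Qed.

Lemma grad_cst c x i : grad (cst c) x 0 i = 0.
Proof. by rewrite gradE ext_cst derive_cst. Qed.

Lemma dffD f g x : dff f x -> dff g x -> dff (fun y => f y + g y) x.
Proof. exact: differentiableD. Qed.

Lemma gradD f g x i : dff f x -> dff g x ->
  grad (fun y => f y + g y) x 0 i = grad f x 0 i + grad g x 0 i.
Proof. by move=> df dg; rewrite !gradE; apply: deriveD; exact: dff_derivable. Qed.

Lemma dffM f g x : dff f x -> dff g x -> dff (fun y => f y * g y) x.
Proof. exact: differentiableM. Qed.

Lemma gradM f g x i : dff f x -> dff g x ->
  grad (fun y => f y * g y) x 0 i = f x * grad g x 0 i + g x * grad f x 0 i.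
Proof.
move=> df dg; rewrite !gradE.
have -> : ext (fun y => f y * g y) = ext f * ext g by [].
by rewrite deriveM ?ext_pt //; exact: dff_derivable.
Qed.

Lemma dffZ c f x : dff f x -> dff (fun y => c * f y) x.
Proof. by move=> df; apply: (dffM (f := cst c)) df; exact: dff_cst. Qed.

Lemma gradZ c f x i : dff f x ->
  grad (fun y => c * f y) x 0 i = c * grad f x 0 i.
Proof.
move=> df; have := gradM i (dff_cst c x) df.
by rewrite grad_cst mulr0 addr0.
Qed.

Lemma dff_comp (h : R -> R) f x dh : is_derive (f x) 1 h dh -> dff f x ->
  dff (fun y => h (f y)) x.
Proof.
move=> [dh' _] df; have E : ext (fun y => h (f y)) = h \o ext f by [].
rewrite /dff E; apply: differentiable_comp => //.
by rewrite ext_pt; exact/derivable1_diffP.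
Qed.

Lemma derive_comp1 (V : normedModType R) (h : R -> R) (f : V -> R) (p v : V) dh :
  is_derive (f p) 1 h dh -> differentiable f p ->
  'D_v (h \o f) p = dh * 'D_v f p.
Proof.
move=> [dh' dhE] df; have dhf : differentiable h (f p) by exact/derivable1_diffP.
rewrite !deriveE //; last exact: differentiable_comp.
by rewrite diff_comp //= diff1E // /GRing.scale/= mulrC derive1E dhE.
Qed.

Lemma grad_comp (h : R -> R) f x dh i : is_derive (f x) 1 h dh -> dff f x ->
  grad (fun y => h (f y)) x 0 i = dh * grad f x 0 i.
Proof.
move=> dh' df; rewrite !gradE; have -> : ext (fun y => h (f y)) = h \o ext f by [].
by apply: derive_comp1 => //; rewrite ext_pt.
Qed.

Lemma dirderE f x v : dff f x -> dirder f x v = \sum_i v 0 i * grad f x 0 i.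
Proof.
move=> df; rewrite /dirder deriveE // {1}(row_sum_delta v) linear_sum.
by apply: eq_bigr => i _; rewrite linearZ /= gradE deriveE.
Qed.

End calculus.

(** The extension of a coordinate has a closed formula only near the sphere, so differentiability
    must be carried over from a function that agrees with it locally. *)
Lemma near_eq_differentiable (R : numFieldType) (V W : normedModType R)
    (f g : V -> W) x : {near x, f =1 g} ->
  differentiable f x -> differentiable g x.
Proof.
move=> fg /[dup] df /diff_locally /eqaddoP dfx.
have E : g \o shift x = cst (g x) + 'd f x +o_ 0 id.
  apply/eqaddoP => e e0; have := dfx e e0; rewrite -(nbhs_singleton fg).
  have : \forall h \near (0 : V), f (h + x) = g (h + x).
    have /nbhs0P := fg; apply: filterS => h; by rewrite addrC.
  apply: filterS2 => h /= fgh; rewrite fctE /= fgh. 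
  by [].
have Ed := diff_unique (diff_continuous df) E.
by apply/diff_locallyP; rewrite Ed; split => //; exact: diff_continuous.
Qed.

(** * Coordinate functions and the radial derivative *)

Section coordinates.
Variable R : realType.
Implicit Types (x : S2 R).

Lemma differentiable_dot (p : 'rV[R]_3) : differentiable (fun y => dot y y) p.
Proof.
have -> : (fun y => dot y y) = \sum_i (fun y : 'rV[R]_3 => y 0 i * y 0 i).
  by apply/funext => y; rewrite fct_sumE.
apply: differentiable_sum => i; apply: differentiableM; exact: differentiable_coord.
Qed.

Lemma derive_coord (p v : 'rV[R]_3) i : 'D_v (fun y : 'rV[R]_3 => y 0 i : R) p = v 0 i.
Proof.
rewrite /derive; apply: norm_cvg_lim.
apply: (@cvg_trans _ ((fun=> v 0 i : R) @ (0:R)^')); last exact: cvg_cst.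
apply: near_eq_cvg; near=> h => /=; rewrite !mxE addrK /GRing.scale /=.
by rewrite mulKf //; near: h; exact: nbhs_dnbhs_neq.
Unshelve. all: by end_near. Qed.

Lemma derive_dot (p v : 'rV[R]_3) : 'D_v (fun y => dot y y) p = 2 * dot p v.
Proof.
have -> : (fun y => dot y y) = \sum_i (fun y : 'rV[R]_3 => y 0 i * y 0 i).
  by apply/funext => y; rewrite fct_sumE.
have dc i : differentiable (fun y : 'rV[R]_3 => y 0 i : R) p by exact: differentiable_coord.
rewrite derive_sum => [|i]; last first.
  by apply: diff_derivable; apply: differentiableM.
rewrite mulr_sumr; apply: eq_bigr => i _.
have -> : (fun y : 'rV[R]_3 => y 0 i * y 0 i) = (fun y => y 0 i) * (fun y => y 0 i) by [].
rewrite deriveM; [|exact: diff_derivable..].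
by rewrite derive_coord /GRing.scale /=; ring.
Qed.

Lemma is_derive_invsqrt1 : is_derive (1 : R) 1 (fun t => (Num.sqrt t)^-1) (- 2^-1).
Proof.
have d1 : is_derive (1 : R) 1 (@Num.sqrt R) (2 * Num.sqrt 1)^-1 by apply: is_derive1_sqrt.
have n0 : Num.sqrt (1 : R) != 0 by rewrite sqrtr1 oner_neq0.
apply: is_derive_eq (is_deriveV n0 d1) _.
by rewrite sqrtr1 expr1n invr1 scaleN1r mulr1.
Qed.

Definition crd i : S2 R -> R := fun x => pt x 0 i.

(** The formula is local because at the origin the normalised vector leaves the sphere and [insubd]
    returns the pole. *)
Lemma ext_crd_near i x :
  \forall y \near pt x, ext (crd i) y = y 0 i * (Num.sqrt (dot y y))^-1.
Proof.
have : \forall y \near pt x, 0 < dot y y.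
  have := differentiable_continuous (differentiable_dot (pt x)).
  move=> /(_ [set t | 0 < t]); apply; rewrite dot_pt.
  exact: lt_nbhsr.
apply: filterS => y y0.
rewrite /ext /crd /pt val_insubd ifT; last first.
  rewrite /dot; apply/eqP.
  rewrite (eq_bigr (fun j => (Num.sqrt (dot y y))^-1 ^+ 2 * (y 0 j * y 0 j))); last first.
    by move=> j _; rewrite !mxE; ring.
  by rewrite -mulr_sumr exprVn sqr_sqrtr ?ltW// mulVf // gt_eqF.
by rewrite mxE mulrC.
Qed.

Lemma dff_crd i x : dff (crd i) x.
Proof.
apply: (near_eq_differentiable (f := (fun y : 'rV[R]_3 => y 0 i) *
   ((fun t => (Num.sqrt t)^-1) \o (fun y => dot y y)))).
  by apply: filterS (ext_crd_near i x) => y ->.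
apply: differentiableM; first exact: differentiable_coord.
apply: differentiable_comp; first exact: differentiable_dot.
apply/derivable1_diffP; rewrite dot_pt; apply: ex_derive; exact: is_derive_invsqrt1.
Qed.

(** This is the tangential projection of a basis vector. It is again a polynomial in the
    coordinates, which is what lets inductions on the order of smoothness close. *)
Lemma grad_crd i j x : grad (crd j) x 0 i = (i == j)%:R - pt x 0 i * pt x 0 j.
Proof.
rewrite gradE; rewrite (near_eq_derive _ (ext_crd_near j x)).
have -> : (fun y : 'rV[R]_3 => y 0 j * (Num.sqrt (dot y y))^-1) =
  (fun y : 'rV[R]_3 => y 0 j : R) * ((fun t => (Num.sqrt t)^-1) \o (fun y => dot y y)) by [].
have ds : is_derive (dot (pt x) (pt x)) 1 (fun t => (Num.sqrt t)^-1) (- 2^-1).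
  by rewrite dot_pt; exact: is_derive_invsqrt1.
have dd := differentiable_dot (pt x).
rewrite deriveM; last first.
- apply: diff_derivable; apply: differentiable_comp => //.
  by apply/derivable1_diffP; apply: ex_derive.
- by apply: diff_derivable; exact: differentiable_coord.
rewrite derive_coord (derive_comp1 (f := fun y => dot y y) _ ds dd) derive_dot.
have -> : dot (pt x) (delta_mx 0 i) = pt x 0 i.
  rewrite /dot (bigD1 i) //= big1 => [|k ki]; rewrite !mxE ?eqxx ?mulr1 ?addr0 //.
  by rewrite (negPf ki) mulr0.
rewrite /= dot_pt sqrtr1 invr1 !mxE eqxx /= eq_sym.
by rewrite /GRing.scale /=; field.
Qed.

Lemma ext_scale (f : S2 R -> R) (c : R) (p : 'rV[R]_3) : 0 < c ->
  ext f (c *: p) = ext f p.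
Proof.
move=> c0; rewrite /ext.
have -> : dot (c *: p) (c *: p) = c ^+ 2 * dot p p.
  by rewrite /dot mulr_sumr; apply: eq_bigr => j _; rewrite !mxE; ring.
rewrite sqrtrM ?sqr_ge0// sqrtr_sqr gtr0_norm // scalerA invfM.
by rewrite mulrAC mulVf ?mul1r // gt_eqF.
Qed.

(** [ext f] is invariant under positive scaling and x + h x = (1 + h) x, so the difference quotient
    vanishes as soon as |h| < 1. *)
Lemma grad_radial (f : S2 R -> R) x : dff f x ->
  \sum_i pt x 0 i * grad f x 0 i = 0.
Proof.
move=> df; rewrite -(dirderE _ df) /dirder /derive; apply: norm_cvg_lim.
apply: (@cvg_trans _ ((fun=> 0 : R) @ (0:R)^')); last exact: cvg_cst.
apply: near_eq_cvg; near=> h => /=.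
have -> : h *: pt x + pt x = (1 + h) *: pt x by rewrite scalerDl scale1r addrC.
rewrite ext_scale ?subrr ?scaler0 //.
have : `|h| < 1 by near: h; apply: dnbhs0_lt.
by rewrite ltr_norml -ltrBlDl sub0r => /andP[].
Unshelve. all: by end_near. Qed.

Lemma sum_crd2 x : pt x 0 0 ^+ 2 + pt x 0 1 ^+ 2 + pt x 0 2%:R ^+ 2 = 1.
Proof.
rewrite -(dot_pt x) /dot !big_ord_recl big_ord0 addr0 !addrA -!expr2.
by congr (pt x 0 _ ^+ 2 + pt x 0 _ ^+ 2 + pt x 0 _ ^+ 2); apply/val_inj.
Qed.

End coordinates.

(** * Closure properties of C^k functions *)

Section Ck_closure.
Variable R : realType.
Implicit Types (f g : S2 R -> R) (k : nat).

Lemma Ck_dff k f x : Ck k.+1 f -> dff f x.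
Proof. by move=> [+ _]; exact. Qed.

Lemma CkW k f : Ck k.+1 f -> Ck k f.
Proof.
elim: k f => [|k IH] f [df dg] //=.
  by move=> x; apply: differentiable_continuous; exact: df.
by split => // i; apply: IH; exact: dg.
Qed.

Lemma Ck_cst k c : Ck k (cst c : S2 R -> R).
Proof.
elim: k c => [|k IH] c /=; first by move=> x; exact: cst_continuous.
split => [x|i]; first exact: dff_cst.
by rewrite (_ : (fun x => _) = cst 0) //; apply/funext => x; rewrite grad_cst.
Qed.

Lemma CkD k f g : Ck k f -> Ck k g -> Ck k (fun x => f x + g x).
Proof.
elim: k f g => [|k IH] f g /=; first by move=> cf cg x; exact: continuousD (cf x) (cg x).
move=> [df cf] [dg cg]; split => [x|i]; first exact: dffD.
rewrite (_ : (fun x => _) = (fun x => grad f x 0 i + grad g x 0 i)); first exact: IH.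
by apply/funext => x; rewrite gradD.
Qed.

Lemma CkM k f g : Ck k f -> Ck k g -> Ck k (fun x => f x * g x).
Proof.
elim: k f g => [|k IH] f g; first by move=> cf cg x; exact: continuousM (cf x) (cg x).
move=> cf cg; split => [x|i]; first by apply: dffM; [exact: Ck_dff cf|exact: Ck_dff cg].
rewrite (_ : (fun x => _) = (fun x => f x * grad g x 0 i + g x * grad f x 0 i)).
  by apply: CkD; apply: IH; [exact: CkW|exact: cg.2|exact: CkW|exact: cf.2].
by apply/funext => x; rewrite gradM //; [exact: Ck_dff cf|exact: Ck_dff cg].
Qed.

Lemma CkZ k c f : Ck k f -> Ck k (fun x => c * f x).
Proof. by move=> cf; exact: CkM (Ck_cst k c) cf. Qed.

Lemma CkN k f : Ck k f -> Ck k (fun x => - f x).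
Proof.
move=> cf; rewrite (_ : (fun x => _) = (fun x => - 1 * f x)); first exact: CkZ.
by apply/funext => x; rewrite mulN1r.
Qed.

Lemma Ck_sum k (I : Type) (r : seq I) (F : I -> S2 R -> R) :
  (forall i, Ck k (F i)) -> Ck k (fun x => \sum_(i <- r) F i x).
Proof.
move=> CF; elim: r => [|i r IH].
  by rewrite (_ : (fun x => _) = cst 0); [exact: Ck_cst|apply/funext => x; rewrite big_nil].
rewrite (_ : (fun x => _) = (fun x => F i x + \sum_(j <- r) F j x)); first exact: CkD.
by apply/funext => x; rewrite big_cons.
Qed.

Lemma Ck_crd k i : Ck k (@crd R i).
Proof.
elim: k i => [|k IH] i /=.
  by move=> x; apply: differentiable_continuous; exact: dff_crd.
split => [x|j]; first exact: dff_crd.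
rewrite (_ : (fun x => _) = (fun x => (cst (j == i)%:R) x + - (crd j x * crd i x))).
  by apply: CkD; [exact: Ck_cst|apply: CkN; exact: CkM].
by apply/funext => x; rewrite grad_crd.
Qed.

Lemma CkV k f : (forall x, f x != 0) -> Ck k f -> Ck k (fun x => (f x)^-1).
Proof.
move=> f0; elim: k => [|k IH] cf.
  by move=> x; apply: (cvgV _ (cf x)); rewrite ext_pt.
have dV x : is_derive (f x) 1 (fun t => t^-1) (- f x ^- 2).
  by apply: is_derive_eq (is_deriveV (f0 x) (is_derive_id _ _)) _; rewrite /GRing.scale /= mulr1.
split => [x|i]; first exact: dff_comp (dV x) (Ck_dff _ cf).
rewrite (_ : (fun x => _) = (fun x => - ((f x)^-1 * (f x)^-1) * grad f x 0 i)).
  have := IH (CkW cf) => cV.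
  by apply: CkM; [apply: CkN; exact: CkM|exact: cf.2].
apply/funext => x; rewrite (grad_comp i (dV x) (Ck_dff _ cf)).
by rewrite -exprVn expr2.
Qed.

(** The gradient is f^-1 grad f, so order k+1 for the logarithm only asks for order k of the
    reciprocal, and no induction is required. *)
Lemma Ck_ln k f : (forall x, 0 < f x) -> Ck k.+1 f -> Ck k.+1 (fun x => ln (f x)).
Proof.
move=> f0 cf; split => [x|i]; first exact: dff_comp (is_derive1_ln (f0 x)) (Ck_dff _ cf).
rewrite (_ : (fun x => _) = (fun x => (f x)^-1 * grad f x 0 i)).
  by apply: CkM; [apply: CkV; [move=> x; rewrite gt_eqF|exact: CkW]|exact: cf.2].
by apply/funext => x; rewrite (grad_comp i (is_derive1_ln (f0 x)) (Ck_dff _ cf)).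
Qed.

End Ck_closure.

(** * Boundedness and measurability of continuous functions *)

Section continuous_functions.
Variable R : realType.

Lemma mx_norm_ltP (p : 'rV[R]_3) (e : R) : 0 < e -> (forall i, `|p 0 i| < e) -> `|p| < e.
Proof.
move=> e0 pe; have -> : `|p| = \big[Num.max/0]_ij `|p ij.1 ij.2| by exact: mx_normrE.
apply/bigmax_ltP; split => // -[i j] _ /=.
by rewrite (ord1 i).
Qed.
Implicit Types (f : S2 R -> R).

Lemma compact_sphere : compact [set p : 'rV[R]_3 | dot p p = 1].
Proof.
apply: bounded_closed_compact.
  exists 1; split => // M M1 p /= pp; apply/ltW/mx_norm_ltP; first exact: lt_trans M1.
  move=> i; apply: le_lt_trans M1.
  rewrite -(@ler_pXn2r _ 2) ?nnegrE // expr1n -normrX ger0_norm ?sqr_ge0 // -pp /dot.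
  by rewrite (bigD1 i) //= -expr2 lerDl; apply: sumr_ge0 => j _; rewrite -expr2 sqr_ge0.
rewrite (_ : [set p | _] = (fun p : 'rV[R]_3 => dot p p) @^-1` [set 1]) //.
apply: preimage_closed; last exact: closed_eq.
by move=> p _; exact: differentiable_continuous (differentiable_dot p).
Qed.

Lemma Ck0_bounded f : Ck 0 f -> exists M : R, forall x, `|f x| <= M.
Proof.
move=> cf.
have cw : {within [set p : 'rV[R]_3 | dot p p = 1], continuous (ext f)}.
  apply: continuous_in_subspaceT => p; rewrite inE /= => /eqP pp.
  by have := cf (exist _ p pp).
have := compact_bounded (continuous_compact cw compact_sphere).
move=> [M [_ /(_ (`|M| + 1))]]; rewrite ltr_pwDr ?ler_norm // => /(_ isT) HM.
exists (`|M| + 1) => x; rewrite -[f x]ext_pt; apply: HM.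
by exists (pt x) => //=; exact: dot_pt.
Qed.

Lemma measurable_crd i : measurable_fun [set: S2 R] (@crd R i).
Proof.
move=> _ A mA; rewrite setTI; apply: sub_gen_smallest.
by rewrite (bigD1 i) //=; left; exists A; rewrite ?setTI.
Qed.

(** The sigma-algebra is generated by the coordinates and not by open sets, so the preimage of a ray
    has to be written as a countable union of sets cut out by coordinates. *)
Lemma Ck0_measurable f : Ck 0 f -> measurable_fun [set: S2 R] f.
Proof.
move=> cf; apply: (measurability (@RGenOInfty.G R)).
  exact: RGenOInfty.measurableE.
move=> _ [_ [a ->] <-]; rewrite setTI.
(* Boxes with rational centre and radius: there are countably many, and a box of radius below e/4
   containing x stays inside the ball of radius e around x. *)
pose B (c : rat * rat * rat * rat) (x : S2 R) :=
  [/\ `|crd 0 x - ratr c.1.1.1| < ratr c.2, `|crd 1 x - ratr c.1.1.2| < ratr c.2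
    & `|crd 2%:R x - ratr c.1.2| < ratr c.2].
pose F c := if `[< B c `<=` f @^-1` `]a, +oo[ >] then B c : set _ else set0.
have -> : f @^-1` `]a, +oo[ = \bigcup_c F c.
  apply/seteqP; split => [x /= fx|x [c _]]; last first.
    by rewrite /F; case: asboolP => [|_ []]; exact.
  have : ext f p @[p --> pt x] --> f x by rewrite -[f x]ext_pt; exact: cf.
  move=> /(_ `]a, +oo[%classic).
  have /[swap]/[apply] : nbhs (f x) `]a, +oo[%classic.
    by apply: open_nbhs_nbhs; split => //; exact: interval_open.
  rewrite -[nbhs _ _]/(nbhs (pt x) (ext f @^-1` `]a, +oo[%classic)) => /nbhs_ballP[e /= e0 He].
  have e40 : 0 < e / 4 by rewrite divr_gt0.
  have [r] := rat_in_itvoo e40; rewrite in_itv /= => /andP[r0 re].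
  have H i : {q : rat | `|crd i x - ratr q| < ratr r}.
    have /rat_in_itvoo/cid[q] : crd i x - ratr r < crd i x by rewrite ltrBlDr ltrDl.
    rewrite in_itv /= => /andP[q1 q2]; exists q.
    by rewrite ger0_norm ?subr_ge0 ?ltW // ltrBlDr -ltrBlDl.
  pose c := (sval (H 0), sval (H 1), sval (H 2%:R), r).
  have Bx : B c x by split; exact: (svalP (H _)).
  exists c => //; rewrite /F asboolT // => z [z0 z1 z2] /=.
  rewrite -ext_pt; apply: He; rewrite mx_norm_ball /ball_ /=; apply: mx_norm_ltP => // i.
  rewrite !mxE; have : [|| i == 0, i == 1 | i == 2%:R] by case: i => [[|[|[|]]]].
  have D (u v w : R) : `|u - v| < ratr r -> `|w - v| < ratr r -> `|u - w| < e.
    move=> uv wv; rewrite (_ : u - w = (u - v) - (w - v)); last by ring.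
    by apply: le_lt_trans (ler_normB _ _) _; lra.
  by case: Bx => [x0 x1 x2]; case/or3P => /eqP ->; apply: D; eassumption.
apply: countable_bigcupT_measurable; first exact: countableP.
move=> c.
rewrite /F; case: asboolP => // _.
rewrite (_ : B c = (fun x => `|crd 0 x - ratr c.1.1.1|) @^-1` `]-oo, ratr c.2[ `&`
   (fun x => `|crd 1 x - ratr c.1.1.2|) @^-1` `]-oo, ratr c.2[ `&`
   (fun x => `|crd 2%:R x - ratr c.1.2|) @^-1` `]-oo, ratr c.2[); last first.
  apply/seteqP; split => x /=; rewrite !in_itv /= => -[]; first by [].
  by case.
have mB i q : measurable ((fun x : S2 R => `|crd i x - q|) @^-1` `]-oo, ratr c.2[).
  rewrite -[X in measurable X]setTI.
  have : measurable_fun [set: S2 R] (fun x : S2 R => `|crd i x - q|).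
    by apply: measurableT_comp => //; apply: measurable_funB => //; exact: measurable_crd.
  by apply.
by do 2 apply: measurableI => //.
Qed.

End continuous_functions.

(** * The surface measure in the cylindrical chart *)

Section surface_measure.
Variable R : realType.
Local Notation leb := (@lebesgue_measure R).
Local Notation leb2 := (leb \x leb)%E.
Local Open Scope ereal_scope.

(** [mu] is the sum of its restrictions to D and to the complement; the function cut off to D only
    sees the first one, and agrees with f almost everywhere for it. *)
Lemma ge0_integral_mrestr d (T : measurableType d) (mu : {measure set T -> \bar R})
    (D : set T) (mD : measurable D) (f : T -> \bar R) :
  measurable_fun setT f -> (forall x, 0 <= f x) ->
  \int[mrestr mu mD]_x f x = \int[mu]_(x in D) f x.
Proof.
move=> mf f0; have mC : measurable (~` D) by exact: measurableC.
have mfD : measurable_fun setT (f \_ D) by apply/(measurable_restrictT _ _).1 => //; exact: measurable_funTS.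
have fD0 x : setT x -> 0 <= (f \_ D) x by move=> _; rewrite patchE; case: ifP.
rewrite [RHS]integral_mkcond.
rewrite (eq_measure_integral (measure_add (mrestr mu mD) (mrestr mu mC))); last first.
  move=> A mA _; rewrite /measure_add /= /msum /= !big_ord_recl big_ord0 /= adde0 /mrestr.
  rewrite -measureU //; [|exact: measurableI|exact: measurableI|].
    by rewrite -setIUr setUv setIT.
  by rewrite setIACA setICr setI0.
rewrite ge0_integral_measure_add //.
rewrite [X in _ = _ + X](_ : _ = 0) ?adde0.
  apply: ae_eq_integral => //. 
  exists (~` D); split => //=; first by rewrite /mrestr setICl.
  move=> x /= H Dx; apply: H => _. by rewrite patchE mem_set.
rewrite (ae_eq_integral (cst 0)) ?integral0 //.
exists D; split => //=; first by rewrite /mrestr setICr.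
by move=> x /= H; apply: contrapT => Dx; apply: H => _; rewrite patchE memNset.
Qed.

Lemma ge0_integral_dv (f : S2 R -> \bar R) : measurable_fun setT f ->
  (forall x, 0 <= f x) ->
  \int[@dv R]_x f x = \int[leb2]_(p in @cyl_dom R) f (cyl p).
Proof.
move=> mf f0.
rewrite -(ge0_integral_mrestr leb2 (@measurable_cyl_dom R) (f := f \o @cyl R)).
- have f0' : {in setT, forall x, 0 <= f x} by move=> x _; exact: f0.
  pose T2 := (measurableTypeR R * measurableTypeR R)%type.
  have mc : measurable_fun [set: T2] (@cyl R) := @measurable_cyl R.
  pose m : {measure set T2 -> \bar R} := mrestr leb2 (@measurable_cyl_dom R).
  have E := ge0_integral_pushforward mc m measurableT mf f0'.
  by apply: etrans E; apply: eq_measure_integral.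
- by apply: measurableT_comp => //; exact: measurable_cyl.
- by move=> x /=; exact: f0.
Qed.

Lemma integral_dv (f : S2 R -> \bar R) : measurable_fun setT f ->
  \int[@dv R]_x f x = \int[leb2]_(p in @cyl_dom R) f (cyl p).
Proof.
move=> mf; rewrite [LHS]integralE [RHS]integralE.
have mp : measurable_fun setT f^\+ by exact: measurable_funepos.
have mn : measurable_fun setT f^\- by exact: measurable_funeneg.
have p0 x : 0 <= f^\+ x by exact: funepos_ge0.
have n0 x : 0 <= f^\- x by exact: funeneg_ge0.
rewrite (ge0_integral_dv mp p0) (ge0_integral_dv mn n0).
by congr (_ - _); apply: eq_integral => p _; rewrite ?funeposE ?funenegE.
Qed.

Lemma dv_setT : @dv R setT = (4 * pi)%:E.
Proof.
rewrite /dv /pushforward preimage_setT /mrestr setTI /cyl_dom product_measure1E //.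
have E1 : leb `[(-1)%R, 1%R]%classic = 2%:E.
  by rewrite lebesgue_measure_itv /= lte_fin ifT -?EFinB; [congr EFin|]; lra.
have E2 : leb `[0%R, (2 * pi)%R]%classic = (2 * pi)%:E.
  by rewrite lebesgue_measure_itv /= lte_fin mulr_gt0 ?pi_gt0 // -EFinB subr0.
transitivity (2%:E * (2 * pi)%:E : \bar R); first by congr (_ * _).
by rewrite -EFinM; congr EFin; ring.
Qed.

Lemma dv_ltyT : @dv R setT < +oo.
Proof. by rewrite dv_setT ltry. Qed.

Let dv_fin : fin_num_fun (@dv R).
Proof.
move=> A mA; rewrite ge0_fin_numE //; apply: (@le_lt_trans _ _ (@dv R setT)); last exact: dv_ltyT.
by apply: le_measure; rewrite ?inE.
Qed.

HB.instance Definition _ := @Measure_isFinite.Build _ _ _ (@dv R) dv_fin.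

Lemma measurable_inv_ge0 d (T : measurableType d) (f : T -> R) :
  (forall x, (0 <= f x)%R) -> measurable_fun setT f ->
  measurable_fun setT (fun x => (f x)^-1)%R.
Proof.
move=> f0 mf; rewrite (_ : (fun x => _)%R = (fun x => f x `^ (- 1))%R); last first.
  by apply/funext => x; rewrite powR_inv1.
exact: (measurableT_comp (@measurable_powR R (- 1)%R) mf).
Qed.

Lemma bounded_integrable_dv (f : S2 R -> R) (M : R) : measurable_fun setT f ->
  (forall x, `|f x| <= M)%R -> (@dv R).-integrable setT (EFin \o f).
Proof.
move=> mf fM; apply: measurable_bounded_integrable => //; first exact: dv_ltyT.
by exists M; split; [exact: num_real|move=> N MN x _; apply: le_trans (fM x) (ltW MN)].
Qed.

(** Both orders of integration are kept, because a rotation field is a sum of a z-derivative and a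
    t-derivative, and each is integrated first in its own variable. *)
Lemma integral_rectangle (I J : interval R) (h : R * R -> R) (M : R) :
  leb [set` I] < +oo -> leb [set` J] < +oo ->
  measurable_fun setT h ->
  (forall z t, z \in I -> t \in J -> `|h (z, t)| <= M)%R ->
  \int[leb2]_(p in [set` I] `*` [set` J]) (h p)%:E =
    \int[leb]_(z in [set` I]) \int[leb]_(t in [set` J]) (h (z, t))%:E /\
  \int[leb2]_(p in [set` I] `*` [set` J]) (h p)%:E =
    \int[leb]_(t in [set` J]) \int[leb]_(z in [set` I]) (h (z, t))%:E.
Proof.
move=> Ifin Jfin mh hM; set D := [set` I] `*` [set` J].
have mD : measurable D by apply: measurableX.
have fD : leb2 D < +oo.
  by rewrite /D product_measure1E //; apply: lte_mul_pinfty => //; rewrite ge0_fin_numE.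
have iD : leb2.-integrable D (EFin \o h).
  apply: measurable_bounded_integrable => //.
  - exact: measurable_funTS.
  - exists M; split; first exact: num_real.
    by move=> N MN [z t] [/= zI tJ]; apply: le_trans (ltW MN); exact: hM.
have ih := (integrable_mkcond (mu := leb2) (EFin \o h) mD).1 iD.
have P1 z : z \in [set` I] -> (fun t => ((EFin \o h) \_ D) (z, t)) = (fun t => (h (z, t))%:E) \_ [set` J].
  move=> zI; apply/funext => t; rewrite !patchE /D /=.
  have -> : ((z, t) \in [set` I] `*` [set` J]) = (t \in [set` J]).
    apply/idP/idP; rewrite !inE /=; first by case.
    by move=> tJ; split => //=; rewrite inE in zI.
  by case: ifP.
have P2 z : z \notin [set` I] -> (fun t => ((EFin \o h) \_ D) (z, t)) = cst 0.
  move=> zI; apply/funext => t; rewrite !patchE /D /= ifF //.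
  by apply/negbTE; apply: contra zI; rewrite !inE => -[].
have Q1 t : t \in [set` J] -> (fun z => ((EFin \o h) \_ D) (z, t)) = (fun z => (h (z, t))%:E) \_ [set` I].
  move=> tJ; apply/funext => z; rewrite !patchE /D /=.
  have -> : ((z, t) \in [set` I] `*` [set` J]) = (z \in [set` I]).
    apply/idP/idP; rewrite !inE /=; first by case.
    by move=> zI; split => //=; rewrite inE in tJ.
  by case: ifP.
have Q2 t : t \notin [set` J] -> (fun z => ((EFin \o h) \_ D) (z, t)) = cst 0.
  move=> tJ; apply/funext => z; rewrite !patchE /D /= ifF //.
  by apply/negbTE; apply: contra tJ; rewrite !inE => -[].
have E1 : \int[leb2]_(p in D) (h p)%:E =
    \int[leb]_(z in [set` I]) \int[leb]_(t in [set` J]) (h (z, t))%:E.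
  rewrite integral_mkcond -(integral12_prod_meas1 ih) [RHS]integral_mkcond.
  apply: eq_integral => z _; rewrite /fubini_F [RHS]patchE; case: ifPn => [zI|zI].
    by rewrite P1 // -integral_mkcond.
  by rewrite P2 // integral0.
split => //; rewrite integral_mkcond -(integral12_prod_meas1 ih) (Fubini ih) [RHS]integral_mkcond.
apply: eq_integral => t _; rewrite [RHS]patchE; case: ifPn => [tJ|tJ].
  by rewrite Q1 // -integral_mkcond.
by rewrite Q2 // integral0.
Qed.

End surface_measure.

(** * Derivatives along the coordinate curves of the chart *)

Section chart.
Variable R : realType.
Implicit Types (f : S2 R -> R) (z t : R).

Lemma vec3_0 (a b c : R) : (vec3 a b c) 0 0 = a. Proof. by rewrite mxE. Qed.
Lemma vec3_1 (a b c : R) : (vec3 a b c) 0 1 = b. Proof. by rewrite mxE. Qed.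
Lemma vec3_2 (a b c : R) : (vec3 a b c) 0 2%:R = c. Proof. by rewrite mxE. Qed.

Lemma sum3 (F : 'I_3 -> R) : \sum_i F i = F 0 + F 1 + F 2%:R.
Proof.
rewrite !big_ord_recl big_ord0 addr0 addrA.
by congr (F _ + F _ + F _); apply/val_inj.
Qed.

Lemma pt_cyl z t : -1 <= z <= 1 -> pt (cyl (z, t)) = cyl_vec (z, t).
Proof.
move=> /andP[z1 z2]; rewrite /pt val_insubd ifT //.
rewrite dot_vec3 /=; apply/eqP.
have w2 : Num.sqrt (1 - z ^+ 2) * Num.sqrt (1 - z ^+ 2) = 1 - z ^+ 2.
  by rewrite -expr2 sqr_sqrtr //; nra.
transitivity (Num.sqrt (1 - z ^+ 2) * Num.sqrt (1 - z ^+ 2) * (cos t ^+ 2 + sin t ^+ 2) + z * z).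
  by ring.
by rewrite w2 cos2Dsin2; ring.
Qed.

Lemma is_derive_curve f (c : R -> 'rV[R]_3) s (v : 'rV[R]_3) x : dff f x -> c s = pt x ->
  (forall i, is_derive s 1 (fun r => c r 0 i) (v 0 i)) ->
  is_derive s 1 (ext f \o c) (dot v (grad f x)).
Proof.
move=> df cx dc.
have dcs : derivable c s 1.
  by apply/derivable_mxP => i j; rewrite (ord1 i); exact: ex_derive.
have cv : 'D_1 c s = v.
  rewrite derive_mx //; apply/rowP => j; rewrite mxE; exact: derive_val.
have dc' : differentiable c s by exact/derivable1_diffP.
have df' : differentiable (ext f) (c s) by rewrite cx.
apply: DeriveDef; first by apply/derivable1_diffP; exact: differentiable_comp.
rewrite deriveE; last exact: differentiable_comp.
rewrite diff_comp //= -(deriveE _ dc') cv cx -deriveE // -[LHS]/(dirder f x v).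
by rewrite dirderE.
Qed.

(** Velocities of the two coordinate curves of [cyl_vec]. The first blows up at the poles, the
    second vanishes there. *)
Definition dz_vec z t : 'rV[R]_3 :=
  vec3 (- z / Num.sqrt (1 - z ^+ 2) * cos t) (- z / Num.sqrt (1 - z ^+ 2) * sin t) 1.
Definition dt_vec z t : 'rV[R]_3 :=
  vec3 (- Num.sqrt (1 - z ^+ 2) * sin t) (Num.sqrt (1 - z ^+ 2) * cos t) 0.

Lemma is_derive_sqrt1m z : -1 < z < 1 ->
  is_derive z 1 (fun z => Num.sqrt (1 - z ^+ 2)) (- z / Num.sqrt (1 - z ^+ 2)).
Proof.
move=> /andP[z1 z2]; have w0 : 0 < 1 - z ^+ 2 by nra.
have d1 : is_derive z 1 (fun z : R => 1 - z ^+ 2) (- (2 * z)).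
  apply: is_derive_eq; rewrite /GRing.scale /=; ring.
have ds := @is_derive1_comp R Num.sqrt (fun z => 1 - z ^+ 2) z _ _ (is_derive1_sqrt w0) d1.
rewrite -[fun _ => Num.sqrt _]/(Num.sqrt \o (fun z : R => 1 - z ^+ 2)).
apply: is_derive_eq ds _.
have : Num.sqrt (1 - z ^+ 2) != 0 by rewrite gt_eqF // sqrtr_gt0.
move=> ?; by field.
Qed.

Lemma is_derive_cyl_z f z t : -1 < z < 1 -> dff f (cyl (z, t)) ->
  is_derive z 1 (fun z => f (cyl (z, t))) (dot (dz_vec z t) (grad f (cyl (z, t)))).
Proof.
move=> zI df; have [z1 z2] := andP zI.
have zI' : -1 <= z <= 1 by rewrite !ltW.
have dw := is_derive_sqrt1m zI.
apply: (near_eq_is_derive (f := ext f \o (fun z => cyl_vec (z, t)))).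
  have : \forall y \near z, -1 < y < 1.
    by near=> y; apply/andP; split; near: y; [exact: lt_nbhsr|exact: lt_nbhsl].
  by apply: filterS => y /andP[y1 y2]; rewrite /= -pt_cyl ?ext_pt // !ltW.
apply: is_derive_curve => //; first by rewrite pt_cyl.
have H (a : R) : is_derive z 1 (fun z => Num.sqrt (1 - z ^+ 2) * a) (- z / Num.sqrt (1 - z ^+ 2) * a).
  apply: is_derive_eq; rewrite /GRing.scale /=; ring.
case=> [[|[|[|//]]] ?].
- under eq_fun do rewrite mxE /=. by rewrite mxE /=.
- under eq_fun do rewrite mxE /=. by rewrite mxE /=.
- under eq_fun do rewrite mxE /=. rewrite mxE /=. exact: is_derive_id.
Unshelve. all: by end_near. Qed.

Lemma is_derive_cyl_t f z t : -1 <= z <= 1 -> dff f (cyl (z, t)) ->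
  is_derive t 1 (fun t => f (cyl (z, t))) (dot (dt_vec z t) (grad f (cyl (z, t)))).
Proof.
move=> zI df; rewrite (_ : (fun t => _) = ext f \o (fun t => cyl_vec (z, t))); last first.
  by apply/funext => y; rewrite /= -pt_cyl ?ext_pt.
apply: is_derive_curve => //; first by rewrite pt_cyl.
case=> [[|[|[|//]]] ?].
- under eq_fun do rewrite mxE /=. rewrite mxE /=. 
  apply: is_derive_eq; rewrite /GRing.scale /=; ring.
- under eq_fun do rewrite mxE /=. rewrite mxE /=.
  apply: is_derive_eq; rewrite /GRing.scale /=; ring.
- under eq_fun do rewrite mxE /=. rewrite mxE /=. exact: is_derive_cst.
Qed.

Lemma continuous_curve f (c : R -> 'rV[R]_3) s x : Ck 0 f -> c s = pt x ->
  (forall i, derivable (fun r => c r 0 i) s 1) -> {for s, continuous (ext f \o c)}.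
Proof.
move=> cf cx dc; apply: continuous_comp; last by rewrite cx; exact: cf.
apply: differentiable_continuous; apply/derivable1_diffP/derivable_mxP => i j.
by rewrite (ord1 i).
Qed.

Lemma continuous_cyl_z f z t : Ck 0 f -> -1 < z < 1 ->
  {for z, continuous (fun z => f (cyl (z, t)))}.
Proof.
move=> cf zI; have [z1 z2] := andP zI; have dw := is_derive_sqrt1m zI.
have E : \forall y \near z, (ext f \o (fun z => cyl_vec (z, t))) y = f (cyl (y, t)).
  have : \forall y \near z, -1 < y < 1.
    by near=> y; apply/andP; split; near: y; [exact: lt_nbhsr|exact: lt_nbhsl].
  by apply: filterS => y /andP[y1 y2]; rewrite /= -pt_cyl ?ext_pt // !ltW.
have cc : {for z, continuous (ext f \o (fun z => cyl_vec (z, t)))}.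
  apply: (continuous_curve (x := cyl (z, t))) => //; first by rewrite pt_cyl // !ltW.
  case=> [[|[|[|//]]] ?]; under eq_fun do rewrite mxE /=; exact: ex_derive.
move: cc; rewrite /prop_for /continuous_at (nbhs_singleton E) => cc.
apply: cvg_trans cc; exact: near_eq_cvg.
Unshelve. all: by end_near. Qed.

Lemma continuous_cyl_t f z t : Ck 0 f -> -1 <= z <= 1 ->
  {for t, continuous (fun t => f (cyl (z, t)))}.
Proof.
move=> cf zI; rewrite (_ : (fun t => _) = ext f \o (fun t => cyl_vec (z, t))); last first.
  by apply/funext => y; rewrite /= -pt_cyl ?ext_pt.
apply: (continuous_curve (x := cyl (z, t))) => //; first by rewrite pt_cyl.
case=> [[|[|[|//]]] ?]; under eq_fun do rewrite mxE /=; exact: ex_derive.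
Qed.

Lemma FTC_is_derive (F f : R -> R) (a b : R) : a < b ->
  (forall x, a <= x <= b -> is_derive x 1 F (f x)) ->
  (forall x, a <= x <= b -> {for x, continuous f}) ->
  (\int[lebesgue_measure]_(x in `[a, b]) (f x)%:E = (F b - F a)%:E)%E.
Proof.
move=> ab dF cf.
have cF x : a <= x <= b -> {for x, continuous F}.
  move=> xab; apply: differentiable_continuous; apply/derivable1_diffP.
  by apply: ex_derive; exact: dF.
rewrite EFinB; apply: continuous_FTC2 => //.
- apply: continuous_in_subspaceT => x; rewrite inE /= in_itv /=; exact: cf.
- split.
  + move=> x; rewrite in_itv /= => /andP[x1 x2].
    by apply: ex_derive; apply: dF; rewrite !ltW.
  + by apply: cvg_at_right_filter; apply: cF; rewrite lexx ltW.
  + by apply: cvg_at_left_filter; apply: cF; rewrite lexx ltW.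
- move=> x; rewrite in_itv /= => /andP[x1 x2]; rewrite derive1E.
  by apply: derive_val; apply: dF; rewrite !ltW.
Qed.

(** Shaped for the removal of two polar caps: they leave an error of order e^2 from their area and
    one of order e from their boundary. *)
Lemma eq0_small_bound (X A B : R) : 0 <= A -> 0 <= B ->
  (forall e : R, 0 < e < 1 -> `|X| <= A * e ^+ 2 + B * e) -> X = 0.
Proof.
move=> A0 B0 H; apply/eqP; rewrite -normr_le0; apply/ler_addgt0Pl => e e0.
pose d := Num.min (e / (A + B + 1)) (2^-1).
have AB : 0 < A + B + 1 by lra.
have d0 : 0 < d by rewrite lt_min divr_gt0 //= invr_gt0.
have d1 : d <= 2^-1 by rewrite ge_min lexx orbT.
have d2 : d * (A + B + 1) <= e by rewrite -ler_pdivlMr // ge_min lexx.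
have /H : 0 < d < 1 by rewrite d0 /=; lra.
move=> /le_trans; apply; rewrite addr0; apply: le_trans d2.
clearbody d; have h : 0 <= A * (d * (1 - d)) by apply: mulr_ge0 => //; apply: mulr_ge0; lra.
by rewrite expr2; nra.
Qed.

End chart.

Lemma integrable_rectangle (R : realType) (I J : interval R) (h : R * R -> R) (M : R) :
  (lebesgue_measure [set` I] < +oo)%E -> (lebesgue_measure [set` J] < +oo)%E ->
  measurable_fun setT h ->
  (forall z t, z \in I -> t \in J -> `|h (z, t)| <= M) ->
  (lebesgue_measure \x lebesgue_measure)%E.-integrable ([set` I] `*` [set` J]) (EFin \o h).
Proof.
move=> Ifin Jfin mh hM; set D := [set` I] `*` [set` J].
have mD : measurable D by apply: measurableX.
have fD : ((lebesgue_measure \x lebesgue_measure) D < +oo)%E.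
  by rewrite /D product_measure1E //; apply: lte_mul_pinfty => //; rewrite ge0_fin_numE.
apply: measurable_bounded_integrable => //.
- exact: measurable_funTS.
- exists M; split; first exact: num_real.
  by move=> N MN [z t] [/= zI tJ]; apply: le_trans (ltW MN); exact: hM.
Qed.

(** * Rotations mixing the axis with a horizontal direction *)

Section rotation_field.
Variable R : realType.
Local Notation leb := (@lebesgue_measure R).
Local Notation leb2 := (leb \x leb)%E.
Local Notation w z := (Num.sqrt (1 - z ^+ 2)).
Variables (f L : S2 R -> R) (sg kp : R -> R).
Hypothesis cf : Ck 1 f.
Hypothesis cL : Ck 0 L.
Hypothesis dsg : forall t : R, is_derive t 1 sg (kp t).
Hypothesis dkp : forall t : R, is_derive t 1 kp (- sg t).
Hypothesis sgM : forall t : R, `|sg t| <= 1.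
Hypothesis kpM : forall t : R, `|kp t| <= 1.
Hypothesis kp_per : kp (2 * pi) = kp 0.
Hypothesis LE : forall z t : R, -1 < z < 1 -> L (cyl (z, t)) =
  w z * (sg t * dot (dz_vec z t) (grad f (cyl (z, t)))) -
  z / w z * (kp t * dot (dt_vec z t) (grad f (cyl (z, t)))).

(** Since kp' = - sg, [G] is the t-derivative of kp f, and [Hd] is the z-derivative of w sg f. Hence
    L is d/dz (w sg f) minus d/dt ((z / w) kp f), a divergence in the chart. The pair (sg, kp) will
    be (sin, cos) or (cos, - sin), one for each horizontal direction. *)
Let G (p : R * R) := - sg p.2 * f (cyl p) + kp p.2 * dot (dt_vec p.1 p.2) (grad f (cyl p)).
Let Hd (p : R * R) := L (cyl p) + p.1 / w p.1 * G p.

Let dff_f x : dff f x. Proof. exact: Ck_dff cf. Qed.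
Let f_Ck0 : Ck 0 f. Proof. exact: CkW. Qed.
Let gr_Ck0 i : Ck 0 (fun x => grad f x 0 i). Proof. exact: cf.2. Qed.

Let sg_cont : continuous sg.
Proof. by move=> t; apply/differentiable_continuous/derivable1_diffP; apply: ex_derive. Qed.
Let kp_cont : continuous kp.
Proof. by move=> t; apply/differentiable_continuous/derivable1_diffP; apply: ex_derive. Qed.

Let intG (c z : R) : -1 < z < 1 -> (\int[leb]_(t in `[0%R, (2 * pi)%R]) (c * G (z, t))%:E = 0)%E.
Proof.
move=> zI; have [z1 z2] := andP zI; have zI' : -1 <= z <= 1 by rewrite !ltW.
apply: (etrans (@FTC_is_derive R (fun t => c * (kp t * f (cyl (z, t)))) (fun t => c * G (z, t)) 0 (2 * pi) _ _ _)).
- by rewrite mulr_gt0 ?pi_gt0.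
- move=> t _; have df := is_derive_cyl_t zI' (dff_f (cyl (z, t))).
  apply: is_derive_eq; rewrite /G /= /GRing.scale /=; ring.
- move=> t _; rewrite /G /=; apply: continuousM; first exact: cst_continuous.
  apply: continuousD; apply: continuousM.
  + by apply: continuousN; exact: sg_cont.
  + exact: continuous_cyl_t.
  + exact: kp_cont.
  + rewrite (_ : (fun t => _) = (fun t => - w z * sin t * grad f (cyl (z, t)) 0 0 +
      w z * cos t * grad f (cyl (z, t)) 0 1)); last first.
      by apply/funext => s; rewrite /dot sum3 vec3_0 vec3_1 vec3_2 mul0r addr0.
    apply: continuousD; apply: continuousM; first [exact: (continuous_cyl_t (f := fun x => grad f x 0 0) (@gr_Ck0 0) zI')|exact: (continuous_cyl_t (f := fun x => grad f x 0 1) (@gr_Ck0 1) zI')|idtac].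
    * by apply: continuousM; [exact: cst_continuous|exact: continuous_sin].
    * by apply: continuousM; [exact: cst_continuous|exact: continuous_cos].
- rewrite kp_per (_ : cyl (z, 2 * pi) = cyl (z, 0)) ?subrr //.
  by rewrite mulr_natl; apply: val_inj; rewrite -!/(pt _) !pt_cyl // /cyl_vec /= cos2pi sin2pi cos0 sin0.
Qed.

Let intH (a b t : R) : -1 < a -> a < b -> b < 1 ->
  (\int[leb]_(z in `[a, b]) (Hd (z, t))%:E =
   (w b * sg t * f (cyl (b, t)) - w a * sg t * f (cyl (a, t)))%:E)%E.
Proof.
move=> a1 ab b1.
have zI z : a <= z <= b -> -1 < z < 1.
  by move=> /andP[az zb]; rewrite (lt_le_trans a1 az) (le_lt_trans zb b1).
apply: (@FTC_is_derive R (fun z => w z * sg t * f (cyl (z, t))) (fun z => Hd (z, t)) a b) => //.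
- move=> z /zI zab; have dw := is_derive_sqrt1m zab.
  have df := is_derive_cyl_z zab (dff_f (cyl (z, t))).
  apply: is_derive_eq; rewrite /Hd LE // /G /= /GRing.scale /=; ring.
- move=> z /zI zab; rewrite /Hd /G /=.
  have cw : {for z, continuous (fun z : R => w z)}.
    by apply/differentiable_continuous/derivable1_diffP; apply: ex_derive; exact: is_derive_sqrt1m.
  have w0 : w z != 0 by case/andP: zab => ? ?; rewrite gt_eqF // sqrtr_gt0; nra.
  apply: continuousD; first exact: continuous_cyl_z.
  apply: continuousM; first by apply: continuousM; [exact: cvg_id|exact: continuousV].
  apply: continuousD.
    by apply: continuousM; [exact: cst_continuous|exact: continuous_cyl_z].
  apply: continuousM; first exact: cst_continuous.
  rewrite (_ : (fun z => _) = (fun z => - w z * sin t * grad f (cyl (z, t)) 0 0 +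
      w z * cos t * grad f (cyl (z, t)) 0 1)); last first.
    by apply/funext => s; rewrite /dot sum3 vec3_0 vec3_1 vec3_2 mul0r addr0.
  apply: continuousD; apply: continuousM.
  + apply: continuousM; last exact: cst_continuous.
    exact: continuousN.
  + exact: (continuous_cyl_z (f := fun x => grad f x 0 0) (@gr_Ck0 0) zab).
  + by apply: continuousM; [exact: cw|exact: cst_continuous].
  + exact: (continuous_cyl_z (f := fun x => grad f x 0 1) (@gr_Ck0 1) zab).
Qed.

Let mcyl g : Ck 0 g -> measurable_fun [set: R * R] (fun p => g (cyl p) : R).
Proof.
by move=> cg; apply: measurableT_comp; [exact: Ck0_measurable|exact: measurable_cyl].
Qed.

Let mw : measurable_fun [set: R * R] (fun p => w p.1 : R).
Proof.
apply: (@measurableT_comp _ _ _ _ _ _ (@Num.sqrt R)).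
  by apply: continuous_measurable_fun; exact: sqrt_continuous.
by apply: measurable_funB => //; apply: measurable_funX.
Qed.

Let mG : measurable_fun [set: R * R] G.
Proof.
apply: measurable_funD; apply: measurable_funM.
- apply: measurableT_comp => //; apply: (@measurableT_comp _ _ _ _ _ _ sg) => //.
  exact: continuous_measurable_fun.
- exact: mcyl.
- by apply: (@measurableT_comp _ _ _ _ _ _ kp) => //; exact: continuous_measurable_fun.
- rewrite (_ : (fun p : R * R => _) = (fun p : R * R => - w p.1 * sin p.2 * grad f (cyl p) 0 0 +
      w p.1 * cos p.2 * grad f (cyl p) 0 1)); last first.
    by apply/funext => s; rewrite /dot sum3 vec3_0 vec3_1 vec3_2 mul0r addr0.
  apply: measurable_funD; (apply: measurable_funM; first apply: measurable_funM).
  + exact: measurableT_comp.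
  + by apply: (@measurableT_comp _ _ _ _ _ _ (@sin R)) => //; apply: continuous_measurable_fun; exact: continuous_sin.
  + exact: (mcyl (@gr_Ck0 0)).
  + exact: mw.
  + by apply: (@measurableT_comp _ _ _ _ _ _ (@cos R)) => //; apply: continuous_measurable_fun; exact: continuous_cos.
  + exact: (mcyl (@gr_Ck0 1)).
Qed.

Let q (p : R * R) := p.1 / w p.1 * G p.
Let mq : measurable_fun [set: R * R] q.
Proof.
apply: measurable_funM => //; apply: measurable_funM => //.
apply: measurable_inv_ge0 => //; move=> p; exact: sqrtr_ge0.
Qed.

Lemma integral_rotation_field : (\int[@dv R]_x (L x)%:E = 0)%E.
Proof.
have mL := Ck0_measurable cL.
have [M0 fM] := Ck0_bounded f_Ck0.
have [M1 gM0] := Ck0_bounded (@gr_Ck0 0).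
have [M2 gM1] := Ck0_bounded (@gr_Ck0 1).
have [M3 LM] := Ck0_bounded cL.
have M0_ge0 : 0 <= M0 := le_trans (normr_ge0 _) (fM (pole R)).
have M3_ge0 : 0 <= M3 := le_trans (normr_ge0 _) (LM (pole R)).
have iL := bounded_integrable_dv mL LM.
rewrite -(fineK (integrable_fin_num measurableT iL)); congr EFin.
pose J := `[0, (2 * pi : R)].
have lebcc (a b : R) : a < b -> leb `[a, b]%classic = (b - a)%:E.
  by move=> ab; rewrite lebesgue_measure_itv /= lte_fin ab -EFinB.
have lebJ : leb [set` J] = (2 * pi)%:E by rewrite lebcc ?subr0 // mulr_gt0 ?pi_gt0.
have Jfin : (leb [set` J] < +oo)%E by rewrite lebJ ltry.
apply: (@eq0_small_bound _ _ (M3 * (4 * pi)) (4 * M0 * pi)).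
- by rewrite !mulr_ge0 // pi_ge0.
- by rewrite !mulr_ge0 // pi_ge0.
move=> e e01; have e0 : 0 < e by case/andP: e01.
(* The factor z / w is unbounded at the poles, so the integral is cut to |z| <= b. As w(b) = e, the
   boundary terms are of order e, and the removed caps have area at most 4 pi e^2. *)
set b := Num.sqrt (1 - e ^+ 2).
have e2 : 0 < 1 - e ^+ 2 < 1 by nra.
have b2 : b ^+ 2 = 1 - e ^+ 2 by rewrite sqr_sqrtr //; case/andP: e2 => /ltW.
have b0 : 0 < b by rewrite sqrtr_gt0; case/andP: e2.
have b1 : b < 1 by nra.
have wb : w b = e by rewrite b2 opprB addrC subrK sqrtr_sqr gtr0_norm.
have wNb : w (- b) = e by rewrite sqrrN.
clearbody b.
pose I := `[- b, b].
have lebI : leb [set` I] = (2 * b)%:E by rewrite lebcc ?opprK; [congr EFin; ring|lra].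
have Ifin : (leb [set` I] < +oo)%E by rewrite lebI ltry.
have zI (z : R) : z \in I -> -1 < z < 1 by rewrite in_itv /= => /andP[? ?]; lra.
have wI (z : R) : z \in I -> e <= w z.
  rewrite in_itv /= => /andP[z1 z2]; rewrite -wb; apply: ler_wsqrtr; nra.
have w1 (z : R) : w z <= 1.
  by rewrite -[leRHS]sqrtr1; apply: ler_wsqrtr; nra.
pose D0 := [set` `[(-1 : R), 1]] `*` [set` J]; pose D := [set` I] `*` [set` J].
have mD0 : measurable D0 by apply: measurableX.
have mD : measurable D by apply: measurableX.
have DD0 : D `<=` D0.
  move=> [z t] [/= zI' tJ]; split => //=; have := zI _ zI'.
  by rewrite in_itv /= => /andP[/ltW -> /ltW ->].
pose h := fun p : R * R => L (cyl p).
have mh : measurable_fun [set: R * R] h by exact: mcyl.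
have i0 : leb2.-integrable D0 (EFin \o h).
  apply: (integrable_rectangle (M := M3)) => // => [|z t _ _]; last exact: LM.
  by rewrite lebcc ?ltry //; lra.
have wM (z a c N : R) : `|a| <= 1 -> `|c| <= N -> w z * `|a| * `|c| <= N.
  move=> a1 cN; rewrite -[leRHS]mul1r; apply: ler_pM => //.
  by rewrite -[leRHS]mul1r; apply: ler_pM => //; exact: sqrtr_ge0.
have Gbd z t : `|G (z, t)| <= M0 + (M1 + M2).
  rewrite /G /=; apply: le_trans (ler_normD _ _) _; apply: lerD.
    rewrite normrM normrN; apply: le_trans (ler_pM (normr_ge0 _) (normr_ge0 _) (sgM t) (fM _)) _.
    by rewrite mul1r.
  rewrite normrM; have -> : M1 + M2 = 1 * (M1 + M2) by rewrite mul1r.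
  apply: ler_pM => //; rewrite /dot sum3 vec3_0 vec3_1 vec3_2 mul0r addr0.
  apply: le_trans (ler_normD _ _) _; apply: lerD; rewrite !normrM ?normrN (ger0_norm (sqrtr_ge0 _)).
    by apply: wM => //; rewrite ler_norml sin_geN1 sin_le1.
  by apply: wM => //; rewrite ler_norml cos_geN1 cos_le1.
have qbd z t : z \in I -> t \in J -> `|q (z, t)| <= e^-1 * (M0 + (M1 + M2)).
  move=> zi _; rewrite /q /= !normrM; apply: ler_pM => //.
  rewrite -[leRHS]mul1r; apply: ler_pM => //.
    by have /andP[? ?] := zI _ zi; rewrite ler_norml !ltW.
  rewrite normfV ger0_norm ?sqrtr_ge0 // lef_pV2 ?posrE ?wI //; exact: lt_le_trans (wI _ zi).
have iq : leb2.-integrable D (EFin \o q) by apply: (integrable_rectangle Ifin Jfin mq qbd).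
have intq : (\int[leb2]_(p in D) (q p)%:E = 0)%E.
  have [-> _] := integral_rectangle Ifin Jfin mq qbd.
  rewrite (eq_integral (cst 0%E)) ?integral0 // => z; rewrite inE /= => /zI zi.
  exact: (@intG (z / w z) z zi).
have Hbd z t : z \in I -> t \in J -> `|Hd (z, t)| <= M3 + e^-1 * (M0 + (M1 + M2)).
  move=> zi tj; apply: le_trans (ler_normD _ _) _; apply: lerD; [exact: LM|exact: qbd].
have mHd : measurable_fun [set: R * R] Hd by exact: measurable_funD.
have intHd : (`|\int[leb2]_(p in D) (Hd p)%:E| <= (4 * M0 * pi * e)%:E)%E.
  have [_ ->] := integral_rectangle Ifin Jfin mHd Hbd.
  have -> : (\int[leb]_(t in [set` J]) \int[leb]_(z in [set` I]) (Hd (z, t))%:E =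
      \int[leb]_(t in [set` J]) (e * sg t * (f (cyl (b, t)) - f (cyl (- b, t))))%:E)%E.
    apply: eq_integral => t _; rewrite (@intH (- b) b t); [|lra|lra|lra].
    by rewrite wb wNb; congr EFin; ring.
  have mcz (z : R) : measurable_fun setT (fun t => f (cyl (z, t))).
    apply: measurableT_comp; first exact: Ck0_measurable.
    by apply: measurableT_comp; [exact: measurable_cyl|exact: measurable_pair1].
  have mf : measurable_fun [set` J] (fun t => (e * sg t * (f (cyl (b, t)) - f (cyl (- b, t))))%:E).
    apply: measurable_funTS; apply/measurable_EFinP; apply: measurable_funM.
      by apply: measurable_funM => //; exact: continuous_measurable_fun.
    by apply: measurable_funB.
  have mJ : measurable ([set` J] : set (measurableTypeR R)) by [].
  apply: le_trans (le_abse_integral leb mJ mf) _.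
  have M0e : 0 <= 2 * M0 * e by rewrite !mulr_ge0 // ltW.
  apply: le_trans (integral_le_bound (mu := leb) (2 * M0 * e)%:E mJ mf _ _) _ => //.
    apply: aeW => t _; rewrite lee_fin normrM normrM (gtr0_norm e0) mulrAC [leRHS]mulrC.
    rewrite -[leRHS]mulr1; apply: ler_pM => //.
      by rewrite mulr_ge0 // ltW.
    rewrite ler_pM2l //; apply: le_trans (ler_normB _ _) _.
    by rewrite mulr_natl mulr2n; apply: lerD.
  by rewrite [X in (_ * X)%E]lebJ -EFinM lee_fin; nra.
have intD : (\int[leb2]_(p in D) (h p)%:E = \int[leb2]_(p in D) (Hd p)%:E)%E.
  have ih : leb2.-integrable D (EFin \o h) by exact: integrableS i0.
  rewrite -[LHS]adde0 -intq -integralD //.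
have mr : measurable_fun (D0 `\` D) (fun p => (h p)%:E).
  by apply: measurable_funTS; exact/measurable_EFinP.
have rest : (`|\int[leb2]_(p in D0 `\` D) (h p)%:E| <= (M3 * (4 * pi) * e ^+ 2)%:E)%E.
  have mDD : measurable (D0 `\` D) by exact: measurableD.
  apply: le_trans (le_abse_integral leb2 mDD mr) _.
  apply: le_trans (integral_le_bound (mu := leb2) M3%:E mDD mr _ _) _ => //.
    by apply: aeW => p _; rewrite lee_fin; exact: LM.
  have l0 : leb2 D0 = (4 * pi)%:E.
    have leb1 : leb `[-1, 1]%classic = (2 : R)%:E by rewrite lebcc; [congr EFin; ring|lra].
    rewrite /D0 product_measure1E //; transitivity ((2 : R)%:E * (2 * pi)%:E)%E.
      by congr (_ * _)%E.
    by rewrite -EFinM; congr EFin; ring.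
  have l1 : leb2 D = (2 * b * (2 * pi))%:E by rewrite /D product_measure1E // EFinM; congr (_ * _)%E.
  rewrite [X in (_ * X <= _)%E](_ : _ = ((4 * pi)%:E - (2 * b * (2 * pi))%:E)%E); last first.
    by rewrite -l0 -l1 -{2}(setIidr DD0); apply: measureD => //; rewrite [ltLHS]l0 ltry.
  rewrite -EFinB -EFinM lee_fin -!mulrA ler_wpM2l //.
  have pi0 : 0 < pi :> R by exact: pi_gt0.
  have : 1 - b <= e ^+ 2 by nra.
  by nra.
rewrite -lee_fin -abse_EFin fineK; last by apply: (integrable_fin_num measurableT iL).
rewrite integral_dv; last by apply/measurable_EFinP.
rewrite -[cyl_dom (R:=R)]/D0.
have -> : D0 = D `|` (D0 `\` D) by rewrite setDUK.
rewrite integral_setU //=; last 3 first.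
- exact: measurableD.
- by rewrite setDUK //; apply: measurable_funTS; exact/measurable_EFinP.
- by apply/disj_setPS => x [Dx []].
apply: le_trans (lee_abs_add _ _) _; rewrite EFinD addeC; apply: leeD; first exact: rest.
by rewrite intD.
Qed.

End rotation_field.

(** * Divergence theorem *)

Section divergence.
Variable R : realType.
Local Notation leb := (@lebesgue_measure R).
Local Notation leb2 := (leb \x leb)%E.

Implicit Types (f g : S2 R -> R) (x : S2 R).

Definition rot (i j : 'I_3) (f : S2 R -> R) (x : S2 R) : R :=
  pt x 0 i * grad f x 0 j - pt x 0 j * grad f x 0 i.

Lemma Ck_rot k i j f : Ck k.+1 f -> Ck k (rot i j f).
Proof.
move=> cf; rewrite (_ : rot i j f =
   (fun x => crd i x * grad f x 0 j + - (crd j x * grad f x 0 i))) //.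
by apply: CkD; [|apply: CkN]; apply: CkM; (exact: Ck_crd || exact: cf.2).
Qed.

Lemma rotN i j f : rot j i f = (fun x => - rot i j f x).
Proof. by apply/funext => x; rewrite /rot opprB. Qed.

Let int_rot12 f : Ck 1 f -> (\int[@dv R]_x (rot 1 2%:R f x)%:E = 0)%E.
Proof.
move=> cf; apply: (integral_rotation_field (sg := @sin R) (kp := @cos R) cf).
- exact: Ck_rot.
- by move=> t; rewrite ler_norml sin_geN1 sin_le1.
- by move=> t; rewrite ler_norml cos_geN1 cos_le1.
- by rewrite mulr_natl cos2pi cos0.
- move=> z t zI; have w0 : Num.sqrt (1 - z ^+ 2) != 0.
    by case/andP: zI => ? ?; rewrite gt_eqF // sqrtr_gt0; nra.
  have cs := cos2Dsin2 t.
  rewrite /rot pt_cyl; last by case/andP: zI => ? ?; rewrite !ltW.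
  rewrite /dot !sum3 !(vec3_0, vec3_1, vec3_2) /=.
  set g0 := grad f _ 0 0; set g1 := grad f _ 0 1; set g2 := grad f _ 0 2%:R.
  transitivity (Num.sqrt (1 - z ^+ 2) * sin t * g2 - z * (cos t ^+ 2 + sin t ^+ 2) * g1).
    by rewrite cs mulr1.
  by field.
Qed.

Let int_rot02 f : Ck 1 f -> (\int[@dv R]_x (rot 0 2%:R f x)%:E = 0)%E.
Proof.
move=> cf; apply: (integral_rotation_field (sg := @cos R) (kp := fun t => - sin t) cf).
- exact: Ck_rot.
- by move=> t; rewrite ler_norml cos_geN1 cos_le1.
- by move=> t; rewrite normrN ler_norml sin_geN1 sin_le1.
- by rewrite mulr_natl sin2pi sin0.
- move=> z t zI; have w0 : Num.sqrt (1 - z ^+ 2) != 0.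
    by case/andP: zI => ? ?; rewrite gt_eqF // sqrtr_gt0; nra.
  have cs := cos2Dsin2 t.
  rewrite /rot pt_cyl; last by case/andP: zI => ? ?; rewrite !ltW.
  rewrite /dot !sum3 !(vec3_0, vec3_1, vec3_2) /=.
  set g0 := grad f _ 0 0; set g1 := grad f _ 0 1; set g2 := grad f _ 0 2%:R.
  transitivity (Num.sqrt (1 - z ^+ 2) * cos t * g2 - z * (cos t ^+ 2 + sin t ^+ 2) * g0).
    by rewrite cs mulr1.
  by field.
Qed.

(** The rotation about the axis is d/dt in the chart. It has no singularity at the poles, so
    periodicity in t suffices. *)
Let int_rot01 f : Ck 1 f -> (\int[@dv R]_x (rot 0 1 f x)%:E = 0)%E.
Proof.
move=> cf; have cr : Ck 0 (rot 0 1 f) by exact: Ck_rot.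
have [M rM] := Ck0_bounded cr.
have mr := Ck0_measurable cr.
have mrc : measurable_fun [set: R * R] (fun p => rot 0 1 f (cyl p)).
  by apply: measurableT_comp; [exact: mr|exact: measurable_cyl].
rewrite integral_dv; last exact/measurable_EFinP.
have fin (a b : R) : (leb `[a, b]%classic < +oo)%E.
  by rewrite lebesgue_measure_itv /=; case: ifP => // _; rewrite -EFinB ltry.
have [E _] := integral_rectangle (fin (- 1) 1) (fin 0 (2 * pi)) mrc (fun z t _ _ => rM (cyl (z, t))).
rewrite [LHS]E (eq_integral (cst 0%E)) ?integral0 // => z; rewrite inE /= in_itv /= => zI.
have drt (t : R) : is_derive t 1 (fun t => f (cyl (z, t))) (rot 0 1 f (cyl (z, t))).
  apply: is_derive_eq (is_derive_cyl_t zI (Ck_dff _ cf)) _.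
  rewrite /rot pt_cyl // /dot !sum3 !(vec3_0, vec3_1, vec3_2) /=; ring.
apply: (etrans (@FTC_is_derive R (fun t => f (cyl (z, t))) (fun t => rot 0 1 f (cyl (z, t))) 0 (2 * pi) _ _ _)).
- by rewrite mulr_gt0 ?pi_gt0.
- by move=> t _; exact: continuous_cyl_t.
- rewrite (_ : cyl (z, 2 * pi) = cyl (z, 0)) ?subrr //.
  by rewrite mulr_natl; apply: val_inj; rewrite -!/(pt _) !pt_cyl // /cyl_vec /= cos2pi sin2pi cos0 sin0.
Qed.

Lemma Ck0_integrable f : Ck 0 f -> (@dv R).-integrable setT (EFin \o f).
Proof.
move=> cf; have [M fM] := Ck0_bounded cf.
exact: bounded_integrable_dv (Ck0_measurable cf) fM.
Qed.

Lemma integral_rot i j f : Ck 1 f -> (\int[@dv R]_x (rot i j f x)%:E = 0)%E.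
Proof.
move=> cf.
have N k l : (\int[@dv R]_x (rot k l f x)%:E = 0)%E -> (\int[@dv R]_x (rot l k f x)%:E = 0)%E.
  move=> H; rewrite rotN; under eq_integral do rewrite EFinN.
  rewrite integralN ?H ?oppe0 //; apply: integrable_add_def => //.
  exact: Ck0_integrable (Ck_rot k l cf).
have D k : (\int[@dv R]_x (rot k k f x)%:E = 0)%E.
  by rewrite (eq_integral (cst 0%E)) ?integral0 // => x _; rewrite /rot subrr.
have H (k : 'I_3) : [\/ k = 0, k = 1 | k = 2%:R].
  case: k => [[|[|[|//]]] ?]; [apply: Or31|apply: Or32|apply: Or33]; exact: val_inj.
have [->|->|->] := H i; have [->|->|->] := H j => //.
- exact: int_rot01.
- exact: int_rot02.
- by apply: N; exact: int_rot01.
- exact: int_rot12.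
- by apply: N; exact: int_rot02.
- by apply: N; exact: int_rot12.
Qed.

Lemma eq_RI (g f : S2 R -> R) : f =1 g -> \int[@dv R]_x f x = \int[@dv R]_x g x.
Proof. by move=> fg; apply: eq_Rintegral => x _; exact: fg. Qed.

Lemma dffN f x : dff f x -> dff (fun y => - f y) x.
Proof. exact: differentiableN. Qed.

Lemma gradN f x k : dff f x -> grad (fun y => - f y) x 0 k = - grad f x 0 k.
Proof. by move=> df; rewrite !gradE; apply: deriveN; exact: dff_derivable. Qed.

Let grad_W (f g : S2 R -> R) i j k x : dff f x -> dff g x ->
  grad (fun y => f y * crd j y - g y * crd i y) x 0 k =
  f x * ((k == j)%:R - pt x 0 k * pt x 0 j) + pt x 0 j * grad f x 0 k
    - (g x * ((k == i)%:R - pt x 0 k * pt x 0 i) + pt x 0 i * grad g x 0 k).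
Proof.
move=> df dg; have dfj := dffM df (dff_crd j x); have dgi := dffM dg (dff_crd i x).
rewrite (gradD k dfj (dffN dgi)) (gradN k dgi) (gradM k df (dff_crd j x)).
by rewrite (gradM k dg (dff_crd i x)) (grad_crd k j x) (grad_crd k i x).
Qed.

(** Expanded form of the identity div V = - sum over i < j of rot_ij (V_i x_j - V_j x_i) for tangent
    V, which reduces the divergence theorem to the three rotations. The hypotheses are |x| = 1,
    tangency, and the vanishing of the radial derivatives of the components. *)
Let div_rot_alg (x0 x1 x2 v0 v1 v2 g00 g01 g02 g10 g11 g12 g20 g21 g22 : R) :
  x0 ^+ 2 + x1 ^+ 2 + x2 ^+ 2 = 1 -> v0 * x0 + v1 * x1 + v2 * x2 = 0 ->
  x0 * g00 + x1 * g01 + x2 * g02 = 0 -> x0 * g10 + x1 * g11 + x2 * g12 = 0 ->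
  x0 * g20 + x1 * g21 + x2 * g22 = 0 ->
  g00 + g11 + g22 = - (
    (x0 * (v0 * (1 - x1 * x1) + x1 * g01 - (v1 * (0 - x1 * x0) + x0 * g11)) -
     x1 * (v0 * (0 - x0 * x1) + x1 * g00 - (v1 * (1 - x0 * x0) + x0 * g10))) +
    (x0 * (v0 * (1 - x2 * x2) + x2 * g02 - (v2 * (0 - x2 * x0) + x0 * g22)) -
     x2 * (v0 * (0 - x0 * x2) + x2 * g00 - (v2 * (1 - x0 * x0) + x0 * g20))) +
    (x1 * (v1 * (1 - x2 * x2) + x2 * g12 - (v2 * (0 - x2 * x1) + x1 * g22)) -
     x2 * (v1 * (0 - x1 * x2) + x2 * g11 - (v2 * (1 - x1 * x1) + x1 * g21)))).
Proof.
move=> n xV r0 r1 r2.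
pose nn := x0 ^+ 2 + x1 ^+ 2 + x2 ^+ 2; pose xv := v0 * x0 + v1 * x1 + v2 * x2.
transitivity (- (xv * (3 - nn) + (x0 * (x0 * g00 + x1 * g01 + x2 * g02) +
    x1 * (x0 * g10 + x1 * g11 + x2 * g12) + x2 * (x0 * g20 + x1 * g21 + x2 * g22)) -
    nn * (g00 + g11 + g22) - xv + nn * xv)).
  by rewrite r0 r1 r2 /nn /xv n xV; ring.
by rewrite /nn /xv; ring.
Qed.

Lemma divergence_theorem (V : S2 R -> 'rV[R]_3) : tangent V ->
  (forall i, Ck 1 (fun x => V x 0 i)) -> \int[@dv R]_x div V x = 0.
Proof.
move=> tV cV.
pose W i j (x : S2 R) := V x 0 i * crd j x - V x 0 j * crd i x.
have cW i j : Ck 1 (W i j).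
  apply: CkD; first by apply: CkM; [exact: cV|exact: Ck_crd].
  by apply: CkN; apply: CkM; [exact: cV|exact: Ck_crd].
have dV i x : dff (fun y => V y 0 i) x by exact: Ck_dff (cV i).
have E x : div V x = - (rot 0 1 (W 0 1) x + rot 0 2%:R (W 0 2%:R) x + rot 1 2%:R (W 1 2%:R) x).
  have gW i j k := grad_W i j k (dV i x) (dV j x).
  have := tV x; rewrite /dot sum3 => xV.
  have r i : pt x 0 0 * grad (fun y => V y 0 i) x 0 0 + pt x 0 1 * grad (fun y => V y 0 i) x 0 1
     + pt x 0 2%:R * grad (fun y => V y 0 i) x 0 2%:R = 0.
    by have := grad_radial (dV i x); rewrite sum3.
  rewrite /div sum3 (div_rot_alg (sum_crd2 x) xV (r 0) (r 1) (r 2%:R)) /rot.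
  by rewrite (gW 0 1 1) (gW 0 1 0) (gW 0 2%:R 2%:R) (gW 0 2%:R 0) (gW 1 2%:R 2%:R) (gW 1 2%:R 1).
have ci i j : Ck 0 (rot i j (W i j)) by exact: Ck_rot.
have ii i j := Ck0_integrable (ci i j).
have Z i j : \int[@dv R]_x (rot i j (W i j) x) = 0.
  by rewrite /Rintegral integral_rot.
pose r i j := rot i j (W i j).
rewrite (eq_RI (g := fun x => -1 * (r 0 1 x + r 0 2%:R x + r 1 2%:R x))); last first.
  by move=> x; rewrite E mulN1r.
have ir i j : (@dv R).-integrable setT (EFin \o r i j) by exact: ii.
have i2 : (@dv R).-integrable setT (EFin \o (fun x => r 0 1 x + r 0 2%:R x)).
  exact: (integrableD measurableT (ir _ _) (ir _ _)).
have i3 : (@dv R).-integrable setT (EFin \o (fun x => r 0 1 x + r 0 2%:R x + r 1 2%:R x)).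
  exact: (integrableD measurableT i2 (ir _ _)).
rewrite (RintegralZl _ measurableT i3) (RintegralD measurableT i2 (ir _ _)).
by rewrite (RintegralD measurableT (ir _ _) (ir _ _)) !Z !addr0 mulr0.
Qed.

End divergence.

(** * Functions of the scalar product with a fixed point *)

Section zonal.
Variable R : realType.
Implicit Types (f g : S2 R -> R) (x y : S2 R).

Definition sdot x y : R := dot (pt x) (pt y).

Lemma sdotC x y : sdot x y = sdot y x.
Proof. by apply: eq_bigr => i _; rewrite mulrC. Qed.

Lemma sdotE x y : sdot x y = \sum_i pt y 0 i * crd i x.
Proof. by apply: eq_bigr => i _; rewrite mulrC. Qed.

Lemma Ck_sdot k y : Ck k (sdot^~ y).
Proof.
rewrite (_ : sdot^~ y = (fun x => \sum_i pt y 0 i * crd i x)); last first.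
  by apply/funext => x; rewrite sdotE.
by apply: Ck_sum => i; apply: CkZ; exact: Ck_crd.
Qed.

Lemma grad_sdot y x i : grad (sdot^~ y) x 0 i = pt y 0 i - sdot x y * pt x 0 i.
Proof.
rewrite (_ : sdot^~ y = (fun x => pt y 0 0 * crd 0 x + pt y 0 1 * crd 1 x + pt y 0 2%:R * crd 2%:R x)); last first.
  by apply/funext => z; rewrite sdotE sum3.
have dc j z : dff (@crd R j) z by exact: dff_crd.
have dZ j z : dff (fun x => pt y 0 j * crd j x) z by exact: dffZ.
rewrite (gradD _ (dffD (dZ _ _) (dZ _ _)) (dZ _ _)) (gradD _ (dZ _ _) (dZ _ _)).
rewrite (gradZ _ i (dc 0 x)) (gradZ _ i (dc 1 x)) (gradZ _ i (dc 2%:R x)).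
rewrite (grad_crd i 0 x) (grad_crd i 1 x) (grad_crd i 2%:R x) sdotE sum3.
have H (k : 'I_3) : [\/ k = 0, k = 1 | k = 2%:R].
  case: k => [[|[|[|//]]] ?]; [apply: Or31|apply: Or32|apply: Or33]; exact: val_inj.
have e1 (k : 'I_3) : (k == k)%:R = 1 :> R by rewrite eqxx.
have ne (k l : 'I_3) : k != l -> (k == l)%:R = 0 :> R by move=> /negPf ->.
by have [->|->|->] := H i; rewrite !e1 !ne // /crd; ring.
Qed.

Lemma sdot_bound x y : -1 <= sdot x y <= 1.
Proof.
have P (e : R) : e ^+ 2 = 1 -> 0 <= 2 + 2 * e * sdot x y.
  move=> e2; have : 0 <= \sum_i (pt x 0 i + e * pt y 0 i) ^+ 2 by apply: sumr_ge0 => i _; exact: sqr_ge0.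
  rewrite sum3; have := sum_crd2 x; have := sum_crd2 y; rewrite sdotE sum3 /crd => y1 x1.
  by nra.
have := P 1 (expr1n _ _); have := P (-1); rewrite sqrrN expr1n => /(_ erefl); lra.
Qed.

(** The vector y - (x.y) x is the gradient of x.y in x, so this is the general field that points
    along the meridians through y. *)
Definition zfield (a : S2 R -> R) y x : 'rV[R]_3 := \row_i (a x * (pt y 0 i - sdot x y * crd i x)).

Lemma zfieldE a y i : (fun x => zfield a y x 0 i) = (fun x => a x * (pt y 0 i - sdot x y * crd i x)).
Proof. by apply/funext => x; rewrite mxE. Qed.

Let Ck_tang k y i : Ck k (fun x => pt y 0 i - sdot x y * crd i x).
Proof.
apply: CkD; first exact: Ck_cst.
by apply: CkN; apply: CkM; [exact: Ck_sdot|exact: Ck_crd].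
Qed.

Lemma Ck_zfield k a y i : Ck k a -> Ck k (fun x => zfield a y x 0 i).
Proof. by move=> ca; rewrite zfieldE; exact: CkM. Qed.

Lemma zfield_tangent a y : tangent (zfield a y).
Proof.
move=> x; rewrite /dot sum3 !mxE /crd; have := sum_crd2 x; have := sdotE x y.
rewrite sum3 /crd; set t := sdot x y; clearbody t => tE x1.
transitivity (a x * ((pt y 0 0 * pt x 0 0 + pt y 0 1 * pt x 0 1 + pt y 0 2%:R * pt x 0 2%:R) -
    t * (pt x 0 0 ^+ 2 + pt x 0 1 ^+ 2 + pt x 0 2%:R ^+ 2))).
  by ring.
by rewrite x1 -tE; ring.
Qed.

Lemma div_zfield (a b : S2 R -> R) y x : Ck 1 a ->
  (forall i, grad a x 0 i = b x * (pt y 0 i - sdot x y * pt x 0 i)) ->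
  div (zfield a y) x = b x * (1 - sdot x y ^+ 2) - 2 * sdot x y * a x.
Proof.
move=> ca ga.
have gc i : grad (fun x => pt y 0 i - sdot x y * crd i x) x 0 i =
    - (sdot x y * (1 - pt x 0 i ^+ 2) + crd i x * (pt y 0 i - sdot x y * pt x 0 i)).
  have ds := Ck_dff x (Ck_sdot 1 y).
  have dsc : dff (fun x => sdot x y * crd i x) x by apply: dffM => //; exact: dff_crd.
  rewrite (gradD _ (dff_cst _ _) (dffN dsc)) (grad_cst _ _ i) (gradN _ dsc) add0r.
  by rewrite (gradM _ ds (dff_crd _ _)) grad_crd grad_sdot eqxx expr2.
rewrite /div; under eq_bigr => i _ do rewrite zfieldE (gradM _ (Ck_dff _ ca) (Ck_dff _ (@Ck_tang 1 y i))) gc ga.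
rewrite sum3 /crd; have := sum_crd2 x; have := sum_crd2 y; have := sdotE x y.
rewrite sum3 /crd; set t := sdot x y; clearbody t => tE y1 x1.
set n := pt x 0 0 ^+ 2 + pt x 0 1 ^+ 2 + pt x 0 2%:R ^+ 2.
have n1 : n = 1 by [].
set s := pt y 0 0 * pt x 0 0 + pt y 0 1 * pt x 0 1 + pt y 0 2%:R * pt x 0 2%:R in tE.
set m := pt y 0 0 ^+ 2 + pt y 0 1 ^+ 2 + pt y 0 2%:R ^+ 2 in y1.
transitivity (- a x * (t * (3 - n) + s - t * n) + b x * (m - 2 * t * s + t ^+ 2 * n)).
  by rewrite /n /s /m; ring.
by rewrite -tE n1 y1; ring.
Qed.

Lemma zonal_field (a b : S2 R -> R) y : Ck 1 a ->
  (forall x i, grad a x 0 i = b x * (pt y 0 i - sdot x y * pt x 0 i)) ->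
  \int[@dv R]_x (b x * (1 - sdot x y ^+ 2) - 2 * sdot x y * a x) = 0.
Proof.
move=> ca ga; rewrite -[RHS](divergence_theorem (zfield_tangent a y) (fun i => @Ck_zfield 1 a y i ca)).
by apply: eq_Rintegral => x _; rewrite (div_zfield ca (ga x)).
Qed.

(** [zonal_field] with a = t^(k+1). With the moments of order 0 and 1, the recursion fixes every
    moment of x.y without reference to y; this is the source of rotation invariance. *)
Lemma zonal_moment_rec y k :
  (k.+3)%:R * \int[@dv R]_x (sdot x y ^+ k.+2) = (k.+1)%:R * \int[@dv R]_x (sdot x y ^+ k).
Proof.
have Ct n : Ck 1 (fun x => sdot x y ^+ n).
  elim: n => [|n IH]; first exact: Ck_cst.
  rewrite (_ : (fun x => _) = (fun x => sdot x y * sdot x y ^+ n)); last by apply/funext => x; rewrite exprS.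
  by apply: CkM => //; exact: Ck_sdot.
have it n : (@dv R).-integrable setT (EFin \o (fun x => sdot x y ^+ n)).
  by apply: Ck0_integrable; apply: CkW.
have iZ c n : (@dv R).-integrable setT (EFin \o (fun x => c * sdot x y ^+ n)).
  by apply: Ck0_integrable; apply: CkZ; apply: CkW.
have := @zonal_field (fun x => sdot x y ^+ k.+1) (fun x => k.+1%:R * sdot x y ^+ k) y (Ct _).
have ge x i : grad (fun x => sdot x y ^+ k.+1) x 0 i =
     k.+1%:R * sdot x y ^+ k * (pt y 0 i - sdot x y * pt x 0 i).
  have dh : is_derive (sdot x y) 1 (fun t : R => t ^+ k.+1) (k.+1%:R * sdot x y ^+ k).
    apply: DeriveDef; first exact: exprn_derivable.
    by rewrite exp_derive /GRing.scale /= mulr1.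
  by rewrite (grad_comp (f := sdot^~ y) i dh (Ck_dff x (Ck_sdot 1 y))) grad_sdot.
move=> /(_ ge).
rewrite (eq_RI (g := fun x => k.+1%:R * sdot x y ^+ k - k.+3%:R * sdot x y ^+ k.+2)); last first.
  by move=> x; rewrite -[k.+3]addn2 -[k.+2]addn1 -[k.+1]addn1 !natrD !exprD; ring.
rewrite (RintegralB measurableT (iZ _ _) (iZ _ _)).
rewrite (RintegralZl _ measurableT (it _)) (RintegralZl _ measurableT (it _)).
by move/eqP; rewrite subr_eq0 => /eqP.
Qed.

Lemma zonal_moment1 y : \int[@dv R]_x sdot x y = 0.
Proof.
have := @zonal_field (cst 1) (cst 0) y (Ck_cst _ _).
have g0 x i : grad (cst 1) x 0 i = cst 0 x * (pt y 0 i - sdot x y * pt x 0 i).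
  by rewrite mul0r grad_cst.
move=> /(_ g0); rewrite (eq_RI (g := fun x => -2 * sdot x y)); last first.
  by move=> x /=; ring.
rewrite (RintegralZl _ measurableT (Ck0_integrable (Ck_sdot 0 y))) => /eqP.
by rewrite mulf_eq0 oppr_eq0 pnatr_eq0 /= => /eqP.
Qed.

Lemma zonal_moment y y' n : \int[@dv R]_x (sdot x y ^+ n) = \int[@dv R]_x (sdot x y' ^+ n).
Proof.
elim/ltn_ind: n => -[_|[_|n IH]].
- by apply: eq_Rintegral => x _; rewrite !expr0.
- exact: etrans (zonal_moment1 y) (esym (zonal_moment1 y')).
- apply: (@mulfI _ (n.+3)%:R); first by rewrite pnatr_eq0.
  by rewrite !zonal_moment_rec IH.
Qed.

End zonal.

(** * Polynomials approximating the indicator of a half-line *)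

Section step_polynomials.
Variable R : realType.
Implicit Types (a t : R) (n : nat).

(** Clamping the threshold to [-2, 2] does not change its comparison with t in [-1, 1], and it keeps
    |t - clip a| <= 3, hence q = 1/2 - (t - clip a)/6 in [0, 1]. *)
Definition clip a := Num.max (-2) (Num.min a 2).

(* [step_poly a n] tends to the indicator of the half-line ]a, +oo[ on [-1, 1]: with q = 1/2 - (t - clip a)/6,
   the bounds 1 - n (2 q)^n <= (1 - q^n)^(n 2^n) <= 1 / (1 + n (2 q)^n) separate q < 1/2 from q >= 1/2. *)
Definition step_poly a n : {poly R} :=
  (1 - ((2^-1 + clip a / 6)%:P - 6^-1 *: 'X) ^+ n) ^+ (n * 2 ^ n).

Lemma step_polyE a n t : (step_poly a n).[t] =
  (1 - (2^-1 - (t - clip a) / 6) ^+ n) ^+ (n * 2 ^ n).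
Proof.
rewrite /step_poly !hornerE; congr ((1 - _ ^+ n) ^+ _); lra.
Qed.

Lemma clip_bound a : -2 <= clip a <= 2.
Proof.
rewrite /clip le_max lexx /= ge_max; apply/andP; split; first lra.
by rewrite ge_min lexx orbT.
Qed.

Lemma lt_clip a t : -1 <= t <= 1 -> (clip a < t) = (a < t).
Proof. by move=> ?; rewrite /clip gt_max gt_min; apply/idP/idP; lra. Qed.

Let qI a t : -1 <= t <= 1 -> 0 <= 2^-1 - (t - clip a) / 6 <= 1.
Proof. by have := clip_bound a; lra. Qed.

Lemma step_poly_bound a n t : -1 <= t <= 1 -> 0 <= (step_poly a n).[t] <= 1.
Proof.
move=> /(qI a) /andP[q0 q1]; rewrite step_polyE.
have x01 : 0 <= 1 - (2^-1 - (t - clip a) / 6) ^+ n <= 1.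
  by rewrite subr_ge0 exprn_ile1 //= gerBl exprn_ge0.
by case/andP: x01 => x0 x1; rewrite exprn_ge0 //= exprn_ile1.
Qed.

Lemma bernoulli (x : R) n : 0 <= x <= 1 -> 1 - n%:R * x <= (1 - x) ^+ n.
Proof.
move=> /andP[x0 x1]; elim: n => [|n IH]; first by rewrite mul0r subr0 expr0.
rewrite exprS -natr1; have : (1 - x) * (1 - n%:R * x) <= (1 - x) * (1 - x) ^+ n.
  by rewrite ler_wpM2l // subr_ge0.
have : 0 <= n%:R * x * x by rewrite !mulr_ge0.
nra.
Qed.

Lemma bernoulli_inv (x : R) n : 0 <= x <= 1 -> (1 - x) ^+ n * (1 + n%:R * x) <= 1.
Proof.
move=> /andP[x0 x1]; elim: n => [|n IH]; first by rewrite mul0r addr0 expr0 mulr1.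
apply: le_trans IH; rewrite exprS -natr1 -mulrA mulrCA ler_wpM2l ?exprn_ge0 ?subr_ge0 //.
have : 0 <= n%:R * x * x by rewrite !mulr_ge0.
nra.
Qed.

Lemma cvg_nat_geometric (r : R) : 0 <= r < 1 -> (fun n => n%:R * r ^+ n) @ \oo --> 0.
Proof.
(* Since r <= s^2 with s < 1, n r^n is at most (n s^n) s^n, and n s^n is bounded by Bernoulli's
   inequality applied to 1/s. *)
move=> /andP[r0 r1]; pose s := Num.sqrt ((1 + r) / 2).
have s2 : s ^+ 2 = (1 + r) / 2 by rewrite sqr_sqrtr //; lra.
have s0 : 0 < s by rewrite sqrtr_gt0; lra.
have s1 : s < 1 by nra.
have rs : r <= s ^+ 2 by rewrite s2; lra.
pose C := (s^-1 - 1)^-1.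
have i1 : 0 < s^-1 - 1 by rewrite subr_gt0 -invr1 ltf_pV2 ?posrE.
have H n : n%:R * s ^+ n <= C.
  rewrite -ler_pdivlMr ?exprn_gt0 // /C ler_pdivlMl // -exprVn.
  have : 1 + n%:R * (s^-1 - 1) <= (s^-1) ^+ n.
    elim: n => [|n IH]; first by rewrite mul0r addr0 expr0.
    rewrite exprS -natr1; have si0 : 0 <= s^-1 by rewrite invr_ge0 ltW.
    apply: le_trans (ler_wpM2l si0 IH).
    have : 0 <= n%:R * (s^-1 - 1) * (s^-1 - 1) by rewrite !mulr_ge0 // ltW.
    nra.
  by rewrite mulrC; lra.
apply: (@squeeze_cvgr _ _ _ _ (fun=> 0) (fun n => C * s ^+ n)).
- near=> n; rewrite mulr_ge0 ?exprn_ge0 //=.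
  apply: (@le_trans _ _ (n%:R * (s ^+ 2) ^+ n)).
    by rewrite ler_wpM2l // lerXn2r // ?nnegrE // sqr_ge0.
  by rewrite -exprM mulnC muln2 -addnn exprD mulrA ler_wpM2r // exprn_ge0 // ltW.
- exact: cvg_cst.
- rewrite -[X in _ --> X](mulr0 C); apply: cvgM; first exact: cvg_cst.
  by apply: cvg_expr; rewrite gtr0_norm.
Unshelve. all: by end_near. Qed.

Lemma cvg_step_poly a t : -1 <= t <= 1 ->
  (fun n => (step_poly a n).[t]) @ \oo --> ((a < t)%R%:R : R).
Proof.
move=> t1; under eq_fun do rewrite step_polyE.
rewrite -(lt_clip _ t1); have := qI a t1.
set q := _ - _ => q01; have [q0 q1] := andP q01.
have qn n : 0 <= q ^+ n <= 1 by rewrite exprn_ge0 //= exprn_ile1.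
have E n : (n * 2 ^ n)%:R * q ^+ n = n%:R * (2 * q) ^+ n :> R.
  by rewrite natrM natrX exprMn mulrA.
have [at_|ta] := ltP (clip a) t.
- have q2' : q < 2^-1 by rewrite /q; lra.
  have q2 : 0 <= 2 * q < 1 by lra.
  apply: (@squeeze_cvgr _ _ _ _ (fun n => 1 - n%:R * (2 * q) ^+ n) (fun=> 1)).
  + near=> n; rewrite -E bernoulli //= exprn_ile1 ?subr_ge0 ?gerBl //; by have /andP[] := qn n.
  + rewrite -[X in _ --> X]subr0; apply: cvgB; first exact: cvg_cst.
    exact: cvg_nat_geometric.
  + exact: cvg_cst.
- have q2' : 2^-1 <= q by rewrite /q; lra.
  have q2 : 1 <= 2 * q by lra.
  apply: (@squeeze_cvgr _ _ _ _ (fun=> 0) (fun n => n.+1%:R^-1)).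
  + near=> n; rewrite exprn_ge0 ?subr_ge0 /=; last by have /andP[] := qn n.
    rewrite -[leRHS]mul1r ler_pdivlMr ?ltr0n //.
    apply: le_trans (bernoulli_inv (n * 2 ^ n) (qn n)).
    rewrite ler_wpM2l ?exprn_ge0 ?subr_ge0 //; first by have /andP[] := qn n.
    by rewrite E -natr1 addrC lerD2l ler_peMr // exprn_ege1.
  + exact: cvg_cst.
  + exact: cvg_harmonic.
Unshelve. all: by end_near. Qed.

End step_polynomials.

Lemma ord3P (k : 'I_3) : [\/ k = 0, k = 1 | k = 2%:R].
Proof.
by case: k => [[|[|[|//]]] ?]; [apply: Or31|apply: Or32|apply: Or33]; exact: val_inj.
Qed.

(** * Polynomials on the sphere and a monotone class theorem *)

Section monotone_class.
Variable R : realType.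
Implicit Types (f g : S2 R -> R).

(* Restrictions to the sphere of the polynomials of degree at most [k]. *)
Inductive wp : nat -> (S2 R -> R) -> Prop :=
| wp_cst c : wp 0 (cst c)
| wp_crd k i f : wp k f -> wp k.+1 (fun x => crd i x * f x)
| wpD k f g : wp k f -> wp k g -> wp k (fun x => f x + g x)
| wpW k f : wp k f -> wp k.+1 f.

Lemma wp_le k l f : (k <= l)%N -> wp k f -> wp l f.
Proof.
by move=> /subnKC <-; elim: (l - k)%N => [|m IH] wf; rewrite ?addn0 // addnS; apply: wpW; exact: IH.
Qed.

Lemma wpM k l f g : wp k f -> wp l g -> wp (k + l) (fun x => f x * g x).
Proof.
have wZ c h m : wp m h -> wp m (fun x => c * h x).
  elim=> {m h} [c'|m i h _ IH|m h h' _ IH _ IH'|m h _ IH].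
  - exact: (wp_cst (c * c')).
  - rewrite (_ : (fun x => _) = (fun x => crd i x * (c * h x))); first exact: wp_crd.
    by apply/funext => x; rewrite mulrCA.
  - rewrite (_ : (fun x => _) = (fun x => c * h x + c * h' x)); first exact: wpD.
    by apply/funext => x; rewrite mulrDr.
  - exact: wpW.
move=> wf wg; elim: wf => {k f} [c|k i f _ IH|k f f' _ IH _ IH'|k f _ IH].
- exact: wZ.
- rewrite (_ : (fun x => _) = (fun x => crd i x * (f x * g x))); first exact: wp_crd.
  by apply/funext => x; rewrite mulrA.
- rewrite (_ : (fun x => _) = (fun x => f x * g x + f' x * g x)); first exact: wpD.
  by apply/funext => x; rewrite mulrDl.
- exact: wpW.
Qed.

Lemma wp_Ck j k f : wp k f -> Ck j f.
Proof.
elim=> {k f} [c|k i f _ IH|k f f' _ IH _ IH'|k f _ IH] //.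
- exact: Ck_cst.
- by apply: CkM => //; exact: Ck_crd.
- exact: CkD.
Qed.

Definition spoly f := exists k, wp k f.

Lemma spolyM f g : spoly f -> spoly g -> spoly (fun x => f x * g x).
Proof. by move=> [k wf] [l wg]; exists (k + l)%N; exact: wpM. Qed.

Lemma spolyD f g : spoly f -> spoly g -> spoly (fun x => f x + g x).
Proof.
move=> [k wf] [l wg]; exists (k + l)%N; apply: wpD.
  by apply: wp_le wf; rewrite leq_addr.
by apply: wp_le wg; rewrite leq_addl.
Qed.

Lemma spoly_cst c : spoly (cst c). Proof. by exists 0; exact: wp_cst. Qed.

Lemma spoly_crd i : spoly (crd i).
Proof.
exists 1%N; rewrite (_ : crd i = (fun x => crd i x * cst 1 x)).
  by apply: wp_crd; exact: wp_cst.
by apply/funext => x; rewrite mulr1.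
Qed.

Lemma spoly_horner (p : {poly R}) f : spoly f -> spoly (fun x => p.[f x]).
Proof.
move=> sf; elim/poly_ind: p => [|p c IH].
  rewrite (_ : (fun x => _) = cst 0); first exact: spoly_cst.
  by apply/funext => x; rewrite horner0.
rewrite (_ : (fun x => _) = (fun x => p.[f x] * f x + cst c x)).
  by apply: spolyD; [exact: spolyM|exact: spoly_cst].
by apply/funext => x; rewrite !hornerE.
Qed.

Lemma crd_bound i x : -1 <= @crd R i x <= 1.
Proof.
rewrite -ler_norml -(@ler_pXn2r _ 2) ?nnegrE // expr1n -normrX ger0_norm ?sqr_ge0 //.
rewrite -(dot_pt x) /dot (bigD1 i) //= -expr2 lerDl.
by apply: sumr_ge0 => j _; rewrite -expr2 sqr_ge0.
Qed.

Definition box (a : R * R * R) : set (S2 R) :=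
  [set x | [/\ a.1.1 < crd 0 x, a.1.2 < crd 1 x & a.2 < crd 2%:R x]].

Lemma measurable_box_gen :
  @measurable _ (S2 R) = <<s range box >>.
Proof.
apply/seteqP; split.
  apply: smallest_sub; first exact: smallest_sigma_algebra.
  move=> B; rewrite -bigcup_mkord_ord => -[k _ [C mC <-]]; pose i : 'I_3 := inord k.
  pose T' := g_sigma_algebraType (range box).
  suff : measurable_fun [set: T'] (crd i : T' -> R) by move=> /(_ measurableT _ mC).
  apply: (measurability (@RGenOInfty.G R)); first exact: RGenOInfty.measurableE.
  move=> _ [_ [a ->] <-]; rewrite setTI; apply: sub_gen_smallest.
  (* The bound -2 stands for an absent constraint, so that a condition on a single coordinate is
     also a [box]. *)
  have lo (j : 'I_3) x : -2 < @crd R j x by have := crd_bound j x; lra.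
  have [->|->|->] := ord3P i.
  - exists (a, -2, -2) => //; apply/seteqP; split => x /=; rewrite in_itv /= andbT.
      by case.
    by move=> ?; split => //=; exact: lo.
  - exists (-2, a, -2) => //; apply/seteqP; split => x /=; rewrite in_itv /= andbT.
      by case.
    by move=> ?; split => //=; exact: lo.
  - exists (-2, -2, a) => //; apply/seteqP; split => x /=; rewrite in_itv /= andbT.
      by case.
    by move=> ?; split => //=; exact: lo.
apply: smallest_sub; first exact: sigma_algebra_measurable.
move=> _ [a _ <-].
rewrite (_ : box a = crd 0 @^-1` `]a.1.1, +oo[ `&` crd 1 @^-1` `]a.1.2, +oo[ `&` crd 2%:R @^-1` `]a.2, +oo[).
  have mp i (b : R) : measurable (@crd R i @^-1` `]b, +oo[).
    by rewrite -[X in measurable X]setTI; apply: measurable_crd.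
  by do 2 apply: measurableI => //.
by apply/seteqP; split => x /=; rewrite !in_itv /= !andbT => -[]; [|case].
Qed.

(** Boxes are stable under intersection and generate the sigma-algebra, and the indicator of a box
    is the bounded limit of products of three step polynomials. Linearity and bounded limits give
    complements and disjoint unions, so Dynkin's theorem applies. *)
Lemma monotone_class (H : (S2 R -> R) -> Prop) :
  (forall f, spoly f -> H f) ->
  (forall f g, H f -> H g -> H (fun x => f x + g x)) ->
  (forall c f, H f -> H (fun x => c * f x)) ->
  (forall (f_ : nat -> S2 R -> R) f (M : R), (forall n, H (f_ n)) ->
    (forall n x, `|f_ n x| <= M) -> (forall x, f_ n x @[n --> \oo] --> f x) -> H f) ->
  forall A, measurable A -> H \1_A.
Proof.
move=> Hp HD HZ Hlim A; rewrite measurable_box_gen => sA.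
have H1 : H \1_[set: S2 R].
  by rewrite indicT; apply: Hp; exact: spoly_cst.
apply: (@dynkin_induction _ _ (range box) (fun A => H \1_A)) sA => //.
- exact: measurable_box_gen.
- move=> _ _ [a _ <-] [b _ <-].
  exists (Num.max a.1.1 b.1.1, Num.max a.1.2 b.1.2, Num.max a.2 b.2) => //.
  apply/seteqP; split => x; rewrite /box /= !gt_max.
    by move=> [/andP[? ?] /andP[? ?] /andP[? ?]].
  by move=> [[-> -> ->] [-> -> ->]].
- move=> _ [a _ <-].
  apply: (Hlim (fun n x => (step_poly a.1.1 n).[crd 0 x] * (step_poly a.1.2 n).[crd 1 x] *
    (step_poly a.2 n).[crd 2%:R x]) _ 1).
  + move=> n; apply: Hp; apply: spolyM; first apply: spolyM; apply: spoly_horner; exact: spoly_crd.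
  + move=> n x; have B b i := step_poly_bound b n (crd_bound i x).
    have /andP[p0 p1] := B a.1.1 0; have /andP[q0 q1] := B a.1.2 1.
    have /andP[r0 r1] := B a.2 2%:R.
    by rewrite !normrM !ger0_norm // mulr_ile1 ?mulr_ge0 ?mulr_ile1.
  + move=> x; rewrite (_ : \1_(box a) x = (a.1.1 < crd 0 x)%R%:R * (a.1.2 < crd 1 x)%R%:R * (a.2 < crd 2%:R x)%R%:R).
      by apply: cvgM; first apply: cvgM; apply: cvg_step_poly; exact: crd_bound.
    rewrite indicE -!natrM !mulnb; congr (nat_of_bool _)%:R.
    apply/idP/idP; rewrite inE /box /=; first by case=> -> -> ->.
    by move=> /andP[/andP[? ?] ?]; split.
- move=> S mS HS; rewrite (_ : \1_(~` S) = (fun x => \1_[set: S2 R] x + (-1) * \1_S x)).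
    by apply: HD => //; exact: HZ.
  apply/funext => x; rewrite !indicE in_setT in_setC; case: (x \in S) => /=; ring.
- move=> F mF tF HF.
  (* Disjointness keeps the partial sums of indicators in {0, 1}, which provides the uniform bound
     required of a limit. *)
  have Sk k x : F k x -> forall n, \sum_(i < n) \1_(F i) x = (k < n)%N%:R :> R.
    move=> Fk; elim=> [|n IH]; first by rewrite big_ord0.
    rewrite big_ord_recr /= IH indicE ltnS.
    have [kn|kn] := eqVneq k n; first by rewrite -kn ltnn leqnn add0r mem_set.
    rewrite ltn_neqAle kn /= memNset ?addr0 // => Fn; move/eqP: kn; apply.
    exact: (tF k n I I (ex_intro _ x (conj Fk Fn))).
  apply: (Hlim (fun n x => \sum_(i < n) \1_(F i) x) _ 1).
  + elim=> [|n IH].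
      rewrite (_ : (fun x => _) = cst 0); first by apply: Hp; exact: spoly_cst.
      by apply/funext => x; rewrite big_ord0.
    rewrite (_ : (fun x => _) = (fun x => \sum_(i < n) \1_(F i) x + \1_(F n) x)).
      exact: HD.
    by apply/funext => x; rewrite big_ord_recr.
  + move=> n x; have [[k Fk]|nF] := pselect (exists k, F k x).
      by rewrite (Sk _ _ Fk) normr_nat lern1 leq_b1.
    by rewrite big1 ?normr0 // => i _; rewrite indicE memNset // => Fi; apply: nF; exists i.
  + move=> x; have [[k Fk]|nF] := pselect (exists k, F k x).
      under eq_fun do rewrite (Sk _ _ Fk).
      rewrite indicE mem_set; last by exists k.
      apply: cvg_near_cst; near=> n.
      by rewrite (_ : (k < n)%N) //; near: n; exact: nbhs_infty_gt.
    rewrite indicE memNset; last by move=> [k _ Fk]; apply: nF; exists k.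
    apply: cvg_near_cst; near=> n.
    by rewrite big1 // => i _; rewrite indicE memNset // => Fi; apply: nF; exists i.
Unshelve. all: by end_near. Qed.

End monotone_class.

(** * Law of the scalar product with a fixed point *)

Section zonal_law.
Variable R : realType.
Implicit Types (f g w : S2 R -> R) (x y : S2 R).

Lemma bounded_cvg_Rintegral w (f_ : nat -> S2 R -> R) f (M : R) :
  (@dv R).-integrable setT (EFin \o w) ->
  (forall n, measurable_fun setT (f_ n)) ->
  (forall n x, `|f_ n x| <= M) -> (forall x, f_ n x @[n --> \oo] --> f x) ->
  \int[@dv R]_x (w x * f_ n x) @[n --> \oo] --> \int[@dv R]_x (w x * f x).
Proof.
move=> iw mf fM fc.
have mw : measurable_fun setT w by apply/measurable_EFinP; exact: measurable_int iw.
have mlim : measurable_fun setT f by apply: measurable_fun_cvg mf _ => x _; exact: fc.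
have M0 : 0 <= M := le_trans (normr_ge0 _) (fM 0 (pole R)).
have ig : (@dv R).-integrable setT (EFin \o (fun x => M * `|w x|)).
  have := integrableZl measurableT M (integrable_abse iw); congr (integrable _ _ _).
have mwf n : measurable_fun setT (fun x => (w x * f_ n x)%:E).
  by apply/measurable_EFinP; exact: measurable_funM.
have mwl : measurable_fun setT (fun x => (w x * f x)%:E).
  by apply/measurable_EFinP; exact: measurable_funM.
have cwf x : (w x * f_ n x)%:E @[n --> \oo] --> (w x * f x)%:E.
  apply: cvg_EFin; first exact: nearW.
  by apply: cvgM; [exact: cvg_cst|exact: fc].
have bd x n : (`|(w x * f_ n x)%:E| <= (M * `|w x|)%:E)%E.
  by rewrite lee_fin normrM mulrC ler_wpM2r.
have [il _ cv] := @dominated_convergence _ _ _ (@dv R) setT measurableT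
  (fun n x => (w x * f_ n x)%:E) (fun x => (w x * f x)%:E) (EFin \o (fun x => M * `|w x|))
  mwf mwl (aeW _ (fun x _ => cwf x)) ig (aeW _ (fun x n _ => bd x n)).
apply: fine_cvg; rewrite fineK; first exact: cv.
exact: integrable_fin_num il.
Qed.

Lemma measurable_sdot y : measurable_fun [set: S2 R] (fun x => sdot x y).
Proof. exact: Ck0_measurable (Ck_sdot 0 y). Qed.

Lemma Ck0_horner (q : {poly R}) z : Ck 0 (fun x => q.[sdot x z]).
Proof.
have [k wk] : spoly (fun x => q.[sdot x z]).
  apply: spoly_horner; rewrite (_ : (fun x => sdot x z) = (fun x => cst (pt z 0 0) x * crd 0 x +
     cst (pt z 0 1) x * crd 1 x + cst (pt z 0 2%:R) x * crd 2%:R x)).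
    by apply: spolyD; first apply: spolyD; (apply: spolyM; [exact: spoly_cst|exact: spoly_crd]).
  by apply/funext => x; rewrite sdotE sum3.
exact: wp_Ck wk.
Qed.

Lemma zonal_horner y y' (p : {poly R}) :
  \int[@dv R]_x p.[sdot x y] = \int[@dv R]_x p.[sdot x y'].
Proof.
suff H m : \int[@dv R]_x (p.[sdot x y] * sdot x y ^+ m) = \int[@dv R]_x (p.[sdot x y'] * sdot x y' ^+ m).
  have E z : (fun x => p.[sdot x z]) =1 (fun x => p.[sdot x z] * sdot x z ^+ 0).
    by move=> x; rewrite expr0 mulr1.
  by rewrite (eq_RI (E y)) (eq_RI (E y')).
elim/poly_ind: p m => [|p c IH] m.
  by apply: eq_Rintegral => x _; rewrite !horner0 !mul0r.
have E z : (fun x => (p * 'X + c%:P).[sdot x z] * sdot x z ^+ m) =1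
    (fun x => p.[sdot x z] * sdot x z ^+ m.+1 + c * sdot x z ^+ m).
  by move=> x; rewrite !hornerE exprS; ring.
have i1 z : (@dv R).-integrable setT (EFin \o (fun x => p.[sdot x z] * sdot x z ^+ m.+1)).
  apply: Ck0_integrable; rewrite (_ : (fun x => _) = (fun x => (p * 'X ^+ m.+1).[sdot x z])).
    exact: Ck0_horner.
  by apply/funext => x; rewrite !hornerE.
have i2 z : (@dv R).-integrable setT (EFin \o (fun x => sdot x z ^+ m)).
  apply: Ck0_integrable; rewrite (_ : (fun x => _) = (fun x => ('X^m : {poly R}).[sdot x z])).
    exact: Ck0_horner.
  by apply/funext => x; rewrite !hornerE.
have i3 z : (@dv R).-integrable setT (EFin \o (fun x => c * sdot x z ^+ m)).
  apply: Ck0_integrable; rewrite (_ : (fun x => _) = (fun x => (c%:P * 'X^m : {poly R}).[sdot x z])).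
    exact: Ck0_horner.
  by apply/funext => x; rewrite !hornerE.
rewrite (eq_RI (E y)) (eq_RI (E y')).
rewrite (RintegralD measurableT (i1 y) (i3 y)) (RintegralD measurableT (i1 y') (i3 y')).
rewrite (RintegralZl _ measurableT (i2 y)) (RintegralZl _ measurableT (i2 y')).
by rewrite IH (zonal_moment y y').
Qed.

(** Moments determine the law: the integrals of the step polynomials do not depend on y, and they
    converge to the measure of the half-line. *)
Lemma zonal_ray y (a : R) : @dv R [set x | a < sdot x y] = @dv R [set x | a < sdot x (pole R)].
Proof.
have mr z : measurable [set x | a < sdot x z].
  rewrite (_ : [set x | _] = (fun x : S2 R => sdot x z) @^-1` `]a, +oo[).
    by rewrite -[X in measurable X]setTI; apply: measurable_sdot.
  by apply/seteqP; split => x /=; rewrite in_itv /= andbT.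
have L z : \int[@dv R]_x (step_poly a n).[sdot x z] @[n --> \oo] --> fine (@dv R [set x | a < sdot x z]).
  have mp n : measurable_fun setT (fun x => (step_poly a n).[sdot x z]).
    by apply: Ck0_measurable; exact: Ck0_horner.
  have bp n x : `|(step_poly a n).[sdot x z]| <= 1.
    by have /andP[p0 p1] := step_poly_bound a n (sdot_bound x z); rewrite ger0_norm.
  have cp x : (step_poly a n).[sdot x z] @[n --> \oo] --> (\1_[set x | a < sdot x z] x : R).
    rewrite indicE (_ : _ \in _ = (a < sdot x z)); first exact: cvg_step_poly (sdot_bound x z).
    by apply/idP/idP; rewrite inE.
  have := bounded_cvg_Rintegral (Ck0_integrable (Ck_cst 0 1)) mp bp cp.
  rewrite (_ : (fun n => _) = (fun n => \int[@dv R]_x (step_poly a n).[sdot x z])); last first.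
    by apply/funext => n; apply: eq_RI => x; rewrite mul1r.
  rewrite (_ : \int[@dv R]_x (cst 1 x * \1_[set x | a < sdot x z] x) = fine (@dv R [set x | a < sdot x z])).
    by move=> X; exact: X.
  rewrite (eq_RI (g := \1_[set x | a < sdot x z])); last by move=> x; rewrite mul1r.
  by rewrite /Rintegral integral_indic // setIT.
have := L y; under eq_fun do rewrite (zonal_horner y (pole R)).
move=> /(cvg_unique _ (L (pole R))) => /(_ (@norm_hausdorff _ _)) E.
have fK z : (fine (@dv R [set x | a < sdot x z]))%:E = @dv R [set x | a < sdot x z].
  by apply: fineK; apply: fin_num_measure.
by rewrite -(fK y) -(fK (pole R)) E.
Qed.

Lemma zonal_set y (B : set R) : measurable B ->
  @dv R ((fun x => sdot x y) @^-1` B) = @dv R ((fun x => sdot x (pole R)) @^-1` B).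
Proof.
move=> mB0; have : <<s @RGenOInfty.G R >> B.
  exact: (eq_ind _ (fun X : set (set R) => X B) mB0 _ (RGenOInfty.measurableE R)).
pose P (C : set R) :=
  @dv R ((fun x => sdot x y) @^-1` C) = @dv R ((fun x => sdot x (pole R)) @^-1` C).
have mpre z C : measurable C -> measurable ((fun x : S2 R => sdot x z) @^-1` C).
  by move=> mC; rewrite -[X in measurable X]setTI; apply: measurable_sdot.
apply: (@dynkin_induction _ R (@RGenOInfty.G R) P).
- exact: RGenOInfty.measurableE.
- move=> _ _ [a ->] [b ->]; exists (Num.max a b).
  apply/seteqP; split => t /=; rewrite !in_itv /= !andbT gt_max; first by case=> -> ->.
  by case/andP.
- by rewrite /P !preimage_setT.
- move=> _ [a ->]; rewrite /P; have := zonal_ray y a.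
  have E z : [set x | a < sdot x z] = (fun x => sdot x z) @^-1` `]a, +oo[.
    by apply/seteqP; split => x /=; rewrite in_itv /= andbT.
  by rewrite !E.
- move=> C mC PC; rewrite /P.
  change (@dv R (~` ((fun x => sdot x y) @^-1` C)) = @dv R (~` ((fun x => sdot x (pole R)) @^-1` C))).
  have D z : (@dv R (~` ((fun x => sdot x z) @^-1` C)) =
      @dv R setT - @dv R ((fun x => sdot x z) @^-1` C))%E.
    rewrite -{2}[(fun x => sdot x z) @^-1` C]setTI -setTD; apply: measureD => //; last exact: dv_ltyT.
    exact: mpre.
  by rewrite !D PC.
- move=> F mF tF PF; rewrite /P !preimage_bigcup.
  have tr z : trivIset setT (fun i => (fun x : S2 R => sdot x z) @^-1` F i).
    apply/trivIsetP => i j _ _ ij; rewrite -preimage_setI.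
    by move/trivIsetP : tF => /(_ _ _ I I ij) ->; rewrite preimage_set0.
  have mU z : measurable (\bigcup_i (fun x : S2 R => sdot x z) @^-1` F i).
    by apply: bigcupT_measurable => i; exact: mpre.
  have sa z := @measure_semi_sigma_additive _ _ _ (@dv R) _ (fun i => mpre z _ (mF i)) (tr z) (mU z).
  have := sa y; rewrite (_ : (fun n => _) = (fun n => (\sum_(0 <= i < n) @dv R ((fun x => sdot x (pole R)) @^-1` F i))%E)); last first.
    by apply/funext => n; apply: eq_bigr => i _; exact: PF.
  by move=> /(cvg_unique _ (sa (pole R))) => /(_ (@ereal_hausdorff _)).
Qed.

(** Archimedes' theorem. By [zonal_set] the point y may be taken to be the pole, where x.y is the
    chart coordinate z; integrating out t leaves the factor 2 pi. *)
Lemma zonal_integral y (phi : R -> \bar R) : measurable_fun setT phi ->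
  (forall t, (0 <= phi t)%E) ->
  (\int[@dv R]_x phi (sdot x y) =
   (2 * pi)%:E * \int[lebesgue_measure]_(t in `[(-1)%R, 1%R]) phi t)%E.
Proof.
move=> mphi phi0.
have S z := ge0_integral_pushforward (measurable_sdot z) (@dv R) measurableT mphi (fun t _ => phi0 t).
transitivity (\int[@dv R]_x phi (sdot x (pole R)))%E.
  apply: (etrans (esym (S y))); apply: etrans (S (pole R)).
  pose mm z := measure_function_pushforward__canonical__measure_function_Measure (@dv R) (measurable_sdot z).
  apply: (@eq_measure_integral _ _ _ setT (mm (pole R)) (mm y)) => A mA *.
  exact: zonal_set.
have mc z : measurable_fun setT (fun x : S2 R => phi (sdot x z)).
  by apply: measurableT_comp => //; exact: measurable_sdot.
rewrite ge0_integral_dv //.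
pose leb := @lebesgue_measure R.
pose D := @cyl_dom R.
pose h : measurableTypeR R * measurableTypeR R -> \bar R := (phi \o fst) \_ D.
have mh : measurable_fun setT h.
  apply/(measurable_restrictT _ _).1; first exact: measurable_cyl_dom.
  by apply: measurable_funTS; exact: measurableT_comp.
have h0 p : (0 <= h p)%E by rewrite /h patchE; case: ifP => // _; exact: phi0.
transitivity (\int[leb \x leb]_p h p)%E.
  rewrite [RHS](_ : _ = \int[leb \x leb]_(p in D) phi p.1)%E; last by rewrite /h -integral_mkcond.
  apply: eq_integral => -[z t]; rewrite inE => -[/= zI tJ].
  congr (phi _); rewrite /sdot pt_cyl; last by rewrite in_itv in zI.
  by rewrite /pt /= dot_vec3 /= !mulr0 !add0r mulr1.
rewrite fubini_tonelli1 // -ge0_integralZl //; last 2 first.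
- exact: measurable_funTS.
- by rewrite lee_fin mulr_ge0 // pi_ge0.
rewrite [RHS]integral_mkcond; apply: eq_integral => z _; rewrite /fubini_F /h.
have lebJ : leb `[0%R, (2 * pi)%R]%classic = (2 * pi)%:E.
  by rewrite /leb lebesgue_measure_itv /= lte_fin mulr_gt0 ?pi_gt0 // -EFinB subr0.
rewrite [RHS]patchE; case: ifPn => zI.
  rewrite -lebJ muleC -integral_cst //.
  rewrite [RHS]integral_mkcond; apply: eq_integral => t _; rewrite !patchE /D /cyl_dom.
  have -> : ((z, t) \in `[-1, 1] `*` `[0, 2 * pi]) = (t \in `[0%R, (2 * pi)%R]%classic).
    apply/idP/idP; rewrite !inE /=; first by case.
    by move=> tJ; split => //=; rewrite inE in zI.
  by case: ifP.
rewrite integral0_eq // => t _; rewrite patchE ifF //.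
by apply/negbTE; apply: contra zI; rewrite !inE => -[].
Qed.

End zonal_law.

(** * Density of polynomials in L^2 *)

Section density.
Variable R : realType.
Implicit Types (f g h p q : S2 R -> R) (x y : S2 R).
Local Notation mu := (@dv R).
Local Notation meas f := (measurable_fun [set: S2 R] f).

Lemma cvg_norm_bound (f_ : nat -> R) (l M : R) : (forall n, `|f_ n| <= M) ->
  f_ n @[n --> \oo] --> l -> `|l| <= M.
Proof.
move=> fM fl; have nl : `|f_ n| @[n --> \oo] --> `|l| by apply: cvg_norm.
rewrite -(cvg_lim (@norm_hausdorff _ _) nl); apply: limr_le; first by apply/cvg_ex; exists `|l|.
exact: nearW.
Qed.

Lemma integrable_mul_bdd f g (M : R) : mu.-integrable setT (EFin \o f) -> meas g ->
  (forall x, `|g x| <= M) -> mu.-integrable setT (EFin \o (fun x => f x * g x)).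
Proof.
move=> fi mg gM; have mf : meas f by apply/measurable_EFinP; exact: measurable_int fi.
apply: (le_integrable _ _ (g := fun x => (M%:E * (EFin \o f) x)%E)) => //.
- by apply/measurable_EFinP; exact: measurable_funM.
- move=> x _ /=; rewrite lee_fin !normrM mulrC ler_wpM2r //.
  by apply: le_trans (gM x) (ler_norm _).
- exact: integrableZl.
Qed.

Lemma dominated_small (g_ : nat -> S2 R -> R) (G : S2 R -> R) (e : R) : 0 < e ->
  (forall n, meas (g_ n)) -> mu.-integrable setT (EFin \o G) ->
  (forall n x, 0 <= g_ n x <= G x) -> (forall x, g_ n x @[n --> \oo] --> (0 : R)) ->
  exists n, (\int[mu]_x (g_ n x)%:E <= e%:E)%E.
Proof.
move=> e0 mg iG gG gc.
have mge n : measurable_fun setT (fun x => (g_ n x)%:E) by exact/measurable_EFinP.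
have cg x : (g_ n x)%:E @[n --> \oo] --> (cst 0%E : S2 R -> \bar R) x.
  by apply: cvg_EFin; [exact: nearW|exact: gc].
have bd x n : (`|(g_ n x)%:E| <= (EFin \o G) x)%E.
  by have /andP[g0 gG'] := gG n x; rewrite lee_fin ger0_norm.
have [_ _] := @dominated_convergence _ _ _ mu setT measurableT (fun n x => (g_ n x)%:E)
  (cst 0%E) (EFin \o G) mge (measurable_cst _) (aeW _ (fun x _ => cg x)) iG
  (aeW _ (fun x n _ => bd x n)).
rewrite integral0 => cv.
have /fine_cvgP[[N1 _ f1] /cvgr_lt/(_ e e0)[N2 _ f2]] : (\int[mu]_x (g_ n x)%:E)%E @[n --> \oo] --> (0 : R)%:E.
  exact: cv.
exists (N1 + N2)%N; rewrite -(fineK (f1 _ _)) /= ?leq_addr // lee_fin ltW //.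
by apply: f2; rewrite /= leq_addl.
Qed.

Definition L2appr f := meas f /\ forall e : R, 0 < e ->
  exists2 p, spoly p & (\int[mu]_x ((f x - p x) ^+ 2)%:E <= e%:E)%E.

Lemma spoly_meas p : spoly p -> meas p.
Proof. by move=> [k wk]; apply: Ck0_measurable; exact: wp_Ck wk. Qed.

Lemma meas_sq f g : meas f -> meas g -> measurable_fun setT (fun x => ((f x - g x) ^+ 2)%:E).
Proof. by move=> mf mg; apply/measurable_EFinP; apply: measurable_funX; exact: measurable_funB. Qed.

Lemma sq_triangle f g h (a b : R) : meas f -> meas g -> meas h ->
  (\int[mu]_x ((f x - g x) ^+ 2)%:E <= a%:E)%E -> (\int[mu]_x ((g x - h x) ^+ 2)%:E <= b%:E)%E ->
  (\int[mu]_x ((f x - h x) ^+ 2)%:E <= (2 * (a + b))%:E)%E.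
Proof.
move=> mf mg mh fg gh.
have m1 := meas_sq mf mg; have m2 := meas_sq mg mh; have m3 := meas_sq mf mh.
apply: (@le_trans _ _ (\int[mu]_x (2%:E * (((f x - g x) ^+ 2)%:E + ((g x - h x) ^+ 2)%:E)))%E).
  apply: ge0_le_integral => //.
  - by move=> x _; rewrite lee_fin sqr_ge0.
  - by apply: measurable_funeM; exact: emeasurable_funD.
  - move=> x _; rewrite -EFinD -EFinM lee_fin.
    have := sqr_ge0 ((f x - g x) - (g x - h x)); nra.
rewrite ge0_integralZl_EFin //; last 2 first.
- by move=> x _; rewrite adde_ge0 // lee_fin sqr_ge0.
- exact: emeasurable_funD.
rewrite EFinM lee_pmul2l ?lte_fin // ge0_integralD //; last 2 first.
- by move=> x _; rewrite lee_fin sqr_ge0.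
- by move=> x _; rewrite lee_fin sqr_ge0.
by rewrite EFinD leeD.
Qed.

Lemma L2apprD f g : L2appr f -> L2appr g -> L2appr (fun x => f x + g x).
Proof.
move=> [mf af] [mg ag]; split; first exact: measurable_funD.
move=> e e0; have e4 : 0 < e / 4 by rewrite divr_gt0.
have [p sp fp] := af _ e4; have [q sq gq] := ag _ e4.
exists (fun x => p x + q x); first exact: spolyD.
have mp := spoly_meas sp; have mq := spoly_meas sq.
have mfg : meas (fun x => f x + g x) by exact: measurable_funD.
have mpg : meas (fun x => p x + g x) by exact: measurable_funD.
have mpq : meas (fun x => p x + q x) by exact: measurable_funD.
apply: le_trans (sq_triangle mfg mpg mpq (a := e / 4) (b := e / 4) _ _) _.
- by under eq_integral do rewrite opprD addrACA subrr addr0.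
- by under eq_integral do rewrite opprD addrACA subrr add0r.
- by rewrite lee_fin; lra.
Qed.

Lemma L2apprZ c f : L2appr f -> L2appr (fun x => c * f x).
Proof.
move=> [mf af]; split; first exact: measurable_funM.
move=> e e0; have c0 : 0 < c ^+ 2 + 1 by rewrite ltr_wpDl // sqr_ge0.
have e4 : 0 < e / (c ^+ 2 + 1) by rewrite divr_gt0.
have [p sp fp] := af _ e4.
exists (fun x => c * p x); first by apply: spolyM => //; exact: spoly_cst.
have mp := spoly_meas sp.
under eq_integral do rewrite -mulrBr exprMn EFinM.
rewrite ge0_integralZl_EFin ?sqr_ge0 //; last 2 first.
- by move=> x _; rewrite lee_fin sqr_ge0.
- exact: meas_sq.
apply: le_trans (lee_wpmul2l _ fp) _; first by rewrite lee_fin sqr_ge0.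
rewrite -EFinM lee_fin mulrCA ger_pMr // ler_pdivrMr // mul1r lerDl //.
Qed.

(** The squared errors are dominated by an integrable G and not by a constant: simple functions
    below an unbounded f only satisfy (f - f_n)^2 <= f^2. *)
Lemma L2appr_lim (f_ : nat -> S2 R -> R) f G : meas f ->
  (forall n, L2appr (f_ n)) -> mu.-integrable setT (EFin \o G) ->
  (forall n x, (f x - f_ n x) ^+ 2 <= G x) ->
  (forall x, f_ n x @[n --> \oo] --> f x) -> L2appr f.
Proof.
move=> mf af iG fG fc; split => // e e0; have e4 : 0 < e / 4 by rewrite divr_gt0.
have [n Hn] : exists n, (\int[mu]_x ((f x - f_ n x) ^+ 2)%:E <= (e / 4)%:E)%E.
  apply: dominated_small iG _ _ => //.
  - by move=> n; apply: measurable_funX; apply: measurable_funB => //; exact: (af n).1.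
  - by move=> n x; rewrite sqr_ge0 fG.
  - move=> x; rewrite (_ : 0 = (f x - f x) ^+ 2); last by rewrite subrr expr0n.
    have h : (f x - f_ n x) @[n --> \oo] --> f x - f x by apply: cvgB; [exact: cvg_cst|exact: fc].
    rewrite [X in _ --> X]expr2; under eq_fun do rewrite expr2.
    exact: cvgM.
have [p sp fp] := (af n).2 _ e4; exists p => //.
apply: le_trans (sq_triangle mf (af n).1 (spoly_meas sp) Hn fp) _.
by rewrite lee_fin; lra.
Qed.

Lemma spoly_L2appr p : spoly p -> L2appr p.
Proof.
move=> sp; split; first exact: spoly_meas.
move=> e e0; exists p => //; under eq_integral do rewrite subrr expr0n.
by rewrite integral0 lee_fin ltW.
Qed.

Lemma L2appr_indic A : measurable A -> L2appr \1_A.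
Proof.
apply: monotone_class => //.
- exact: spoly_L2appr.
- exact: L2apprD.
- exact: L2apprZ.
- move=> f_ f M af fM fc.
  have mf : meas f by apply: measurable_fun_cvg (fun n => (af n).1) _ => x _; exact: fc.
  have fM' x : `|f x| <= M.
    exact: (cvg_norm_bound (fun n => fM n x) (fc x)).
  apply: (L2appr_lim mf af (G := cst (4 * M ^+ 2)) _ _ fc); first exact: Ck0_integrable (Ck_cst _ _).
  move=> n x /=; have := fM n x; have := fM' x; rewrite !ler_norml => /andP[? ?] /andP[? ?]; nra.
Qed.

Import HBNNSimple.
Lemma L2appr_ge0 f : meas f -> (forall x, 0 <= f x) ->
  mu.-integrable setT (EFin \o (fun x => f x ^+ 2)) -> L2appr f.
Proof.
move=> mf f0 if2; have mfe : measurable_fun setT (EFin \o f) by exact/measurable_EFinP.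
pose f_ n := nnsfun_approx measurableT mfe n.
have af n : L2appr (fun x => f_ n x).
  have [s fs] : exists s : seq R, forall x, f_ n x = \sum_(r <- s) r * \1_((f_ n) @^-1` [set r]) x.
    by eexists => x; rewrite fimfunE fsbig_finite.
  rewrite (funext fs) => {fs}; elim: s => [|r s IH].
    rewrite (_ : (fun x => _) = cst 0); first exact/spoly_L2appr/spoly_cst.
    by apply/funext => x; rewrite big_nil.
  rewrite (_ : (fun x => _) = (fun x => r * \1_((f_ n) @^-1` [set r]) x +
     \sum_(r <- s) r * \1_((f_ n) @^-1` [set r]) x)); last by apply/funext => x; rewrite big_cons.
  apply: L2apprD => //; apply: L2apprZ; apply: L2appr_indic.
  by rewrite -[X in measurable X]setTI; apply: (@measurable_funP _ _ _ _ _ (f_ n)).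
have f_le n x : f_ n x <= f x.
  rewrite -lee_fin /f_ nnsfun_approxE.
  exact: (@le_approx _ _ _ setT (EFin \o f) n x (fun z _ => f0 z) I).
have f_0 n x : 0 <= f_ n x by exact: fun_ge0.
apply: (L2appr_lim mf af if2) => [n x|x].
- by have := f_le n x; have := f_0 n x; have := f0 x; nra.
- have := @cvg_nnsfun_approx _ _ _ _ measurableT _ mfe (fun z _ => f0 z) x I.
  by move=> /fine_cvgP[_].
Qed.

Lemma L2appr_L2 f : meas f -> mu.-integrable setT (EFin \o (fun x => f x ^+ 2)) -> L2appr f.
Proof.
move=> mf if2.
have H (s : R) : s ^+ 2 = 1 -> L2appr (fun x => Num.max (s * f x) 0).
  move=> s2; have m1 : meas (fun x => Num.max (s * f x) 0).
    by apply: measurable_maxr => //; exact: measurable_funM.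
  apply: L2appr_ge0 => //; first by move=> x; rewrite le_max lexx orbT.
  apply: le_integrable if2 => //.
    by apply/measurable_EFinP; apply: measurable_funX.
  move=> x _; rewrite lee_fin !ger0_norm ?sqr_ge0 //.
  have [_|_] := leP (s * f x) 0; first by rewrite expr0n sqr_ge0.
  by rewrite exprMn s2 mul1r.
rewrite (_ : f = (fun x => Num.max (1 * f x) 0 + -1 * Num.max (-1 * f x) 0)).
  by apply: L2apprD; [|apply: L2apprZ]; apply: H; rewrite ?sqrrN expr1n.
by apply/funext => x; rewrite mul1r !mulN1r; have [?|?] := leP (f x) 0; have [?|?] := leP (- f x) 0; lra.
Qed.

(** f is merely integrable here, so density in L^2 does not apply. Instead the bounded functions
    orthogonal to f form a class to which [monotone_class] applies, and f then integrates to 0 over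
    every measurable set. *)
Lemma ortho_spoly_ae0 f : meas f -> mu.-integrable setT (EFin \o f) ->
  (forall p, spoly p -> \int[mu]_x (f x * p x) = 0) -> {ae mu, forall x, f x = 0}.
Proof.
move=> mf fi fp.
pose H (g : S2 R -> R) := [/\ meas g, exists M : R, forall x, `|g x| <= M & \int[mu]_x (f x * g x) = 0].
have iM g (M : R) : meas g -> (forall x, `|g x| <= M) -> mu.-integrable setT (EFin \o (fun x => f x * g x)).
  by move=> mg gM; exact: integrable_mul_bdd fi mg gM.
have H1 A : measurable A -> H \1_A.
  apply: monotone_class => {A}.
  - move=> p sp; split; [exact: spoly_meas| |exact: fp].
    by case: sp => k wk; apply: Ck0_bounded; exact: wp_Ck wk.
  - move=> g h [mg [M gM] g0] [mh [N hN] h0]; split; first exact: measurable_funD.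
      by exists (M + N) => x; apply: le_trans (ler_normD _ _) (lerD _ _).
    rewrite (eq_RI (g := fun x => f x * g x + f x * h x)); last by move=> x; rewrite mulrDr.
    by rewrite (RintegralD measurableT (iM _ _ mg gM) (iM _ _ mh hN)) g0 h0 addr0.
  - move=> c g [mg [M gM] g0]; split; first exact: measurable_funM.
      by exists (`|c| * M) => x; rewrite normrM ler_wpM2l.
    rewrite (eq_RI (g := fun x => c * (f x * g x))); last by move=> x; rewrite mulrCA.
    by rewrite (RintegralZl _ measurableT (iM _ _ mg gM)) g0 mulr0.
  - move=> g_ g M Hg gM gc.
    have mg n : meas (g_ n) by have [] := Hg n.
    split.
    + by apply: measurable_fun_cvg mg _ => x _; exact: gc.
    + exists M => x; exact: (cvg_norm_bound (fun n => gM n x) (gc x)).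
    + have := bounded_cvg_Rintegral fi mg gM gc.
      rewrite (_ : (fun n => _) = cst 0); last by apply/funext => n; have [] := Hg n.
      by move=> /(cvg_unique _ (@cvg_cst _ _ _ _ _)) => /(_ (@norm_hausdorff _ _)).
have : ae_eq mu setT (EFin \o f) (cst 0%E).
  apply: (integral_ae_eq measurableT fi (measurable_cst _)) => E _ mE.
  rewrite integral0 integral_mkcond.
  have [_ _ h] := H1 E mE.
  have iE := iM _ 1 (measurable_indic mE) _.
  rewrite -[RHS](_ : (\int[mu]_x (f x * \1_E x))%:E = 0%E); last by rewrite h.
  rewrite /Rintegral fineK; last first.
    apply: integrable_fin_num => //; apply: iE => x.
    by rewrite indicE normr_nat lern1 leq_b1.
  apply: eq_integral => x _; rewrite patchE indicE.
  by case: (x \in E); rewrite ?mulr1 ?mulr0.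
by apply: filterS => x /(_ I) /= [].
Qed.

End density.

(** * Integrals of functions of the distance *)

Section zonal_kernels.
Variable R : realType.
Implicit Types (f g : S2 R -> R) (x y z : S2 R).
Local Notation mu := (@dv R).
Local Notation meas f := (measurable_fun [set: S2 R] f).
Local Notation leb := (@lebesgue_measure R).

(** Half the squared Euclidean distance: polynomial in both points, and distributed as 2 pi times
    Lebesgue measure on [0, 2]. *)
Definition sd x y : R := 1 - sdot x y.

Lemma sdC x y : sd x y = sd y x. Proof. by rewrite /sd sdotC. Qed.

Lemma sd_ge0 x y : 0 <= sd x y.
Proof. by have := sdot_bound x y; rewrite /sd; lra. Qed.

Lemma sd_le2 x y : sd x y <= 2.
Proof. by have := sdot_bound x y; rewrite /sd; lra. Qed.

(** Follows from |x + z - 2 y|^2 >= 0. The factor 2, the price of squaring the distance, is the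
    origin of the numbers 4, 6 and 32 in the comparisons of potentials. *)
Lemma sd_quasi x y z : sd x z <= 2 * (sd x y + sd y z).
Proof.
have P : 0 <= \sum_i (pt x 0 i + pt z 0 i - 2 * pt y 0 i) ^+ 2 by apply: sumr_ge0 => i _; exact: sqr_ge0.
move: P; rewrite /sd !sdotE !sum3 /crd.
have := sum_crd2 x; have := sum_crd2 y; have := sum_crd2 z; nra.
Qed.

Lemma measurable_sdot2 : measurable_fun [set: S2 R * S2 R] (fun p => sdot p.1 p.2).
Proof.
rewrite (_ : (fun p => _) = (fun p : S2 R * S2 R => crd 0 p.1 * crd 0 p.2 + crd 1 p.1 * crd 1 p.2 +
  crd 2%:R p.1 * crd 2%:R p.2)); last by apply/funext => p; rewrite sdotE sum3 /crd; ring.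
have m1 i : measurable_fun [set: S2 R * S2 R] (fun p => crd i p.1).
  by apply: measurableT_comp; [exact: measurable_crd|exact: measurable_fst].
have m2 i : measurable_fun [set: S2 R * S2 R] (fun p => crd i p.2).
  by apply: measurableT_comp; [exact: measurable_crd|exact: measurable_snd].
by do !apply: measurable_funD; apply: measurable_funM.
Qed.

Lemma measurable_sd2 : measurable_fun [set: S2 R * S2 R] (fun p => sd p.1 p.2).
Proof. by apply: measurable_funB => //; exact: measurable_sdot2. Qed.

Lemma measurable_sd y : meas (fun x => sd x y).
Proof. by apply: measurable_funB => //; exact: measurable_sdot. Qed.

Lemma measurable_bool_itv (a b : R) :
  measurable_fun [set: R] (fun s : R => (a <= s <= b)%R%:R : R).
Proof.
rewrite (_ : (fun s => _) = \1_`[a, b]%classic); first exact: measurable_indic.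
by apply/funext => s; rewrite indicE mem_setE in_itv.
Qed.

Lemma zonal_itv y (a b : R) (phi : R -> R) : measurable_fun setT phi ->
  (forall s, 0 <= phi s) -> 0 <= a -> b <= 2 ->
  (\int[mu]_x ((a <= sd x y <= b)%R%:R * phi (sd x y))%:E =
   (2 * pi)%:E * \int[leb]_(t in `[(1 - b)%R, (1 - a)%R]) (phi (1 - t)%R)%:E)%E.
Proof.
move=> mp p0 a0 b2.
have m1 : measurable_fun [set: R] (fun t : R => 1 - t) by exact: measurable_funB.
have := @zonal_integral R y (fun t => (((a <= 1 - t <= b)%R%:R * phi (1 - t)))%:E).
rewrite /sd => ->; last 2 first.
- apply/measurable_EFinP; apply: (measurableT_comp (f := fun s => (a <= s <= b)%R%:R * phi s)) => //.
  by apply: measurable_funM => //; exact: measurable_bool_itv.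
- by move=> t; rewrite lee_fin mulr_ge0.
congr (_ * _)%E; rewrite [LHS]integral_mkcond [RHS]integral_mkcond.
apply: eq_integral => t _; rewrite !patchE !mem_setE !in_itv /=.
have -> : (1 - b <= t <= 1 - a) = (-1 <= t <= 1) && (a <= 1 - t <= b).
  apply/idP/idP => [|/andP[]]; last by move=> _; lra.
  by move=> ?; apply/andP; split; lra.
case: ifP => //= _; case: ifP => _; by rewrite ?mul1r ?mul0r.
Qed.

Lemma zonal_vol y (A : R) : 0 < A <= 2 ->
  (\int[mu]_x ((sd x y <= A)%R%:R)%:E = (2 * pi * A)%:E)%E.
Proof.
move=> /andP[A0 A2]; transitivity (\int[mu]_x ((0 <= sd x y <= A)%R%:R * cst 1 (sd x y))%:E)%E.
  by apply: eq_integral => x _; rewrite sd_ge0 /= mulr1.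
rewrite zonal_itv // subr0; under eq_integral do rewrite /=.
rewrite integral_cst //= mul1e lebesgue_measure_itv /= lte_fin ifT; last lra.
by rewrite -EFinB -EFinM; congr EFin; ring.
Qed.

Lemma measurable_powN (c : R) : measurable_fun [set: R] (fun s : R => s `^ c).
Proof. exact: measurable_powR. Qed.

Lemma is_derive_1B (t : R) : is_derive t (1 : R) (fun t : R => 1 - t) (-1).
Proof.
have h := is_deriveB (is_derive_cst (1 : R) t 1) (is_derive_id t 1).
by apply: (is_derive_eq h); rewrite sub0r.
Qed.

Lemma zonal_pow y (c A : R) : 0 < c < 1 -> 0 < A <= 2 ->
  (\int[mu]_x ((0 <= sd x y <= A)%R%:R * sd x y `^ (- c))%:E <= (2 * pi * (A `^ (1 - c) / (1 - c)))%:E)%E.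
Proof.
move=> /andP[c0 c1] /andP[A0 A2].
rewrite (zonal_itv y (phi := fun s => s `^ (- c))) // ?subr0; last first.
  by move=> s; exact: powR_ge0.
rewrite [leRHS]EFinM lee_pmul2l ?lte_fin ?mulr_gt0 ?pi_gt0 //.
have mf : measurable_fun setT (fun t : R => ((1 - t) `^ (- c))%:E).
  by apply/measurable_EFinP; apply: (measurableT_comp (measurable_powN _)); exact: measurable_funB.
rewrite -integral_itv_bndo_bndc; last exact: measurable_funTS.
(* The integrand is unbounded at distance 0. The sets [F n] stay at distance A / (n + 2) from the
   singularity, where the fundamental theorem applies, and they increase to the whole range. *)
pose F n := `[(1 - A)%R, (1 - A / n.+2%:R)%R]%classic : set R.
have FU : `[1 - A, 1[%classic = \bigcup_n F n.
  apply/seteqP; split => t /=; last first.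
    move=> [n _]; rewrite /F /= !in_itv /= => /andP[-> t1] /=; apply: le_lt_trans t1 _.
    by rewrite ltrBlDr ltrDl divr_gt0.
  rewrite in_itv /= => /andP[At t1]; have t0 : 0 < 1 - t by rewrite subr_gt0.
  exists (Num.trunc (A / (1 - t))) => //; rewrite /F /= in_itv /= At /= lerBrDr -lerBrDl ler_pdivrMr //.
  rewrite -ler_pdivrMl // mulrC; apply/ltW/(lt_trans (truncnS_gt _)).
  by rewrite ltr_nat.
have ndF : nondecreasing_seq F.
  move=> m n mn; rewrite subsetEset; apply: subset_itvl; rewrite bnd_simp lerB // ler_pM2l //.
  by rewrite lef_pV2 ?posrE // ler_nat !ltnS.
have mfF n : measurable_fun (F n) (fun t : R => ((1 - t) `^ (- c))%:E) by exact: measurable_funTS.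
have cv : (\int[leb]_(t in F n) ((1 - t) `^ (- c))%:E)%E @[n --> \oo] -->
    (\int[leb]_(t in \bigcup_n F n) ((1 - t) `^ (- c))%:E)%E.
  apply: ge0_nondecreasing_set_cvg_integral => //.
  - by move=> n; exact: measurable_itv.
  - by move=> n t _; exact: powR_ge0.
have -> : (\int[leb]_(t in `[(1 - A)%R, 1%R[) ((1 - t) `^ (- c))%:E =
   \int[leb]_(t in \bigcup_n F n) ((1 - t) `^ (- c))%:E)%E by rewrite -FU.
rewrite -(cvg_lim _ cv) //; apply: lime_le; first by apply: cvgP cv.
apply: nearW => n; pose G : R -> R := - (1 - c)^-1 \*: ((fun s : R => s `^ (1 - c)) \o (fun t : R => 1 - t)).
have d0 : 0 < A / n.+2%:R by rewrite divr_gt0.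
have ts (t : R) : 1 - A <= t <= 1 - A / n.+2%:R -> 0 < 1 - t.
  by move: d0; move: (A / n.+2%:R) => d d0; lra.
have -> : (\int[leb]_(t in F n) ((1 - t) `^ (- c))%:E = (G (1 - A / n.+2%:R) - G (1 - A))%:E)%E; last first.
  have -> : G (1 - A / n.+2%:R) - G (1 - A) = (A `^ (1 - c) - (A / n.+2%:R) `^ (1 - c)) / (1 - c).
    by rewrite /G /= !subKr /GRing.scale /=; ring.
  by rewrite lee_fin ler_pM2r ?invr_gt0 ?subr_gt0 // gerBl powR_ge0.
apply: FTC_is_derive.
- by rewrite ltrD2l ltrN2 ltr_pdivrMr // ltr_pMr // ltr1n.
- move=> t /ts t0.
  have h := is_derive1_comp (g := fun t : R => 1 - t) (is_derive1_powR (1 - c) t0) (is_derive_1B t).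
  apply: (is_derive_eq (is_deriveZ (- (1 - c)^-1) h)).
  have -> : 1 - c - 1 = - c by ring.
  by rewrite /GRing.scale /= mulrN1 mulrNN mulKf // subr_eq0 gt_eqF.
- move=> t /ts t0; apply: differentiable_continuous; apply/derivable1_diffP.
  exact: @ex_derive _ _ _ _ _ _ _ (is_derive1_comp (g := fun t : R => 1 - t) (is_derive1_powR (- c) t0) (is_derive_1B t)).
Qed.

End zonal_kernels.

(** * Kernels with an integrable singularity *)

Section kernel.
Variable R : realType.
Implicit Types (f g p w : S2 R -> R) (x y z : S2 R) (K : R -> R).
Local Notation mu := (@dv R).
Local Notation meas f := (measurable_fun [set: S2 R] f).
Local Notation leb := (@lebesgue_measure R).

Lemma zonal_inv y (a b : R) : 0 < a < b -> b <= 2 ->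
  (\int[mu]_x ((a <= sd x y <= b)%R%:R * (sd x y) `^ (-1))%:E = (2 * pi * ln (b / a))%:E)%E.
Proof.
move=> /andP[a0 ab] b2; rewrite (zonal_itv y (phi := fun s => s `^ (- 1)) (measurable_powN _) (fun s => powR_ge0 _ _) (ltW a0) b2).
rewrite [RHS]EFinM; congr (_ * _)%E.
pose G : R -> R := -1 \*: (@ln R \o (fun t : R => 1 - t)).
have t0 (t : R) : 1 - b <= t <= 1 - a -> 0 < 1 - t by lra.
rewrite (_ : (ln (b / a))%:E = (G (1 - a) - G (1 - b))%:E); last first.
  rewrite /G /= !subKr /GRing.scale /= !mulN1r opprK addrC -lnV ?posrE //.
  by rewrite -lnM ?posrE ?invr_gt0 // (lt_trans a0).
apply: FTC_is_derive; first by rewrite ltrD2l ltrN2.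
- move=> t /t0 tp.
  have h := is_derive1_comp (g := fun t : R => 1 - t) (is_derive1_ln tp) (is_derive_1B t).
  apply: (is_derive_eq (is_deriveZ (-1) h)).
  by rewrite /GRing.scale /= mulrN1 mulrNN mul1r powR_inv1 // ltW.
- move=> t /t0 tp; apply: differentiable_continuous; apply/derivable1_diffP.
  have h := is_derive1_comp (g := fun t : R => 1 - t) (is_derive1_powR (-1) tp) (is_derive_1B t).
  exact: @ex_derive _ _ _ _ _ _ _ h.
Qed.

(** One majorant for the logarithms, for the approximate identities and for s^(-1/2) itself. The
    estimates depend on C alone, hence are uniform over a family of regularisations with the same C.
    The coefficient 2 comes from - ln s <= 2 s^(-1/2). *)
Definition kern K (C : R) := measurable_fun setT K /\
  forall s : R, 0 <= s <= 2 -> `|K s| <= 2 * s `^ (- 2^-1) + C.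

Lemma sd_pow_half y :
  (\int[mu]_x (sd x y `^ (- 2^-1))%:E <= (2 * pi * (2 `^ (1 - 2^-1) / (1 - 2^-1)))%:E)%E.
Proof.
apply: le_trans (zonal_pow y (c := 2^-1) (A := 2) _ _); [|lra|lra].
by rewrite le_eqVlt; apply/orP; left; apply/eqP; apply: eq_integral => x _; rewrite sd_ge0 sd_le2 mul1r.
Qed.

Lemma measurable_ksd K y : measurable_fun setT K -> meas (fun x => K (sd x y)).
Proof. by move=> mK; apply: measurableT_comp => //; exact: measurable_sd. Qed.

Lemma kern_int (C : R) : 0 <= C ->
  exists2 B : R, 0 <= B & forall K, kern K C -> forall y, (\int[mu]_x (`|K (sd x y)|)%:E <= B%:E)%E.
Proof.
move=> C0; exists (2 * (2 * pi * (2 `^ (1 - 2^-1) / (1 - 2^-1))) + C * (4 * pi)).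
  have p0 := pi_ge0 R.
  by rewrite addr_ge0 ?mulr_ge0 ?powR_ge0 // invr_ge0; lra.
move=> K [mK bK] y; have ms := measurable_ksd y (measurable_powN (- 2^-1 : R)).
apply: (@le_trans _ _ (\int[mu]_x (2%:E * (sd x y `^ (- 2^-1))%:E + C%:E))%E).
  apply: ge0_le_integral => //.
  - by apply/measurable_EFinP; apply: measurableT_comp => //; exact: measurable_ksd.
  - by apply/measurable_EFinP; apply: measurable_funD => //; exact: measurable_funM.
  - by move=> x _; rewrite -EFinM -EFinD lee_fin bK // sd_ge0 sd_le2.
rewrite ge0_integralD //; last 2 first.
- by move=> x _; rewrite lee_fin mulr_ge0 // powR_ge0.
- by apply/measurable_EFinP; exact: measurable_funM.
rewrite ge0_integralZl_EFin //; last 2 first.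
- by move=> x _; rewrite lee_fin powR_ge0.
- exact/measurable_EFinP.
rewrite integral_cst //= dv_setT [leRHS]EFinD; apply: leeD; last by rewrite EFinM.
by rewrite [leRHS]EFinM lee_pmul2l ?lte_fin //; exact: sd_pow_half.
Qed.

Lemma kern_prod_integrable w p (M : R) K (C : R) : 0 <= C -> kern K C ->
  mu.-integrable setT (EFin \o w) -> meas p -> (forall y, `|p y| <= M) ->
  (mu \x mu)%E.-integrable setT (fun q : S2 R * S2 R => (w q.1 * (K (sd q.1 q.2) * p q.2))%:E).
Proof.
move=> C0 kK iw mp pM; have [B B0 /(_ K kK) bB] := kern_int C0; have [mK _] := kK.
have mw : meas w by apply/measurable_EFinP; exact: measurable_int iw.
have mF : measurable_fun setT (fun q : S2 R * S2 R => (w q.1 * (K (sd q.1 q.2) * p q.2))%:E).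
  apply/measurable_EFinP; apply: measurable_funM.
    exact: (measurableT_comp mw measurable_fst).
  apply: measurable_funM; first exact: (measurableT_comp (f := K) mK (@measurable_sd2 R)).
  exact: (measurableT_comp mp measurable_snd).
have M0 : 0 <= M by apply: le_trans (normr_ge0 _) (pM (pole R)).
apply/(integrable12ltyP mu mu mF).
apply: (@le_lt_trans _ _ (\int[mu]_x ((M * B)%:E * `|(w x)%:E|))%E).
  apply: ge0_le_integral => //.
  - by move=> x _; exact: integral_ge0.
  - apply: (measurable_fun_fubini_tonelli_F (m2 := mu) (fun q : S2 R * S2 R => `|(w q.1 * (K (sd q.1 q.2) * p q.2))%:E|%E)) => //.
    exact: measurableT_comp.
  - apply: measurable_funeM; apply: measurableT_comp => //; exact/measurable_EFinP.
  - move=> x _ /=.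
    apply: (@le_trans _ _ (\int[mu]_y ((`|w x| * M)%:E * (`|K (sd y x)|)%:E))%E).
      apply: ge0_le_integral => //.
      + have h : measurable_fun setT (fun y => (w x * (K (sd x y) * p y))%:E).
          by apply: (measurableT_comp mF (g := fun y => (x, y))); exact: measurable_pair1.
        by apply/measurable_EFinP; apply: measurableT_comp => //; exact/measurable_EFinP.
      + apply: measurable_funeM; apply/measurable_EFinP; apply: measurableT_comp => //.
        exact: measurable_ksd.
      + move=> y _; rewrite -EFinM lee_fin !normrM -mulrA ler_wpM2l // mulrC sdC ler_wpM2r //.
    rewrite ge0_integralZl_EFin ?mulr_ge0 //; last first.
      by apply/measurable_EFinP; apply: measurableT_comp => //; exact: measurable_ksd.
    rewrite [leRHS](_ : _ = ((`|w x| * M)%:E * B%:E)%E); last first.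
      by rewrite -!EFinM; congr EFin; ring.
    by apply: lee_wpmul2l => //; rewrite lee_fin mulr_ge0.
have : mu.-integrable setT (fun x => ((M * B)%:E * `|(w x)%:E|)%E).
  by apply: integrableZl => //; exact: integrable_abse.
move=> /integrableP[_]; apply: le_lt_trans.
apply: ge0_le_integral => //.
- by move=> x _; rewrite mule_ge0 // lee_fin mulr_ge0.
- by apply: measurable_funeM; apply: measurableT_comp => //; exact/measurable_EFinP.
- by apply: measurableT_comp => //; apply: measurable_funeM; apply: measurableT_comp => //; exact/measurable_EFinP.
- by move=> x _; rewrite lee_abs.
Qed.

Lemma kern_ae_integrable w K (C : R) : 0 <= C -> kern K C -> mu.-integrable setT (EFin \o w) ->
  {ae mu, forall y, mu.-integrable setT (fun x => (w x * K (sd x y))%:E)}.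
Proof.
move=> C0 kK iw.
have := kern_prod_integrable C0 kK iw (measurable_cst (1 : R)) (M := 1) (fun _ => ltac:(by rewrite normr1)).
move=> iF; have mF := measurable_int _ iF.
have ig : mu.-integrable setT (fubini_G mu (fun q : S2 R * S2 R => `|(w q.1 * (K (sd q.1 q.2) * cst 1 q.2))%:E|%E)).
  apply/integrableP; split.
    by apply: measurable_fun_fubini_tonelli_G => //; exact: measurableT_comp.
  have := (integrable21ltyP mu mu mF).1 iF; apply: le_lt_trans.
  rewrite le_eqVlt; apply/orP; left; apply/eqP; apply: eq_integral => y _.
  by rewrite gee0_abs //; exact: integral_ge0.
have := integrable_ae measurableT ig; apply: filterS => y /(_ I) fy.
apply/integrableP; split.
  apply/measurable_EFinP; apply: measurable_funM; last exact: measurable_ksd kK.1.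
  by apply/measurable_EFinP; exact: measurable_int iw.
move: fy; rewrite ge0_fin_numE; last exact: integral_ge0.
apply: le_lt_trans; rewrite le_eqVlt; apply/orP; left; apply/eqP.
by apply: eq_integral => x _; rewrite /= mulr1.
Qed.

Lemma kern_fubini w p (M : R) K (C : R) : 0 <= C -> kern K C ->
  mu.-integrable setT (EFin \o w) -> meas p -> (forall y, `|p y| <= M) ->
  \int[mu]_x (w x * \int[mu]_y (K (sd x y) * p y)) =
  \int[mu]_y ((\int[mu]_x (w x * K (sd x y))) * p y) /\
  mu.-integrable setT (fun y => (\int[mu]_x (w x * K (sd x y)))%:E).
Proof.
move=> C0 kK iw mp pM.
have iF := kern_prod_integrable C0 kK iw mp pM.
have iF1 := kern_prod_integrable C0 kK iw (measurable_cst (1 : R)) (M := 1) (fun _ => ltac:(by rewrite normr1)).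
have mF1 := measurable_int _ iF1; have [B B0 /(_ K kK) bB] := kern_int C0.
pose N y := \int[mu]_x (w x * K (sd x y)).
have NE y : N y = fine (fubini_G mu (fun q : S2 R * S2 R => (w q.1 * (K (sd q.1 q.2) * cst 1 q.2))%:E) y).
  by rewrite /N /Rintegral; congr fine; apply: eq_integral => x _; rewrite /= mulr1.
have mN : meas N.
  rewrite (funext NE); apply: measurableT_comp => //.
  exact: (measurable_fubini_G (m2 := mu) iF1).
have iN : mu.-integrable setT (EFin \o N).
  apply: (le_integrable _ _ (g := fubini_G mu (fun q : S2 R * S2 R => `|(w q.1 * (K (sd q.1 q.2) * cst 1 q.2))%:E|%E))) => //.
  - exact/measurable_EFinP.
  - move=> y _; rewrite [leRHS]gee0_abs; last exact: integral_ge0.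
    have mF1y : measurable_fun setT (fun x => (w x * (K (sd x y) * cst 1 y))%:E).
      apply: (measurableT_comp mF1 (g := fun x => (x, y))); exact: measurable_pair2.
    apply: le_trans (le_abse_integral mu measurableT mF1y).
    by rewrite /= NE /fubini_G /=; case: (integral _ _ _) => //=; rewrite normr0 leey.
  - apply/integrableP; split.
      by apply: measurable_fun_fubini_tonelli_G => //; exact: measurableT_comp.
    have := (integrable21ltyP mu mu mF1).1 iF1; apply: le_lt_trans.
    rewrite le_eqVlt; apply/orP; left; apply/eqP; apply: eq_integral => y _.
    by rewrite gee0_abs //; exact: integral_ge0.
split => //.
have E := etrans (integral12_prod_meas1 iF) (esym (integral21_prod_meas1 iF)).
rewrite /Rintegral.
transitivity (fine (\int[mu]_x fubini_F mu (fun q : S2 R * S2 R => (w q.1 * (K (sd q.1 q.2) * p q.2))%:E) x)).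
  congr fine; apply: eq_integral => x _; rewrite /fubini_F /=.
  have ik : mu.-integrable setT (EFin \o (fun y => K (sd x y) * p y)).
    apply: (integrable_mul_bdd _ mp pM); apply/integrableP; split.
      apply/measurable_EFinP; under eq_fun do rewrite sdC; exact: measurable_ksd kK.1.
    under eq_integral do rewrite /= sdC.
    exact: le_lt_trans (bB x) (ltry _).
  under [RHS]eq_integral do rewrite EFinM.
  by rewrite (integralZl measurableT ik) EFinM fineK //; exact: integrable_fin_num.
rewrite E; congr fine; apply: ae_eq_integral => //.
- exact: (measurable_fubini_G (m2 := mu) iF).
- by apply/measurable_EFinP; exact: measurable_funM.
(* The integral over x converges only for almost every y; elsewhere [fine] may return a default
   value, which an almost everywhere equality tolerates. *)
- have := kern_ae_integrable C0 kK iw; apply: filterS => y iy _.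
  rewrite /fubini_G /= EFinM /Rintegral fineK; last exact: integrable_fin_num.
  rewrite -(integralZr measurableT iy); apply: eq_integral => x _.
  by rewrite -EFinM mulrA.
Qed.

Lemma kern_pot (M C : R) : 0 <= C -> exists B : R, forall K p, kern K C ->
  meas p -> (forall y, `|p y| <= M) ->
  [/\ forall x, mu.-integrable setT (fun y => (K (sd x y) * p y)%:E),
      forall x, `|\int[mu]_y (K (sd x y) * p y)| <= B &
      meas (fun x => \int[mu]_y (K (sd x y) * p y))].
Proof.
move=> C0; have [B B0 bB] := kern_int C0; exists (M * B) => K p kK mp pM.
have M0 : 0 <= M by apply: le_trans (normr_ge0 _) (pM (pole R)).
have ik x : mu.-integrable setT (fun y => (K (sd x y))%:E).
  apply/integrableP; split.
    by apply/measurable_EFinP; under eq_fun do rewrite sdC; exact: measurable_ksd kK.1.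
  by under eq_integral do rewrite /= sdC; exact: le_lt_trans (bB _ kK x) (ltry _).
have ikp x : mu.-integrable setT (EFin \o (fun y => K (sd x y) * p y)).
  exact: integrable_mul_bdd (ik x) mp pM.
split => // [x|].
  apply: le_trans (le_normr_Rintegral measurableT (ikp x)) _.
  apply: (@le_trans _ _ (\int[mu]_y (M * `|K (sd x y)|))).
    apply: le_Rintegral => //.
    - exact: (integrable_abse (ikp x)).
    - exact: (integrableZl measurableT M (integrable_abse (ik x))).
    - by move=> y _; rewrite normrM mulrC ler_wpM2r.
  rewrite (RintegralZl _ measurableT (integrable_abse (ik x))) ler_wpM2l //.
  have fk : (\int[mu]_y (`|K (sd x y)|)%:E)%E \is a fin_num.
    by apply: integrable_fin_num => //; exact: (integrable_abse (ik x)).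
  rewrite -lee_fin /Rintegral fineK //; under eq_integral do rewrite sdC; exact: bB.
have iF := kern_prod_integrable C0 kK (Ck0_integrable (Ck_cst 0 1)) mp pM.
have := measurable_fubini_F (m1 := mu) (m2 := mu) iF => mF.
apply: (eq_measurable_fun (fun x => fine (fubini_F mu (fun q : S2 R * S2 R => (cst 1 q.1 * (K (sd q.1 q.2) * p q.2))%:E) x))).
  move=> x _; rewrite /Rintegral /fubini_F; congr fine.
  by apply: eq_integral => y _; rewrite /= mul1r.
by apply: measurableT_comp mF.
Qed.

End kernel.

(** * Regularised logarithms and the approximate identity *)

Section log_kernel.
Variable R : realType.
Implicit Types (f g p w u Q : S2 R -> R) (x y z : S2 R) (e s : R).
Local Notation mu := (@dv R).
Local Notation meas f := (measurable_fun [set: S2 R] f).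

(** For e > 0 a smooth, hence admissible, test function; for e = 0 it is the Green function of the
    sphere with pole y, up to normalisation. *)
Definition ltest e y x : R := ln (e + sd x y).

(** The Laplacian of [ltest e y] increased by 1: nonnegative, and of mass 4 pi for every e by the
    divergence theorem. *)
Definition ktest e s : R := e * (2 + e) * ((e + s) ^+ 2)^-1.

Lemma Ck_esd k e y : Ck k (fun x => e + sd x y).
Proof.
rewrite (_ : (fun x => _) = (fun x => cst (e + 1) x + - sdot x y)).
  by apply: CkD; [exact: Ck_cst|apply: CkN; exact: Ck_sdot].
by apply/funext => x; rewrite /sd addrA.
Qed.

Lemma grad_esd e y x i : grad (fun x => e + sd x y) x 0 i = - (pt y 0 i - sdot x y * pt x 0 i).
Proof.
rewrite (_ : (fun x => _) = (fun x => cst (e + 1) x + - sdot x y)); last first.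
  by apply/funext => z; rewrite /sd addrA.
have ds := Ck_dff x (Ck_sdot 1 y).
by rewrite (gradD _ (dff_cst _ _) (dffN ds)) grad_cst (gradN _ ds) grad_sdot add0r.
Qed.

Lemma esd_gt0 e x y : 0 < e -> 0 < e + sd x y.
Proof. by move=> e0; rewrite ltr_wpDr // sd_ge0. Qed.

Lemma ltest_smooth e y : 0 < e -> smooth (ltest e y).
Proof. by move=> e0 k; apply: CkW; apply: Ck_ln; [move=> x; exact: esd_gt0|exact: Ck_esd]. Qed.

Lemma Ck_inv_esd k e y : 0 < e -> Ck k (fun x => - (e + sd x y)^-1).
Proof.
move=> e0; apply: CkN; apply: CkV; last exact: Ck_esd.
by move=> x; rewrite gt_eqF // esd_gt0.
Qed.

Lemma grad_ltest e y : 0 < e -> grad (ltest e y) = zfield (fun x => - (e + sd x y)^-1) y.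
Proof.
move=> e0; apply/funext => x; apply/rowP => i.
have sx := esd_gt0 x y e0.
rewrite (grad_comp i (is_derive1_ln sx) (Ck_dff x (Ck_esd 1 e y))) grad_esd.
by rewrite mxE mulrN mulNr.
Qed.

Lemma div_grad_ltest e y x : 0 < e -> div (grad (ltest e y)) x = - 1 + ktest e (sd x y).
Proof.
move=> e0; have sx := esd_gt0 x y e0.
rewrite grad_ltest // (div_zfield (b := fun x => - ((e + sd x y) ^+ 2)^-1)); last 2 first.
- exact: Ck_inv_esd.
- move=> i; have s0 : e + sd x y != 0 by rewrite gt_eqF.
  have dV : is_derive (e + sd x y) 1 (fun t : R => t^-1) (- (e + sd x y) ^- 2).
    have h := is_deriveV (f := fun t : R => t) s0 (is_derive_id (e + sd x y) (1 : R)).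
    by apply: (is_derive_eq h); rewrite /GRing.scale /= mulr1.
  have de := Ck_dff x (Ck_esd 1 e y).
  rewrite (gradN _ (dff_comp dV de)) (grad_comp i dV de) grad_esd.
  by ring.
rewrite /ktest; have -> : sdot x y = 1 - sd x y by rewrite /sd; ring.
by field; rewrite gt_eqF.
Qed.

Lemma measurable_ktest e : measurable_fun setT (ktest e).
Proof.
apply: measurable_funM => //; apply: measurable_inv_ge0; first by move=> s; exact: sqr_ge0.
by apply: measurable_funX; exact: measurable_funD.
Qed.

Lemma ktest_ge0 e s : 0 < e -> 0 <= ktest e s.
Proof. by move=> e0; rewrite /ktest mulr_ge0 ?invr_ge0 ?sqr_ge0 // mulr_ge0; lra. Qed.

Lemma ktest_le e s : 0 < e -> 0 <= s -> ktest e s <= e * (2 + e) * (e ^+ 2)^-1.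
Proof.
move=> e0 s0; rewrite /ktest ler_wpM2l //; first by apply: mulr_ge0; lra.
rewrite lef_pV2 ?posrE ?exprn_gt0 //; last lra.
by rewrite ler_sqr ?nnegrE; lra.
Qed.

Lemma kern_ktest e : 0 < e -> kern (ktest e) (e * (2 + e) * (e ^+ 2)^-1).
Proof.
move=> e0; split; first exact: measurable_ktest.
move=> s /andP[s0 _]; rewrite ger0_norm ?ktest_ge0 //.
by rewrite (le_trans (ktest_le e0 s0)) // lerDr mulr_ge0 // powR_ge0.
Qed.

Lemma ktest_bd_integrable e y : 0 < e -> mu.-integrable setT (fun x => (ktest e (sd x y))%:E).
Proof.
move=> e0; apply: (bounded_integrable_dv (M := e * (2 + e) * (e ^+ 2)^-1)).
  by apply: measurable_ksd; exact: measurable_ktest.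
by move=> x; rewrite ger0_norm ?ktest_ge0 // ktest_le // sd_ge0.
Qed.

Lemma integral_ktest e y : 0 < e -> \int[mu]_x ktest e (sd x y) = 4 * pi.
Proof.
move=> e0; have sp := ltest_smooth y e0.
have tg : tangent (grad (ltest e y)) by rewrite grad_ltest //; exact: zfield_tangent.
have := divergence_theorem tg (fun i => (sp 2%N).2 i).
rewrite (eq_RI (g := fun x => - 1 + ktest e (sd x y))); last by move=> x; rewrite div_grad_ltest.
rewrite (RintegralD measurableT (Ck0_integrable (Ck_cst 0 (-1))) (ktest_bd_integrable y e0)).
rewrite Rintegral_cst //= dv_setT /= mulN1r => /eqP; rewrite addrC subr_eq0 => /eqP.
exact.
Qed.

(** The Lipschitz property for the chord, stated with squares because [sd] is a squared distance.
    The induction bounds the square of a sum by twice the sum of the squares. *)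
Lemma spoly_lip p : spoly p -> exists2 L : R, 0 <= L & forall x y, (p x - p y) ^+ 2 <= L * sd x y.
Proof.
move=> [k]; elim=> {k p} [c|k i f wf [L L0 IH]|k f g _ [L L0 IH] _ [L' L0' IH']|k f _ [L L0 IH]].
- by exists 0 => // x y; rewrite subrr expr0n mul0r.
- have [M fM] := Ck0_bounded (wp_Ck 0 wf).
  exists (2 * L + 4 * M ^+ 2); first by rewrite addr_ge0 // mulr_ge0 // sqr_ge0.
  move=> x y; have c2 : (crd i x - crd i y) ^+ 2 <= 2 * sd x y.
    have -> : 2 * sd x y = \sum_j (crd j x - crd j y) ^+ 2.
      rewrite /sd sdotE !sum3; have := sum_crd2 x; have := sum_crd2 y; rewrite /crd; nra.
    by rewrite (bigD1 i) //= lerDl; apply: sumr_ge0 => j _; exact: sqr_ge0.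
  have cx : (crd i x) ^+ 2 <= 1.
    by rewrite -[leRHS](dot_pt x) /dot (bigD1 i) //= expr2 lerDl; apply: sumr_ge0 => j _; rewrite -expr2 sqr_ge0.
  have fy : f y ^+ 2 <= M ^+ 2 by rewrite -[f y ^+ 2]real_normK ?num_real // ler_sqr ?nnegrE // (le_trans _ (fM y)).
  have h1 : crd i x ^+ 2 * (f x - f y) ^+ 2 <= L * sd x y.
    by apply: le_trans (IH x y); rewrite ler_piMl ?sqr_ge0.
  have h2 : f y ^+ 2 * (crd i x - crd i y) ^+ 2 <= M ^+ 2 * (2 * sd x y).
    by apply: ler_pM => //; exact: sqr_ge0.
  have -> : crd i x * f x - crd i y * f y = crd i x * (f x - f y) + f y * (crd i x - crd i y) by ring.
  have := sqr_ge0 (crd i x * (f x - f y) - f y * (crd i x - crd i y)); nra.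
- exists (2 * L + 2 * L'); first by rewrite addr_ge0 // mulr_ge0.
  move=> x y; have := IH x y; have := IH' x y.
  have -> : f x + g x - (f y + g y) = (f x - f y) + (g x - g y) by ring.
  have := sqr_ge0 ((f x - f y) - (g x - g y)); nra.
- by exists L.
Qed.

Definition en n : R := n.+1%:R^-1.

Lemma en_gt0 n : 0 < en n. Proof. by rewrite invr_gt0. Qed.

Lemma en_le1 n : en n <= 1. Proof. by rewrite invf_le1 // ler1n. Qed.

Lemma cvg_en : en n @[n --> \oo] --> (0 : R).
Proof. exact: cvg_harmonic. Qed.

Lemma ktest_s_cvg y : \int[mu]_x (ktest (en n) (sd x y) * sd x y) @[n --> \oo] --> (0 : R).
Proof.
have B n x : 0 <= ktest (en n) (sd x y) * sd x y <= 3.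
  have e0 := en_gt0 n; have e1 := en_le1 n; have s0 := sd_ge0 x y.
  rewrite mulr_ge0 ?ktest_ge0 //= /ktest mulrAC ler_pdivrMr ?exprn_gt0 ?esd_gt0 //.
  have : 0 <= en n * sd x y by rewrite mulr_ge0 // ltW.
  move: (en n) (sd x y) e0 e1 s0 => a b; nra.
have := @bounded_cvg_Rintegral R (cst 1) (fun n x => ktest (en n) (sd x y) * sd x y) (cst 0) 3
  (Ck0_integrable (Ck_cst 0 1)).
rewrite (eq_RI (g := cst 0)); last by move=> x; rewrite mulr0.
rewrite Rintegral_cst // mul0r; under eq_fun do rewrite (eq_RI (fun x => mul1r _)).
apply.
- move=> n; apply: measurable_funM; last exact: measurable_sd.
  by apply: measurable_ksd; exact: measurable_ktest.
- by move=> n x; have /andP[? ?] := B n x; rewrite ger0_norm.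
- move=> x; have [s0|s0] := eqVneq (sd x y) 0.
    by rewrite s0; under eq_fun do rewrite mulr0; exact: cvg_cst.
  have sp : 0 < sd x y by rewrite lt_neqAle eq_sym s0 sd_ge0.
  apply: (@squeeze_cvgr _ _ _ _ (cst 0) (fun n => en n * (3 / sd x y))); last 2 first.
  + exact: cvg_cst.
  + by rewrite -(mul0r (3 / sd x y)); apply: cvgM; [exact: cvg_en|exact: cvg_cst].
  apply: nearW => n; have /andP[-> _] := B n x => /=.
  have e0 := en_gt0 n; have e1 := en_le1 n.
  rewrite /ktest mulrAC ler_pdivrMr ?exprn_gt0 ?esd_gt0 //.
  rewrite [leRHS](_ : _ = en n * 3 * (en n + sd x y) ^+ 2 / sd x y); last by ring.
  rewrite ler_pdivlMr //; move: (en n) (sd x y) sp e0 e1 => a b b0 a0 a1.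
  rewrite -!mulrA ler_pM2l //; have : a * b ^+ 2 <= b ^+ 2 by rewrite ler_piMl // sqr_ge0.
  have : 0 <= a * b by rewrite mulr_ge0 // ltW.
  nra.
Qed.

(* Since [ktest e (sd x _)] has mass [4 pi] and concentrates at [x] as [e] tends to 0. *)
Lemma ktest_cvg p x : spoly p ->
  \int[mu]_y (ktest (en n) (sd x y) * p y) @[n --> \oo] --> 4 * pi * p x.
Proof.
move=> sp; have [L L0 pL] := spoly_lip sp.
have [M pM] : exists M : R, forall y, `|p y| <= M.
  by case: sp => k wk; apply: Ck0_bounded; exact: wp_Ck wk.
have mk n : meas (fun y => ktest (en n) (sd x y)).
  by under eq_fun do rewrite sdC; apply: measurable_ksd; exact: measurable_ktest.
have ik n : mu.-integrable setT (fun y => (ktest (en n) (sd x y))%:E).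
  by under eq_fun do rewrite sdC; exact: ktest_bd_integrable (en_gt0 n).
have k4 n : \int[mu]_y ktest (en n) (sd x y) = 4 * pi.
  by rewrite -(integral_ktest x (en_gt0 n)); apply: eq_RI => y; rewrite sdC.
have iks n : mu.-integrable setT (fun y => (ktest (en n) (sd x y) * sd x y)%:E).
  apply: (integrable_mul_bdd (ik n) (M := 2)).
    by apply: eq_measurable_fun (measurable_sd x) => y _; rewrite sdC.
  by move=> y; rewrite ger0_norm ?sd_ge0 // sd_le2.
have ikp n : mu.-integrable setT (fun y => (ktest (en n) (sd x y) * p y)%:E).
  exact: (integrable_mul_bdd (ik n) (spoly_meas sp) pM).
(* By |d| <= h + d^2 / (4 h) with d = p y - p x, the error is controlled by h and by the first
   moment of the kernel, which tends to 0; h is chosen afterwards in terms of [eps]. *)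
have key n (h : R) : 0 < h -> `|\int[mu]_y (ktest (en n) (sd x y) * p y) - 4 * pi * p x| <=
    h * (4 * pi) + L / (4 * h) * \int[mu]_y (ktest (en n) (sd x y) * sd x y).
  move=> h0.
  have iD : mu.-integrable setT (EFin \o (fun y => ktest (en n) (sd x y) * (p y - p x))).
    apply: (integrable_mul_bdd (ik n) (M := M + M)).
      by apply: measurable_funB => //; exact: spoly_meas.
    by move=> y; apply: le_trans (ler_normB _ _) (lerD _ _).
  have -> : \int[mu]_y (ktest (en n) (sd x y) * p y) - 4 * pi * p x =
      \int[mu]_y (ktest (en n) (sd x y) * (p y - p x)).
    rewrite -(k4 n) mulrC -(RintegralZl _ measurableT (ik n)) -(RintegralB measurableT (ikp n)).
      by apply: eq_RI => y; ring.
    exact: (integrableZl measurableT _ (ik n)).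
  apply: le_trans (le_normr_Rintegral measurableT iD) _.
  have iZ1 : mu.-integrable setT (fun y => (h * ktest (en n) (sd x y))%:E).
    exact: (integrableZl measurableT _ (ik n)).
  have iZ2 : mu.-integrable setT (fun y => (L / (4 * h) * (ktest (en n) (sd x y) * sd x y))%:E).
    exact: (integrableZl measurableT _ (iks n)).
  rewrite -(k4 n) -(RintegralZl _ measurableT (ik n)) -(RintegralZl _ measurableT (iks n)).
  rewrite -(RintegralD measurableT iZ1 iZ2).
  apply: le_Rintegral => //.
  - exact: (integrable_abse iD).
  - exact: (integrableD measurableT iZ1 iZ2).
  move=> y _; have k0 := ktest_ge0 (sd x y) (en_gt0 n).
  rewrite normrM ger0_norm // [leRHS](_ : _ = ktest (en n) (sd x y) * (h + L / (4 * h) * sd x y)); last by ring.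
  rewrite ler_wpM2l //; have := pL y x; rewrite sdC => H.
  have h4 : 0 < 4 * h by rewrite mulr_gt0.
  rewrite mulrAC -(ler_pM2l h4) mulrDr [4 * h * (_ / _)]mulrC divfK ?gt_eqF //.
  apply: le_trans (_ : 4 * h * h + (p y - p x) ^+ 2 <= _); last by rewrite lerD2l.
  have := sqr_ge0 (2 * h - `|p y - p x|); rewrite -[(p y - p x) ^+ 2]real_normK ?num_real //; nra.
suff main (eps : R) : 0 < eps -> \forall n \near \oo,
    `|4 * pi * p x - \int[mu]_y (ktest (en n) (sd x y) * p y)| <= eps by apply/cvgrPdist_le.
move=> eps0; pose h : R := eps / 2 / (4 * pi); have pi0 : 0 < pi :> R := pi_gt0 R.
have h0 : 0 < h by rewrite !divr_gt0 // mulr_gt0.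
have hE : h * (4 * pi) = eps / 2 by rewrite divfK // gt_eqF // mulr_gt0.
pose c := L / (4 * h); have c0 : 0 <= c by rewrite divr_ge0 // mulr_ge0 // ltW.
have cs : c * \int[mu]_y (ktest (en n) (sd x y) * sd x y) @[n --> \oo] --> (0 : R).
  rewrite -[X in _ --> X](mulr0 c); apply: cvgM; first exact: cvg_cst.
  have -> : (fun n => \int[mu]_y (ktest (en n) (sd x y) * sd x y)) =
      (fun n => \int[mu]_y (ktest (en n) (sd y x) * sd y x)).
    by apply/funext => n; apply: eq_RI => y; rewrite sdC.
  exact: ktest_s_cvg.
have e2 : 0 < eps / 2 by rewrite divr_gt0.
apply: filterS (cvgr_le _ cs _ e2) => n Hn.
rewrite distrC (le_trans (key n h h0)) // hE.
by rewrite [leRHS]splitr lerD2l; exact: Hn.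
Qed.

End log_kernel.

(** * Weak form of the representation by the logarithmic potential *)

Section representation.
Variable R : realType.
Implicit Types (f g p w u Q : S2 R -> R) (x y z : S2 R) (e s : R).
Local Notation mu := (@dv R).
Local Notation meas f := (measurable_fun [set: S2 R] f).

(** The indicator removes the diagonal, where ln e has no finite limit as e tends to 0. The
    regularised kernels then converge at every s, and the diagonal has measure 0. *)
Definition logk e s : R := (0 < s)%R%:R * ln (e + s).

Lemma measurable_ln_add e : measurable_fun setT (fun s : R => ln (e + s)).
Proof. by apply: (measurableT_comp (@measurable_ln R)); exact: measurable_funD. Qed.

(** Above, ln (e + s) < e + s <= 3. Below, ln r < r at r = s^(-1/2) gives - ln s < 2 s^(-1/2). Both
    are uniform in e. *)
Lemma kern_logk e : 0 <= e <= 1 -> kern (logk e) 3.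
Proof.
move=> /andP[e0 e1]; split.
  apply: measurable_funM; last exact: measurable_ln_add.
  rewrite (_ : (fun s : R => (0 < s)%R%:R : R) = \1_`]0, +oo[%classic); first exact: measurable_indic.
  by apply/funext => s; rewrite indicE mem_setE in_itv /= andbT.
move=> s /andP[s0 s2]; rewrite /logk; have [s1|_] := ltP 0 s; last first.
  by rewrite mul0r normr0 addr_ge0 // mulr_ge0 // powR_ge0.
rewrite mul1r; have es : 0 < e + s by rewrite ltr_wpDl.
have P : 0 <= s `^ (- 2^-1) by exact: powR_ge0.
rewrite ler_norml; apply/andP; split; last first.
  by have := ln_sublinear es; lra.
have h1 : ln s <= ln (e + s) by rewrite ler_ln ?posrE // lerDr.
have : ln (s `^ (- 2^-1)) < s `^ (- 2^-1) by apply: ln_sublinear; exact: powR_gt0.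
by rewrite ln_powR; lra.
Qed.

Lemma cvg_logk s : logk (en R n) s @[n --> \oo] --> logk 0 s.
Proof.
rewrite /logk add0r; have [s0|s0] := ltP 0 s; last first.
  by rewrite mul0r; under eq_fun do rewrite mul0r; exact: cvg_cst.
rewrite mul1r; under eq_fun do rewrite mul1r.
have h : (en R n + s) @[n --> \oo] --> 0 + s by apply: cvgD; [exact: cvg_en|exact: cvg_cst].
by rewrite add0r in h; apply: (cvg_comp _ _ h); exact: continuous_ln.
Qed.

Lemma ae_sd_neq0 x : {ae mu, forall y, sd x y != 0}.
Proof.
have z0 : (\int[mu]_y ((0 <= sd y x <= 0)%R%:R * cst 1 (sd y x))%:E = 0)%E.
  rewrite zonal_itv //; under eq_integral do rewrite /=.
  by rewrite integral_cst //= lebesgue_measure_itv /= ltxx mule0 mule0.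
have mf : measurable_fun setT (fun y => ((0 <= sd y x <= 0)%R%:R * cst 1 (sd y x))%:E : \bar R).
  apply/measurable_EFinP; apply: (measurable_ksd x (K := fun s => (0 <= s <= 0)%R%:R * cst 1 s)).
  by apply: measurable_funM => //; exact: measurable_bool_itv.
have := (ae_eq_integral_abs mu measurableT mf).1; rewrite (eq_integral (fun y => ((0 <= sd y x <= 0)%R%:R * cst 1 (sd y x))%:E)).
  move=> /(_ z0); apply: filterS => y /(_ I) /= [] h; apply: contraNneq (oner_neq0 R) => s0.
  by rewrite -h sdC s0 lexx mulr1.
by move=> y _; rewrite /= ger0_norm // mulr1.
Qed.

Lemma integral_logk e p x : 0 < e <= 1 -> meas p ->
  \int[mu]_y (logk e (sd x y) * p y) = \int[mu]_y (ln (e + sd x y) * p y).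
Proof.
move=> /andP[e0 e1] mp; rewrite /Rintegral; congr fine; apply: ae_eq_integral => //.
- apply/measurable_EFinP; apply: measurable_funM => //.
  apply: eq_measurable_fun (measurable_ksd x (kern_logk (e := e) _).1); last by rewrite ltW.
  by move=> y _; rewrite sdC.
- apply/measurable_EFinP; apply: measurable_funM => //.
  apply: eq_measurable_fun (measurable_ksd x (measurable_ln_add e)).
  by move=> y _; rewrite sdC.
- apply: filterS (ae_sd_neq0 x) => y s0 _; rewrite /logk lt_neqAle eq_sym s0 sd_ge0 mul1r //.
Qed.

Definition pot p x := \int[mu]_y (logk 0 (sd x y) * p y).

Lemma en01 n : 0 <= en R n <= 1.
Proof. by rewrite ltW ?en_gt0 // en_le1. Qed.

Lemma cvg_pot p (M : R) x : meas p -> (forall y, `|p y| <= M) ->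
  \int[mu]_y (logk (en R n) (sd x y) * p y) @[n --> \oo] --> pot p x.
Proof.
(* The unbounded majorant D is moved into the integrable weight, so that the remaining quotients are
   bounded by M and the bounded convergence lemma applies. *)
move=> mp pM; pose D y : R := 2 * sd x y `^ (- 2^-1) + 3.
have D0 y : 0 < D y by rewrite ltr_wpDl // mulr_ge0 // powR_ge0.
have mD : meas D.
  apply: measurable_funD => //; apply: measurable_funM => //.
  apply: (measurableT_comp (f := fun s : R => s `^ (- 2^-1)) (measurable_powN _)).
  by apply: eq_measurable_fun (measurable_sd x) => y _; rewrite sdC.
have kD : kern (fun s : R => 2 * s `^ (- 2^-1) + 3) 3.
  split; first by apply: measurable_funD => //; apply: measurable_funM => //; exact: measurable_powN.
  by move=> s _; rewrite ger0_norm // addr_ge0 // mulr_ge0 // powR_ge0.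
have [B Hpot] := @kern_pot R 1 3 (ler0n _ _).
have [iD _ _] := Hpot _ (cst 1) kD (measurable_cst _) (fun _ => ltac:(by rewrite normr1)).
have {iD} iD : mu.-integrable setT (EFin \o D).
  by apply: eq_integrable (iD x) => // y _; rewrite /= mulr1.
have ml e : 0 <= e <= 1 -> meas (fun y => logk e (sd x y)).
  move=> e01; apply: eq_measurable_fun (measurable_ksd x (kern_logk e01).1) => y _.
  by rewrite sdC.
have := @bounded_cvg_Rintegral R D (fun n y => logk (en R n) (sd x y) * p y / D y)
   (fun y => logk 0 (sd x y) * p y / D y) M iD.
have E e : \int[mu]_y (D y * (logk e (sd x y) * p y / D y)) = \int[mu]_y (logk e (sd x y) * p y).
  by apply: eq_RI => y; rewrite mulrC divfK // gt_eqF.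
rewrite E; under eq_fun do rewrite E; apply.
- move=> n; apply: measurable_funM; first by apply: measurable_funM => //; exact: ml (en01 n).
  by apply: measurable_inv_ge0 => // y; rewrite ltW.
- move=> n y; rewrite mulrAC normrM mulrC -[leRHS]mulr1 ler_pM //.
  rewrite normrM normfV (gtr0_norm (D0 y)) ler_pdivrMr // mul1r.
  by apply: (kern_logk (en01 n)).2; rewrite sd_ge0 sd_le2.
- move=> y; apply: cvgM; last exact: cvg_cst.
  by apply: cvgM; [exact: cvg_logk|exact: cvg_cst].
Qed.

(** The equation is tested with [ltest e y], multiplied by p(y), integrated in y, and e is sent to
    0. Putting the limit on the polynomial side is essential: [ktest] reproduces p pointwise, while
    u is only integrable. *)
Lemma representation_weak u G Q p : mu.-integrable setT (EFin \o u) -> is_weak_grad u G ->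
  mu.-integrable setT (EFin \o Q) ->
  (forall phi, smooth phi -> \int[mu]_x dot (G x) (grad phi x) = \int[mu]_x (Q x * phi x)) ->
  spoly p ->
  \int[mu]_x (Q x * pot p x) = (\int[mu]_x u x) * (\int[mu]_x p x) - 4 * pi * \int[mu]_x (u x * p x).
Proof.
move=> iu [_ _ wG] iQ eqQ sp.
have mp := spoly_meas sp.
have [M pM] : exists M : R, forall y, `|p y| <= M.
  by case: sp => k wk; apply: Ck0_bounded; exact: wp_Ck wk.
have mQ : meas Q by apply/measurable_EFinP; exact: measurable_int iQ.
have ip : mu.-integrable setT (EFin \o p) by exact: bounded_integrable_dv mp pM.
have step e : 0 < e <= 1 ->
   \int[mu]_x (Q x * \int[mu]_y (logk e (sd x y) * p y)) =
   (\int[mu]_x u x) * (\int[mu]_x p x) - \int[mu]_x (u x * \int[mu]_y (ktest e (sd x y) * p y)).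
  move=> /andP[e0 e1]; have e01 : 0 <= e <= 1 by rewrite ltW.
  have k0 : 0 <= e * (2 + e) * (e ^+ 2)^-1 by rewrite mulr_ge0 ?invr_ge0 ?sqr_ge0 // mulr_ge0; lra.
  have [-> iN1] := kern_fubini (ler0n _ 3) (kern_logk e01) iQ mp pM.
  have [-> iN2] := kern_fubini k0 (kern_ktest e0) iu mp pM.
  have Hy y : \int[mu]_x (Q x * logk e (sd x y)) = \int[mu]_x u x - \int[mu]_x (u x * ktest e (sd x y)).
    transitivity (\int[mu]_x (Q x * ltest e y x)).
      have := @integral_logk e Q y; rewrite e0 e1 => /(_ isT mQ) H.
      rewrite (eq_RI (g := fun x => logk e (sd y x) * Q x)); last by move=> x; rewrite sdC mulrC.
      by rewrite H; apply: eq_RI => x; rewrite /ltest sdC mulrC.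
    have sl := ltest_smooth y e0; rewrite -eqQ //.
    have sf : smooth_field (grad (ltest e y)).
      split; first by rewrite grad_ltest //; exact: zfield_tangent.
      by move=> i k; exact: (sl k.+1).2.
    have := wG _ sf => /(congr1 (fun t => - t)); rewrite opprK => <-.
    have iuk : mu.-integrable setT (EFin \o (fun x => u x * ktest e (sd x y))).
      apply: (integrable_mul_bdd iu (M := e * (2 + e) * (e ^+ 2)^-1)).
        by apply: measurable_ksd; exact: measurable_ktest.
      by move=> x; rewrite ger0_norm ?ktest_ge0 // ktest_le // sd_ge0.
    rewrite -(RintegralB measurableT iu iuk) -[LHS]mulN1r -RintegralZl //.
      by apply: eq_RI => x; rewrite div_grad_ltest //; ring.
    rewrite (_ : EFin \o _ = (fun x => (-1 * u x + u x * ktest e (sd x y))%:E)).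
      have iNu : mu.-integrable setT (EFin \o (fun x => -1 * u x)) by exact: (integrableZl measurableT (-1) iu).
      exact: (integrableD measurableT iNu iuk).
    by apply/funext => x; rewrite /= div_grad_ltest // mulrDr mulrC.
  have iup : mu.-integrable setT (EFin \o (fun y => (\int[mu]_x u x) * p y)).
    by apply: (integrableZl measurableT _ ip).
  have iNp := integrable_mul_bdd iN2 mp pM.
  rewrite -(RintegralZl _ measurableT ip) -(RintegralB measurableT iup iNp).
  by apply: eq_RI => y; rewrite Hy mulrBl.
have l1 : \int[mu]_x (Q x * \int[mu]_y (logk (en R n) (sd x y) * p y)) @[n --> \oo] -->
    \int[mu]_x (Q x * pot p x).
  have [B HB] := @kern_pot R M 3 (ler0n _ _).
  apply: (bounded_cvg_Rintegral (M := B) iQ).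
  - by move=> n; have [] := HB _ p (kern_logk (en01 n)) mp pM.
  - by move=> n; have [] := HB _ p (kern_logk (en01 n)) mp pM.
  - by move=> x; exact: cvg_pot mp pM.
have l2 : \int[mu]_x (u x * \int[mu]_y (ktest (en R n) (sd x y) * p y)) @[n --> \oo] -->
    \int[mu]_x (u x * (4 * pi * p x)).
  apply: (bounded_cvg_Rintegral (M := M * (4 * pi)) iu).
  - move=> n; have e0 := en_gt0 R n.
    have k0 : 0 <= en R n * (2 + en R n) * (en R n ^+ 2)^-1.
      by rewrite mulr_ge0 ?invr_ge0 ?sqr_ge0 // mulr_ge0; lra.
    have [B HB] := @kern_pot R M _ k0.
    by have [] := HB _ p (kern_ktest e0) mp pM.
  - move=> n x; have e0 := en_gt0 R n.
    have ik : mu.-integrable setT (EFin \o (fun y => ktest (en R n) (sd x y))).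
      by under eq_fun do rewrite /= sdC; exact: ktest_bd_integrable.
    have ikp := integrable_mul_bdd ik mp pM.
    apply: le_trans (le_normr_Rintegral measurableT ikp) _.
    rewrite -(integral_ktest x e0) -RintegralZl //; last first.
      exact: ktest_bd_integrable.
    apply: le_Rintegral => //.
    + exact: (integrable_abse ikp).
    + exact: (integrableZl measurableT M (ktest_bd_integrable x e0)).
    + by move=> y _; rewrite normrM sdC ger0_norm ?ktest_ge0 // mulrC ler_wpM2r // ktest_ge0.
  - by move=> x; exact: ktest_cvg.
have := cvg_unique (@norm_hausdorff _ _) l1 _.
rewrite -[RHS]opprK; apply.
rewrite (_ : (fun n => _) = (fun n => (\int[mu]_x u x) * (\int[mu]_x p x) -
   \int[mu]_x (u x * \int[mu]_y (ktest (en R n) (sd x y) * p y)))); last first.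
  by apply/funext => n; rewrite step // en_gt0 en_le1.
rewrite opprK; apply: cvgB; first exact: cvg_cst.
rewrite -(RintegralZl _ measurableT (integrable_mul_bdd iu mp pM)).
by rewrite (eq_RI (g := fun x => u x * (4 * pi * p x))) // => x; ring.
Qed.

End representation.

(** * Representation almost everywhere, with a nonnegative kernel *)

Section representation_ae.
Variable R : realType.
Implicit Types (f g p w u P Q : S2 R -> R) (x y z : S2 R) (e s : R).
Local Notation mu := (@dv R).
Local Notation meas f := (measurable_fun [set: S2 R] f).

Lemma representation_ae u G Q : mu.-integrable setT (EFin \o u) -> is_weak_grad u G ->
  mu.-integrable setT (EFin \o Q) ->
  (forall phi, smooth phi -> \int[mu]_x dot (G x) (grad phi x) = \int[mu]_x (Q x * phi x)) ->
  {ae mu, forall y, mu.-integrable setT (fun x => (Q x * logk 0 (sd x y))%:E) /\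
    4 * pi * u y = \int[mu]_x u x - \int[mu]_x (Q x * logk 0 (sd x y))}.
Proof.
move=> iu wG iQ eqQ; have k00 : 0 <= (0 : R) <= 1 by rewrite lexx ler01.
have k0 := kern_logk k00.
pose N y := \int[mu]_x (Q x * logk 0 (sd x y)); pose U := \int[mu]_x u x.
have [_ iN] := kern_fubini (ler0n _ 3) k0 iQ (measurable_cst (1 : R)) (M := 1) (fun _ => ltac:(by rewrite normr1)).
have i4u : mu.-integrable setT (EFin \o (fun y => 4 * pi * u y)) by exact: (integrableZl measurableT _ iu).
have iU : mu.-integrable setT (EFin \o cst (- U)) by exact: Ck0_integrable (Ck_cst 0 (- U)).
have i1 : mu.-integrable setT (EFin \o (fun y => 4 * pi * u y + - U)) by exact: (integrableD measurableT i4u iU).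
have if0 : mu.-integrable setT (EFin \o (fun y => 4 * pi * u y + - U + N y)) by exact: (integrableD measurableT i1 iN).
have : {ae mu, forall y, 4 * pi * u y + - U + N y = 0}.
  apply: ortho_spoly_ae0 => //; first by apply/measurable_EFinP; exact: measurable_int if0.
  move=> p sp; have mp := spoly_meas sp.
  have [M pM] : exists M : R, forall y, `|p y| <= M.
    by case: sp => k wk; apply: Ck0_bounded; exact: wp_Ck wk.
  have [E _] := kern_fubini (ler0n _ 3) k0 iQ mp pM.
  have := representation_weak iu wG iQ eqQ sp; rewrite /pot E -/U => EE.
  have ip := bounded_integrable_dv mp pM.
  have iup := integrable_mul_bdd iu mp pM; have iNp := integrable_mul_bdd iN mp pM.
  have i2 : mu.-integrable setT (EFin \o (fun y => 4 * pi * (u y * p y))) by exact: (integrableZl measurableT _ iup).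
  have i3 : mu.-integrable setT (EFin \o (fun y => U * p y)) by exact: (integrableZl measurableT _ ip).
  have i4 : mu.-integrable setT (EFin \o (fun y => 4 * pi * (u y * p y) - U * p y)) by exact: (integrableB measurableT i2 i3).
  rewrite (eq_RI (g := fun y => 4 * pi * (u y * p y) - U * p y + N y * p y)); last by move=> y; ring.
  rewrite (RintegralD measurableT i4 iNp) (RintegralB measurableT i2 i3).
  rewrite (RintegralZl _ measurableT iup) (RintegralZl _ measurableT ip) EE; ring.
have := kern_ae_integrable (ler0n _ 3) k0 iQ.
apply: filterS2 => y iy Hy; split => //.
by move: Hy => /eqP; rewrite -addrA addr_eq0 opprD opprK => /eqP.
Qed.

(** As [sd] is at most 2 this kernel is nonnegative, so that the constant of the representation
    becomes a lower bound of u. *)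
Definition lpos s : R := (0 < s)%R%:R * (ln 2 - ln s).

Lemma lpos_ge0 s : s <= 2 -> 0 <= lpos s.
Proof.
rewrite /lpos; have [s0|s0] := ltP 0 s; last by rewrite mul0r.
by move=> s2; rewrite mul1r subr_ge0 ler_ln ?posrE.
Qed.

Lemma kern_lpos : kern lpos 4.
Proof.
have k00 : 0 <= (0 : R) <= 1 by rewrite lexx ler01.
have [ml bl] := kern_logk k00.
have mi : measurable_fun setT (fun s : R => (0 < s)%R%:R : R).
  rewrite (_ : (fun s : R => _) = \1_`]0, +oo[%classic); first exact: measurable_indic.
  by apply/funext => s; rewrite indicE mem_setE in_itv /= andbT.
have E s : lpos s = ln 2 * (0 < s)%R%:R - logk 0 s by rewrite /lpos /logk add0r; ring.
split.
  rewrite (funext E); apply: measurable_funB => //; exact: measurable_funM.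
move=> s s02; rewrite E; apply: le_trans (ler_normB _ _) _.
have l2 : 0 <= ln (2 : R) <= 1.
  apply/andP; split; first by apply: ln_ge0; lra.
  by have := @le_ln1Dx R 1; rewrite (_ : 1 + 1 = 2) //; apply; lra.
have h1 : `|ln 2 * (0 < s)%R%:R| <= (1 : R).
  by case: (0 < s); rewrite ?mulr1 ?mulr0 ?normr0 // ger0_norm; lra.
by have := bl _ s02; lra.
Qed.

Lemma measurable_lpos : measurable_fun setT lpos.
Proof. exact: kern_lpos.1. Qed.

Definition avgP P f : R := (4 * pi)^-1 * \int[mu]_x (P x * f x).

Lemma representation_pos u G P : mu.-integrable setT (EFin \o u) -> is_weak_grad u G ->
  mu.-integrable setT (EFin \o P) ->
  (forall phi, smooth phi -> \int[mu]_x dot (G x) (grad phi x) = \int[mu]_x ((P x - 1) * phi x)) ->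
  \int[mu]_x P x = 4 * pi /\
  exists c : R, {ae mu, forall y, mu.-integrable setT (fun x => (P x * lpos (sd x y))%:E) /\
    u y = c + avgP P (fun x => lpos (sd x y))}.
Proof.
move=> iu wG iP eqQ; have i1 := Ck0_integrable (Ck_cst 0 (1 : R)).
have p0 := pi_gt0 R.
have iQ : mu.-integrable setT (EFin \o (fun x => P x - 1)) by exact: (integrableB measurableT iP i1).
have P4 : \int[mu]_x P x = 4 * pi.
  have := eqQ (cst 1) (fun k => Ck_cst k 1).
  rewrite (eq_RI (g := cst 0)); last first.
    by move=> x; rewrite /dot big1 // => i _; rewrite grad_cst mulr0.
  rewrite Rintegral_cst // mul0r (eq_RI (g := fun x => P x - cst 1 x)); last by move=> x; rewrite mulr1.
  by rewrite (RintegralB measurableT iP i1) Rintegral_cst //= dv_setT mul1r => /esym/eqP; rewrite subr_eq0 => /eqP.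
split => //.
pose L := \int[mu]_x lpos (sd x (pole R)).
have kL y : mu.-integrable setT (fun x => (lpos (sd x y))%:E).
  have [B HB] := @kern_pot R 1 4 (ler0n _ _).
  have [h _ _] := HB _ (cst 1) kern_lpos (measurable_cst _) (fun _ => ltac:(by rewrite normr1)).
  by apply: eq_integrable (h y) => // x _; rewrite /= mulr1 sdC.
(* By the zonal law the integral of the kernel does not depend on y. Passing from P - 1 to P, and
   from - ln s to ln (2 / s), therefore only alters the constant. *)
have LE y : \int[mu]_x lpos (sd x y) = L.
  have Z z : (\int[mu]_x (lpos (sd x z))%:E = (2 * pi)%:E * \int[lebesgue_measure]_(t in `[(1 - 2)%R, (1 - 0)%R]) (`|lpos (1 - t)|%R)%:E)%E.
    rewrite -(zonal_itv z (phi := fun s => `|lpos s|)) //.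
      by apply: eq_integral => x _; rewrite sd_ge0 sd_le2 mul1r ger0_norm // lpos_ge0 // sd_le2.
    by apply: measurableT_comp => //; exact: measurable_lpos.
  by rewrite /L /Rintegral !Z.
exists ((4 * pi)^-1 * (\int[mu]_x u x - L)).
have := kern_ae_integrable (ler0n _ 4) kern_lpos iP.
have := representation_ae iu wG iQ eqQ.
apply: filterS2 => y [iQy uE] iPy; split => //.
apply: (mulfI (_ : 4 * pi != 0)); first by rewrite gt_eqF // mulr_gt0.
rewrite uE /avgP -mulrDr mulrA divff ?gt_eqF ?mulr_gt0 // mul1r.
suff -> : \int[mu]_x ((P x - 1) * logk 0 (sd x y)) = L - \int[mu]_x (P x * lpos (sd x y)) by ring.
have iLP : mu.-integrable setT (EFin \o (fun x => lpos (sd x y) - P x * lpos (sd x y))).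
  exact: (integrableB measurableT (kL y) iPy).
have iQ2 : mu.-integrable setT (EFin \o (fun x => ln 2 * (P x - 1))) by exact: (integrableZl measurableT _ iQ).
rewrite -(LE y) -(RintegralB measurableT (kL y) iPy).
transitivity (\int[mu]_x (ln 2 * (P x - 1) + (lpos (sd x y) - P x * lpos (sd x y)))); last first.
  rewrite (RintegralD measurableT iQ2 iLP) (RintegralZl _ measurableT iQ) (RintegralB measurableT iP i1).
  by rewrite P4 Rintegral_cst //= dv_setT mul1r subrr mulr0 add0r.
rewrite /Rintegral; congr fine; apply: ae_eq_integral => //.
- exact: measurable_int iQy.
- exact: measurable_int (integrableD measurableT iQ2 iLP).
- have := ae_sd_neq0 y; apply: filterS => x s0 _; congr EFin.
  have sp : 0 < sd x y by rewrite lt_neqAle sd_ge0 eq_sym sdC s0.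
  by rewrite /lpos /logk sp add0r !mul1r; ring.
Qed.

End representation_ae.

(** * Integrability of the source and the gradient estimate *)

Section energy.
Variable R : realType.
Implicit Types (f g p w u P Q : S2 R -> R) (x y z : S2 R) (e s : R).
Local Notation mu := (@dv R).
Local Notation meas f := (measurable_fun [set: S2 R] f).

Lemma L2norm_sq f : (L2norm f `^ 2 = \int[mu]_x (f x ^+ 2)%:E)%E.
Proof.
rewrite /L2norm poweR_Lnorm //; apply: eq_integral => x _.
have -> : (`|(EFin \o f) x|)%E = (`|f x|)%:E by [].
by rewrite poweR_EFin powR_mulrn // real_normK // num_real.
Qed.

Lemma L2_integrable_sq f : L2 f -> mu.-integrable setT (EFin \o (fun x => f x ^+ 2)).
Proof.
move=> [mf lf]; apply/integrableP; split.
  by apply/measurable_EFinP; exact: measurable_funX.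
have := poweR_lty 2 lf; rewrite L2norm_sq; under [X in _ -> (X < _)%E]eq_integral.
  by move=> x _; rewrite /= ger0_norm ?sqr_ge0 //; over.
by [].
Qed.

Lemma integrable_sq_mul f g : meas f -> meas g ->
  mu.-integrable setT (EFin \o (fun x => f x ^+ 2)) -> mu.-integrable setT (EFin \o (fun x => g x ^+ 2)) ->
  mu.-integrable setT (EFin \o (fun x => f x * g x)).
Proof.
move=> mf mg f2 g2; apply: (le_integrable measurableT _ _ (integrableD measurableT f2 g2)).
  by apply/measurable_EFinP; exact: measurable_funM.
move=> x _ /=; rewrite lee_fin normrM [leRHS]ger0_norm ?addr_ge0 ?sqr_ge0 //.
have := sqr_ge0 (`|f x| - `|g x|); have := sqr_ge0 (`|f x| + `|g x|).
by rewrite -(real_normK (num_real (f x))) -(real_normK (num_real (g x))); nra.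
Qed.

Lemma L2_integrable f : L2 f -> mu.-integrable setT (EFin \o f).
Proof.
move=> lf; have := integrable_sq_mul lf.1 (measurable_cst (1 : R)) (L2_integrable_sq lf).
move=> /(_ (Ck0_integrable (Ck_cst 0 (1 ^+ 2)))); apply: eq_integrable => // x _.
by rewrite /= mulr1.
Qed.

(** Suppose P has infinite integral. Adding a constant to a test function changes neither its
    gradient nor the left side and makes it at least 1; the right side is then an integral equal to
    +oo, whose real value is 0. So u is weakly harmonic, hence constant almost everywhere by the
    representation with source 0, and in that case P is integrable by hypothesis. *)
Lemma source_integrable u G P : mu.-integrable setT (EFin \o u) -> is_weak_grad u G ->
  meas P -> (forall x, 0 <= P x) ->
  (forall phi, smooth phi -> \int[mu]_x dot (G x) (grad phi x) = \int[mu]_x ((P x - 1) * phi x)) ->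
  (forall c, {ae mu, forall x, u x = c} -> mu.-integrable setT (EFin \o P)) ->
  mu.-integrable setT (EFin \o P).
Proof.
move=> iu wG mP P0 eqQ Hc; apply: contrapT => nP.
have Py : (\int[mu]_x (P x)%:E = +oo)%E.
  apply: contrapT => /eqP Pn; apply: nP; apply/integrableP; split; first exact/measurable_EFinP.
  rewrite ltey; apply: contra Pn => /eqP <-; apply/eqP; apply: eq_integral => x _.
  by rewrite /= ger0_norm.
apply: nP; have p0 := pi_gt0 R.
suff J phi : smooth phi -> \int[mu]_x dot (G x) (grad phi x) = \int[mu]_x (cst 0 x * phi x).
  apply: (Hc ((4 * pi)^-1 * \int[mu]_x u x)).
  have := representation_ae iu wG (Ck0_integrable (Ck_cst 0 0)) J.
  apply: filterS => y [_ uE]; apply: (mulfI (_ : 4 * pi != 0)); first by rewrite gt_eqF // mulr_gt0.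
  rewrite uE mulrA divff ?gt_eqF ?mulr_gt0 // mul1r (eq_RI (f := fun x => cst 0 x * logk 0 (sd x y)) (g := cst 0)).
    by rewrite Rintegral_cst // mul0r subr0.
  by move=> x; rewrite mul0r.
move=> sphi; have [M phiM] := Ck0_bounded (sphi 0).
have M0 : 0 <= M by apply: le_trans (normr_ge0 _) (phiM (pole R)).
rewrite [RHS](eq_RI (g := cst 0)); last by move=> x; rewrite mul0r.
rewrite Rintegral_cst // mul0r.
pose F x := (P x - 1) * (phi x + (M + 1)).
have sphi' : smooth (fun x => phi x + cst (M + 1) x) by move=> k; apply: CkD => //; exact: Ck_cst.
have := eqQ _ sphi'; rewrite (eq_RI (g := fun x => dot (G x) (grad phi x))); last first.
  move=> x; rewrite /dot; apply: eq_bigr => i _.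
  by rewrite (gradD _ (Ck_dff _ (sphi 1%N)) (dff_cst _ _)) grad_cst addr0.
move=> ->; rewrite -/(\int[mu]_x F x) /Rintegral integralE.
have mphi : meas phi by exact: @Ck0_measurable _ _ (sphi 0).
have mF : measurable_fun setT (EFin \o F).
  by apply/measurable_EFinP; apply: measurable_funM; [exact: measurable_funB|exact: measurable_funD].
have b x : 1 <= phi x + (M + 1) <= 2 * M + 1 by have := phiM x; rewrite ler_norml; lra.
have mp := measurable_funepos mF; have mn := measurable_funeneg mF.
have Fp : (\int[mu]_x (EFin \o F)^\+ x = +oo)%E.
  apply/eqP; rewrite eq_le leey /=.
  have : (\int[mu]_x (P x)%:E <= \int[mu]_x ((EFin \o F)^\+ x + (2 * M + 1)%:E))%E.
    apply: ge0_le_integral => //.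
    - by move=> x _; rewrite lee_fin.
    - exact/measurable_EFinP.
    - exact: emeasurable_funD.
    - move=> x _; apply: (@le_trans _ _ ((F x)%:E + (2 * M + 1)%:E)%E).
        by rewrite -EFinD lee_fin /F; have := P0 x; have := b x; nra.
      by rewrite leeD2r // funeposE le_max lexx.
  rewrite Py ge0_integralD //; last first.
    by move=> x _; rewrite lee_fin; lra.
  rewrite integral_cst //= dv_setT -EFinM; case: (integral _ _ _) => //.
have Fn : (\int[mu]_x (EFin \o F)^\- x <= ((2 * M + 1) * (4 * pi))%:E)%E.
  have -> : (((2 * M + 1) * (4 * pi))%:E = \int[mu]_x (cst (2 * M + 1)%:E x))%E.
    by rewrite integral_cst //= dv_setT EFinM.
  apply: ge0_le_integral => //.
  move=> x _; rewrite funenegE /= ge_max !lee_fin.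
  by have := b x; have := P0 x; rewrite /F => Px bx; apply/andP; split; nra.
have Fn0 : (0 <= \int[mu]_x (EFin \o F)^\- x)%E by apply: integral_ge0.
rewrite Fp; move: Fn Fn0; case: (integral _ _ _) => //=.
Qed.

Lemma dot_CS (v w : 'rV[R]_3) : dot v w ^+ 2 <= dot v v * dot w w.
Proof.
rewrite /dot !sum3; have := sqr_ge0 (v 0 0 * w 0 1 - v 0 1 * w 0 0).
have := sqr_ge0 (v 0 0 * w 0 2%:R - v 0 2%:R * w 0 0); have := sqr_ge0 (v 0 1 * w 0 2%:R - v 0 2%:R * w 0 1).
nra.
Qed.

Lemma div_scale (phi : S2 R -> R) (V : S2 R -> 'rV[R]_3) y : Ck 1 phi -> (forall i, Ck 1 (fun y => V y 0 i)) ->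
  div (fun y => phi y *: V y) y = phi y * div V y + dot (grad phi y) (V y).
Proof.
move=> cp cV; rewrite /div /dot mulr_sumr -big_split /=; apply: eq_bigr => i _.
rewrite (_ : (fun z => (phi z *: V z) 0 i) = (fun z => phi z * V z 0 i)); last first.
  by apply/funext => z; rewrite mxE.
by rewrite (gradM _ (Ck_dff _ cp) (Ck_dff _ (cV i))) [V y 0 i * _]mulrC.
Qed.

(** The gradient of s = [sd] has squared length s (2 - s), so that of ln (e + s) has length at most
    the square root of 2 / s, uniformly in e. *)
Lemma grad_ltest_bound e x y (v : 'rV[R]_3) : 0 < e -> dot v (pt y) = 0 ->
  dot (grad (ltest e x) y) v ^+ 2 <= 2 * (sd x y `^ (- 2^-1)) ^+ 2 * dot v v.
Proof.
move=> e0 vy; have v0 : 0 <= dot v v by apply: sumr_ge0 => i _; rewrite -expr2 sqr_ge0.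
rewrite grad_ltest // sdC; set s := sd y x.
have -> : dot (zfield (fun y => - (e + sd y x)^-1) x y) v = - (e + s)^-1 * dot (\row_i (pt x 0 i - sdot y x * pt y 0 i)) v.
  by rewrite /dot mulr_sumr; apply: eq_bigr => i _; rewrite !mxE /crd mulrA.
set w := \row_i _; have ww : dot w w = s * (2 - s).
  have := sdotE y x; rewrite /s /sd /dot !sum3 !mxE /crd; have := sum_crd2 x; have := sum_crd2 y.
  move: (sdot y x) => t y1 x1 tE.
  transitivity ((pt x 0 0 ^+ 2 + pt x 0 1 ^+ 2 + pt x 0 2%:R ^+ 2) - 2 * t * (pt x 0 0 * pt y 0 0 + pt x 0 1 * pt y 0 1 + pt x 0 2%:R * pt y 0 2%:R) + t ^+ 2 * (pt y 0 0 ^+ 2 + pt y 0 1 ^+ 2 + pt y 0 2%:R ^+ 2)).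
    by ring.
  by rewrite x1 y1 -tE; ring.
have CS := dot_CS w v; have s0 : 0 <= s := sd_ge0 y x; have s2 : s <= 2 := sd_le2 y x.
rewrite exprMn sqrrN; have [sz|sn] := eqVneq s 0.
  have -> : dot w v ^+ 2 = 0.
    by apply/eqP; rewrite eq_le sqr_ge0 andbT; apply: le_trans CS _; rewrite ww sz !mul0r.
  by rewrite mulr0 mulr_ge0 // mulr_ge0 // sqr_ge0.
have sp : 0 < s by rewrite lt_neqAle eq_sym sn.
have -> : (s `^ (- 2^-1)) ^+ 2 = s^-1.
  rewrite -powR_mulrn ?powR_ge0 // -powRrM (_ : - 2^-1 * 2%:R = -1); last by lra.
  by rewrite powR_inv1 // ltW.
have h1 : ((e + s)^-1) ^+ 2 <= s^-1 * s^-1.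
  by rewrite expr2 ler_pM ?invr_ge0 //; try lra; rewrite lef_pV2 ?posrE; lra.
apply: (@le_trans _ _ (s^-1 * s^-1 * (s * (2 - s) * dot v v))).
  apply: ler_pM => //; rewrite ?sqr_ge0 //.
  by rewrite -ww.
rewrite [leLHS](_ : _ = s^-1 * ((2 - s) * dot v v)); last by field.
rewrite [2 * _]mulrC -mulrA ler_wpM2l ?invr_ge0 // ler_wpM2r //; lra.
Qed.

(** Integration by parts moves the divergence from V to the regularised logarithm. Young's
    inequality then separates q from V, leaving the weight s^(-1/2) on both sides, as Schur's test
    requires. *)
Lemma grad_pot_bound V x (al : R) : tangent V -> (forall i, Ck 1 (fun y => V y 0 i)) -> Ck 0 (div V) -> 0 < al ->
  forall q : R, q * pot (div V) x <=
   al * q ^+ 2 * \int[mu]_y (sd x y `^ (- 2^-1)) + (2 * al)^-1 * \int[mu]_y (sd x y `^ (- 2^-1) * dot (V y) (V y)).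
Proof.
move=> tV cV cd al0 q; have [M dM] := Ck0_bounded cd; have md := Ck0_measurable cd.
have cvv : Ck 0 (fun y => dot (V y) (V y)).
  by apply: (@Ck_sum R 0); move=> i; apply: (@CkM R 0); apply: CkW; exact: cV.
have [N vN] := Ck0_bounded cvv; have mvv := Ck0_measurable cvv.
have kr : kern (fun s : R => s `^ (- 2^-1)) 0.
  split; first exact: measurable_powN.
  by move=> s _; rewrite ger0_norm ?powR_ge0 // addr0 ler_peMl ?powR_ge0 // ler1n.
have [B1 HB1] := @kern_pot R N 0 (lexx _); have [ir _ _] := HB1 _ _ kr mvv vN.
have [B2 HB2] := @kern_pot R 1 0 (lexx _).
have [ir1 _ _] := HB2 _ (cst 1) kr (measurable_cst _) (fun _ => ltac:(by rewrite normr1)).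
have {ir1} ir1 : mu.-integrable setT (EFin \o (fun y => sd x y `^ (- 2^-1))).
  by apply: eq_integrable (ir1 x) => // y _; rewrite /= mulr1.
have l : q * \int[mu]_y (logk (en R n) (sd x y) * div V y) @[n --> \oo] --> q * pot (div V) x.
  by apply: cvgM; [exact: cvg_cst|exact: cvg_pot md dM].
rewrite -(cvg_lim (@norm_hausdorff _ _) l); apply: limr_le; first by apply/cvg_ex; exists (q * pot (div V) x).
apply: nearW => n; have e0 := en_gt0 R n; have e1 := en_le1 R n; move: (en R n) e0 e1 => e e0 e1.
rewrite integral_logk ?e0 ?e1 //.
have sl := ltest_smooth x e0.
have cW i : Ck 1 (fun y => (ltest e x y *: V y) 0 i).
  rewrite (_ : (fun z => _) = (fun z => ltest e x z * V z 0 i)); first by apply: CkM => //; exact: sl.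
  by apply/funext => z; rewrite mxE.
have tW : tangent (fun y => ltest e x y *: V y).
  move=> y; have -> : dot (ltest e x y *: V y) (pt y) = ltest e x y * dot (V y) (pt y); last by rewrite tV mulr0.
  by rewrite /dot [RHS]mulr_sumr; apply: eq_bigr => i _; rewrite mxE mulrA.
have cg : Ck 0 (fun y => dot (grad (ltest e x) y) (V y)).
  by apply: (@Ck_sum R 0) => i; apply: (@CkM R 0); [exact: (sl 1%N).2|apply: CkW; exact: cV].
have ig := Ck0_integrable cg.
have il : mu.-integrable setT (EFin \o (fun y => ltest e x y * div V y)).
  by apply: Ck0_integrable; apply: (@CkM R 0) => //; exact: (sl 0).
have := divergence_theorem tW cW.
rewrite (eq_RI (g := fun y => ltest e x y * div V y + dot (grad (ltest e x) y) (V y))); last first.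
  by move=> y; rewrite div_scale //; exact: sl.
rewrite (RintegralD measurableT il ig) => /eqP; rewrite addr_eq0 => /eqP EE.
rewrite (eq_RI (g := fun y => ltest e x y * div V y)); last by move=> y; rewrite /ltest sdC.
rewrite EE mulrN -mulNr -(RintegralZl _ measurableT ig).
have iA : mu.-integrable setT (EFin \o (fun y => al * q ^+ 2 * sd x y `^ (- 2^-1))).
  exact: (integrableZl measurableT _ ir1).
have iB : mu.-integrable setT (EFin \o (fun y => (2 * al)^-1 * (sd x y `^ (- 2^-1) * dot (V y) (V y)))).
  exact: (integrableZl measurableT _ (ir x)).
rewrite -(RintegralZl _ measurableT ir1) -(RintegralZl _ measurableT (ir x)) -(RintegralD measurableT iA iB).
apply: le_Rintegral => //.
- exact: (integrableZl measurableT (- q) ig).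
- exact: (integrableD measurableT iA iB).
move=> y _; have := @grad_ltest_bound e x y (V y) e0 (tV y).
set a := dot (grad _ _) _; set r := sd x y `^ _; set vv := dot (V y) (V y).
have [r0|rn] := eqVneq r 0.
  rewrite r0 expr0n /= !(mulr0, mul0r) addr0 => h.
  have /eqP -> : a == 0 by rewrite -sqrf_eq0 eq_le h sqr_ge0.
  by rewrite mulr0.
have rp : 0 < r by rewrite lt_neqAle eq_sym rn powR_ge0.
move=> h; have c0 : 0 < 4 * al * r by rewrite !mulr_gt0.
rewrite -(ler_pM2l c0).
have -> : 4 * al * r * (al * q ^+ 2 * r + (2 * al)^-1 * (r * vv)) = 4 * al ^+ 2 * r ^+ 2 * q ^+ 2 + 2 * r ^+ 2 * vv.
  by field; rewrite gt_eqF.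
apply: (@le_trans _ _ (4 * al ^+ 2 * r ^+ 2 * q ^+ 2 + a ^+ 2)); last by rewrite lerD2l.
by have := sqr_ge0 (2 * al * r * q + a); nra.
Qed.

(** The value of 2 pi times the integral of s^(-1/2) over [0, 2], which is the Schur constant of the
    kernel. *)
Definition halfpow : R := 2 * pi * (2 `^ (1 - 2^-1) / (1 - 2^-1)).

(** Schur's test. The parameter of Young's inequality is halfpow / (4 pi), for which the term in V
    receives exactly the coefficient 1 that the duality argument absorbs. *)
Lemma weak_grad_poly u G Q V : mu.-integrable setT (EFin \o u) -> is_weak_grad u G ->
  mu.-integrable setT (EFin \o Q) -> mu.-integrable setT (EFin \o (fun x => Q x ^+ 2)) ->
  (forall phi, smooth phi -> \int[mu]_x dot (G x) (grad phi x) = \int[mu]_x (Q x * phi x)) ->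
  tangent V -> (forall i, spoly (fun x => V x 0 i)) -> spoly (div V) ->
  2 * \int[mu]_x dot (G x) (V x) <=
    2 * (halfpow / (4 * pi)) ^+ 2 * \int[mu]_x (Q x ^+ 2) + \int[mu]_x dot (V x) (V x).
Proof.
move=> iu wG iQ iQ2 eqQ tV sV sdV; have p0 := pi_gt0 R.
have cV k i : Ck k (fun x => V x 0 i) by have [j wj] := sV i; exact: wp_Ck wj.
have cd : Ck 0 (div V) by have [j wj] := sdV; exact: wp_Ck wj.
have [_ _ wGV] := wG; have [M dM] := Ck0_bounded cd; have md := Ck0_measurable cd.
have := wGV V (conj tV (fun i k => cV k i)) => /(congr1 (fun t => - t)); rewrite opprK => <-.
have := representation_weak iu wG iQ eqQ sdV.
rewrite (divergence_theorem tV (cV 1%N)) mulr0 sub0r => EE.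
pose k := halfpow / (4 * pi); have k0 : 0 < k.
  rewrite /k /halfpow !divr_gt0 ?mulr_gt0 ?divr_gt0 ?powR_gt0 ?invr_gt0 //; lra.
suff H : \int[mu]_x (Q x * pot (div V) x) <= 4 * pi * (k ^+ 2 * \int[mu]_x (Q x ^+ 2) + 2^-1 * \int[mu]_x dot (V x) (V x)).
  have pp : 0 < 4 * pi :> R by rewrite mulr_gt0.
  by move: H; rewrite EE -mulrN ler_pM2l // -/k; lra.
have cvv : Ck 0 (fun y => dot (V y) (V y)).
  by apply: (@Ck_sum R 0); move=> i; apply: (@CkM R 0); exact: cV.
have [N vN] := Ck0_bounded cvv; have mvv := Ck0_measurable cvv.
have vv0 y : 0 <= dot (V y) (V y) by apply: sumr_ge0 => i _; rewrite -expr2 sqr_ge0.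
have kr : kern (fun s : R => s `^ (- 2^-1)) 0.
  split; first exact: measurable_powN.
  by move=> s _; rewrite ger0_norm ?powR_ge0 // addr0 ler_peMl ?powR_ge0 // ler1n.
have [B HB] := @kern_pot R N 0 (lexx _); have [_ bB mB] := HB _ _ kr mvv vN.
have [B' HB'] := @kern_pot R M 3 (ler0n _ _).
have k00 : 0 <= (0 : R) <= 1 by rewrite lexx ler01.
have [_ bB' mB'] := HB' _ _ (kern_logk k00) md dM.
have iQp : mu.-integrable setT (EFin \o (fun x => Q x * pot (div V) x)) by exact: integrable_mul_bdd iQ mB' bB'.
pose T x := \int[mu]_y (sd x y `^ (- 2^-1) * dot (V y) (V y)).
have iT : mu.-integrable setT (EFin \o T) by exact: bounded_integrable_dv mB bB.
have hp x : \int[mu]_y (sd x y `^ (- 2^-1)) <= halfpow.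
  rewrite -lee_fin /Rintegral.
  have h := sd_pow_half x.
  have E : (\int[mu]_y (sd x y `^ (- 2^-1))%:E = \int[mu]_y (sd y x `^ (- 2^-1))%:E)%E.
    by apply: eq_integral => y _; rewrite sdC.
  rewrite E fineK // ge0_fin_numE; first exact: le_lt_trans h (ltry _).
  by apply: integral_ge0 => y _; rewrite lee_fin powR_ge0.
have i1 : mu.-integrable setT (EFin \o (fun x => k * halfpow * Q x ^+ 2)) by exact: (integrableZl measurableT _ iQ2).
have i2 : mu.-integrable setT (EFin \o (fun x => (2 * k)^-1 * T x)) by exact: (integrableZl measurableT _ iT).
apply: (@le_trans _ _ (\int[mu]_x (k * halfpow * Q x ^+ 2 + (2 * k)^-1 * T x))).
  apply: le_Rintegral => //; first exact: (integrableD measurableT i1 i2).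
  move=> x _; apply: le_trans (grad_pot_bound x tV (cV 1%N) cd k0 (Q x)) _.
  by rewrite lerD2r mulrAC ler_wpM2r ?sqr_ge0 // ler_pM2l.
rewrite (RintegralD measurableT i1 i2) (RintegralZl _ measurableT iQ2) (RintegralZl _ measurableT iT).
have hE : halfpow = 4 * pi * k by rewrite /k mulrC divfK // gt_eqF // mulr_gt0.
have TE : \int[mu]_x T x <= halfpow * \int[mu]_x dot (V x) (V x).
  have [E _] := kern_fubini (lexx _) kr (Ck0_integrable (Ck_cst 0 (1 : R))) mvv vN.
  rewrite (eq_RI (g := fun x => cst 1 x * T x)); last by move=> x; rewrite mul1r.
  have ivv := bounded_integrable_dv mvv vN.
  rewrite E -(RintegralZl _ measurableT ivv); apply: le_Rintegral => //.
  - have [_ iN] := kern_fubini (lexx _) kr (Ck0_integrable (Ck_cst 0 (1 : R))) mvv vN.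
    exact: integrable_mul_bdd iN mvv vN.
  - exact: (integrableZl measurableT _ ivv).
  - move=> y _; rewrite ler_wpM2r // (eq_RI (g := fun x => sd y x `^ (- 2^-1))) ?hp // => x.
    by rewrite mul1r sdC.
apply: (@le_trans _ _ (k * halfpow * \int[mu]_x (Q x ^+ 2) + (2 * k)^-1 * (halfpow * \int[mu]_x dot (V x) (V x)))).
  by rewrite lerD2l ler_wpM2l // invr_ge0 mulr_ge0 // ltW.
by rewrite hE le_eqVlt; apply/orP; left; apply/eqP; field; rewrite gt_eqF.
Qed.

Lemma spoly_grad p i : spoly p -> spoly (fun x => grad p x 0 i).
Proof.
move=> [k]; elim=> {k p} [c|k j f wf IH|k f g wf IH wg IH'|k f _ IH] //.
- by rewrite (_ : (fun x => _) = cst 0); [exact: spoly_cst|apply/funext => x; rewrite grad_cst].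
- rewrite (_ : (fun x => _) = (fun x => crd j x * grad f x 0 i + f x * (cst (i == j)%:R x + -1 * (crd i x * crd j x)))).
    apply: spolyD; first by apply: spolyM => //; exact: spoly_crd.
    apply: spolyM; first by exists k.
    apply: spolyD; first exact: spoly_cst.
    by apply: (spolyM (f := cst (-1))); [exact: spoly_cst|apply: spolyM; exact: spoly_crd].
  apply/funext => x; rewrite (gradM _ (dff_crd _ _) (Ck_dff _ (wp_Ck 1 wf))) grad_crd.
  by rewrite mulN1r.
- rewrite (_ : (fun x => _) = (fun x => grad f x 0 i + grad g x 0 i)); first exact: spolyD.
  by apply/funext => x; rewrite (gradD _ (Ck_dff _ (wp_Ck 1 wf)) (Ck_dff _ (wp_Ck 1 wg))).
Qed.

(** Duality: if V is close to the gradient G in L^2, then 2 G.V - V.V is close to G.G, and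
    [weak_grad_poly] bounds its integral in terms of Q. Only smooth fields are paired with G, as the
    definition of a weak gradient demands. *)
Lemma energy_bound u G Q : mu.-integrable setT (EFin \o u) -> is_weak_grad u G ->
  mu.-integrable setT (EFin \o Q) -> mu.-integrable setT (EFin \o (fun x => Q x ^+ 2)) ->
  (forall phi, smooth phi -> \int[mu]_x dot (G x) (grad phi x) = \int[mu]_x (Q x * phi x)) ->
  \int[mu]_x dot (G x) (G x) <= 2 * (halfpow / (4 * pi)) ^+ 2 * \int[mu]_x (Q x ^+ 2).
Proof.
move=> iu wG iQ iQ2 eqQ; have [lG tG _] := wG.
have iG2 i := L2_integrable_sq (lG i); have mG i := (lG i).1.
apply/ler_addgt0Pr => e e0.
have e3 : 0 < e / 3 by rewrite divr_gt0.
have ap i : exists p, spoly p /\ (\int[mu]_x ((G x 0 i - p x) ^+ 2)%:E <= (e / 3)%:E)%E.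
  by have [_ /(_ _ e3)[p sp pe]] := L2appr_L2 (mG i) (iG2 i); exists p.
have [p Hp] := choice ap.
(* The tangential projection of p, again polynomial. As G is tangent, projecting does not increase
   the distance to G. *)
pose V x : 'rV[R]_3 := \row_i (p i x - (\sum_j p j x * crd j x) * crd i x).
have VE i : (fun x => V x 0 i) = (fun x => p i x + -1 * ((p 0 x * crd 0 x + p 1 x * crd 1 x + p 2%:R x * crd 2%:R x) * crd i x)).
  by apply/funext => x; rewrite mxE sum3; ring.
have sV i : spoly (fun x => V x 0 i).
  rewrite VE; apply: spolyD; first exact: (Hp i).1.
  apply: (spolyM (f := cst (-1))); first exact: spoly_cst.
  apply: spolyM; last exact: spoly_crd.
  by apply: spolyD; [apply: spolyD|]; apply: spolyM; (exact: spoly_crd || exact: (Hp _).1).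
have tV : tangent V.
  move=> x; rewrite /dot !sum3 !mxE !sum3 /crd; have := sum_crd2 x.
  set a := _ + _ + _ => a1; set b := p 0 x * _ + _ + _.
  transitivity (b * (1 - a)); first by rewrite /a /b; ring.
  by rewrite a1 subrr mulr0.
have sdV : spoly (div V).
  rewrite (_ : div V = (fun x => grad (fun x => V x 0 0) x 0 0 + grad (fun x => V x 0 1) x 0 1 + grad (fun x => V x 0 2%:R) x 0 2%:R)).
    by apply: spolyD; [apply: spolyD|]; exact: spoly_grad.
  by apply/funext => x; rewrite /div sum3.
have main := weak_grad_poly iu wG iQ iQ2 eqQ tV sV sdV.
have mV i : meas (fun x => V x 0 i) by exact: spoly_meas.
have iV2 i : mu.-integrable setT (EFin \o (fun x => V x 0 i ^+ 2)).
  by have [j wj] := sV i; apply: Ck0_integrable; apply: (@CkM R 0); exact: wp_Ck wj.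
have id2 (A B : S2 R -> 'rV[R]_3) : (forall i, mu.-integrable setT (EFin \o (fun x => A x 0 i * B x 0 i))) ->
    mu.-integrable setT (EFin \o (fun x => dot (A x) (B x))).
  move=> iAB; apply: eq_integrable (integrableD measurableT (integrableD measurableT (iAB 0) (iAB 1)) (iAB 2%:R)) => //.
  by move=> x _ /=; rewrite /dot sum3.
have iGG : mu.-integrable setT (EFin \o (fun x => dot (G x) (G x))) by apply: id2 => i; exact: iG2.
have iGV : mu.-integrable setT (EFin \o (fun x => dot (G x) (V x))).
  by apply: id2 => i; exact: integrable_sq_mul.
have iVV : mu.-integrable setT (EFin \o (fun x => dot (V x) (V x))) by apply: id2 => i; exact: iV2.
pose d i x := (G x 0 i - p i x) ^+ 2.
have md i : measurable_fun setT (fun x => (d i x)%:E) by exact: meas_sq (mG i) (spoly_meas (Hp i).1).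
have d0 i x : 0 <= d i x by exact: sqr_ge0.
have id i : mu.-integrable setT (EFin \o d i).
  apply/integrableP; split; first exact: md; apply: (@le_lt_trans _ _ (e / 3)%:E); last exact: ltry.
  by apply: le_trans (Hp i).2; rewrite le_eqVlt; apply/orP; left; apply/eqP; apply: eq_integral => x _; rewrite /= ger0_norm.
have dle i : \int[mu]_x d i x <= e / 3.
  rewrite -lee_fin /Rintegral fineK; first exact: (Hp i).2.
  by apply: integrable_fin_num => //; exact: id.
have id01 := integrableD measurableT (id 0) (id 1); have id3 := integrableD measurableT id01 (id 2%:R).
have i2GV : mu.-integrable setT (EFin \o (fun x => 2 * dot (G x) (V x))) by exact: (integrableZl measurableT _ iGV).
have i3 : mu.-integrable setT (EFin \o (fun x => 2 * dot (G x) (V x) - dot (V x) (V x))) by exact: (integrableB measurableT i2GV iVV).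
apply: (@le_trans _ _ (\int[mu]_x (2 * dot (G x) (V x) - dot (V x) (V x) + (d 0 x + d 1 x + d 2%:R x)))).
  apply: le_Rintegral => //; first exact: (integrableD measurableT i3 id3).
  move=> x _; have := tG x; rewrite /d /dot !sum3 !mxE !sum3 /crd; have := sum_crd2 x.
  move: (pt x 0 0) (pt x 0 1) (pt x 0 2%:R) (G x 0 0) (G x 0 1) (G x 0 2%:R) (p 0 x) (p 1 x) (p 2%:R x).
  move=> a b c g h k q r s n1 t0; set w := q * a + r * b + s * c.
  rewrite -subr_ge0.
  have -> : 2 * (g * (q - w * a) + h * (r - w * b) + k * (s - w * c)) -
     ((q - w * a) * (q - w * a) + (r - w * b) * (r - w * b) + (s - w * c) * (s - w * c)) +
     ((g - q) ^+ 2 + (h - r) ^+ 2 + (k - s) ^+ 2) - (g * g + h * h + k * k) =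
     - 2 * w * (g * a + h * b + k * c) + 2 * w * (q * a + r * b + s * c) - w ^+ 2 * (a ^+ 2 + b ^+ 2 + c ^+ 2) by ring.
  by rewrite t0 n1 -/w mulr0 add0r mulr1; have := sqr_ge0 w; nra.
rewrite (RintegralD measurableT i3 id3) (RintegralB measurableT i2GV iVV) (RintegralZl _ measurableT iGV).
rewrite (RintegralD measurableT id01 (id 2%:R)) (RintegralD measurableT (id 0) (id 1)).
by have := dle 0; have := dle 1; have := dle 2%:R; move: main; lra.
Qed.

End energy.

(** * Averages against the mass and exponential integrability of potentials *)

Section weighted_average.
Variable R : realType.
Implicit Types (f g p w u P Q : S2 R -> R) (x y z : S2 R) (s : R).
Local Notation mu := (@dv R).
Local Notation meas f := (measurable_fun [set: S2 R] f).

Lemma measurable_lt_ind (a : R) : measurable_fun [set: R] (fun s : R => (s < a)%R%:R : R).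
Proof.
rewrite (_ : (fun s : R => _) = \1_`]-oo, a[%classic); first exact: measurable_indic.
by apply/funext => s; rewrite indicE mem_setE in_itv.
Qed.

Lemma measurable_ge_ind (a : R) : measurable_fun [set: R] (fun s : R => (a <= s)%R%:R : R).
Proof.
rewrite (_ : (fun s : R => _) = \1_`[a, +oo[%classic); first exact: measurable_indic.
by apply/funext => s; rewrite indicE mem_setE in_itv /= andbT.
Qed.

Lemma measurable_gt_ind (a : R) : measurable_fun [set: R] (fun s : R => (a < s)%R%:R : R).
Proof.
rewrite (_ : (fun s : R => _) = \1_`]a, +oo[%classic); first exact: measurable_indic.
by apply/funext => s; rewrite indicE mem_setE in_itv /= andbT.
Qed.

Lemma bool_le1 (b : bool) : 0 <= (b%:R : R) <= 1.
Proof. by case: b; rewrite /= ?lexx ?ler01. Qed.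

Section fixed_weight.
Variable P : S2 R -> R.
Hypotheses (iP : mu.-integrable setT (EFin \o P)) (P0 : forall x, 0 <= P x) (P4 : \int[mu]_x P x = 4 * pi).
Local Notation Pint f := (mu.-integrable setT (EFin \o (fun x => P x * f x))).
Local Notation A := (avgP P).

Let c0 : 0 < (4 * pi)^-1 :> R. Proof. by rewrite invr_gt0 mulr_gt0 // pi_gt0. Qed.

Lemma Pint_bdd f (M : R) : meas f -> (forall x, `|f x| <= M) -> Pint f.
Proof. by move=> mf fM; exact: integrable_mul_bdd iP mf fM. Qed.

Lemma PintZ (k : R) f : Pint f -> Pint (fun x => k * f x).
Proof.
move=> pf; apply: eq_integrable (integrableZl measurableT k pf) => // x _.
by rewrite /= -EFinM; congr EFin; ring.
Qed.

Lemma PintD f g : Pint f -> Pint g -> Pint (fun x => f x + g x).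
Proof.
move=> pf pg; apply: eq_integrable (integrableD measurableT pf pg) => // x _.
by rewrite /= -EFinD; congr EFin; ring.
Qed.

Lemma avgPZ (k : R) f : Pint f -> A (fun x => k * f x) = k * A f.
Proof.
move=> pf; rewrite /avgP mulrCA -(RintegralZl _ measurableT pf); congr (_ * _).
by apply: eq_RI => x; ring.
Qed.

Lemma avgPD f g : Pint f -> Pint g -> A (fun x => f x + g x) = A f + A g.
Proof.
move=> pf pg; rewrite /avgP -mulrDr -(RintegralD measurableT pf pg); congr (_ * _).
by apply: eq_RI => x; ring.
Qed.

Lemma avgP_cst (k : R) : A (cst k) = k.
Proof.
rewrite /avgP (eq_RI (g := fun x => k * P x)); last by move=> x; rewrite mulrC.
by rewrite (RintegralZl _ measurableT iP) P4 mulrC mulfK // gt_eqF // mulr_gt0 // pi_gt0.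
Qed.

(** The point y is excepted because logarithmic kernels take the default value 0 there, where the
    true value would be infinite; it is a null set. *)
Lemma avgP_le y f g : Pint f -> Pint g -> (forall x, sd x y != 0 -> f x <= g x) -> A f <= A g.
Proof.
move=> pf pg fg; rewrite /avgP ler_pM2l // -subr_ge0 -(RintegralB measurableT pg pf).
have ih := integrableB measurableT pg pf.
rewrite (_ : \int[mu]_x (P x * g x - P x * f x) = \int[mu]_x `|P x * g x - P x * f x|); last first.
  rewrite /Rintegral; congr fine; apply: ae_eq_integral => //.
  - exact: measurable_int ih.
  - by apply: measurable_int (integrable_abse ih).
  - apply: filterS (ae_sd_neq0 y) => x; rewrite sdC => s0 _; rewrite ger0_norm //.
    by rewrite -mulrBr mulr_ge0 // subr_ge0 fg.
by apply: Rintegral_ge0.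
Qed.

Lemma avgP_ge0 f : (forall x, 0 <= f x) -> 0 <= A f.
Proof.
move=> f0; rewrite /avgP mulr_ge0 //; first exact: ltW.
by apply: Rintegral_ge0 => x _; rewrite mulr_ge0.
Qed.

(** [lA 2] is [lpos]. A smaller A measures the logarithm relative to that scale, and the kernel is
    then nonnegative only up to distance A. *)
Definition lA (A : R) s : R := (0 < s)%R%:R * (ln A - ln s).

Lemma measurable_lA (B : R) : measurable_fun setT (lA B).
Proof.
apply: measurable_funM; first exact: measurable_gt_ind.
apply: measurable_funB => //; exact: measurable_ln.
Qed.

Lemma lA_ge0 (B : R) s : s <= B -> 0 <= lA B s.
Proof.
rewrite /lA; have [s0 sB|] := ltP 0 s; last by rewrite mul0r.
by rewrite mul1r subr_ge0 ler_ln ?posrE // (lt_le_trans s0).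
Qed.

Lemma expR_lA (th B : R) s : 0 < B -> expR (th * lA B s) <= 1 + B `^ th * s `^ (- th).
Proof.
move=> B0; rewrite /lA; have [s0|] := ltP 0 s; last first.
  by rewrite mul0r mulr0 expR0 lerDl mulr_ge0 // powR_ge0.
rewrite mul1r mulrBr expRD expRN /powR !gt_eqF // -expRN mulNr.
by rewrite lerDr.
Qed.

Lemma expR1_le4 : expR 1 <= 4 :> R.
Proof.
have h : 2^-1 <= expR (- 2^-1) :> R by have := expR_ge1Dx (- 2^-1 : R); lra.
have -> : 1 = 2^-1 + 2^-1 :> R by lra.
rewrite expRD; have h2 : expR 2^-1 <= 2 :> R.
  have hm : expR 2^-1 * expR (- 2^-1) = 1 :> R by rewrite -expRD subrr expR0.
  have := expR_gt0 (2^-1 : R); nra.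
have := expR_gt0 (2^-1 : R); nra.
Qed.

(* Jensen's inequality for the measure [chi P], in the form of the tangent line of [exp] at the mean. *)
Lemma exp_avgP (chi l : S2 R -> R) (b m : R) : meas chi -> meas l ->
  (forall x, 0 <= chi x <= 1) -> (forall x, 0 <= chi x * l x) -> 0 < b -> 0 < m ->
  Pint (fun x => chi x * l x) -> A chi <= m ->
  ((expR (b * A (fun x => chi x * l x)))%:E <=
   4%:E + ((4 * pi * m)^-1)%:E * \int[mu]_x (P x * (chi x * expR (b * m * l x)))%:E)%E.
Proof.
move=> mchi ml chi01 chil b0 m0 pl chim.
have mP : meas P by apply/measurable_EFinP; exact: measurable_int iP.
set a := A _; pose F x := P x * (chi x * expR (b * m * l x)).
have mF : meas F.
  apply: measurable_funM => //; apply: measurable_funM => //.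
  by apply: measurableT_comp => //; exact: measurable_funM.
have F0 x : 0 <= F x by rewrite !mulr_ge0 ?expR_ge0 //; have /andP[] := chi01 x.
have pm : 0 < 4 * pi * m :> R by rewrite !mulr_gt0 // pi_gt0.
have [Fy|Fn] := eqVneq (\int[mu]_x (F x)%:E)%E +oo%E.
  by rewrite Fy gt0_muley ?lte_fin ?invr_gt0 // addey // leey.
have iF : mu.-integrable setT (EFin \o F).
  apply/integrableP; split; first exact/measurable_EFinP.
  by under eq_integral do rewrite /= ger0_norm //; rewrite ltey.
have a0 : 0 <= a by apply: avgP_ge0.
have E : \int[mu]_x F x = 4 * pi * A (fun x => chi x * expR (b * m * l x)).
  by rewrite /avgP mulrA divff ?mul1r // gt_eqF // mulr_gt0 // pi_gt0.
rewrite (_ : (\int[mu]_x (F x)%:E)%E = (\int[mu]_x F x)%:E); last first.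
  by rewrite /Rintegral fineK //; exact: integrable_fin_num.
rewrite -EFinM -EFinD lee_fin E [(4 * pi * m)^-1]invfM mulrACA mulVf ?mul1r; last first.
  by rewrite gt_eqF // mulr_gt0 // pi_gt0.
have ex0 := expR_gt0 (b * a).
(* If b a < 1 the left side is at most e <= 4, which is where the constant 4 comes from. Otherwise 1
   - b a <= 0, and in the tangent line the total mass of chi may be replaced by its upper bound
   m. *)
have [ba1|ba1] := leP 1 (b * a); last first.
  have h1 : expR (b * a) <= 4.
    apply: (@le_trans _ _ (expR 1)); first by rewrite ler_expR ltW.
    exact: expR1_le4.
  apply: le_trans h1 _; rewrite lerDl mulr_ge0 //; first by rewrite invr_ge0 ltW.
  by apply: avgP_ge0 => x; rewrite mulr_ge0 ?expR_ge0 //; have /andP[] := chi01 x.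
apply: (@le_trans _ _ (m^-1 * A (fun x => chi x * expR (b * m * l x)))); last by rewrite lerDr.
rewrite ler_pdivlMl //.
have pchi : Pint chi by apply: (Pint_bdd (M := 1)) => // x; have /andP[? ?] := chi01 x; rewrite ger0_norm.
have p1 := PintZ (expR (b * a) * (1 - b * a)) pchi; have p2 := PintZ (expR (b * a) * (b * m)) pl.
apply: (@le_trans _ _ (A (fun x => expR (b * a) * (1 - b * a) * chi x + expR (b * a) * (b * m) * (chi x * l x)))).
  rewrite (avgPD p1 p2) (avgPZ _ pchi) (avgPZ _ pl) -/a mulrC -!mulrA -mulrDr ler_pM2l //.
  have : (1 - b * a) * m <= (1 - b * a) * A chi by rewrite ler_wnM2l // subr_le0.
  lra.
apply: (avgP_le (y := pole R)) => //; first exact: PintD.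
move=> x _; have /andP[c1 _] := chi01 x.
have -> : expR (b * a) * (1 - b * a) * chi x + expR (b * a) * (b * m) * (chi x * l x) =
  chi x * (expR (b * a) * (1 + (b * m * l x - b * a))) by ring.
rewrite ler_wpM2l // (_ : expR (b * m * l x) = expR (b * a) * expR (b * m * l x - b * a)); last first.
  by rewrite -expRD addrC subrK.
by rewrite ler_pM2l // expR_ge1Dx.
Qed.

Lemma measurable_avgP_lA (chi : S2 R -> S2 R -> R) (B : R) :
  measurable_fun setT (fun q : S2 R * S2 R => chi q.1 q.2) ->
  (forall x y, 0 <= chi x y * lA B (sd x y)) ->
  meas (fun y => A (fun x => chi x y * lA B (sd x y))).
Proof.
move=> mchi chil; have mP : meas P by apply/measurable_EFinP; exact: measurable_int iP.
apply: measurable_funM => //.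
pose H (q : S2 R * S2 R) : \bar R := (P q.1 * (chi q.1 q.2 * lA B (sd q.1 q.2)))%:E.
apply: (measurableT_comp (f := fine) (g := fubini_G mu H)) => //.
apply: measurable_fun_fubini_tonelli_G; last by move=> q; rewrite lee_fin mulr_ge0.
apply/measurable_EFinP; apply: measurable_funM; first exact: (measurableT_comp mP measurable_fst).
apply: measurable_funM => //.
exact: (measurableT_comp (measurable_lA B) (@measurable_sd2 R)).
Qed.

(** An inequality of Brezis-Merle type. After Jensen and Tonelli only the integral over y of (B /
    s)^(b m) on a cap remains, finite exactly because b m < 1. [iota] restricts y, and the mass
    bound on [chi] is needed only where [iota] does not vanish. *)
Lemma exp_avgP_integral (chi : S2 R -> S2 R -> R) (iota : S2 R -> R) (b m B V : R) :
  measurable_fun setT (fun q : S2 R * S2 R => chi q.1 q.2) -> meas iota ->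
  (forall x y, 0 <= chi x y <= 1) -> (forall y, 0 <= iota y <= 1) ->
  (forall x y, chi x y != 0 -> sd x y <= B) -> 0 < B <= 2 -> 0 < b -> 0 < m -> b * m < 1 ->
  (forall y, iota y != 0 -> A (chi^~ y) <= m) ->
  (\int[mu]_y (iota y)%:E <= V%:E)%E ->
  {ae mu, forall y, Pint (fun x => chi x y * lA B (sd x y))} ->
  (\int[mu]_y (iota y * expR (b * A (fun x => (chi x y * lA B (sd x y))%R)))%:E <=
    (4 * V + m^-1 * (2 * pi * B * (1 + (1 - b * m)^-1)))%:E)%E.
Proof.
move=> mchi miota chi01 iota01 chiB /andP[B0 B2] b0 m0 bm1 chim iV aeP.
have mP : meas P by apply/measurable_EFinP; exact: measurable_int iP.
have bm0 : 0 < b * m by rewrite mulr_gt0.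
pose F (q : S2 R * S2 R) : \bar R := (P q.1 * (chi q.1 q.2 * expR (b * m * lA B (sd q.1 q.2))))%:E.
have mP1 : measurable_fun setT (fun q : S2 R * S2 R => P q.1) by exact: (measurableT_comp mP measurable_fst).
have ml2 : measurable_fun setT (fun q : S2 R * S2 R => lA B (sd q.1 q.2)).
  exact: (measurableT_comp (measurable_lA B) (@measurable_sd2 R)).
have mF : measurable_fun setT F.
  apply/measurable_EFinP; apply: measurable_funM => //; apply: measurable_funM => //.
  by apply: measurableT_comp => //; exact: measurable_funM.
have chil x y : 0 <= chi x y * lA B (sd x y).
  have [->|c0'] := eqVneq (chi x y) 0; first by rewrite mul0r.
  by rewrite mulr_ge0 ?lA_ge0 ?chiB //; have /andP[] := chi01 x y.
have F0 q : (0 <= F q)%E.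
  by rewrite lee_fin !mulr_ge0 ?expR_ge0 //; have /andP[] := chi01 q.1 q.2.
have FE x y : F (x, y) = (P x * (chi x y * expR (b * m * lA B (sd x y))))%:E by [].
clearbody F.
have mchiy y : meas (chi^~ y) by apply: (measurableT_comp mchi (g := fun x => (x, y))); exact: measurable_pair2.
have mly y : meas (fun x => lA B (sd x y)) by apply: measurable_ksd; exact: measurable_lA.
have mA := measurable_avgP_lA mchi chil.
have mG : measurable_fun setT (fubini_G mu F) by exact: measurable_fun_fubini_tonelli_G.
have G0 y : (0 <= fubini_G mu F y)%E by apply: integral_ge0.
have k0 : 0 < (4 * pi * m)^-1 :> R by rewrite invr_gt0 !mulr_gt0 // pi_gt0.
apply: (@le_trans _ _ (\int[mu]_y (4%:E * (iota y)%:E + ((4 * pi * m)^-1)%:E * fubini_G mu F y))%E).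
  apply: ae_ge0_le_integral => //.
  - by move=> y _; rewrite lee_fin mulr_ge0 ?expR_ge0 //; have /andP[] := iota01 y.
  - apply/measurable_EFinP; apply: measurable_funM => //; apply: measurableT_comp => //.
    exact: measurable_funM.
  - by move=> y _; apply: adde_ge0; apply: mule_ge0; rewrite ?lee_fin ?(ltW k0) //; have /andP[] := iota01 y.
  - apply: emeasurable_funD; apply: measurable_funeM => //; exact/measurable_EFinP.
  apply: filterS aeP => y py _; have /andP[i0 i1] := iota01 y.
  have [iy|iy] := eqVneq (iota y) 0.
    by rewrite iy mul0r mule0 add0e mule_ge0 // lee_fin ltW.
  have := exp_avgP (mchiy y) (mly y) (chi01^~ y) (chil^~ y) b0 m0 py (chim y iy).
  rewrite EFinM => /(lee_wpmul2l (_ : 0%:E <= (iota y)%:E)%E) => /(_ _)/le_trans; apply.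
    by rewrite lee_fin.
  have GE : fubini_G mu F y = (\int[mu]_x (P x * (chi x y * expR (b * m * lA B (sd x y))))%:E)%E.
    by apply: eq_integral => x _; rewrite FE.
  have := G0 y; rewrite GE => Gy.
  have Hy : (0 <= ((4 * pi * m)^-1)%:E * \int[mu]_x (P x * (chi x y * expR (b * m * lA B (sd x y))))%:E)%E.
    by apply: mule_ge0 => //; rewrite lee_fin ltW.
  rewrite ge0_muleDr ?lee_fin //.
  rewrite muleC; apply: leeD => //.
  rewrite -[leRHS]mul1e; by apply: lee_wpmul2r => //; rewrite lee_fin.
rewrite ge0_integralD //; last 4 first.
- by move=> y _; rewrite mule_ge0 ?lee_fin //; have /andP[] := iota01 y.
- by apply: measurable_funeM; exact/measurable_EFinP.
- by move=> y _; apply: mule_ge0 => //; rewrite lee_fin ltW.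
- exact: measurable_funeM.
rewrite [leRHS]EFinD; apply: leeD.
  rewrite ge0_integralZl_EFin //; last 2 first.
  - by move=> y _; rewrite lee_fin; have /andP[] := iota01 y.
  - exact/measurable_EFinP.
  by rewrite EFinM lee_pmul2l ?lte_fin.
rewrite ge0_integralZl_EFin //; last by rewrite ltW.
have -> : (\int[mu]_y fubini_G mu F y = \int[mu]_x \int[mu]_y F (x, y))%E := esym (fubini_tonelli F mF F0).
pose C : R := 2 * pi * B * (1 + (1 - b * m)^-1).
have C0 : 0 <= C.
  rewrite /C !mulr_ge0 ?pi_ge0 ?(ltW B0) // addr_ge0 // invr_ge0; lra.
have h1 : (\int[mu]_x \int[mu]_y F (x, y) <= \int[mu]_x (C%:E * (P x)%:E))%E.
  apply: ge0_le_integral => //.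
  - by move=> x _; exact: integral_ge0.
  - by apply: (measurable_fun_fubini_tonelli_F (m2 := mu) F).
  - by apply: measurable_funeM; exact/measurable_EFinP.
  move=> x _.
  pose D y : \bar R := (((sd y x <= B)%R%:R)%:E + (B `^ (b * m))%:E * ((0 <= sd y x <= B)%R%:R * sd y x `^ (- (b * m)))%:E)%E.
  have mD1 : measurable_fun setT (fun y => ((sd y x <= B)%R%:R : R)%:E).
    apply/measurable_EFinP; apply: (eq_measurable_fun (fun y => (0 <= sd y x <= B)%R%:R : R)).
      by move=> y _; rewrite sd_ge0.
    by apply: (measurable_ksd x (K := fun s => (0 <= s <= B)%R%:R)); exact: measurable_bool_itv.
  have mD2 : measurable_fun setT (fun y => (((0 <= sd y x <= B)%R%:R * sd y x `^ (- (b * m))) : R)%:E).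
    apply/measurable_EFinP; apply: (measurable_ksd x (K := fun s => (0 <= s <= B)%R%:R * s `^ (- (b * m)))).
    by apply: measurable_funM; [exact: measurable_bool_itv|exact: measurable_powN].
  have D10 y : (0 <= ((sd y x <= B)%R%:R : R)%:E)%E by rewrite lee_fin ler0n.
  have D20 y : (0 <= (((0 <= sd y x <= B)%R%:R * sd y x `^ (- (b * m))) : R)%:E)%E.
    by rewrite lee_fin mulr_ge0 ?powR_ge0.
  apply: (@le_trans _ _ (\int[mu]_y ((P x)%:E * D y))%E).
    apply: ge0_le_integral => //.
    - by apply: (measurableT_comp mF (g := fun y => (x, y))); exact: measurable_pair1.
    - by apply: measurable_funeM; apply: emeasurable_funD => //; exact: measurable_funeM.
    move=> y _; have -> : ((P x)%:E * D y = (P x * ((sd y x <= B)%R%:R + B `^ (b * m) * ((0 <= sd y x <= B)%R%:R * sd y x `^ (- (b * m)))))%:E)%E by [].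
    rewrite FE lee_fin ler_wpM2l // sdC sd_ge0 /=.
    have [->|cn0] := eqVneq (chi x y) 0.
      by rewrite mul0r addr_ge0 // mulr_ge0 ?powR_ge0 // mulr_ge0 ?powR_ge0.
    have := chiB _ _ cn0; rewrite sdC => ->; rewrite mul1r.
    apply: le_trans (expR_lA (b * m) (sd y x) B0).
    by rewrite ler_piMl ?expR_ge0 //; have /andP[] := chi01 x y.
  rewrite ge0_integralZl_EFin //; last 2 first.
  - by move=> y _; rewrite adde_ge0 // mule_ge0 // lee_fin powR_ge0.
  - by apply: emeasurable_funD => //; exact: measurable_funeM.
  rewrite muleC; apply: lee_wpmul2r; first by rewrite lee_fin.
  rewrite /D ge0_integralD //; last 2 first.
  - by move=> y _; rewrite mule_ge0 // lee_fin powR_ge0.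
  - exact: measurable_funeM.
  rewrite zonal_vol ?B0 // ge0_integralZl_EFin ?powR_ge0 //.
  rewrite (_ : C = 2 * pi * B + 2 * pi * B * (1 - b * m)^-1); last by rewrite /C; ring.
  rewrite [leRHS]EFinD; apply: leeD => //.
  apply: (@le_trans _ _ ((B `^ (b * m))%:E * (2 * pi * (B `^ (1 - b * m) / (1 - b * m)))%:E)%E).
    by apply: lee_wpmul2l; [rewrite lee_fin powR_ge0|apply: zonal_pow; [rewrite bm0 bm1|rewrite B0 B2]].
  rewrite -EFinM lee_fin mulrCA -!mulrA ler_wpM2l // ler_wpM2l ?pi_ge0 // mulrCA mulrA.
  by rewrite -powRD; [rewrite subrK powRr1 // ltW|apply/implyP => _; rewrite gt_eqF].
apply: le_trans (lee_wpmul2l _ h1) _; first by rewrite lee_fin ltW.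
rewrite ge0_integralZl_EFin //; last 2 first.
- by move=> x _; rewrite lee_fin.
- exact/measurable_EFinP.
rewrite (_ : (\int[mu]_x (P x)%:E)%E = (4 * pi)%:E); last first.
  by rewrite -P4 /Rintegral fineK //; exact: integrable_fin_num.
rewrite -!EFinM lee_fin -/C [(4 * pi * m)^-1]invfM [C * _]mulrC mulrACA mulVf ?mul1r //.
by rewrite gt_eqF // mulr_gt0 // pi_gt0.
Qed.

Lemma exp_avgP_bound (chi : S2 R -> S2 R -> R) (iota f : S2 R -> R) (b m B V k : R) :
  measurable_fun setT (fun q : S2 R * S2 R => chi q.1 q.2) -> meas iota ->
  (forall x y, 0 <= chi x y <= 1) -> (forall y, 0 <= iota y <= 1) ->
  (forall x y, chi x y != 0 -> sd x y <= B) -> 0 < B <= 2 -> 0 < b -> 0 < m -> b * m < 1 ->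
  (forall y, iota y != 0 -> A (chi^~ y) <= m) ->
  (\int[mu]_y (iota y)%:E <= V%:E)%E ->
  {ae mu, forall y, Pint (fun x => chi x y * lA B (sd x y))} ->
  meas f -> (forall y, 0 <= f y) -> 0 <= k ->
  {ae mu, forall y, f y <= k * (iota y * expR (b * A (fun x => chi x y * lA B (sd x y))))} ->
  (\int[mu]_y (f y)%:E <= (k * (4 * V + m^-1 * (2 * pi * B * (1 + (1 - b * m)^-1))))%:E)%E.
Proof.
move=> mchi miota chi01 iota01 chiB B02 b0 m0 bm1 chim iV aeP mf f0 k0 fle.
have chil x y : 0 <= chi x y * lA B (sd x y).
  have [->|c0'] := eqVneq (chi x y) 0; first by rewrite mul0r.
  by rewrite mulr_ge0 ?lA_ge0 ?chiB //; have /andP[] := chi01 x y.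
have mA := measurable_avgP_lA mchi chil.
have H := exp_avgP_integral mchi miota chi01 iota01 chiB B02 b0 m0 bm1 chim iV aeP.
have mH : meas (fun y => iota y * expR (b * A (fun x => chi x y * lA B (sd x y)))).
  by apply: measurable_funM => //; apply: measurableT_comp => //; exact: measurable_funM.
have H0 y : 0 <= iota y * expR (b * A (fun x => chi x y * lA B (sd x y))).
  by rewrite mulr_ge0 ?expR_ge0 //; have /andP[] := iota01 y.
apply: (@le_trans _ _ (\int[mu]_y (k%:E * (iota y * expR (b * A (fun x => (chi x y * lA B (sd x y))%R)))%:E))%E).
  apply: ae_ge0_le_integral => //.
  - by move=> y _; rewrite lee_fin.
  - exact/measurable_EFinP.
  - by move=> y _; rewrite -EFinM lee_fin mulr_ge0.
  - by apply: measurable_funeM; exact/measurable_EFinP.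
  - by apply: filterS fle => y fy _; rewrite -EFinM lee_fin.
rewrite ge0_integralZl_EFin //; last 2 first.
- by move=> x _; rewrite lee_fin.
- exact/measurable_EFinP.
by rewrite [leRHS]EFinM; apply: lee_wpmul2l => //; rewrite lee_fin.
Qed.

End fixed_weight.
End weighted_average.

Ltac posR := repeat first [ exact: pi_gt0 | assumption | done | match goal with
  | |- is_true (0 < _ * _) => apply: mulr_gt0
  | |- is_true (0 < _^-1) => rewrite invr_gt0
  | |- is_true (0 < _ + _) => apply: addr_gt0
  | |- is_true (0 < _ ^+ _) => apply: exprn_gt0
  | |- is_true (0 < expR _) => exact: expR_gt0
  | |- is_true (0 <= _) => apply: ltW end ].

(** * Quantitative consequences of concentration *)

Section concentration.
Variable R : realType.
Implicit Types (f p w : S2 R -> R) (x y z : S2 R) (s : R).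
Local Notation mu := (@dv R).
Local Notation meas f := (measurable_fun [set: S2 R] f).
Local Notation Pint P f := (mu.-integrable setT (EFin \o (fun x => P x * f x))).

(** Everything about a solution that the bound on u uses, with g = |psi|^2, so that all constants
    depend on m1, M1, M2 and Lam alone. [sys_g2] expresses uniform integrability of g^2: up to a
    remainder of integral eta it is bounded by [Lam eta]. *)
Record sys (m1 M1 M2 : R) (Lam : R -> R) (u P g : S2 R -> R) (c : R) : Prop := Sys {
  sys_mu : meas u;
  sys_mg : meas g;
  sys_g0 : forall x, 0 <= g x;
  sys_iP : mu.-integrable setT (EFin \o P);
  sys_P0 : forall x, 0 <= P x;
  sys_P4 : \int[mu]_x P x = 4 * pi;
  sys_lo : forall x, m1 * expR (2 * u x) <= P x;
  sys_hi : forall x, P x <= M1 * expR (2 * u x) + M2 * (expR (u x) * g x);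
  sys_rep : {ae mu, forall y, Pint P (fun x => lA 2 (sd x y)) /\
    u y = c + avgP P (fun x => lA 2 (sd x y))};
  sys_cent : forall y, \int[mu]_x (expR (2 * u x) * sdot x y) = 0;
  sys_g2 : forall eta : R, 0 < eta -> exists r : S2 R -> R,
    [/\ mu.-integrable setT (EFin \o r), forall x, 0 <= r x, \int[mu]_x r x <= eta &
        forall x, g x ^+ 2 <= Lam eta + r x] }.

Variables (m1 M1 M2 : R) (Lam : R -> R).
Hypotheses (m10 : 0 < m1) (M10 : 0 < M1) (M20 : 0 < M2) (Lam0 : forall e, 0 <= Lam e).
Variables (u P g : S2 R -> R) (c : R).
Hypothesis S : sys m1 M1 M2 Lam u P g c.
Local Notation W := (fun x => expR (2 * u x)).

Let pi0 : 0 < pi :> R. Proof. exact: pi_gt0. Qed.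
Let iP := sys_iP S.
Let P0 := sys_P0 S.
Let P4 := sys_P4 S.
Definition ball_ind (y0 : S2 R) (a : R) x : R := (sd x y0 < a)%R%:R.
Definition coball_ind (y0 : S2 R) (a : R) x : R := (a <= sd x y0)%R%:R.

Lemma measurable_ball_ind y0 a : meas (ball_ind y0 a).
Proof. exact: (measurable_ksd y0 (measurable_lt_ind a)). Qed.

Lemma measurable_coball_ind y0 a : meas (coball_ind y0 a).
Proof. exact: (measurable_ksd y0 (measurable_ge_ind a)). Qed.

Lemma ball_ind01 y0 a x : 0 <= ball_ind y0 a x <= 1. Proof. exact: bool_le1. Qed.
Lemma coball_ind01 y0 a x : 0 <= coball_ind y0 a x <= 1. Proof. exact: bool_le1. Qed.

Lemma ball_vol y0 a : 0 < a <= 2 -> (\int[mu]_x (ball_ind y0 a x)%:E <= (2 * pi * a)%:E)%E.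
Proof.
move=> a02; rewrite -(zonal_vol y0 a02); apply: ge0_le_integral => //.
- by move=> x _; rewrite lee_fin ler0n.
- by apply/measurable_EFinP; exact: measurable_ball_ind.
- apply/measurable_EFinP; apply: (eq_measurable_fun (fun x => (0 <= sd x y0 <= a)%R%:R : R)).
    by move=> x _; rewrite sd_ge0.
  by apply: (measurable_ksd y0 (K := fun s => (0 <= s <= a)%R%:R)); exact: measurable_bool_itv.
- move=> x _; rewrite lee_fin ler_nat /ball_ind; case: ltP => // h; by rewrite (ltW h).
Qed.

Lemma meas_P : meas P.
Proof. by apply/measurable_EFinP; exact: measurable_int iP. Qed.

Lemma meas_W : meas W.
Proof. by apply: measurableT_comp => //; apply: measurable_funM => //; exact: sys_mu S. Qed.

Lemma W_ge0 x : 0 <= W x. Proof. exact: expR_ge0. Qed.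

Lemma W_sq x : W x = expR (u x) ^+ 2.
Proof. by rewrite expr2 -expRD; congr expR; ring. Qed.

Lemma integrable_le f h : meas f -> mu.-integrable setT (EFin \o h) ->
  (forall x, `|f x| <= h x) -> mu.-integrable setT (EFin \o f).
Proof.
move=> mf ih fh; apply: (le_integrable measurableT _ _ ih); first exact/measurable_EFinP.
by move=> x _; rewrite lee_fin (le_trans (fh x)) // ler_norm.
Qed.

Lemma ind_mul_le (b t : R) : 0 <= b <= 1 -> 0 <= t -> `|b * t| <= t.
Proof. by move=> /andP[b0 b1] t0; rewrite ger0_norm ?mulr_ge0 // ler_piMl. Qed.

Lemma iW : mu.-integrable setT (EFin \o W).
Proof.
apply: (integrable_le meas_W (h := fun x => m1^-1 * P x)).
  exact: (integrableZl measurableT _ iP).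
by move=> x; rewrite ger0_norm ?W_ge0 // ler_pdivlMl //; exact: sys_lo S x.
Qed.

Lemma int_W_le : \int[mu]_x W x <= 4 * pi / m1.
Proof.
rewrite ler_pdivlMr // mulrC -(RintegralZl _ measurableT iW) -P4; apply: le_Rintegral => //.
- exact: (integrableZl measurableT _ iW).
- by move=> x _; exact: sys_lo S x.
Qed.

Lemma ig2 : mu.-integrable setT (EFin \o (fun x => g x ^+ 2)).
Proof.
have [r [ir r0 _ gr]] := sys_g2 S (ltr01 : 0 < (1 : R)).
apply: (integrable_le _ (h := fun x => Lam 1 + r x)).
- by apply: measurable_funX; exact: sys_mg S.
- exact: (integrableD measurableT (Ck0_integrable (Ck_cst 0 (Lam 1))) ir).
- by move=> x; rewrite ger0_norm ?sqr_ge0.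
Qed.

Lemma int_ind_g2 (chi : S2 R -> R) eta V : meas chi -> (forall x, 0 <= chi x <= 1) -> 0 < eta ->
  (\int[mu]_x (chi x)%:E <= V%:E)%E ->
  \int[mu]_x (chi x * g x ^+ 2) <= Lam eta * V + eta.
Proof.
move=> mc c01 e0 cV; have [r [ir r0 re gr]] := sys_g2 S e0.
have ic : mu.-integrable setT (EFin \o chi).
  by apply: (bounded_integrable_dv (M := 1)) => // x; have /andP[? ?] := c01 x; rewrite ger0_norm.
have icV : \int[mu]_x chi x <= V.
  by rewrite -lee_fin /Rintegral fineK //; exact: integrable_fin_num.
have iLc : mu.-integrable setT (EFin \o (fun x => Lam eta * chi x)) by exact: (integrableZl measurableT _ ic).
apply: (@le_trans _ _ (\int[mu]_x (Lam eta * chi x + r x))).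
  apply: le_Rintegral => //.
  - apply: (integrable_le _ ig2); first by apply: measurable_funM => //; apply: measurable_funX; exact: sys_mg S.
    by move=> x; have /andP[? ?] := c01 x; apply: ind_mul_le; rewrite ?sqr_ge0 //; apply/andP.
  - exact: (integrableD measurableT iLc ir).
  - move=> x _; have /andP[c0 c1] := c01 x; have := gr x; have := r0 x; have := Lam0 eta.
    have : chi x * g x ^+ 2 <= chi x * (Lam eta + r x) by rewrite ler_wpM2l.
    have : chi x * r x <= r x by rewrite ler_piMl.
    lra.
rewrite (RintegralD measurableT iLc ir) (RintegralZl _ measurableT ic).
by apply: lerD => //; rewrite ler_wpM2l.
Qed.

(** Young's inequality e^u g <= (T/2) e^{2u} + g^2 / (2 T); T stays free, because each use gives up
    a different part of the mass. *)
Lemma int_ind_P (chi : S2 R -> R) (T : R) : meas chi -> (forall x, 0 <= chi x <= 1) -> 0 < T ->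
  \int[mu]_x (P x * chi x) <= (M1 + M2 * (T / 2)) * \int[mu]_x (chi x * W x) +
     M2 / (2 * T) * \int[mu]_x (chi x * g x ^+ 2).
Proof.
move=> mc c01 T0.
have ip : Pint P chi by apply: (Pint_bdd iP (M := 1)) => // x; have /andP[? ?] := c01 x; rewrite ger0_norm.
have i1 : mu.-integrable setT (EFin \o (fun x => chi x * W x)).
  apply: (integrable_le _ iW); first by apply: measurable_funM => //; exact: meas_W.
  by move=> x; have /andP[? ?] := c01 x; apply: ind_mul_le; rewrite ?W_ge0 //; apply/andP.
have i2 : mu.-integrable setT (EFin \o (fun x => chi x * g x ^+ 2)).
  apply: (integrable_le _ ig2); first by apply: measurable_funM => //; apply: measurable_funX; exact: sys_mg S.
  by move=> x; have /andP[? ?] := c01 x; apply: ind_mul_le; rewrite ?sqr_ge0 //; apply/andP.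
have j1 := integrableZl measurableT (M1 + M2 * (T / 2)) i1.
have j2 := integrableZl measurableT (M2 / (2 * T)) i2.
rewrite -(RintegralZl _ measurableT i1) -(RintegralZl _ measurableT i2) -(RintegralD measurableT j1 j2).
apply: le_Rintegral => //; first exact: (integrableD measurableT j1 j2).
move=> x _; have /andP[c0 c1] := c01 x.
have h : expR (u x) * g x <= T / 2 * W x + (2 * T)^-1 * g x ^+ 2.
  have T2 : 0 < 2 * T by rewrite mulr_gt0.
  rewrite W_sq -(ler_pM2l T2) [leRHS](_ : _ = T ^+ 2 * expR (u x) ^+ 2 + g x ^+ 2); last by field; rewrite gt_eqF.
  have := sqr_ge0 (T * expR (u x) - g x); nra.
rewrite [leRHS](_ : _ = (M1 * W x + M2 * (T / 2 * W x + (2 * T)^-1 * g x ^+ 2)) * chi x); last by ring.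
rewrite ler_wpM2r //; apply: le_trans (sys_hi S x) _.
by rewrite lerD2l ler_pM2l.
Qed.

Definition G2 : R := Lam 1 * (4 * pi) + 1.
(** From [int_ind_P] with chi = 1 and T = M2 G2 / (4 pi), for which the term in g is at most 2 pi,
    half of the total mass. *)
Definition W_low : R := 2 * pi / (M1 + M2 * (M2 * G2 / (4 * pi) / 2)).

Lemma G2_gt0 : 0 < G2.
Proof. by rewrite ltr_wpDl // mulr_ge0 // mulr_ge0 // ltW. Qed.

Lemma int_g2_le : \int[mu]_x (g x ^+ 2) <= G2.
Proof.
have := @int_ind_g2 (cst 1) 1 (4 * pi) (measurable_cst _) (fun _ => ltac:(by rewrite ler01 lexx)) ltr01.
rewrite (eq_RI (g := fun x => g x ^+ 2)); last by move=> x; rewrite mul1r.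
by apply; rewrite (eq_integral (cst 1%E)) // integral_cst //= dv_setT mul1e.
Qed.

Lemma W_low_gt0 : 0 < W_low.
Proof.
by rewrite divr_gt0 ?mulr_gt0 // addr_gt0 // !mulr_gt0 ?invr_gt0 ?mulr_gt0 // G2_gt0.
Qed.

Lemma int_W_ge : W_low <= \int[mu]_x W x.
Proof.
have g0 := G2_gt0; pose T := M2 * G2 / (4 * pi).
have T0 : 0 < T by rewrite divr_gt0 ?mulr_gt0.
have := @int_ind_P (cst 1) T (measurable_cst _) (fun _ => ltac:(by rewrite ler01 lexx)) T0.
rewrite (eq_RI (g := P)) ?P4; last by move=> x; rewrite mulr1.
rewrite [\int[mu]_x (cst 1 x * W x)](eq_RI (g := W)); last by move=> x; rewrite mul1r.
rewrite [\int[mu]_x (cst 1 x * g x ^+ 2)](eq_RI (g := fun x => g x ^+ 2)); last by move=> x; rewrite mul1r.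
have D0 : 0 < M1 + M2 * (T / 2) by rewrite addr_gt0 // mulr_gt0 // divr_gt0.
move=> H; rewrite ler_pdivrMr // mulrC.
have : M2 / (2 * T) * \int[mu]_x (g x ^+ 2) <= 2 * pi.
  have -> : 2 * pi = M2 / (2 * T) * G2.
    by rewrite /T; move: (pi : R) pi0 => w w0; field; rewrite !gt_eqF.
  by rewrite ler_wpM2l ?int_g2_le //; posR.
by rewrite -/T; lra.
Qed.

(** With this T the part of e^u g absorbed in e^{2u} is at most pi / 4. With eta = T pi / (4 M2) and
    this radius the two contributions of g^2 are at most pi / 8 each. A ball of mass above pi thus
    keeps pi / 2 for M1 e^{2u}. *)
Definition a1 : R :=
  let T := m1 / (8 * M2) in
  Num.min 1 (T / (16 * M2 * (Lam (T * pi / (4 * M2)) + 1))).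

Lemma a1_gt0 : 0 < a1.
Proof.
rewrite /a1 lt_min ltr01 /=.
by rewrite !divr_gt0 ?mulr_gt0 // ltr_wpDl.
Qed.

(* A ball of weighted mass at least [1/4] and small radius carries a definite part of [e^(2u)], because [g] is
   uniformly integrable. *)
Lemma ball_mass (a : R) y0 : 0 < a <= a1 -> 4^-1 < avgP P (ball_ind y0 (2 * a)) ->
  pi / (2 * M1) <= \int[mu]_x (ball_ind y0 (2 * a) x * W x).
Proof.
move=> /andP[a0 aa1] Hm; pose T := m1 / (8 * M2); pose eta := T * pi / (4 * M2).
have [a_1 a_2] : a <= 1 /\ a <= T / (16 * M2 * (Lam eta + 1)).
  by move: aa1; rewrite /a1 le_min => /andP[].
have T0 : 0 < T by rewrite divr_gt0 ?mulr_gt0.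
have eta0 : 0 < eta by rewrite /eta; posR.
have L0 : 0 < Lam eta + 1 by rewrite ltr_wpDl.
have mb := measurable_ball_ind y0 (2 * a); have b01 := ball_ind01 y0 (2 * a).
have a22 : 0 < 2 * a <= 2 by apply/andP; split; lra.
have H1 := int_ind_P mb b01 T0; have H2 := int_ind_g2 mb b01 eta0 (ball_vol y0 a22).
have HM : pi < \int[mu]_x (P x * ball_ind y0 (2 * a) x).
  by move: Hm; rewrite /avgP ltr_pdivlMl ?mulr_gt0 //; lra.
set IW := \int[mu]_x (ball_ind y0 (2 * a) x * W x) in H1 *.
have IWle : IW <= 4 * pi / m1.
  apply: le_trans int_W_le; apply: le_Rintegral => //; last first.
  - by move=> x _; have /andP[? ?] := b01 x; rewrite ler_piMl ?W_ge0.
  - exact: iW.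
  - apply: (integrable_le _ iW); first by apply: measurable_funM => //; exact: meas_W.
    by move=> x; have /andP[? ?] := b01 x; apply: ind_mul_le; rewrite ?W_ge0 //; apply/andP.
have t1 : M2 * (T / 2) * IW <= pi / 4.
  apply: (@le_trans _ _ (M2 * (T / 2) * (4 * pi / m1))).
    by rewrite ler_wpM2l //; posR.
  by rewrite /T le_eqVlt; apply/orP; left; apply/eqP; move: (pi : R) => w; field; rewrite !gt_eqF.
have t2 : M2 / (2 * T) * \int[mu]_x (ball_ind y0 (2 * a) x * g x ^+ 2) <= pi / 4.
  apply: (@le_trans _ _ (M2 / (2 * T) * (Lam eta * (2 * pi * (2 * a)) + eta))).
    by rewrite ler_wpM2l //; posR.
  have -> : M2 / (2 * T) * (Lam eta * (2 * pi * (2 * a)) + eta) = 2 * pi * M2 / T * (Lam eta * a) + pi / 8.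
    by move: (Lam eta) => LL; rewrite /eta; move: (pi : R) => w; field; rewrite !gt_eqF.
  have : 2 * pi * M2 / T * (Lam eta * a) <= pi / 8.
    apply: (@le_trans _ _ (2 * pi * M2 / T * ((Lam eta + 1) * (T / (16 * M2 * (Lam eta + 1)))))).
      rewrite ler_wpM2l //; first by posR.
      by apply: ler_pM => //; [exact: ltW|rewrite lerDl].
    by rewrite le_eqVlt; apply/orP; left; apply/eqP; move: (pi : R) => w; field; rewrite !gt_eqF.
  by lra.
rewrite ler_pdivrMr ?mulr_gt0 //.
by move: H1 HM t1 t2; lra.
Qed.

Lemma ln_le_mul (k s t : R) : 0 < k -> 0 < s -> s <= k * t -> ln s <= ln k + ln t.
Proof.
move=> k0 s0 st; have t0 : 0 < t by rewrite -(pmulr_rgt0 t k0) (lt_le_trans s0).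
by rewrite -lnM ?posrE // ler_ln ?posrE // mulr_gt0.
Qed.

Definition trunc (a s : R) : R := ln 2 - ln (Num.max s a).

Lemma measurable_trunc a : measurable_fun setT (trunc a).
Proof.
apply: measurable_funB => //; apply: (measurableT_comp (@measurable_ln R)).
exact: measurable_maxr.
Qed.

Lemma trunc_bound a s : 0 < a <= 2 -> s <= 2 -> 0 <= trunc a s <= ln 2 - ln a.
Proof.
move=> /andP[a0 a2] s2; have m0 : 0 < Num.max s a by rewrite lt_max a0 orbT.
rewrite /trunc subr_ge0 lerD2l lerN2 !ler_ln ?posrE //.
by rewrite ge_max s2 a2 le_max lexx orbT.
Qed.

Lemma Pint_trunc a y : 0 < a <= 2 -> Pint P (fun x => trunc a (sd x y)).
Proof.
move=> a02; apply: (Pint_bdd iP (M := ln 2 - ln a)).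
  by apply: measurable_ksd; exact: measurable_trunc.
by move=> x; have /andP[t0 t1] := trunc_bound a02 (sd_le2 x y); rewrite ger0_norm.
Qed.

(** The potential at y0 blurred at scale a; it is finite at every point and serves as a reference
    value for u near the ball. *)
Definition upot a y0 := avgP P (fun x => trunc a (sd x y0)).

Lemma Pint_cst (k : R) : Pint P (cst k).
Proof. exact: (Pint_bdd iP (M := `|k|)). Qed.

Lemma Pint_ball y a : Pint P (ball_ind y a).
Proof.
apply: (Pint_bdd iP (M := 1)); first exact: measurable_ball_ind.
by move=> x; have /andP[? ?] := ball_ind01 y a x; rewrite ger0_norm.
Qed.

Lemma measurable_ball_ind2 a : measurable_fun setT (fun q : S2 R * S2 R => ball_ind q.2 a q.1).
Proof. exact: (measurableT_comp (measurable_lt_ind a) (@measurable_sd2 R)). Qed.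

Lemma iWind (chi : S2 R -> R) : meas chi -> (forall x, 0 <= chi x <= 1) ->
  mu.-integrable setT (EFin \o (fun x => chi x * W x)).
Proof.
move=> mc c01; apply: (integrable_le _ iW); first by apply: measurable_funM => //; exact: meas_W.
by move=> x; apply: ind_mul_le; rewrite ?W_ge0.
Qed.

(** For y in the ball, the mass farther than a from y contributes at most [upot a y0] + ln 6, by
    [sd_quasi], whence 36 = 6^2. The mass nearer than a is at most a quarter, so its exponential is
    integrable with b = 2 and m = 1/4. *)
Lemma ball_W_le a y0 : 0 < a <= 1 -> (forall y, avgP P (ball_ind y a) <= 4^-1) ->
  \int[mu]_x (ball_ind y0 (2 * a) x * W x) <= 36 * expR (2 * c + 2 * upot a y0) * (40 * pi * a).
Proof.
move=> /andP[a0 a1'] Na; have a02 : 0 < a <= 2 by lra.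
have a22 : 0 < 2 * a <= 2 by lra.
have mi := measurable_ball_ind y0 (2 * a); have i01 := ball_ind01 y0 (2 * a).
rewrite -lee_fin /Rintegral fineK; last by apply: integrable_fin_num => //; exact: iWind.
have chiint : {ae mu, forall y, Pint P (fun x => ball_ind y a x * lA a (sd x y))}.
  have := sys_rep S; apply: filterS => y [py _]; apply: (integrable_le _ py).
    apply: measurable_funM; first exact: meas_P.
    apply: measurable_funM; first exact: measurable_ball_ind.
    by apply: measurable_ksd; exact: measurable_lA.
  move=> x; rewrite normrM (ger0_norm (P0 x)) ler_wpM2l // /ball_ind; have [sa|] := ltP (sd x y) a; last first.
    by rewrite mul0r normr0 lA_ge0 // sd_le2.
  rewrite mul1r ger0_norm; last by apply: lA_ge0; exact: ltW.
  rewrite /lA; have [sp|sp] := ltP 0 (sd x y); last by rewrite !mul0r.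
  by rewrite !mul1r lerD2r ler_ln ?posrE //; lra.
have K0 : 0 <= 36 * expR (2 * c + 2 * upot a y0) by rewrite mulr_ge0 // expR_ge0.
have := @exp_avgP_bound R P iP P0 P4 (fun x y => ball_ind y a x) (ball_ind y0 (2 * a))
  (fun x => ball_ind y0 (2 * a) x * W x) 2 4^-1 a (2 * pi * (2 * a)) (36 * expR (2 * c + 2 * upot a y0))
  (measurable_ball_ind2 a) mi (fun x y => ball_ind01 y a x) i01 _ a02 _ _ _ _ (ball_vol y0 a22) chiint _ _ K0.
have -> : 36 * expR (2 * c + 2 * upot a y0) * (4 * (2 * pi * (2 * a)) + 4^-1^-1 * (2 * pi * a * (1 + (1 - 2 * 4^-1)^-1))) =
   36 * expR (2 * c + 2 * upot a y0) * (40 * pi * a).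
  have -> : 1 - 2 * 4^-1 = 2^-1 :> R by lra.
  by rewrite !invrK; ring.
apply.
- by move=> x y; rewrite /ball_ind; case: ltP => [h _|_]; [exact: ltW|rewrite eqxx].
- by [].
- by rewrite invr_gt0.
- lra.
- by move=> y _; exact: Na.
- by apply: measurable_funM => //; exact: meas_W.
- by move=> y; have /andP[? ?] := i01 y; rewrite mulr_ge0 ?W_ge0.
have := sys_rep S; apply: filterS2 chiint => y pc [py uy].
have [iy|iy] := eqVneq (ball_ind y0 (2 * a) y) 0; first by rewrite iy !mul0r mulr0.
have sy : sd y y0 < 2 * a by move: iy; rewrite /ball_ind; case: ltP => //; rewrite eqxx.
rewrite mulrCA; apply: ler_wpM2l; first by have /andP[] := i01 y.
have ptr := Pint_trunc y0 a02.
have p1 : Pint P (fun x => trunc a (sd x y0) + cst (ln 6) x) by apply: PintD => //; exact: Pint_cst.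
have H : avgP P (fun x => lA 2 (sd x y)) <=
    avgP P (fun x => ball_ind y a x * lA a (sd x y)) + (upot a y0 + ln 6).
  rewrite -(avgP_cst iP P4 (ln 6)) /upot -(avgPD ptr (Pint_cst _)) -(avgPD pc p1).
  apply: (avgP_le P0 (y := y)) => //; first exact: PintD.
  move=> x s0; have sp : 0 < sd x y by rewrite lt_neqAle eq_sym s0 sd_ge0.
  have q := sd_quasi x y y0; rewrite /ball_ind /lA /trunc sp !mul1r /=.
  have m0 : 0 < Num.max (sd x y0) a by rewrite lt_max a0 orbT.
  have [sa|sa] := ltP (sd x y) a.
    have : ln (Num.max (sd x y0) a) <= ln 6 + ln a.
      by apply: ln_le_mul => //; rewrite ge_max; apply/andP; split; lra.
    by rewrite mul1r; lra.
  have : ln (Num.max (sd x y0) a) <= ln 6 + ln (sd x y).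
    by apply: ln_le_mul => //; rewrite ge_max; apply/andP; split; lra.
  by rewrite mul0r; lra.
have E36 : 36 = expR (2 * ln 6) :> R.
  by rewrite mulr_natl mulr2n expRD lnK ?posrE //; ring.
by rewrite E36 -!expRD ler_expR uy; lra.
Qed.

(** Area is 2 pi ds in the variable s = [sd], so the lower bound k / s is the critical one: it
    produces the logarithm of the ratio of the radii. *)
Lemma lower_W (k a b : R) y0 : 0 < a < b -> b <= 2 -> 0 <= k ->
  {ae mu, forall y, a <= sd y y0 <= b -> k * sd y y0 `^ (-1) <= W y} ->
  k * (2 * pi * ln (b / a)) <= \int[mu]_x W x.
Proof.
move=> ab b2 k0 kW; rewrite -lee_fin /Rintegral fineK; last by apply: integrable_fin_num => //; exact: iW.
rewrite EFinM -(zonal_inv y0 ab b2).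
have mf : measurable_fun setT (fun y => ((a <= sd y y0 <= b)%R%:R * sd y y0 `^ (-1))%:E : \bar R).
  apply/measurable_EFinP; apply: (measurable_ksd y0 (K := fun s => (a <= s <= b)%R%:R * s `^ (-1))).
  by apply: measurable_funM; [exact: measurable_bool_itv|exact: measurable_powN].
have f0 y : (0 <= ((a <= sd y y0 <= b)%R%:R * sd y y0 `^ (-1))%:E)%E by rewrite lee_fin mulr_ge0 ?powR_ge0.
rewrite -ge0_integralZl_EFin //; apply: ae_ge0_le_integral => //.
- by move=> y _; rewrite mule_ge0 // lee_fin.
- exact: measurable_funeM.
- by apply/measurable_EFinP; exact: meas_W.
apply: filterS kW => y kWy _; rewrite -EFinM lee_fin; case: (boolP (a <= sd y y0 <= b)) kWy => [_ /(_ isT)|_ _].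
  by rewrite mul1r.
by rewrite mul0r mulr0 W_ge0.
Qed.

(** Going from scale a out to s costs at most l = ln (s / a) times the mass of the large ball. With
    that mass at most 1/2 + 1/(2L) and l <= L this is at most l/2 + 1/2, so e^{2u} decays no faster
    than a / s. The number 64 is 4^2 times 4, the latter bounding e. For L large the conclusion
    contradicts the finite mass of e^{2u}. *)
Lemma annulus_lower (a L : R) y0 : 0 < a -> 0 < L -> expR L * a <= 2 ->
  avgP P (ball_ind y0 (expR L * a)) <= 2^-1 + (2 * L)^-1 ->
  expR (2 * c + 2 * upot a y0) * a / 64 * (2 * pi * L) <= \int[mu]_x W x.
Proof.
move=> a0 L0 Ra2 mR; have R1 : 1 < expR L by rewrite expR_gt1.
have aRa : 0 < a < expR L * a by rewrite a0 /= ltr_pMl.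
have a02 : 0 < a <= 2 by case/andP: aRa => _ ?; rewrite a0 /= (le_trans _ Ra2) // ltW.
have E0 := expR_gt0 (2 * c + 2 * upot a y0).
have := @lower_W (expR (2 * c + 2 * upot a y0) * a / 64) a (expR L * a) y0 aRa Ra2.
rewrite mulfK ?gt_eqF // expRK; apply; first by posR.
have := sys_rep S; apply: filterS => y [py uy] /andP[ay yR]; set s := sd y y0 in ay yR *.
have s0 : 0 < s by exact: lt_le_trans ay.
pose l := ln s - ln a.
have l0 : 0 <= l by rewrite subr_ge0 ler_ln ?posrE.
have lL : l <= L by rewrite lerBlDr -[L]expRK; apply: ln_le_mul => //; exact: expR_gt0.
have el : expR l = s / a by rewrite expRB !lnK ?posrE.
have ptr := Pint_trunc y0 a02.
pose b := ball_ind y0 (expR L * a); have pb : Pint P b := Pint_ball _ _.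
have pb1 : Pint P (fun x => - l * b x) by exact: PintZ.
have p4 : Pint P (fun x => - l * b x + cst (- ln 4) x) by apply: PintD => //; exact: Pint_cst.
have H : upot a y0 + (- l * avgP P b + - ln 4) <= avgP P (fun x => lA 2 (sd x y)).
  rewrite -(avgPZ (- l) pb) -(avgP_cst iP P4 (- ln 4)) -(avgPD pb1 (Pint_cst _)) /upot -(avgPD ptr p4).
  apply: (avgP_le P0 (y := y)) => //; first exact: PintD.
  move=> x sn0; have sp : 0 < sd x y by rewrite lt_neqAle eq_sym sn0 sd_ge0.
  have q := sd_quasi x y0 y; rewrite [sd y0 y]sdC -/s in q.
  rewrite /b /ball_ind /lA /trunc sp mul1r /=.
  have m0 : 0 < Num.max (sd x y0) a by rewrite lt_max a0 orbT.
  have mx : sd x y0 <= Num.max (sd x y0) a by rewrite le_max lexx.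
  have ma : a <= Num.max (sd x y0) a by rewrite le_max lexx orbT.
  have [sR|sR] := ltP (sd x y0) (expR L * a).
    have : ln (sd x y) <= ln (4 * (s / a)) + ln (Num.max (sd x y0) a).
      apply: ln_le_mul; rewrite ?mulr_gt0 ?invr_gt0 //.
      have h1 : s / a * a <= s / a * Num.max (sd x y0) a by rewrite ler_wpM2l // divr_ge0 // ltW.
      have h2 : 1 * Num.max (sd x y0) a <= s / a * Num.max (sd x y0) a.
        by rewrite ler_wpM2r ?(ltW m0) // ler_pdivlMr // mul1r.
      by rewrite divfK ?gt_eqF // in h1; lra.
    rewrite lnM ?posrE ?divr_gt0 // -el expRK mulr1; lra.
  have : ln (sd x y) <= ln 4 + ln (Num.max (sd x y0) a).
    by apply: ln_le_mul => //; lra.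
  by rewrite mulr0; lra.
have lm : l * avgP P b <= l / 2 + 2^-1.
  apply: (@le_trans _ _ (l * (2^-1 + (2 * L)^-1))); first by rewrite ler_wpM2l.
  rewrite mulrDr lerD2l invfM mulrCA ger_pMr ?invr_gt0 // ler_pdivrMr // mul1r //.
rewrite powR_inv1; last exact: ltW.
have h64 : expR (2 * c + 2 * upot a y0) <= W y * (16 * (s / a) * 4).
  apply: (@le_trans _ _ (W y * (expR (2 * ln 4) * expR l * expR 1))).
    by rewrite -!expRD ler_expR uy; lra.
  rewrite ler_wpM2l ?W_ge0 // el; apply: ler_pM; rewrite ?expR_ge0 ?expR1_le4 //.
    by rewrite mulr_ge0 ?expR_ge0 // divr_ge0 // ltW.
  by rewrite mulr_natl mulr2n expRD lnK ?posrE // -natrM.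
rewrite -[leLHS]mulrA -[leLHS]mulrA -ler_pdivlMr; last by posR.
apply: le_trans h64 _; rewrite le_eqVlt; apply/orP; left; apply/eqP.
by field; rewrite !gt_eqF.
Qed.

(** Each point x of the ball satisfies sd x y <= 4 s, so half of the mass already forces e^{2u} >=
    e^{2c} / (2 s) at distance s >= b; a very small b then forces e^{2c} to be small. *)
Lemma concentrated_c_upper (b : R) y0 : 0 < b < 2^-1 -> 2^-1 <= avgP P (ball_ind y0 b) ->
  expR (2 * c) / 2 * (2 * pi * ln (2^-1 / b)) <= \int[mu]_x W x.
Proof.
move=> b02 mb; apply: (lower_W (y0 := y0)) => //; first by lra.
have := sys_rep S; apply: filterS => y [py uy] /andP[ay yR]; set s := sd y y0 in ay yR *.
have s0 : 0 < s by apply: lt_le_trans ay; case/andP: b02.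
pose l := - ln (2 * s); have l0 : 0 <= l by rewrite oppr_ge0 ln_le0 //; lra.
pose h := ball_ind y0 b; have pb : Pint P h := Pint_ball _ _.
have H : l * avgP P h <= avgP P (fun x => lA 2 (sd x y)).
  rewrite -(avgPZ l pb); apply: (avgP_le P0 (y := y)) => //; first exact: PintZ.
  move=> x sn0; have sp : 0 < sd x y by rewrite lt_neqAle eq_sym sn0 sd_ge0.
  have q := sd_quasi x y0 y; rewrite [sd y0 y]sdC -/s in q.
  rewrite /h /ball_ind; case: ltP => sb; last by rewrite mulr0 lA_ge0 // sd_le2.
  have : ln (sd x y) <= ln 2 + ln (2 * s) by apply: ln_le_mul => //; lra.
  by rewrite /lA sp mulr1 mul1r /l; lra.
have lm : l / 2 <= l * avgP P h by rewrite ler_wpM2l.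
rewrite powR_inv1; last exact: ltW.
have el : expR l = (2 * s)^-1 by rewrite /l expRN lnK // posrE mulr_gt0.
apply: (@le_trans _ _ (expR (2 * c) * expR l)).
  by rewrite el invfM mulrA.
by rewrite -expRD ler_expR uy; lra.
Qed.

(** Less than half of the mass lies outside the ball, by 1/(2L), so e^{2u} is integrable against it
    with 1 - 2 m = 1/L. The ball itself is at distance at least 1/16 from y, and its contribution is
    at most ln 32. *)
Lemma concentrated_far (b L : R) y0 : 0 < b <= 16^-1 -> 1 < L -> 2^-1 + (2 * L)^-1 <= avgP P (ball_ind y0 b) ->
  \int[mu]_x (coball_ind y0 4^-1 x * W x) <=
    32 * 32 * expR (2 * c) * (16 * pi + (2^-1 - (2 * L)^-1)^-1 * (4 * pi * (1 + L))).
Proof.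
move=> /andP[b0 b16] L1 mb.
have L0 : 0 < L by lra.
have iL : (2 * L)^-1 < 2^-1 by rewrite ltf_pV2 ?posrE; lra.
have iL0 : 0 < (2 * L)^-1 by rewrite invr_gt0 mulr_gt0.
have mi := measurable_coball_ind y0 4^-1; have i01 := coball_ind01 y0 4^-1.
rewrite -lee_fin /Rintegral fineK; last by apply: integrable_fin_num => //; exact: iWind.
have mco2 : measurable_fun setT (fun q : S2 R * S2 R => coball_ind y0 b q.1).
  exact: (measurableT_comp (measurable_coball_ind y0 b) measurable_fst).
have chiint : {ae mu, forall y, Pint P (fun x => coball_ind y0 b x * lA 2 (sd x y))}.
  have := sys_rep S; apply: filterS => y [py _]; apply: (integrable_le _ py).
    apply: measurable_funM; first exact: meas_P.
    apply: measurable_funM; first exact: measurable_coball_ind.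
    by apply: measurable_ksd; exact: measurable_lA.
  move=> x; rewrite normrM (ger0_norm (P0 x)) ler_wpM2l //; apply: ind_mul_le; first exact: coball_ind01.
  by rewrite lA_ge0 // sd_le2.
have K0 : 0 <= 32 * 32 * expR (2 * c) by rewrite !mulr_ge0 ?ler0n ?expR_ge0.
have V4 : (\int[mu]_y (coball_ind y0 4^-1 y)%:E <= (4 * pi)%:E)%E.
  have -> : ((4 * pi)%:E = \int[mu]_y (cst 1 y))%E by rewrite integral_cst //= dv_setT mul1e.
  apply: ge0_le_integral => //.
  - by move=> y _; rewrite lee_fin; have /andP[] := i01 y.
  - exact/measurable_EFinP.
  - by move=> y _; rewrite lee_fin; have /andP[] := i01 y.
have m1' : avgP P (coball_ind y0 b) <= 2^-1 - (2 * L)^-1.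
  have pco : Pint P (coball_ind y0 b).
    apply: (Pint_bdd iP (M := 1)); first exact: measurable_coball_ind.
    by move=> x; have /andP[? ?] := coball_ind01 y0 b x; rewrite ger0_norm.
  have := avgP_cst iP P4 1; rewrite (_ : cst 1 = (fun x => ball_ind y0 b x + coball_ind y0 b x)); last first.
    by apply/funext => x; rewrite /ball_ind /coball_ind; case: ltP => _; rewrite /= ?addr0 ?add0r.
  rewrite (avgPD (Pint_ball y0 b) pco); lra.
have b22 : 0 < (2 : R) <= 2 by lra.
have := @exp_avgP_bound R P iP P0 P4 (fun x y => coball_ind y0 b x) (coball_ind y0 4^-1)
  (fun x => coball_ind y0 4^-1 x * W x) 2 (2^-1 - (2 * L)^-1) 2 (4 * pi) (32 * 32 * expR (2 * c))
  mco2 mi (fun x y => coball_ind01 y0 b x) i01 (fun x y _ => sd_le2 x y) b22 _ _ _ _ V4 chiint _ _ K0.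
have -> : 32 * 32 * expR (2 * c) * (4 * (4 * pi) + (2^-1 - (2 * L)^-1)^-1 * (2 * pi * 2 * (1 + (1 - 2 * (2^-1 - (2 * L)^-1))^-1))) =
   32 * 32 * expR (2 * c) * (16 * pi + (2^-1 - (2 * L)^-1)^-1 * (4 * pi * (1 + L))).
  have -> : 1 - 2 * (2^-1 - (2 * L)^-1) = L^-1 by rewrite invfM; lra.
  by rewrite invrK; ring.
apply.
- by [].
- lra.
- lra.
- by move=> y _.
- by apply: measurable_funM => //; exact: meas_W.
- by move=> y; have /andP[? ?] := i01 y; rewrite mulr_ge0 ?W_ge0.
have := sys_rep S; apply: filterS2 chiint => y pc [py uy].
have [iy|iy] := eqVneq (coball_ind y0 4^-1 y) 0; first by rewrite iy !mul0r mulr0.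
have sy : 4^-1 <= sd y y0 by move: iy; rewrite /coball_ind; case: leP => //; rewrite eqxx.
rewrite mulrCA; apply: ler_wpM2l; first by have /andP[] := i01 y.
have H : avgP P (fun x => lA 2 (sd x y)) <= avgP P (fun x => coball_ind y0 b x * lA 2 (sd x y)) + ln 32.
  rewrite -(avgP_cst iP P4 (ln 32)) -(avgPD pc (Pint_cst _)).
  apply: (avgP_le P0 (y := y)) => //; first by apply: PintD => //; exact: Pint_cst.
  move=> x s0; have sp : 0 < sd x y by rewrite lt_neqAle eq_sym s0 sd_ge0.
  have q := sd_quasi y x y0; rewrite [sd y x]sdC in q.
  have l32 : 0 <= ln 32 :> R by rewrite ln_ge0 // ler1n.
  rewrite /coball_ind; have [sb|sb] := leP b (sd x y0); first by rewrite mul1r lerDl.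
  have : ln 2 <= ln 32 + ln (sd x y) by apply: ln_le_mul => //; lra.
  by rewrite /lA sp mul1r mul0r /=; lra.
have E36 : 32 * 32 = expR (2 * ln 32) :> R.
  by rewrite [2 * _]mulr_natl mulr2n expRD lnK // posrE ltr0n.
by rewrite E36 -!expRD ler_expR uy; lra.
Qed.

Lemma centered_far y0 : \int[mu]_x W x <= 3 * \int[mu]_x (coball_ind y0 4^-1 x * W x).
Proof.
have iw := iWind (measurable_coball_ind y0 4^-1) (coball_ind01 y0 4^-1).
have is1 : mu.-integrable setT (EFin \o (fun x => W x * sdot x y0)).
  apply: (integrable_mul_bdd iW (measurable_sdot y0) (M := 1)).
  by move=> x; have := sdot_bound x y0; rewrite ler_norml.
have i3 := integrableZl measurableT (3 / 4) iW; have i7 := integrableZl measurableT (7 / 4) iw.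
(* Pointwise x.y0 is at least 3/4 near y0 and at least -1 elsewhere. Integrated against e^{2u} with
   zero centre of mass this gives the factor 7/3, rounded up to 3. *)
have : \int[mu]_x (3 / 4 * W x - 7 / 4 * (coball_ind y0 4^-1 x * W x)) <= \int[mu]_x (W x * sdot x y0).
  apply: le_Rintegral => //; first exact: (integrableB measurableT i3 i7).
  move=> x _; have w0 := W_ge0 x; have /andP[h1 h2] := sdot_bound x y0; rewrite /coball_ind /sd.
  have [h|h] := leP 4^-1 (1 - sdot x y0).
    have := mulr_ge0 w0 (_ : 0 <= 1 + sdot x y0); rewrite mul1r => /(_ ltac:(lra)); lra.
  have := mulr_ge0 w0 (_ : 0 <= sdot x y0 - 3 / 4); rewrite mul0r => /(_ ltac:(lra)); lra.
rewrite (sys_cent S) (RintegralB measurableT i3 i7) (RintegralZl _ measurableT iW) (RintegralZl _ measurableT iw).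
have : 0 <= \int[mu]_x (coball_ind y0 4^-1 x * W x).
  by apply: Rintegral_ge0 => x _; rewrite mulr_ge0 ?W_ge0 //; have /andP[] := coball_ind01 y0 4^-1 x.
by lra.
Qed.

End concentration.

(** * Uniform nonconcentration and the bound on u *)

Section compactness.
Variable R : realType.
Implicit Types (f p w : S2 R -> R) (x y z : S2 R) (s : R).
Local Notation mu := (@dv R).
Local Notation meas f := (measurable_fun [set: S2 R] f).
Local Notation Pint P f := (mu.-integrable setT (EFin \o (fun x => P x * f x))).

Variables (m1 M1 M2 : R) (Lam : R -> R).
Hypotheses (m10 : 0 < m1) (M10 : 0 < M1) (M20 : 0 < M2) (Lam0 : forall e, 0 <= Lam e).
Local Notation sys := (sys m1 M1 M2 Lam).

Let pi0 : 0 < pi :> R. Proof. exact: pi_gt0. Qed.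

Definition noncon (P : S2 R -> R) (a : R) := forall y, avgP P (ball_ind y a) <= 4^-1.

(** Suppose some ball of radius 2 a has more than a quarter of the mass, while none of radius a has.
    The mass near that ball then bounds [Ea] below, the annulus forces more than half of the mass
    into radius e^L a, the centring condition bounds e^{2c} below, and [concentrated_c_upper] is
    violated when a is small. *)
Lemma noncon_double : exists2 abar : R, 0 < abar <= 1 & forall u P g c, sys u P g c ->
  forall a, 0 < a <= abar -> noncon P a -> noncon P (2 * a).
Proof.
(* k0 is the lower bound of [Ea] obtained by comparing [ball_mass] with [ball_W_le]. L exceeds the
   value 128 / (m1 k0) that [annulus_lower] would tolerate, c3 is the resulting lower bound of
   e^{2c}, and K exceeds the value 4 / (m1 c3) that [concentrated_c_upper] would tolerate. *)
pose k0 : R := (2 * (36 * 40) * M1)^-1; have k00 : 0 < k0 by rewrite invr_gt0 !mulr_gt0 // ltr0n.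
pose L : R := 128 / (m1 * k0) + 2.
have L2 : 2 < L by rewrite ltrDr divr_gt0 ?ltr0n // mulr_gt0.
have L1 : 1 < L by lra.
have L0 : 0 < L by lra.
have iL : (2 * L)^-1 < 2^-1 by rewrite ltf_pV2 ?posrE; lra.
pose C6 : R := 16 * pi + (2^-1 - (2 * L)^-1)^-1 * (4 * pi * (1 + L)).
have C60 : 0 < C6.
  rewrite addr_gt0 ?mulr_gt0 ?invr_gt0 ?subr_gt0 //; lra.
pose c3 : R := W_low M1 M2 Lam / (3 * (32 * 32 * C6)).
have c30 : 0 < c3 by rewrite divr_gt0 ?W_low_gt0 // ?mulr_gt0.
pose K : R := 4 / (m1 * c3) + 1.
have R0 : 0 < expR L := expR_gt0 _.
have a10 := a1_gt0 m10 M20 Lam0.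
pose abar : R := Num.min (a1 m1 M2 Lam) (Num.min 16^-1 (expR (- K) / 2) / expR L).
have b0 : 0 < Num.min 16^-1 (expR (- K) / 2) :> R.
  by rewrite lt_min invr_gt0 ltr0n /= divr_gt0 // expR_gt0.
have ab0 : 0 < abar by rewrite lt_min a10 /= divr_gt0.
exists abar; first by rewrite ab0 /= ge_min /a1 ge_min lexx.
move=> u P g c S a /andP[a0 aab] Na y0; rewrite leNgt; apply/negP => conc.
have aa1 : 0 < a <= a1 m1 M2 Lam by rewrite a0 (le_trans aab) // ge_min lexx.
have aR : expR L * a <= Num.min 16^-1 (expR (- K) / 2).
  by rewrite mulrC -ler_pdivlMr // (le_trans aab) // ge_min lexx orbT.
move: aR; rewrite le_min => /andP[aR16 aRK].
have a1' : 0 < a <= 1 by rewrite a0 (le_trans aab) // ge_min /a1 ge_min lexx.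
have mass := ball_mass m10 M10 M20 Lam0 S aa1 conc.
have up := ball_W_le m10 S y0 a1' Na.
pose Ea := expR (2 * c + 2 * upot P a y0) * a.
have kE : k0 <= Ea.
  have : pi / (2 * M1) <= 36 * 40 * pi * Ea.
    by rewrite (le_trans mass) // (le_trans up) // /Ea le_eqVlt; apply/orP; left; apply/eqP; ring.
  rewrite ler_pdivrMr ?mulr_gt0 // => h.
  rewrite -[k0]mul1r ler_pdivrMr ?mulr_gt0 ?ltr0n // -(ler_pM2l pi0) mulr1 (le_trans h) //.
  by rewrite le_eqVlt; apply/orP; left; apply/eqP; ring.
have Wu := int_W_le m10 S.
have mb : 2^-1 + (2 * L)^-1 <= avgP P (ball_ind y0 (expR L * a)).
  rewrite leNgt; apply/negP => mlt.
  have h2 : expR L * a <= 2 by rewrite (le_trans aR16) //; lra.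
  have := annulus_lower m10 S a0 L0 h2 (ltW mlt); rewrite -/Ea => low.
  have : k0 / 64 * (2 * pi * L) <= 4 * pi / m1.
    apply: le_trans Wu; apply: le_trans low; rewrite ler_pM2r ?mulr_gt0 // ler_pM2r //.
  rewrite ler_pdivlMr // (_ : _ * m1 = pi / 32 * (m1 * k0 * L)); last by field.
  rewrite /L mulrDr mulrCA divff ?mulr1; last by rewrite gt_eqF // mulr_gt0.
  have := mulr_gt0 pi0 (mulr_gt0 m10 k00); move: (m1 * k0) => q; nra.
have b16 : 0 < expR L * a <= 16^-1 by rewrite mulr_gt0.
have far := concentrated_far m10 S b16 L1 mb.
have cen := centered_far m10 S y0; have Wl := int_W_ge m10 M10 M20 Lam0 S.
have c3c : c3 <= expR (2 * c).
  rewrite /c3 ler_pdivrMr ?mulr_gt0 //; apply: le_trans Wl _; apply: le_trans cen _.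
  by rewrite mulrCA ler_pM2l // (le_trans far) // -/C6 le_eqVlt; apply/orP; left; apply/eqP; ring.
have bh : 0 < expR L * a < 2^-1 by case/andP: b16 => -> ?; lra.
have mb2 : 2^-1 <= avgP P (ball_ind y0 (expR L * a)).
  by apply: le_trans mb; rewrite lerDl invr_ge0 mulr_ge0 // ltW.
have := concentrated_c_upper m10 S bh mb2 => cu.
have lK : K <= ln (2^-1 / (expR L * a)).
  rewrite -[K]expRK ler_ln ?posrE ?expR_gt0 ?divr_gt0 ?mulr_gt0 //.
  rewrite ler_pdivlMr ?mulr_gt0 // -[K]opprK expRN mulrC -ler_pdivlMr ?invr_gt0 ?expR_gt0 // invrK mulrC.
  by rewrite mulrC [leRHS]mulrC; exact: aRK.
have : c3 / 2 * (2 * pi * K) <= 4 * pi / m1.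
  apply: le_trans Wu; apply: le_trans cu; apply: ler_pM.
  - by rewrite divr_ge0 // ltW.
  - by rewrite mulr_ge0 // ?mulr_ge0 // ?ltW // addr_gt0 // divr_gt0 // mulr_gt0.
  - by rewrite ler_pM2r.
  - by rewrite ler_pM2l // mulr_gt0.
rewrite ler_pdivlMr // (_ : _ * m1 = pi * (m1 * c3 * K)); last by field.
rewrite /K mulrDr mulrCA divff ?mulr1; last by rewrite gt_eqF // mulr_gt0.
have := mulr_gt0 pi0 (mulr_gt0 m10 c30); move: (m1 * c3) => q; nra.
Qed.

(** The part of P above a level n has mass at most pi / 2 by integrability, and the part below
    contributes at most 2 pi n a, again at most pi / 2 when a <= 2^-(n+2). The scale depends on P,
    and this is why it must be doubled afterwards. *)
Lemma noncon_start u P g c b : sys u P g c -> 0 < b <= 1 -> exists k, noncon P (b / 2 ^+ k).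
Proof.
move=> S /andP[b0 b1]; have iP := sys_iP S; have P0 := sys_P0 S.
have mP : meas P by apply/measurable_EFinP; exact: measurable_int iP.
have mg n : meas (fun x => P x * (n%:R < P x)%R%:R).
  by apply: measurable_funM => //; apply: (measurableT_comp (measurable_gt_ind n%:R)).
have p2 : 0 < pi / 2 :> R by rewrite divr_gt0.
have gP n x : 0 <= P x * (n%:R < P x)%R%:R <= P x.
  by case: (_ < _); rewrite ?mulr1 ?mulr0 ?lexx ?P0.
have [n Hn] : exists n, (\int[mu]_x (P x * (n%:R < P x)%R%:R)%:E <= (pi / 2)%:E)%E.
  apply: (dominated_small p2 mg iP gP) => x; apply: cvg_near_cst.
  exists (Num.trunc (P x)).+1 => // n /= nP.
  have Pn : P x <= n%:R by rewrite (le_trans (ltW (truncnS_gt _))) // ler_nat.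
  by rewrite ltNge Pn mulr0.
exists n.+2 => y; set a := b / 2 ^+ n.+2.
have a0 : 0 < a by rewrite divr_gt0 // exprn_gt0.
have an : 4 * n%:R * a <= 1.
  rewrite /a mulrA ler_pdivrMr ?exprn_gt0 // mul1r -natrX -[leRHS]mulr1.
  have nn : (4 * n <= 2 ^ n.+2)%N by rewrite !expnS mulnA leq_mul // ltnW // ltn_expl.
  by apply: ler_pM; rewrite ?(ltW b0) // -?natrM ?ler_nat // ler0n.
have a2 : 0 < a <= 2.
  rewrite a0 /= ler_pdivrMr ?exprn_gt0 // -natrX -natrM.
  by rewrite (le_trans b1) // ler1n muln_gt0 expn_gt0.
have mb := measurable_ball_ind y a; have b01 := ball_ind01 y a.
have ig : mu.-integrable setT (EFin \o (fun x => P x * (n%:R < P x)%R%:R)).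
  by apply: (integrable_le (mg n) iP) => x; have /andP[? ?] := gP n x; rewrite ger0_norm.
have ic : mu.-integrable setT (EFin \o ball_ind y a).
  by apply: (bounded_integrable_dv (M := 1)) => // x; have /andP[? ?] := b01 x; rewrite ger0_norm.
have icn : mu.-integrable setT (EFin \o (fun x => n%:R * ball_ind y a x)) by exact: (integrableZl measurableT _ ic).
have iPb : Pint P (ball_ind y a).
  by apply: (Pint_bdd iP (M := 1)) => // x; have /andP[? ?] := b01 x; rewrite ger0_norm.
have icV : \int[mu]_x ball_ind y a x <= 2 * pi * a.
  by rewrite -lee_fin /Rintegral fineK; [exact: ball_vol|exact: integrable_fin_num].
have igV : \int[mu]_x (P x * (n%:R < P x)%R%:R) <= pi / 2.
  by rewrite -lee_fin /Rintegral fineK //; exact: integrable_fin_num.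
have H : \int[mu]_x (P x * ball_ind y a x) <= \int[mu]_x (P x * (n%:R < P x)%R%:R + n%:R * ball_ind y a x).
  apply: le_Rintegral => //; first exact: (integrableD measurableT ig icn).
  move=> x _; have /andP[c0 c1] := b01 x; have Px := P0 x.
  case: (ltP n%:R (P x)) => Pn.
    by rewrite mulr1 (le_trans (ler_piMr _ c1)) // lerDl mulr_ge0.
  by rewrite mulr0 add0r ler_wpM2r.
rewrite /avgP ler_pdivrMl ?mulr_gt0 //; apply: le_trans H _.
rewrite (RintegralD measurableT ig icn) (RintegralZl _ measurableT ic).
have : n%:R * \int[mu]_x ball_ind y a x <= n%:R * (2 * pi * a) by rewrite ler_wpM2l.
have : pi * (4 * n%:R * a) <= pi * 1 by rewrite ler_pM2l.
lra.
Qed.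

(** Starting at abar / 2^k, k doublings lead back to the common scale [abar]. *)
Lemma noncon_uniform : exists2 a : R, 0 < a <= 1 & forall u P g c, sys u P g c -> noncon P a.
Proof.
have [abar a01 H] := noncon_double; exists abar => // u P g c S.
have [k] := noncon_start S a01; elim: k => [|k IH]; first by rewrite expr0 divr1.
move=> Nk; apply: IH; have /andP[a0 a1'] := a01.
have := H _ _ _ _ S (abar / 2 ^+ k.+1) _ Nk; rewrite (_ : 2 * (abar / 2 ^+ k.+1) = abar / 2 ^+ k); last first.
  by rewrite exprS invfM mulrCA [2 * _]mulrA mulfV ?mul1r // pnatr_eq0.
apply; rewrite divr_gt0 ?exprn_gt0 //= ler_pdivrMr ?exprn_gt0 //.
by rewrite ler_peMr ?(ltW a0) // exprn_ege1 // ler1n.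
Qed.

Lemma sys_u_ge u P g c : sys u P g c -> {ae mu, forall y, c <= u y}.
Proof.
move=> S; have := sys_rep S; apply: filterS => y [_ ->]; rewrite lerDl.
by apply: (avgP_ge0 (sys_P0 S)) => x; rewrite lA_ge0 // sd_le2.
Qed.

Lemma sys_c_upper u P g c : sys u P g c -> expR (2 * c) <= m1^-1.
Proof.
move=> S; have W4 := int_W_le m10 S; have iw := iW m10 S.
have : expR (2 * c) * (4 * pi) <= \int[mu]_x expR (2 * u x).
  have E : (\int[mu]_x expR (2 * u x))%:E = (\int[mu]_x (expR (2 * u x))%:E)%E.
    by rewrite /Rintegral fineK //; exact: integrable_fin_num.
  rewrite -lee_fin E.
  have -> : ((expR (2 * c) * (4 * pi))%:E = \int[mu]_y (cst (expR (2 * c))%:E y))%E.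
    by rewrite integral_cst //= dv_setT EFinM.
  apply: ae_ge0_le_integral => //.
  - by move=> y _; rewrite lee_fin expR_ge0.
  - exact: measurable_int iw.
  - by have := sys_u_ge S; apply: filterS => y cu _; rewrite lee_fin ler_expR; lra.
move=> h; have := le_trans h W4; rewrite [leRHS]mulrC ler_pM2r // mulr_gt0 //.
Qed.

(** Mass farther than a contributes at most ln (2 / a); mass nearer is at most a quarter, and 3
    times 1/4 is below 1. An exponent above 2 is what the bound on the potential of e^{2u} needs. *)
Lemma sys_exp3 : exists2 C : R, 0 <= C & forall u P g c, sys u P g c ->
  (\int[mu]_y (expR (3 * u y))%:E <= C%:E)%E.
Proof.
have [a /andP[a0 a1'] Ha] := noncon_uniform.
pose k : R := expR (3 * (- ln m1 / 2) + 3 * (ln 2 - ln a)).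
exists (k * (4 * (4 * pi) + 4^-1^-1 * (2 * pi * 2 * (1 + (1 - 3 * 4^-1)^-1)))).
  rewrite mulr_ge0 ?expR_ge0 // addr_ge0 ?mulr_ge0 ?pi_ge0 ?invr_ge0 // addr_ge0 // invr_ge0; lra.
move=> u P g c S; have iP := sys_iP S; have P0 := sys_P0 S; have P4 := sys_P4 S.
have Na := Ha _ _ _ _ S.
have mb2 : measurable_fun setT (fun q : S2 R * S2 R => ball_ind q.2 a q.1).
  exact: (measurableT_comp (measurable_lt_ind a) (@measurable_sd2 R)).
have chiint : {ae mu, forall y, Pint P (fun x => ball_ind y a x * lA 2 (sd x y))}.
  have := sys_rep S; apply: filterS => y [py _]; apply: (integrable_le _ py).
    apply: measurable_funM; first by apply/measurable_EFinP; exact: measurable_int iP.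
    apply: measurable_funM; first exact: measurable_ball_ind.
    by apply: measurable_ksd; exact: measurable_lA.
  move=> x; rewrite normrM (ger0_norm (P0 x)) ler_wpM2l //; apply: ind_mul_le; first exact: ball_ind01.
  by rewrite lA_ge0 // sd_le2.
have V4 : (\int[mu]_y (cst 1 y)%:E <= (4 * pi)%:E)%E.
  by rewrite (eq_integral (cst 1%E)) // integral_cst //= dv_setT mul1e.
have b22 : 0 < (2 : R) <= 2 by lra.
have c01 y : 0 <= (cst 1 y : R) <= 1 by rewrite ler01 lexx.
have := @exp_avgP_bound R P iP P0 P4 (fun x y => ball_ind y a x) (cst 1)
  (fun y => expR (3 * u y)) 3 4^-1 2 (4 * pi) k
  mb2 (measurable_cst _) (fun x y => ball_ind01 y a x) c01 (fun x y _ => sd_le2 x y) b22 _ _ _ _ V4 chiint _ _ (expR_ge0 _).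
apply.
- by rewrite ltr0n.
- by rewrite invr_gt0 ltr0n.
- lra.
- by move=> y _; exact: Na.
- by apply: measurableT_comp => //; apply: measurable_funM => //; exact: sys_mu S.
- by move=> y; exact: expR_ge0.
have := sys_rep S; apply: filterS2 chiint => y pc [py uy]; rewrite mul1r.
have pk : Pint P (cst (ln 2 - ln a)) by exact: (Pint_bdd iP (M := `|ln 2 - ln a|)).
have H : avgP P (fun x => lA 2 (sd x y)) <= avgP P (fun x => ball_ind y a x * lA 2 (sd x y)) + (ln 2 - ln a).
  rewrite -(avgP_cst iP P4 (ln 2 - ln a)) -(avgPD pc pk).
  apply: (avgP_le P0 (y := y)) => //; first exact: PintD.
  move=> x s0; have sp : 0 < sd x y by rewrite lt_neqAle eq_sym s0 sd_ge0.
  have la : 0 <= ln 2 - ln a by rewrite subr_ge0 ler_ln ?posrE //; lra.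
  rewrite /ball_ind; case: (ltP (sd x y) a) => sa; first by rewrite mul1r lerDl.
  by rewrite mul0r add0r /lA sp mul1r lerD2l lerN2 ler_ln ?posrE.
have cm : 2 * c <= - ln m1.
  by rewrite -ler_expR (le_trans (sys_c_upper S)) // expRN lnK.
by rewrite /k -expRD ler_expR uy; lra.
Qed.

(** ln r <= r at r = (2 / s)^(1/12); its sixth power is of order s^(-1/2), which is integrable. *)
Lemma lA2_pow6 s : 0 <= s <= 2 -> lA 2 s ^+ 6 <= 12 ^+ 6 * 2 `^ 2^-1 * s `^ (- 2^-1).
Proof.
move=> /andP[s0' s2]; rewrite /lA; have [s0|] := ltP 0 s; last first.
  by rewrite mul0r expr0n /= mulr_ge0 ?powR_ge0 // mulr_ge0 ?powR_ge0 // exprn_ge0.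
rewrite mul1r; have l0 : 0 <= ln 2 - ln s by rewrite subr_ge0 ler_ln ?posrE.
pose r : R := (2 / s) `^ 12^-1; have r0 : 0 < r by rewrite powR_gt0 // divr_gt0.
have le12 : ln 2 - ln s <= 12 * r.
  rewrite -(ler_pM2l (_ : 0 < 12^-1)) ?invr_gt0 // mulKf // -ln_div ?posrE // -ln_powR.
  by rewrite ltW // ln_sublinear.
have -> : 12 ^+ 6 * 2 `^ 2^-1 * s `^ (- 2^-1) = (12 * r) ^+ 6.
  rewrite exprMn -mulrA; congr (_ * _); rewrite /r -powR_mulrn ?powR_ge0 // -powRrM.
  rewrite (_ : 12^-1 * 6%:R = 2^-1); last by lra.
  rewrite powRM ?invr_ge0 //; congr (_ * _).
  by rewrite -(powR_inv1 s0') -powRrM mulN1r.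
by apply: lerXn2r; rewrite ?nnegrE // mulr_ge0 // ltW.
Qed.

Lemma meas_lA2 y : meas (fun x => lA 2 (sd x y)).
Proof. by apply: measurable_ksd; exact: measurable_lA. Qed.

Lemma lA2_6_integrable y : mu.-integrable setT (EFin \o (fun x => lA 2 (sd x y) ^+ 6)) /\
  \int[mu]_x (lA 2 (sd x y) ^+ 6) <= 12 ^+ 6 * 2 `^ 2^-1 * halfpow R.
Proof.
pose k : R := 12 ^+ 6 * 2 `^ 2^-1.
have k0 : 0 <= k by rewrite mulr_ge0 ?powR_ge0 // exprn_ge0.
have ms : meas (fun x => sd x y `^ (- 2^-1)) by exact: (measurable_ksd y (measurable_powN (- 2^-1 : R))).
have is1 : mu.-integrable setT (EFin \o (fun x => sd x y `^ (- 2^-1))).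
  apply/integrableP; split; first exact/measurable_EFinP.
  apply: le_lt_trans (ltry (halfpow R)); apply: le_trans (sd_pow_half y).
  rewrite le_eqVlt; apply/orP; left; apply/eqP; apply: eq_integral => x _.
  by rewrite /= ger0_norm // powR_ge0.
have isk : mu.-integrable setT (EFin \o (fun x => k * sd x y `^ (- 2^-1))) by exact: (integrableZl measurableT _ is1).
have b x : lA 2 (sd x y) ^+ 6 <= k * sd x y `^ (- 2^-1) by apply: lA2_pow6; rewrite sd_ge0 sd_le2.
have l0 x : 0 <= lA 2 (sd x y) by rewrite lA_ge0 // sd_le2.
have i6 : mu.-integrable setT (EFin \o (fun x => lA 2 (sd x y) ^+ 6)).
  apply: (integrable_le _ isk); first by apply: measurable_funX; exact: meas_lA2.
  by move=> x; rewrite ger0_norm // exprn_ge0.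
split => //; apply: (@le_trans _ _ (\int[mu]_x (k * sd x y `^ (- 2^-1)))).
  exact: le_Rintegral.
rewrite (RintegralZl _ measurableT is1) ler_wpM2l // -lee_fin [in leLHS]/Rintegral fineK.
  exact: sd_pow_half.
exact: integrable_fin_num.
Qed.

(** Young's inequality bounds the potential by e^{3u}, the sixth power of the kernel and g^2, so u -
    c lies between 0 and a constant [Um]. It remains to bound c: above by the mass of e^{2u}, below
    because a very negative c could not produce the total mass 4 pi. *)
Lemma sys_bounded : exists C : R, forall u P g c, sys u P g c -> {ae mu, forall y, `|u y| <= C}.
Proof.
have [C3 C30 HC3] := sys_exp3.
pose D : R := 12 ^+ 6 * 2 `^ 2^-1 * halfpow R.
pose Um : R := (4 * pi)^-1 * ((M1 + M2) * (C3 + D + 4 * pi) + M2 * G2 Lam).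
pose Kz : R := expR Um.
pose zm : R := 4 * pi / (M1 * (4 * pi) * Kz ^+ 2 * expR (- ln m1 / 2) + M2 * Kz * (4 * pi + G2 Lam)).
have G20 := G2_gt0 Lam0.
have Kz0 : 0 < Kz := expR_gt0 _.
have den0 : 0 < M1 * (4 * pi) * Kz ^+ 2 * expR (- ln m1 / 2) + M2 * Kz * (4 * pi + G2 Lam) by posR.
have zm0 : 0 < zm by rewrite divr_gt0 // mulr_gt0.
exists (`|ln zm| + `|- ln m1 / 2 + Um|) => u P g c S.
have iP := sys_iP S; have P0 := sys_P0 S; have P4 := sys_P4 S.
have mu' : meas u := sys_mu S.
have e0 x := expR_gt0 (u x).
have e3E x : expR (3 * u x) = expR (u x) ^+ 3.
  by rewrite -expRM_natl.
have e2E x : expR (2 * u x) = expR (u x) ^+ 2 by rewrite -expRM_natl.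
have i3 : mu.-integrable setT (EFin \o (fun x => expR (3 * u x))).
  apply/integrableP; split.
    by apply/measurable_EFinP; apply: measurableT_comp => //; exact: measurable_funM.
  apply: le_lt_trans (ltry C3); apply: le_trans (HC3 _ _ _ _ S).
  rewrite le_eqVlt; apply/orP; left; apply/eqP; apply: eq_integral => x _.
  by rewrite /= ger0_norm // expR_ge0.
have I3 : \int[mu]_x expR (3 * u x) <= C3.
  by rewrite -lee_fin /Rintegral fineK; [exact: HC3 S|exact: integrable_fin_num].
have ig := ig2 S; have Ig := int_g2_le Lam0 S.
have upper : {ae mu, forall y, u y <= c + Um}.
  have := sys_rep S; apply: filterS => y [py ->]; rewrite lerD2l /avgP /Um ler_pM2l ?invr_gt0 ?mulr_gt0 //.
  have [i6 I6] := lA2_6_integrable y.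
  have ia : mu.-integrable setT (EFin \o (fun x => expR (3 * u x) + lA 2 (sd x y) ^+ 6)) by exact: (integrableD measurableT i3 i6).
  have ib : mu.-integrable setT (EFin \o (fun x => expR (3 * u x) + lA 2 (sd x y) ^+ 6 + cst 1 x)).
    exact: (integrableD measurableT ia (Ck0_integrable (Ck_cst 0 1))).
  have ic : mu.-integrable setT (EFin \o (fun x => (M1 + M2) * (expR (3 * u x) + lA 2 (sd x y) ^+ 6 + cst 1 x))).
    exact: (integrableZl measurableT _ ib).
  have id : mu.-integrable setT (EFin \o (fun x => M2 * g x ^+ 2)) by exact: (integrableZl measurableT _ ig).
  apply: (@le_trans _ _ (\int[mu]_x ((M1 + M2) * (expR (3 * u x) + lA 2 (sd x y) ^+ 6 + cst 1 x) + M2 * g x ^+ 2))).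
    apply: le_Rintegral => //; first exact: (integrableD measurableT ic id).
    move=> x _; have l0 : 0 <= lA 2 (sd x y) by rewrite lA_ge0 // sd_le2.
    have g0 := sys_g0 S x; have := sys_hi S x; rewrite e2E e3E /=.
    move: (e0 x) g0 l0; move: (expR (u x)) (g x) (lA 2 (sd x y)) => E G l E0 G0 l0 hP.
    (* Here E = e^u and l is the kernel. Comparing E with l, and in [t2] comparing E with l^2,
       replaces the mixed products by E^3 and l^6. *)
    have t1 : E ^+ 2 * l <= E ^+ 3 + l ^+ 6 + 1.
      have l3 : l ^+ 3 <= l ^+ 6 + 1.
        have := sqr_ge0 (l ^+ 3 - 1); rewrite (_ : l ^+ 6 = (l ^+ 3) ^+ 2); last by rewrite -exprM.
        by have := sqr_ge0 (l ^+ 3); nra.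
      have l30 : 0 <= l ^+ 3 by rewrite exprn_ge0.
      have [lE|El] := leP l E.
        have : E ^+ 2 * l <= E ^+ 2 * E by rewrite ler_wpM2l // sqr_ge0.
        rewrite -exprSr; have : 0 <= l ^+ 6 by rewrite exprn_ge0.
        lra.
      have : E ^+ 2 * l <= l ^+ 2 * l.
        by rewrite ler_wpM2r // ler_sqr ?nnegrE //; apply: ltW.
      rewrite -exprSr; have : 0 <= E ^+ 3 by rewrite exprn_ge0 // ltW.
      lra.
    have t2 : E * G * l <= E ^+ 3 + l ^+ 6 + G ^+ 2.
      have h : E * G * l <= (E * l) ^+ 2 + G ^+ 2.
        by have := sqr_ge0 (E * l - G); have := sqr_ge0 (E * l + G); nra.
      have E30 : 0 <= E ^+ 3 by rewrite exprn_ge0 // ltW.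
      have l60 : 0 <= l ^+ 6 by rewrite exprn_ge0.
      have [lE|El] := leP (l ^+ 2) E.
        have : E ^+ 2 * l ^+ 2 <= E ^+ 2 * E by rewrite ler_wpM2l // sqr_ge0.
        by rewrite -exprSr -exprMn; lra.
      have : E ^+ 2 * l ^+ 2 <= (l ^+ 2) ^+ 2 * l ^+ 2.
        by rewrite ler_wpM2r ?sqr_ge0 // ler_sqr ?nnegrE ?sqr_ge0 //; apply: ltW.
      by rewrite -exprSr -exprM -exprMn; lra.
    have : P x * l <= (M1 * E ^+ 2 + M2 * (E * G)) * l by rewrite ler_wpM2r.
    have : M1 * (E ^+ 2 * l) <= M1 * (E ^+ 3 + l ^+ 6 + 1) by rewrite ler_pM2l.
    have : M2 * (E * G * l) <= M2 * (E ^+ 3 + l ^+ 6 + G ^+ 2) by rewrite ler_pM2l.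
    have -> : (M1 * E ^+ 2 + M2 * (E * G)) * l = M1 * (E ^+ 2 * l) + M2 * (E * G * l) by ring.
    have -> : (M1 + M2) * (E ^+ 3 + l ^+ 6 + 1) + M2 * G ^+ 2 = M1 * (E ^+ 3 + l ^+ 6 + 1) + M2 * (E ^+ 3 + l ^+ 6 + G ^+ 2) + M2 by ring.
    by have := M20; lra.
  rewrite (RintegralD measurableT ic id) (RintegralZl _ measurableT ib) (RintegralZl _ measurableT ig).
  rewrite (RintegralD measurableT ia (Ck0_integrable (Ck_cst 0 1))) (RintegralD measurableT i3 i6).
  rewrite Rintegral_cst //= dv_setT mul1r; apply: lerD; last by rewrite ler_pM2l.
  by rewrite ler_pM2l ?addr_gt0 //; apply: lerD => //; apply: lerD.
have cm : 2 * c <= - ln m1.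
  by rewrite -ler_expR (le_trans (sys_c_upper S)) // expRN lnK.
pose z := expR c; have z0 : 0 < z := expR_gt0 _.
have zle : z <= expR (- ln m1 / 2) by rewrite ler_expR; lra.
(* With z = e^c, the mass 4 pi is at most a quadratic expression in z without constant term. The
   known upper bound of z turns it into a linear one, which gives z >= zm. *)
have zlow : zm <= z.
  have h : 4 * pi <= M1 * (4 * pi) * Kz ^+ 2 * z ^+ 2 + M2 * Kz * z * (4 * pi + G2 Lam).
    have iB : mu.-integrable setT (EFin \o (fun x => M1 * Kz ^+ 2 * z ^+ 2 + M2 * Kz * z * (1 + g x ^+ 2))).
      have ig1 : mu.-integrable setT (EFin \o (fun x => cst 1 x + g x ^+ 2)) by exact: (integrableD measurableT (Ck0_integrable (Ck_cst 0 1)) ig).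
      exact: (integrableD measurableT (Ck0_integrable (Ck_cst 0 (M1 * Kz ^+ 2 * z ^+ 2))) (integrableZl measurableT (M2 * Kz * z) ig1)).
    have ig1 : mu.-integrable setT (EFin \o (fun x => cst 1 x + g x ^+ 2)) by exact: (integrableD measurableT (Ck0_integrable (Ck_cst 0 1)) ig).
    have igz := integrableZl measurableT (M2 * Kz * z) ig1.
    apply: (@le_trans _ _ (\int[mu]_x (M1 * Kz ^+ 2 * z ^+ 2 + M2 * Kz * z * (1 + g x ^+ 2)))).
      rewrite -P4 -lee_fin.
      have E1 : (\int[mu]_x P x)%:E = (\int[mu]_x (P x)%:E)%E by rewrite /Rintegral fineK //; exact: integrable_fin_num.
      have E2 : (\int[mu]_x (M1 * Kz ^+ 2 * z ^+ 2 + M2 * Kz * z * (1 + g x ^+ 2)))%:E = (\int[mu]_x (M1 * Kz ^+ 2 * z ^+ 2 + M2 * Kz * z * (1 + g x ^+ 2))%:E)%E.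
        by rewrite /Rintegral fineK //; exact: integrable_fin_num.
      rewrite E1 E2; apply: ae_ge0_le_integral => //.
      - by move=> x _; rewrite lee_fin.
      - exact: measurable_int iP.
      - move=> x _; rewrite lee_fin addr_ge0 //; first by posR.
        by rewrite mulr_ge0 //; [posR|rewrite addr_ge0 // sqr_ge0].
      - exact: measurable_int iB.
      apply: filterS upper => x ux _; rewrite lee_fin; apply: le_trans (sys_hi S x) _.
      have ez : expR (u x) <= z * Kz by rewrite -expRD ler_expR.
      have g0 := sys_g0 S x; have gg : g x <= 1 + g x ^+ 2 by have := sqr_ge0 (g x - 1); have := sqr_ge0 (g x); nra.
      rewrite e2E; apply: lerD.
        rewrite -mulrA ler_pM2l // -exprMn mulrC ler_sqr ?nnegrE ?(ltW (e0 x)) ?mulr_ge0 // ?ltW //.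
      rewrite [leRHS](_ : _ = M2 * (z * Kz * (1 + g x ^+ 2))); last by ring.
      by rewrite ler_pM2l //; apply: ler_pM; rewrite ?expR_ge0.
    rewrite (RintegralD measurableT (Ck0_integrable (Ck_cst 0 (M1 * Kz ^+ 2 * z ^+ 2))) igz).
    rewrite (RintegralZl _ measurableT ig1) (RintegralD measurableT (Ck0_integrable (Ck_cst 0 1)) ig).
    rewrite !Rintegral_cst //= dv_setT mul1r; apply: lerD.
      by rewrite /= le_eqVlt; apply/orP; left; apply/eqP; move: (pi : R) => w; ring.
    by rewrite ler_pM2l ?lerD2l //; posR.
  rewrite /zm ler_pdivrMr //; apply: le_trans h _.
  rewrite [leRHS](_ : _ = M1 * (4 * pi) * Kz ^+ 2 * (z * expR (- ln m1 / 2)) + M2 * Kz * z * (4 * pi + G2 Lam)); last first.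
    by move: (pi : R) => w; ring.
  rewrite lerD2r ler_wpM2l //; first by posR.
  by rewrite expr2 ler_pM2l.
have clow : ln zm <= c by rewrite -[c]expRK ler_ln ?posrE.
have := sys_u_ge S; apply: filterS2 upper => y h1 h2; rewrite ler_norml; apply/andP; split.
  have := ler_norm (- ln zm); rewrite normrN; have := normr_ge0 (- ln m1 / 2 + Um); lra.
have := ler_norm (- ln m1 / 2 + Um); have := normr_ge0 (ln zm); lra.
Qed.

End compactness.

(** * The Dirac operator in real components *)

Section real_dirac.
Local Open Scope complex_scope.
Variable R : realType.
Implicit Types (x y : S2 R) (v w : 'rV[R]_3) (r : nat -> R) (f g : nat -> S2 R -> R) (psi : spinor R).
Local Notation Re := complex.Re.
Local Notation Im := complex.Im.

(* The real components of a vector of C^2, and the action of [gamma v] on them. *)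
Definition cmp (z : 'cV[R[i]]_2) (a : nat) : R :=
  match a with 0 => Re (z 0 0) | 1 => Im (z 0 0) | 2 => Re (z 1 0) | _ => Im (z 1 0) end.

Definition Gam (v1 v2 v3 : R) r (a : nat) : R :=
  match a with
  | 0 => - v3 * r 1%N + v2 * r 2%N - v1 * r 3%N
  | 1 => v3 * r 0%N + v1 * r 2%N + v2 * r 3%N
  | 2 => - v2 * r 0%N - v1 * r 1%N + v3 * r 3%N
  | _ => v1 * r 0%N - v2 * r 1%N - v3 * r 2%N
  end.

Definition Gamv v := Gam (v 0 0) (v 0 1) (v 0 2%:R).

Lemma cmp_inj z z' : (forall a, (a < 4)%N -> cmp z a = cmp z' a) -> z = z'.
Proof.
move=> H; apply/matrixP => i j; rewrite (ord1 j).
have c2 (k : 'I_2) : k = 0 \/ k = 1.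
  by case: k => [[|[|//]] ?]; [left|right]; exact: val_inj.
have E (t t' : R[i]) : Re t = Re t' -> Im t = Im t' -> t = t'.
  by case: t t' => [a b] [c d] /= -> ->.
by case: (c2 i) => ->; apply: E; [exact: (H 0%N)|exact: (H 1%N)|exact: (H 2%N)|exact: (H 3%N)].
Qed.

Lemma cmpD z z' a : cmp (z + z') a = cmp z a + cmp z' a.
Proof.
by case: a => [|[|[|a]]]; rewrite /cmp !mxE; case: (z _ _) => ? ?; case: (z' _ _).
Qed.

Lemma cmpZ (k : R) z a : cmp (k%:C *: z) a = k * cmp z a.
Proof.
by case: a => [|[|[|a]]]; rewrite /cmp !mxE; case: (z _ _) => ? ? /=; ring.
Qed.

Lemma cmp_gamma v z a : cmp (gamma v *m z) a = Gamv v (cmp z) a.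
Proof.
have E (k : 'I_2) : (gamma v *m z) k 0 = gamma v k 0 * z 0 0 + gamma v k 1 * z 1 0.
  rewrite mxE !big_ord_recl big_ord0 addr0.
  by congr (_ + gamma v k _ * z _ 0); exact: val_inj.
rewrite /Gamv; case: a => [|[|[|a]]]; rewrite /cmp /= E !mxE /=;
  case: (z 0 0) => p q; case: (z 1 0) => s t /=; ring.
Qed.

(** Components are indexed by natural numbers, and [Gam] reads only the first four; equalities
    between tuples are therefore required below 4 only. *)
Lemma eq_Gam (v1 v2 v3 : R) (r r' : nat -> R) a : (forall b, (b < 4)%N -> r b = r' b) -> Gam v1 v2 v3 r a = Gam v1 v2 v3 r' a.
Proof. by move=> E; case: a => [|[|[|a]]] /=; rewrite !E. Qed.

Lemma sum2 (V : zmodType) (F : 'I_2 -> V) : \sum_i F i = F 0 + F 1.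
Proof. by rewrite !big_ord_recl big_ord0 addr0; congr (_ + F _); exact: val_inj. Qed.

Lemma cmp_cliff x v z a : cmp (cliff x v z) a = Gamv v (Gamv (pt x) (cmp z)) a.
Proof.
by rewrite /cliff cmp_gamma; apply: eq_Gam => b _; rewrite cmp_gamma.
Qed.

Lemma cmp_dirder psi x v a : (a < 4)%N -> (forall b, (b < 4)%N -> dff (fun y => cmp (psi y) b) x) ->
  cmp (spinor_dirder psi x v) a = \sum_i v 0 i * grad (fun y => cmp (psi y) a) x 0 i.
Proof.
move=> a4 df; rewrite -(dirderE v (df a a4)).
by case: a a4 => [|[|[|[|//]]]] _; rewrite /cmp /spinor_dirder !mxE.
Qed.

Lemma orthoframe_ex x : exists e, orthoframe x e.
Proof.
have [e1 [n1 t1]] : exists e1 : 'rV[R]_3, dot e1 e1 = 1 /\ dot e1 (pt x) = 0.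
  have := sum_crd2 x; set a := pt x 0 0; set b := pt x 0 1; set c := pt x 0 2%:R => n1.
  have [ab0|ab0] := eqVneq (a ^+ 2 + b ^+ 2) 0.
    have /andP[/eqP a0 /eqP b0] : (a == 0) && (b == 0).
      by rewrite -(sqrf_eq0 a) -(sqrf_eq0 b) -paddr_eq0 ?sqr_ge0 // ab0.
    exists (vec3 1 0 0); rewrite dot_vec3; split; first by ring.
    by rewrite /dot sum3 !mxE /= -/a a0; ring.
  have p0 : 0 < a ^+ 2 + b ^+ 2 by rewrite lt_neqAle eq_sym ab0 addr_ge0 ?sqr_ge0.
  set s := Num.sqrt (a ^+ 2 + b ^+ 2); have s0 : 0 < s by rewrite sqrtr_gt0.
  have s2 : s ^+ 2 = a ^+ 2 + b ^+ 2 by rewrite sqr_sqrtr // ltW.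
  exists (vec3 (- b / s) (a / s) 0); split.
    rewrite dot_vec3 [LHS](_ : _ = (a ^+ 2 + b ^+ 2) / s ^+ 2); last by field; rewrite gt_eqF.
    by rewrite -s2 divff // expf_neq0 // gt_eqF.
  by rewrite /dot sum3 !mxE /= -/a -/b; ring.
pose e2 : 'rV[R]_3 := vec3 (pt x 0 1 * e1 0 2%:R - pt x 0 2%:R * e1 0 1)
   (pt x 0 2%:R * e1 0 0 - pt x 0 0 * e1 0 2%:R) (pt x 0 0 * e1 0 1 - pt x 0 1 * e1 0 0).
move: n1 t1; rewrite /dot !sum3 => n1 t1; have := sum_crd2 x.
set a := pt x 0 0 in t1 *; set b := pt x 0 1 in t1 *; set c := pt x 0 2%:R in t1 * => nx.
exists (fun k => if k == 0 then e1 else e2); split => k.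
  move=> l; have c2 (m : 'I_2) : m = 0 \/ m = 1.
    by case: m => [[|[|//]] ?]; [left|right]; exact: val_inj.
  rewrite /dot sum3; case: (c2 k) => ->; case: (c2 l) => -> /=; rewrite ?mxE /= -/a -/b -/c.
  - by rewrite n1.
  - by ring.
  - by ring.
  - rewrite [LHS](_ : _ = (a ^+ 2 + b ^+ 2 + c ^+ 2) * (e1 0 0 * e1 0 0 + e1 0 1 * e1 0 1 + e1 0 2%:R * e1 0 2%:R) - (e1 0 0 * a + e1 0 1 * b + e1 0 2%:R * c) ^+ 2); last by ring.
    by rewrite nx n1 t1; ring.
rewrite /dot sum3; case: eqP => _; first by rewrite -/a -/b -/c t1.
by rewrite !mxE /= -/a -/b -/c; ring.
Qed.

(** The matrix with rows e_0, e_1, x is orthogonal, hence so are its columns. *)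
Lemma orthoframe_sum x e i j : orthoframe x e ->
  e 0 0 i * e 0 0 j + e 1 0 i * e 1 0 j = (i == j)%:R - pt x 0 i * pt x 0 j.
Proof.
move=> [ee ex]; pose M : 'M[R]_3 := \matrix_(k, l) [:: e 0 0 l; e 1 0 l; pt x 0 l]`_k.
have row0 l : M 0 l = e 0 0 l by rewrite mxE.
have row1 l : M 1 l = e 1 0 l by rewrite mxE.
have row2 l : M 2%:R l = pt x 0 l by rewrite mxE.
have MM : M *m M^T = 1%:M.
  apply/matrixP => k l; rewrite !mxE.
  have dE (v w : 'rV[R]_3) : \sum_m v 0 m * w 0 m = dot v w by [].
  have pC m : dot (pt x) (e m) = 0 by rewrite -(ex m) /dot; apply: eq_bigr => n _; rewrite mulrC.
  under eq_bigr => m _ do rewrite [M^T m _]mxE.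
  case: (ord3P k) => ->; case: (ord3P l) => ->; under eq_bigr => m _ do rewrite ?row0 ?row1 ?row2;
    rewrite dE ?ee ?ex ?pC ?dot_pt //=.
have /matrixP/(_ i j) := mulmx1C MM; rewrite !mxE sum3 !mxE /= => <-.
by ring.
Qed.

(** The operator sum_i gamma_i d_i of R^3 on the extension constant along rays; [GX] is the product
    by gamma(x). *)
Definition AR f (a : nat) x : R :=
  Gam 1 0 0 (fun b => grad (f b) x 0 0) a + Gam 0 1 0 (fun b => grad (f b) x 0 1) a
  + Gam 0 0 1 (fun b => grad (f b) x 0 2%:R) a.

Definition GX f (a : nat) x : R := Gamv (pt x) (fun b => f b x) a.

Definition DR f (a : nat) x : R := - GX (AR f) a x - f a x.

(** The frame enters only through e_0 e_0^T + e_1 e_1^T = 1 - x x^T. The coefficients d0, d1, d2 of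
    the radial direction drop out, and the connection term, with h = 1/2, sums to - r. *)
Lemma dirac_frame_sum (p0 p1 p2 q0 q1 q2 x0 x1 x2 h : R) (d0 d1 d2 r : nat -> R) a : (a < 4)%N ->
  x0 ^+ 2 + x1 ^+ 2 + x2 ^+ 2 = 1 -> h * 2 = 1 ->
  p0 * p0 + q0 * q0 = 1 - x0 * x0 -> p1 * p1 + q1 * q1 = 1 - x1 * x1 -> p2 * p2 + q2 * q2 = 1 - x2 * x2 ->
  p0 * p1 + q0 * q1 = - (x0 * x1) -> p0 * p2 + q0 * q2 = - (x0 * x2) -> p1 * p2 + q1 * q2 = - (x1 * x2) ->
  (forall b, (b < 4)%N -> x0 * d0 b + x1 * d1 b + x2 * d2 b = 0) ->
  Gam p0 p1 p2 (Gam x0 x1 x2 (fun b => p0 * d0 b + p1 * d1 b + p2 * d2 b + h * Gam p0 p1 p2 (Gam x0 x1 x2 r) b)) a +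
  Gam q0 q1 q2 (Gam x0 x1 x2 (fun b => q0 * d0 b + q1 * d1 b + q2 * d2 b + h * Gam q0 q1 q2 (Gam x0 x1 x2 r) b)) a =
  - Gam x0 x1 x2 (fun b => Gam 1 0 0 d0 b + Gam 0 1 0 d1 b + Gam 0 0 1 d2 b) a - r a.
Proof.
move=> a4 n1 h2 S00 S11 S22 S01 S02 S12 rad.
pose L a i (z : nat -> R) := Gam (i == 0%N)%:R (i == 1%N)%:R (i == 2%N)%:R (Gam x0 x1 x2 z) a.
pose T a i j z := L a i z + h * L a i (fun b => Gam (j == 0%N)%:R (j == 1%N)%:R (j == 2%N)%:R (Gam x0 x1 x2 r) b).
pose d j := nth d0 [:: d0; d1; d2] j.
have r4 := rad a a4.
rewrite [LHS](_ : _ = (p0 * p0 + q0 * q0) * T a 0%N 0%N (d 0%N) + (p1 * p1 + q1 * q1) * T a 1%N 1%N (d 1%N)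
  + (p2 * p2 + q2 * q2) * T a 2%N 2%N (d 2%N) + (p0 * p1 + q0 * q1) * (T a 0%N 1%N (d 1%N) + T a 1%N 0%N (d 0%N))
  + (p0 * p2 + q0 * q2) * (T a 0%N 2%N (d 2%N) + T a 2%N 0%N (d 0%N)) + (p1 * p2 + q1 * q2) * (T a 1%N 2%N (d 2%N) + T a 2%N 1%N (d 1%N)));
  last by rewrite /T /L /d {r4}; case: a a4 => [|[|[|[|//]]]] _ /=; ring.
rewrite S00 S11 S22 S01 S02 S12 [LHS](_ : _ = - Gam x0 x1 x2 (fun b => Gam 1 0 0 d0 b + Gam 0 1 0 d1 b + Gam 0 0 1 d2 b) a
  + (x0 ^+ 2 + x1 ^+ 2 + x2 ^+ 2 - 2) * (x0 * d0 a + x1 * d1 a + x2 * d2 a) - h * ((x0 ^+ 2 + x1 ^+ 2 + x2 ^+ 2) + (x0 ^+ 2 + x1 ^+ 2 + x2 ^+ 2) ^+ 2) * r a);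
  last by rewrite /T /L /d {r4}; case: a a4 => [|[|[|[|//]]]] _ /=; ring.
by rewrite n1 r4 mulr0 addr0 expr1n -[1 + 1]/2 h2 mul1r.
Qed.

(* On S^2 the operator is [D = - gamma(x) (sum_i gamma_i d_i) - 1]. *)
Lemma cmp_dirac psi x a : (a < 4)%N -> (forall b y, (b < 4)%N -> dff (fun z => cmp (psi z) b) y) ->
  cmp (Defs.dirac psi x) a = DR (fun b y => cmp (psi y) b) a x.
Proof.
move=> a4 df; rewrite /Defs.dirac; set e := xget _ _.
have oe : orthoframe x e by have [e0 he0] := orthoframe_ex x; exact: (xgetPex _ (ex_intro _ e0 he0)).
have rad b : (b < 4)%N -> pt x 0 0 * grad (fun y => cmp (psi y) b) x 0 0 + pt x 0 1 * grad (fun y => cmp (psi y) b) x 0 1 + pt x 0 2%:R * grad (fun y => cmp (psi y) b) x 0 2%:R = 0.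
  by move=> b4; have := grad_radial (df b x b4); rewrite sum3.
have n1 := sum_crd2 x.
have S00 := orthoframe_sum 0 0 oe; have S11 := orthoframe_sum 1 1 oe; have S22 := orthoframe_sum 2%:R 2%:R oe.
have S01 := orthoframe_sum 0 1 oe; have S02 := orthoframe_sum 0 2%:R oe; have S12 := orthoframe_sum 1 2%:R oe.
rewrite /= ?subr0 ?sub0r in S00 S11 S22 S01 S02 S12.
have nE k : forall b, (b < 4)%N -> cmp (nabla psi x (e k)) b =
    e k 0 0 * grad (fun y => cmp (psi y) b) x 0 0 + e k 0 1 * grad (fun y => cmp (psi y) b) x 0 1
    + e k 0 2%:R * grad (fun y => cmp (psi y) b) x 0 2%:R + 2^-1 * Gamv (e k) (Gamv (pt x) (cmp (psi x))) b.
  by move=> b b4; rewrite cmpD cmpZ cmp_cliff cmp_dirder ?sum3 // => c c4; exact: df.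
have cE k : cmp (cliff x (e k) (nabla psi x (e k))) a = Gam (e k 0 0) (e k 0 1) (e k 0 2%:R) (Gam (pt x 0 0) (pt x 0 1) (pt x 0 2%:R)
    (fun b => e k 0 0 * grad (fun y => cmp (psi y) b) x 0 0 + e k 0 1 * grad (fun y => cmp (psi y) b) x 0 1
    + e k 0 2%:R * grad (fun y => cmp (psi y) b) x 0 2%:R + 2^-1 * Gam (e k 0 0) (e k 0 1) (e k 0 2%:R) (Gam (pt x 0 0) (pt x 0 1) (pt x 0 2%:R) (cmp (psi x))) b)) a.
  by rewrite cmp_cliff /Gamv; apply: eq_Gam => b _; apply: eq_Gam => c c4; exact: nE.
apply: (etrans (congr1 (fun z => cmp z a) (sum2 _))).
apply: (etrans (cmpD _ _ _)).
apply: (etrans (congr2 +%R (cE _) (cE _))).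
have h2 : 2^-1 * 2 = 1 :> R by rewrite mulVf // pnatr_eq0.
by rewrite (dirac_frame_sum _ a4 n1 h2 S00 S11 S22 S01 S02 S12 rad).
Qed.

End real_dirac.

(** * Polynomial spinors as sums of eigenspinors *)

Section dirac_decomposition.
Variable R : realType.
Implicit Types (x : S2 R) (f g : nat -> S2 R -> R) (p q : S2 R -> R).

Lemma spoly_Ck k p : spoly p -> Ck k p.
Proof. by move=> [d wf]; exact: wp_Ck wf. Qed.

Lemma spoly_dff p x : spoly p -> dff p x.
Proof. by move=> sp; exact: Ck_dff (spoly_Ck 1 sp). Qed.

Lemma spolyZ c p : spoly p -> spoly (fun x => c * p x).
Proof. exact: spolyM (spoly_cst c). Qed.

Lemma spolyN p : spoly p -> spoly (fun x => - p x).
Proof. by move=> sp; under eq_fun do rewrite -mulN1r; exact: spolyZ. Qed.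

Lemma spoly_sum (I : Type) (s : seq I) (F : I -> S2 R -> R) : (forall i, spoly (F i)) ->
  spoly (fun x => \sum_(i <- s) F i x).
Proof.
move=> sF; elim: s => [|i s IH].
  by under eq_fun do rewrite big_nil; exact: spoly_cst.
by under eq_fun do rewrite big_cons; exact: spolyD.
Qed.

Definition spt f := forall a, spoly (f a).

Lemma spt_Gam (v1 v2 v3 : R) F a : spt F -> spoly (fun x => Gam v1 v2 v3 (fun b => F b x) a).
Proof.
move=> sF; have sN c p : spoly p -> spoly (fun x => - c * p x) by exact: spolyZ.
by case: a => [|[|[|a]]] /=; repeat apply: spolyD; try apply: spolyN; try apply: sN; try apply: spolyZ; exact: sF.
Qed.

Lemma Gam_lin (v1 v2 v3 c : R) (r s : nat -> R) a :
  Gam v1 v2 v3 (fun b => c * r b + s b) a = c * Gam v1 v2 v3 r a + Gam v1 v2 v3 s a.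
Proof. by case: a => [|[|[|a]]] /=; ring. Qed.

Lemma spt_AR f : spt f -> spt (AR f).
Proof.
move=> sf a; apply: spolyD; first apply: spolyD.
- by apply: (@spt_Gam _ _ _ (fun b x => grad (f b) x 0 0)) => b; exact: spoly_grad.
- by apply: (@spt_Gam _ _ _ (fun b x => grad (f b) x 0 1)) => b; exact: spoly_grad.
- by apply: (@spt_Gam _ _ _ (fun b x => grad (f b) x 0 2%:R)) => b; exact: spoly_grad.
Qed.

Lemma spt_GX f : spt f -> spt (GX f).
Proof.
move=> sf a.
have sc i b : spoly (fun x => crd i x * f b x) by exact: spolyM (spoly_crd _ i) (sf b).
have sn i b : spoly (fun x => - crd i x * f b x) by under eq_fun do rewrite mulNr; exact: spolyN.
by case: a => [|[|[|a]]]; rewrite /GX /Gamv /Gam; repeat apply: spolyD; try apply: spolyN; try exact: sc; exact: sn.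
Qed.

Lemma spt_DR f : spt f -> spt (DR f).
Proof.
move=> sf a; rewrite /DR; apply: spolyD; last exact/spolyN.
exact: spolyN (spt_GX (spt_AR sf) a).
Qed.

Lemma spt_lin c f g : spt f -> spt g -> spt (fun a x => c * f a x + g a x).
Proof. by move=> sf sg a; exact: spolyD (spolyZ _ (sf a)) (sg a). Qed.

Lemma gradZD c p q x i : spoly p -> spoly q ->
  grad (fun y => c * p y + q y) x 0 i = c * grad p x 0 i + grad q x 0 i.
Proof.
move=> sp sq; have dp := spoly_dff x sp.
by rewrite (gradD i (dffZ c dp) (spoly_dff x sq)) (gradZ c i dp).
Qed.

Lemma AR_lin c f g a x : spt f -> spt g ->
  AR (fun b y => c * f b y + g b y) a x = c * AR f a x + AR g a x.
Proof.
move=> sf sg; have E i b : (b < 4)%N -> grad (fun y => c * f b y + g b y) x 0 i = c * grad (f b) x 0 i + grad (g b) x 0 i.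
  by move=> _; exact: gradZD.
by rewrite /AR !(eq_Gam _ _ _ _ (E _)) !Gam_lin; ring.
Qed.

Lemma GX_lin c f g a x : GX (fun b y => c * f b y + g b y) a x = c * GX f a x + GX g a x.
Proof. exact: Gam_lin. Qed.

Lemma eq_GX f g a x : (forall b, (b < 4)%N -> f b x = g b x) -> GX f a x = GX g a x.
Proof. by move=> E; exact: eq_Gam. Qed.

Lemma DR_lin c f g a x : spt f -> spt g ->
  DR (fun b y => c * f b y + g b y) a x = c * DR f a x + DR g a x.
Proof.
move=> sf sg; rewrite /DR (eq_GX (g := fun b y => c * AR f b y + AR g b y)); last first.
  by move=> b _; exact: AR_lin.
by rewrite GX_lin; ring.
Qed.

Lemma eq_AR f g a x : (forall b, (b < 4)%N -> f b =1 g b) -> AR f a x = AR g a x.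
Proof.
move=> E; have E' b : (b < 4)%N -> f b = g b by move=> b4; exact/funext/E.
by rewrite /AR; congr (_ + _ + _); apply: eq_Gam => b b4; rewrite E'.
Qed.

Lemma eq_DR f g a x : (a < 4)%N -> (forall b, (b < 4)%N -> f b =1 g b) -> DR f a x = DR g a x.
Proof.
move=> a4 E; rewrite /DR (E a a4 x); congr (- _ - _); apply: eq_GX => b _; exact: eq_AR.
Qed.

Lemma DR0 a x : DR (fun=> cst 0) a x = 0.
Proof.
have s0 : spt (fun=> cst 0 : S2 R -> R) by move=> b; exact: spoly_cst.
have := DR_lin 1 a x s0 s0; rewrite (_ : (fun _ => _) = (fun=> cst 0)); last first.
  by apply/funext => b; apply/funext => y; rewrite mulr0 addr0.
by move=> /eqP; rewrite mul1r -subr_eq0 opprD addNKr oppr_eq0 => /eqP.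
Qed.

Lemma DR_sum n (c : nat -> R) (F : nat -> nat -> S2 R -> R) a x : (forall i, spt (F i)) ->
  DR (fun b y => \sum_(i < n) c i * F i b y) a x = \sum_(i < n) c i * DR (F i) a x.
Proof.
move=> sF; elim: n => [|n IH].
  rewrite big_ord0 -[RHS](DR0 a x); congr (DR _ a x).
  by apply/funext => b; apply/funext => y; rewrite big_ord0.
rewrite big_ord_recr /= -IH addrC -DR_lin //.
  by congr (DR _ a x); apply/funext => b; apply/funext => y; rewrite big_ord_recr /= addrC.
by move=> b; apply: spoly_sum => i; exact/spolyZ/sF.
Qed.

Lemma GX2 f a x : (a < 4)%N -> GX (GX f) a x = - f a x.
Proof.
move=> a4; rewrite -[f a x]mul1r -(sum_crd2 x).
by case: a a4 => [|[|[|[|//]]]] _; rewrite /GX /Gamv /=; ring.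
Qed.

Lemma grad_GX f b x i : spt f -> grad (GX f b) x 0 i = Gamv (pt x) (fun c => grad (f c) x 0 i) b +
  Gam ((i == 0)%:R - pt x 0 i * pt x 0 0) ((i == 1)%:R - pt x 0 i * pt x 0 1) ((i == 2%:R)%:R - pt x 0 i * pt x 0 2%:R) (fun c => f c x) b.
Proof.
move=> sf.
have sc j c : spoly (fun y => crd j y * f c y) by exact/spolyM/sf/spoly_crd.
have gc j c : grad (fun y => crd j y * f c y) x 0 i = pt x 0 j * grad (f c) x 0 i + f c x * ((i == j)%:R - pt x 0 i * pt x 0 j).
  by rewrite (gradM i (dff_crd j x) (spoly_dff x (sf c))) grad_crd.
have E j c d k l m (s1 s2 s3 : R) : grad (fun y => s1 * (crd j y * f c y) + (s2 * (crd d y * f k y) + (s3 * (crd l y * f m y) + cst 0 y))) x 0 i =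
   s1 * (pt x 0 j * grad (f c) x 0 i + f c x * ((i == j)%:R - pt x 0 i * pt x 0 j)) +
   (s2 * (pt x 0 d * grad (f k) x 0 i + f k x * ((i == d)%:R - pt x 0 i * pt x 0 d)) +
   s3 * (pt x 0 l * grad (f m) x 0 i + f m x * ((i == l)%:R - pt x 0 i * pt x 0 l))).
  have s0 := spoly_cst (0 : R); have s4 := spolyD (spolyZ s3 (sc l m)) s0.
  have s5 := spolyD (spolyZ s2 (sc d k)) s4.
  apply: (etrans (gradZD _ _ _ (sc _ _) s5)); congr (_ * _ + _); first exact: gc.
  apply: (etrans (gradZD _ _ _ (sc _ _) s4)); congr (_ * _ + _); first exact: gc.
  by apply: (etrans (gradZD _ _ _ (sc _ _) s0)); rewrite grad_cst addr0 gc.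
case: b => [|[|[|b]]].
- rewrite (_ : GX f 0 = (fun y => -1 * (crd 2%:R y * f 1%N y) + (1 * (crd 1 y * f 2%N y) + (-1 * (crd 0 y * f 3%N y) + cst 0 y)))) ; first by rewrite E /Gamv /=; ring.
  by apply/funext => y; rewrite /GX /Gamv /crd /=; ring.
- rewrite (_ : GX f 1 = (fun y => 1 * (crd 2%:R y * f 0%N y) + (1 * (crd 0 y * f 2%N y) + (1 * (crd 1 y * f 3%N y) + cst 0 y)))) ; first by rewrite E /Gamv /=; ring.
  by apply/funext => y; rewrite /GX /Gamv /crd /=; ring.
- rewrite (_ : GX f 2 = (fun y => -1 * (crd 1 y * f 0%N y) + (-1 * (crd 0 y * f 1%N y) + (1 * (crd 2%:R y * f 3%N y) + cst 0 y)))) ; first by rewrite E /Gamv /=; ring.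
  by apply/funext => y; rewrite /GX /Gamv /crd /=; ring.
- rewrite (_ : GX f b.+3 = (fun y => 1 * (crd 0 y * f 0%N y) + (-1 * (crd 1 y * f 1%N y) + (-1 * (crd 2%:R y * f 2%N y) + cst 0 y)))) ; first by rewrite E /Gamv /=; ring.
  by apply/funext => y; rewrite /GX /Gamv /crd /=; ring.
Qed.

(** Since gamma_i gamma(x) = - gamma(x) gamma_i - 2 x_i, the operator anticommutes with gamma(x) up
    to a radial derivative, which vanishes, and the sum of gamma_i gamma(d_i x). The latter is - 2,
    because the tangent projection has trace 2. *)
Lemma gamma_div (x0 x1 x2 : R) (d0 d1 d2 r : nat -> R) b : (b < 4)%N ->
  x0 ^+ 2 + x1 ^+ 2 + x2 ^+ 2 = 1 -> x0 * d0 b + x1 * d1 b + x2 * d2 b = 0 ->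
  Gam 1 0 0 (fun c => Gam x0 x1 x2 d0 c + Gam (1 - x0 * x0) (0 - x0 * x1) (0 - x0 * x2) r c) b
  + Gam 0 1 0 (fun c => Gam x0 x1 x2 d1 c + Gam (0 - x1 * x0) (1 - x1 * x1) (0 - x1 * x2) r c) b
  + Gam 0 0 1 (fun c => Gam x0 x1 x2 d2 c + Gam (0 - x2 * x0) (0 - x2 * x1) (1 - x2 * x2) r c) b
  = - 2 * r b + - 1 * Gam x0 x1 x2 (fun c => Gam 1 0 0 d0 c + Gam 0 1 0 d1 c + Gam 0 0 1 d2 c) b.
Proof.
move=> b4 n1 rad; rewrite [LHS](_ : _ = - 2 * r b + - 1 * Gam x0 x1 x2 (fun c => Gam 1 0 0 d0 c + Gam 0 1 0 d1 c + Gam 0 0 1 d2 c) b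
  + (x0 ^+ 2 + x1 ^+ 2 + x2 ^+ 2 - 1) * r b - 2 * (x0 * d0 b + x1 * d1 b + x2 * d2 b)).
  by rewrite n1 rad; ring.
by clear rad; case: b b4 => [|[|[|[|//]]]] _ /=; ring.
Qed.

Lemma AR_GX f b x : (b < 4)%N -> spt f -> AR (GX f) b x = - 2 * f b x + - 1 * GX (AR f) b x.
Proof.
move=> b4 sf; have rad : pt x 0 0 * grad (f b) x 0 0 + pt x 0 1 * grad (f b) x 0 1 + pt x 0 2%:R * grad (f b) x 0 2%:R = 0.
  by have := grad_radial (spoly_dff x (sf b)); rewrite sum3.
apply: etrans (gamma_div (fun c => f c x) b4 (sum_crd2 x) rad).
by rewrite /AR; congr (_ + _ + _); apply: eq_Gam => c _; rewrite (grad_GX _ _ _ sf) /Gamv.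
Qed.

Lemma DR_GX f a x : (a < 4)%N -> spt f -> DR (GX f) a x = GX f a x - AR f a x.
Proof.
move=> a4 sf.
rewrite /DR (eq_GX (g := fun b y => - 2 * f b y + - 1 * GX (AR f) b y)); last by move=> b b4; exact: AR_GX.
rewrite (GX_lin _ f) -[X in _ + X]addr0.
have := GX_lin (-1) (GX (AR f)) (fun=> cst 0) a x.
rewrite (eq_GX (g := fun b y => -1 * GX (AR f) b y)) => [->|b b4]; last by rewrite addr0.
by rewrite GX2 // (_ : GX (fun=> cst 0) a x = 0); [ring|case: (a) => [|[|[|c]]]; rewrite /GX /Gamv /=; ring].
Qed.

(* Restrictions of homogeneous polynomials of degree exactly [k]: unlike [wp], the degree is
   not cumulative, so that Euler's identity is available. *)
Inductive hp : nat -> (S2 R -> R) -> Prop :=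
| hp_cst c : hp 0 (cst c)
| hp_crd k i p : hp k p -> hp k.+1 (fun x => crd i x * p x)
| hpD k p q : hp k p -> hp k q -> hp k (fun x => p x + q x).

Lemma hp_spoly k p : hp k p -> spoly p.
Proof.
elim=> {k p} [c|k i p _ IH|k p q _ IH _ IH']; first exact: spoly_cst.
  by apply: spolyM IH; exact: spoly_crd.
exact: spolyD.
Qed.

Lemma hpZ k c p : hp k p -> hp k (fun x => c * p x).
Proof.
elim=> {k p} [d|k i p _ IH|k p q _ IH _ IH'].
- by rewrite (_ : (fun _ => _) = cst (c * d)); [exact: hp_cst|exact/funext].
- by under eq_fun do rewrite mulrCA; exact: hp_crd.
- by under eq_fun do rewrite mulrDr; exact: hpD.
Qed.

Lemma hp0_grad k p x i : hp k p -> k = 0%N -> grad p x 0 i = 0.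
Proof.
elim=> {k p} [c _|//|k p q Hp IHp Hq IHq k0]; first exact: grad_cst.
by rewrite (gradD i (spoly_dff x (hp_spoly Hp)) (spoly_dff x (hp_spoly Hq))) IHp ?IHq ?addr0.
Qed.

(** The right-hand function is the restriction of the Euclidean derivative d_j of the homogeneous
    polynomial: by Euler's identity its radial part is (k+1) x_j p. Its degree has dropped by one.
    The equation l = k+1 is a hypothesis so that the induction can run on [hp]. *)
Lemma hp_euler l p j : hp l p -> forall k, l = k.+1 -> hp k (fun x => grad p x 0 j + k.+1%:R * crd j x * p x).
Proof.
elim=> {l p} [//|l i p Hp IH|l p q Hp IHp Hq IHq] k E.
  have dp x := spoly_dff x (hp_spoly Hp); case: E => kl; rewrite kl in Hp IH *.
  have -> : (fun x => grad (fun x => crd i x * p x) x 0 j + k.+1%:R * crd j x * (crd i x * p x))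
    = (fun x => (j == i)%:R * p x + crd i x * (grad p x 0 j + k%:R * crd j x * p x)).
    apply/funext => x; rewrite (gradM j (dff_crd i x) (dp x)) grad_crd -/(crd i x) -/(crd j x) -natr1; ring.
  apply: hpD; first exact: hpZ.
  case: k IH Hp {kl} => [|k] IH Hp; last by apply: hp_crd; exact: IH.
  rewrite (_ : (fun _ => _) = cst 0); first exact: hp_cst.
  by apply/funext => x; rewrite (hp0_grad x j Hp erefl) !mul0r addr0 mulr0.
rewrite (_ : (fun x => _) = (fun x => (grad p x 0 j + k.+1%:R * crd j x * p x) + (grad q x 0 j + k.+1%:R * crd j x * q x))).
  by apply: hpD; [exact: IHp|exact: IHq].
by apply/funext => x; rewrite (gradD j (spoly_dff x (hp_spoly Hp)) (spoly_dff x (hp_spoly Hq))); ring.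
Qed.

(** The enumeration -1, 1, -2, 2, ... of the nonzero integers. Polynomials of degree k only involve
    the first 2k+1 of them. *)
Definition lam (i : nat) : R := if odd i then (i./2.+1)%:R else - (i./2.+1)%:R.

Definition dec n f := exists F : nat -> nat -> S2 R -> R,
  [/\ forall i, spt (F i), forall i a x, (a < 4)%N -> DR (F i) a x = lam i * F i a x &
      forall a x, (a < 4)%N -> f a x = \sum_(i < n) F i a x].

Lemma decD n f g : dec n f -> dec n g -> dec n (fun a x => f a x + g a x).
Proof.
move=> [F [sF eF fF]] [G [sG eG gG]]; exists (fun i a x => 1 * F i a x + G i a x); split.
- by move=> i; exact: spt_lin.
- by move=> i a x a4; rewrite DR_lin // eF // eG //; ring.
- by move=> a x a4; rewrite fF // gG // -big_split; apply: eq_bigr => i _; rewrite /= mul1r.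
Qed.

Lemma dec_le n m f : (n <= m)%N -> dec n f -> dec m f.
Proof.
move=> nm [F [sF eF fF]]; exists (fun i => if (i < n)%N then F i else (fun=> cst 0)); split.
- by move=> i; case: ifP => // _ a; exact: spoly_cst.
- by move=> i a x a4; case: ifP => _; [exact: eF|rewrite DR0 mulr0].
- move=> a x a4; rewrite fF // (big_ord_widen _ (fun i => F i a x) nm) big_mkcond.
  by apply: eq_bigr => i _; case: ifP.
Qed.

Lemma lam_lt k i : (i < 2 * k.+1 - 3)%N -> (lam i - k.+1%:R) * (lam i + k.+2%:R) != 0.
Proof.
move=> ik; have h : (i./2 < k)%N by rewrite ltn_half_double (leq_trans ik) // leq_subLR -mul2n mulnS leq_add2r.
have h' : (i./2.+1%:R <= k%:R :> R) by rewrite ler_nat.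
have h0 : 0 <= i./2.+1%:R :> R by [].
rewrite -(natr1 k.+1) -(natr1 k) /lam; apply: mulf_neq0; [apply: ltr0_neq0|apply: lt0r_neq0];
  case: ifP => _; move: h' h0; move: (i./2.+1%:R : R) (k%:R : R) => t z h' h0; lra.
Qed.

Lemma lam_odd k : lam (2 * k).+1 = k.+1%:R.
Proof. by rewrite /lam /= mul2n odd_double /= uphalf_double. Qed.

Lemma lam_even k : lam (2 * k) = - k.+1%:R.
Proof. by rewrite /lam mul2n odd_double doubleK. Qed.

(** Solves (D - (k+1)) (D + (k+2)) f = g. The data g only involves eigenvalues of absolute value at
    most k, on which the quadratic is invertible; dividing by it gives a particular solution S. The
    remainder h is annihilated by the quadratic and splits into its two eigenparts. *)
Lemma lagrange k f g : spt f -> dec (2 * k.+1 - 3) g ->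
  (forall a x, (a < 4)%N -> DR (fun b y => k.+2%:R * f b y + DR f b y) a x
     - k.+1%:R * (k.+2%:R * f a x + DR f a x) = g a x) ->
  dec (2 * k).+3 f.
Proof.
move=> sf [F [sF eF fF]] E; set n := (2 * k.+1 - 3)%N in fF.
pose mu i : R := (lam i - k.+1%:R) * (lam i + k.+2%:R).
pose S (b : nat) y := \sum_(i < n) (mu i)^-1 * F i b y.
have sS : spt S by move=> b; apply: spoly_sum => i; exact/spolyZ/sF.
pose h (b : nat) y := -1 * S b y + f b y.
have sh : spt h by exact: spt_lin.
have sDf := spt_DR sf; have sDh := spt_DR sh; have sDS := spt_DR sS.
have hS a x : (a < 4)%N -> DR S a x = \sum_(i < n) (mu i)^-1 * (lam i * F i a x).
  by move=> a4; apply: etrans (DR_sum n (fun i => (mu i)^-1) a x sF) _; apply: eq_bigr => i _; rewrite eF.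
have DRZ c (q : nat -> S2 R -> R) a x : spt q -> DR (fun b y => c * q b y) a x = c * DR q a x.
  move=> sq; rewrite -[RHS]addr0 -(DR0 a x) -DR_lin //; last by move=> b; exact: spoly_cst.
  by congr (DR _ a x); apply/funext => b; apply/funext => y; rewrite addr0.
have hSS a x : (a < 4)%N -> DR (DR S) a x = \sum_(i < n) (mu i)^-1 * (lam i * (lam i * F i a x)).
  move=> a4; rewrite (eq_DR (g := fun b y => \sum_(i < n) (mu i)^-1 * lam i * F i b y)) //; last first.
    by move=> b b4 y; rewrite hS //; apply: eq_bigr => i _; rewrite mulrA.
  by apply: etrans (DR_sum n (fun i => (mu i)^-1 * lam i) a x sF) _; apply: eq_bigr => i _; rewrite eF // -mulrA.
have DDf a x : (a < 4)%N -> DR (DR f) a x = g a x + k.+1%:R * k.+2%:R * f a x - DR f a x.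
  by move=> a4; rewrite -(E a x a4) DR_lin // -!natr1; ring.
have DDh a x : (a < 4)%N -> DR (DR h) a x = k.+1%:R * k.+2%:R * h a x - DR h a x.
  move=> a4; rewrite (eq_DR (g := fun b y => -1 * DR S b y + DR f b y)) //; last by move=> b b4 y; exact: DR_lin.
  rewrite DR_lin // DDf // hSS // [DR h a x]DR_lin // hS // fF // /h /S.
  suff -> : \sum_(i < n) F i a x = \sum_(i < n) (mu i)^-1 * (lam i * (lam i * F i a x)) + \sum_(i < n) (mu i)^-1 * (lam i * F i a x)
    - k.+1%:R * k.+2%:R * \sum_(i < n) (mu i)^-1 * F i a x by ring.
  rewrite mulr_sumr -big_split -sumrB; apply: eq_bigr => i _ /=.
  have m0 : mu i != 0 by exact: lam_lt.
  rewrite [LHS](_ : _ = (mu i)^-1 * ((lam i - k.+1%:R) * (lam i + k.+2%:R)) * F i a x); last by rewrite -/(mu i) mulVf ?mul1r.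
  move: (mu i)^-1 => v; rewrite -!natr1; ring.
(* T is the inverse of the gap between k+1 and -(k+2). The projectors on the two eigenvalues are T
   (D + (k+2)) and T ((k+1) - D), which add up to the identity. *)
pose T : R := (k.+1%:R + k.+2%:R)^-1.
have T1 : T * (k.+1%:R + k.+2%:R) = 1 by rewrite mulVf // -natrD pnatr_eq0.
pose G i : nat -> S2 R -> R := if (i < n)%N then fun b y => (mu i)^-1 * F i b y else
  if i == (2 * k).+1 then fun b y => T * k.+2%:R * h b y + T * DR h b y else
  if i == (2 * k.+1)%N then fun b y => T * k.+1%:R * h b y + - T * DR h b y else fun=> cst 0.
have sl c d : spt (fun b y => c * h b y + d * DR h b y) by move=> b; apply: spolyD; exact: spolyZ.
have lD c d a x : (a < 4)%N -> DR (fun b y => c * h b y + d * DR h b y) a x = c * DR h a x + d * (k.+1%:R * k.+2%:R * h a x - DR h a x).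
  move=> a4; rewrite (@DR_lin c h (fun b y => d * DR h b y) a x sh) ?DRZ ?DDh // => b; exact: spolyZ.
have nk : (n <= (2 * k).+1)%N by rewrite /n mulnS (subnDl 2 _ 1) (leq_trans (leq_subr _ _)).
exists G; split.
- move=> i; rewrite /G; case: ifP => _; first by move=> b; exact/spolyZ/sF.
  by case: ifP => _; [exact: sl|case: ifP => _; [exact: sl|move=> b; exact: spoly_cst]].
- move=> i a x a4; rewrite /G; case: ifP => _; first by rewrite DRZ // eF // mulrCA.
  case: eqP => [->|_]; first by rewrite lD // lam_odd -!natr1; ring.
  case: eqP => [->|_]; first by rewrite lD // lam_even -!natr1; ring.
  by rewrite DR0 mulr0.
- move=> a x a4.
  have fE : f a x = S a x + h a x by rewrite /h; ring.
  have n2 : (2 * k.+1 = (2 * k).+2)%N by rewrite mulnS.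
  rewrite big_ord_recr big_ord_recr /= fE -addrA; congr (_ + _).
    rewrite /S (big_ord_widen _ (fun i => (mu i)^-1 * F i a x) nk) big_mkcond; apply: eq_bigr => i _.
    have i1 := ltn_ord i; rewrite /G; case: ifP => // _; rewrite n2 (ltn_eqF i1).
    by rewrite (ltn_eqF (leq_trans i1 _)).
  rewrite /G n2 !ltnNge nk (leq_trans nk) //= eqxx [(2 * k).+2 == (2 * k).+1](_ : _ = false) ?eqxx; last exact: gtn_eqF.
  rewrite [LHS](_ : _ = T * (k.+1%:R + k.+2%:R) * h a x); [ring|by rewrite T1 mul1r].
Qed.

(** By Euler's identity this is the restriction of the Euclidean Dirac operator applied to the
    homogeneous polynomials themselves, hence of one degree less. *)
Lemma hp_AR k f b : (forall a, hp k.+1 (f a)) -> hp k (fun x => AR f b x + k.+1%:R * GX f b x).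
Proof.
move=> hf; have e c i := hp_euler i (hf c) (erefl k.+1).
pose E i c x := grad (f c) x 0 i + k.+1%:R * crd i x * f c x.
have -> : (fun x => AR f b x + k.+1%:R * GX f b x) =
  (fun x => Gam 1 0 0 (fun c => E 0 c x) b + Gam 0 1 0 (fun c => E 1 c x) b + Gam 0 0 1 (fun c => E 2%:R c x) b).
  by apply/funext => x; rewrite /AR /GX /Gamv /E /crd; move: (b) => [|[|[|c]]] /=; ring.
have hG v1 v2 v3 i : hp k (fun x => Gam v1 v2 v3 (fun c => E i c x) b).
  have z c v : hp k (fun x => v * E i c x) by exact/hpZ/e.
  have zN c v : hp k (fun x => - (v * E i c x)) by under eq_fun do rewrite -mulNr; exact/hpZ/e.
  move: (b) => [|[|[|c]]] /=; repeat apply: hpD; by [exact: z|exact: zN].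
by repeat apply: hpD.
Qed.

(** In degree k+1 let r be the Euclidean Dirac operator of f and g that of r. Then (D + (k+2)) f = -
    gamma(x) r, and applying D - (k+1) to this gives g, of degree k-1. The induction hypothesis
    decomposes g and [lagrange] decomposes f. Constants start the induction, with D = -1. *)
Lemma dec_hp k f : (forall a, hp k (f a)) -> dec (2 * k).+1 f.
Proof.
have [m km] := ubnP k; elim: m k km f => // m IH [|k] km f hf.
  have sf : spt f by move=> a; exact: hp_spoly (hf a).
  have A0 b x : AR f b x = 0.
    rewrite /AR !(eq_Gam _ _ _ _ (fun c _ => hp0_grad x _ (hf c) erefl)).
    by case: b => [|[|[|b]]] /=; ring.
  exists (fun i => if i == 0%N then f else fun=> cst 0); split.
  - by move=> i; case: ifP => // _ a; exact: spoly_cst.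
  - move=> i a x a4; case: eqP => [->|_]; last by rewrite DR0 mulr0.
    rewrite /DR (eq_GX (g := fun=> cst 0)) /lam => [|b _]; last exact: A0.
    by move: (a) (f a x) => [|[|[|c]]] t; rewrite /GX /Gamv /=; ring.
  - by move=> a x a4; rewrite big_ord_recl big_ord0 addr0.
have sf : spt f by move=> a; exact: hp_spoly (hf a).
pose r b y := AR f b y + k.+1%:R * GX f b y.
have hr b : hp k (r b) by exact: hp_AR.
have sr : spt r by move=> b; exact: hp_spoly (hr b).
pose g b y := AR r b y + k%:R * GX r b y.
have dg : dec (2 * k.+1 - 3) g.
  (* In degree 1 the truncated difference 2 * 1 - 3 is 0; accordingly r is constant and g
     vanishes. *)
  case: k @r @g km hf hr sr => [|k] r g km hf hr sr.
    exists (fun=> fun=> cst 0); split.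
    - by move=> i b; exact: spoly_cst.
    - by move=> i a x a4; rewrite DR0 mulr0.
    - move=> a x a4; rewrite big_ord0 /g mul0r addr0 /AR !(eq_Gam _ _ _ _ (fun c _ => hp0_grad x _ (hr c) erefl)).
      by case: (a) => [|[|[|b]]] /=; ring.
  rewrite (_ : (2 * k.+2 - 3 = (2 * k).+1)%N); last by rewrite !mulnS !addSn !add0n !subSS subn0.
  by apply: IH => [|a]; [rewrite -ltnS ltnW|exact: hp_AR].
rewrite mulnS; apply: (lagrange sf dg) => a x a4.
have E b y : (b < 4)%N -> k.+2%:R * f b y + DR f b y = -1 * GX r b y.
  move=> b4; rewrite /r (eq_GX (g := fun c z => k.+1%:R * GX f c z + AR f c z)) => [|c _]; last exact: addrC.
  by rewrite GX_lin GX2 // /DR -(natr1 k.+1); ring.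
have s0 : spt (fun=> cst 0 : S2 R -> R) by move=> b; exact: spoly_cst.
rewrite E // (eq_DR (g := fun b y => -1 * GX r b y + cst 0 y)) //; last by move=> b b4 y; rewrite E // addr0.
by rewrite (DR_lin _ _ _ (spt_GX sr) s0) DR0 (DR_GX x a4 sr) /g -(natr1 k); ring.
Qed.

(** [wp] only bounds the degree; sums of homogeneous pieces of arbitrary degrees are the form to
    which [dec_hp] applies. *)
Inductive hs : (S2 R -> R) -> Prop :=
| hs_hp k p : hp k p -> hs p
| hsD p q : hs p -> hs q -> hs (fun x => p x + q x).

Definition slot c p (a : nat) x : R := if a == c then p x else 0.

Lemma spoly_dec p c : spoly p -> exists n, dec n (slot c p).
Proof.
pose Q p := forall c, exists n, dec n (slot c p).
have QD p1 p2 : Q p1 -> Q p2 -> Q (fun x => p1 x + p2 x).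
  move=> Q1 Q2 d; have [n1 h1] := Q1 d; have [n2 h2] := Q2 d; exists (maxn n1 n2).
  have := decD (dec_le (leq_maxl _ _) h1) (dec_le (leq_maxr _ _) h2).
  by congr (dec _ _); apply/funext => a; apply/funext => x; rewrite /slot; case: ifP; rewrite ?addr0.
have hp00 k : hp k (cst (0 : R)).
  elim: k => [|k IH]; first exact: hp_cst.
  rewrite (_ : cst 0 = (fun x => crd 0 x * cst 0 x)); first exact: hp_crd.
  by apply/funext => x; rewrite mulr0.
have Qhp k q : hp k q -> Q q.
  move=> hq d; exists (2 * k).+1; apply: dec_hp => a; have [->|ad] := eqVneq a d.
    by rewrite (_ : slot d q d = q) //; apply/funext => x; rewrite /slot eqxx.
  by rewrite (_ : slot d q a = cst 0) //; apply/funext => x; rewrite /slot (negbTE ad).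
suff H k q : wp k q -> hs q.
  move=> [k /H]; move: c => c0 h; move: c0; elim: h => {p} [l q Hq|q1 q2 _ I1 _ I2]; first exact: Qhp Hq.
  exact: QD.
elim=> {k q} [d|k i q _ IH|k q1 q2 _ I1 _ I2|//].
- exact: hs_hp (hp_cst d).
- elim: IH => {q} [l q Hq|q1 q2 _ I1 _ I2]; first exact: hs_hp (hp_crd i Hq).
  by under eq_fun do rewrite mulrDr; exact: hsD.
- exact: hsD.
Qed.

Lemma spt_dec f : spt f -> exists n, dec n f.
Proof.
move=> sf; have [n0 d0] := spoly_dec 0 (sf 0%N); have [n1 d1] := spoly_dec 1 (sf 1%N).
have [n2 d2] := spoly_dec 2 (sf 2%N); have [n3 d3] := spoly_dec 3 (sf 3%N).
exists (maxn (maxn n0 n1) (maxn n2 n3)).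
have D01 := decD (dec_le (leq_maxl n0 n1) d0) (dec_le (leq_maxr n0 n1) d1).
have D23 := decD (dec_le (leq_maxl n2 n3) d2) (dec_le (leq_maxr n2 n3) d3).
have [F [sF eF fF]] := decD (dec_le (leq_maxl _ (maxn n2 n3)) D01) (dec_le (leq_maxr (maxn n0 n1) _) D23).
exists F; split => // a x a4; rewrite -fF // /slot.
by case: a a4 => [|[|[|[|//]]]] _ /=; rewrite ?addr0 ?add0r.
Qed.

End dirac_decomposition.

(** * Symmetry of the Dirac operator on polynomial spinors *)

Section dirac_symmetry.
Variable R : realType.
Implicit Types (x : S2 R) (f g : nat -> S2 R -> R) (r s : nat -> R) (p q : S2 R -> R).

Definition ip r s : R := r 0%N * s 0%N + r 1%N * s 1%N + r 2%N * s 2%N + r 3%N * s 3%N.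

Lemma ip_Leibniz r s r' s' : r 0%N * s' 0%N + s 0%N * r' 0%N + (r 1%N * s' 1%N + s 1%N * r' 1%N)
  + (r 2%N * s' 2%N + s 2%N * r' 2%N) + (r 3%N * s' 3%N + s 3%N * r' 3%N) = ip r' s + ip r s'.
Proof. rewrite /ip; ring. Qed.

Definition ipf f g x : R := ip (fun a => f a x) (fun a => g a x).

Lemma spoly_ipf f g : spt f -> spt g -> spoly (ipf f g).
Proof.
move=> sf sg; have m a : spoly (fun x => f a x * g a x) by exact: spolyM.
by repeat apply: spolyD; exact: m.
Qed.

Lemma grad_ipf f g x i : spt f -> spt g ->
  grad (ipf f g) x 0 i = ip (fun a => grad (f a) x 0 i) (fun a => g a x) + ip (fun a => f a x) (fun a => grad (g a) x 0 i).
Proof.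
move=> sf sg; have m a : spoly (fun y => f a y * g a y) by exact: spolyM.
have dm a := spoly_dff x (m a).
have E a : grad (fun y => f a y * g a y) x 0 i = f a x * grad (g a) x 0 i + g a x * grad (f a) x 0 i.
  exact: (gradM i (spoly_dff x (sf a)) (spoly_dff x (sg a))).
have d01 := dffD (dm 0%N) (dm 1%N); have d012 := dffD d01 (dm 2%N).
have G1 := gradD i d01 (dm 2%N); have G0 := gradD i (dm 0%N) (dm 1%N).
apply: (etrans (gradD i d012 (dm 3%N))).
apply: (etrans (congr2 +%R (etrans G1 (congr2 +%R (etrans G0 (congr2 +%R (E 0%N) (E 1%N))) (E 2%N))) (E 3%N))).
exact: ip_Leibniz.
Qed.

Lemma grad_Gam (v1 v2 v3 : R) f b x i : spt f ->
  grad (fun y => Gam v1 v2 v3 (fun c => f c y) b) x 0 i = Gam v1 v2 v3 (fun c => grad (f c) x 0 i) b.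
Proof.
move=> sf.
have E c k m (s1 s2 s3 : R) : grad (fun y => s1 * f c y + (s2 * f k y + (s3 * f m y + cst 0 y))) x 0 i =
   s1 * grad (f c) x 0 i + (s2 * grad (f k) x 0 i + s3 * grad (f m) x 0 i).
  have s0 := spoly_cst (0 : R); have s4 := spolyD (spolyZ s3 (sf m)) s0.
  have s5 := spolyD (spolyZ s2 (sf k)) s4.
  apply: (etrans (gradZD _ _ _ (sf _) s5)); congr (_ * _ + _).
  apply: (etrans (gradZD _ _ _ (sf _) s4)); congr (_ * _ + _).
  by apply: (etrans (gradZD _ _ _ (sf _) s0)); rewrite grad_cst addr0.
case: b => [|[|[|b]]] /=.
- apply: etrans (etrans (E 1%N 2%N 3%N (- v3) v2 (- v1)) _); last by ring.
  by congr (grad _ x 0 i); apply/funext => y /=; ring.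
- apply: etrans (etrans (E 0%N 2%N 3%N v3 v1 v2) _); last by ring.
  by congr (grad _ x 0 i); apply/funext => y /=; ring.
- apply: etrans (etrans (E 0%N 1%N 3%N (- v2) (- v1) v3) _); last by ring.
  by congr (grad _ x 0 i); apply/funext => y /=; ring.
- apply: etrans (etrans (E 0%N 1%N 2%N v1 (- v2) (- v3)) _); last by ring.
  by congr (grad _ x 0 i); apply/funext => y /=; ring.
Qed.

(** The field whose divergence is <f, D g> - <D f, g>. The term x_i <f, g> makes it tangent:
    contracted with x, the first term gives <f, gamma(x) gamma(x) g> = - <f, g>. *)
Definition dirac_flux f g x : 'rV[R]_3 :=
  \row_(i < 3) (ipf f (fun a y => Gam (i == 0)%:R (i == 1)%:R (i == 2%:R)%:R (fun c => GX g c y) a) x + crd i x * ipf f g x).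

Lemma ip_gamma (x0 x1 x2 : R) (d0 d1 d2 s : nat -> R) :
  ip d0 (Gam 1 0 0 (Gam x0 x1 x2 s)) + ip d1 (Gam 0 1 0 (Gam x0 x1 x2 s)) + ip d2 (Gam 0 0 1 (Gam x0 x1 x2 s)) =
  ip (Gam x0 x1 x2 (fun c => Gam 1 0 0 d0 c + Gam 0 1 0 d1 c + Gam 0 0 1 d2 c)) s.
Proof. rewrite /ip /=; ring. Qed.

Lemma eq_ip r r' s s' : (forall a, (a < 4)%N -> r a = r' a) -> (forall a, (a < 4)%N -> s a = s' a) -> ip r s = ip r' s'.
Proof. by move=> E E'; rewrite /ip !E ?E'. Qed.

Lemma flux_sum (x0 x1 x2 : R) (r s d0 d1 d2 e0 e1 e2 X F : nat -> R) (I0 I1 I2 J0 J1 J2 : R) :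
  x0 ^+ 2 + x1 ^+ 2 + x2 ^+ 2 = 1 ->
  (forall b, x0 * d0 b + x1 * d1 b + x2 * d2 b = 0) -> (forall b, x0 * e0 b + x1 * e1 b + x2 * e2 b = 0) ->
  I0 + I1 + I2 = ip r (fun a => - 2 * s a + - 1 * X a) -> J0 + J1 + J2 = ip F s ->
  (J0 + I0 + (x0 * (ip d0 s + ip r e0) + ip r s * (1 - x0 * x0)))
  + (J1 + I1 + (x1 * (ip d1 s + ip r e1) + ip r s * (1 - x1 * x1)))
  + (J2 + I2 + (x2 * (ip d2 s + ip r e2) + ip r s * (1 - x2 * x2)))
  = ip r (fun a => - X a - s a) - ip (fun a => - F a - r a) s.
Proof.
move=> n1 fr gr H1 H2.
rewrite [LHS](_ : _ = (J0 + J1 + J2) + (I0 + I1 + I2)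
  + ((x0 * ip d0 s + x1 * ip d1 s + x2 * ip d2 s) + (x0 * ip r e0 + x1 * ip r e1 + x2 * ip r e2))
  + ip r s * (3 - (x0 ^+ 2 + x1 ^+ 2 + x2 ^+ 2))); last by clear; ring.
have -> : x0 * ip d0 s + x1 * ip d1 s + x2 * ip d2 s = ip (fun b => x0 * d0 b + x1 * d1 b + x2 * d2 b) s.
  by clear; rewrite /ip; ring.
have -> : x0 * ip r e0 + x1 * ip r e1 + x2 * ip r e2 = ip r (fun b => x0 * e0 b + x1 * e1 b + x2 * e2 b).
  by clear; rewrite /ip; ring.
rewrite H1 H2 n1 (eq_ip (fun a _ => fr a) (fun _ _ => erefl)) (eq_ip (fun _ _ => erefl) (fun a _ => gr a)).
by clear; rewrite /ip; ring.
Qed.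

Lemma div_dirac_flux f g x : spt f -> spt g ->
  div (dirac_flux f g) x = ipf f (DR g) x - ipf (DR f) g x.
Proof.
move=> sf sg; have sG := spt_GX sg.
pose W (i : 'I_3) := fun (a : nat) y => Gam (i == 0)%:R (i == 1)%:R (i == 2%:R)%:R (fun c => GX g c y) a.
have sW i : spt (W i) by move=> a; exact: spt_Gam.
have scg i : spoly (fun y => crd i y * ipf f g y) by apply: spolyM (spoly_crd _ i) (spoly_ipf sf sg).
have gE i : grad (fun y => dirac_flux f g y 0 i) x 0 i =
    ip (fun a => grad (f a) x 0 i) (fun a => W i a x)
    + ip (fun a => f a x) (fun a => Gam (i == 0)%:R (i == 1)%:R (i == 2%:R)%:R (fun c => grad (GX g c) x 0 i) a)
    + (pt x 0 i * (ip (fun a => grad (f a) x 0 i) (fun a => g a x) + ip (fun a => f a x) (fun a => grad (g a) x 0 i))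
       + ipf f g x * (1 - pt x 0 i * pt x 0 i)).
  have -> : (fun y => dirac_flux f g y 0 i) = (fun y => ipf f (W i) y + crd i y * ipf f g y) by apply/funext => y; rewrite mxE.
  apply: (etrans (gradD i (spoly_dff x (spoly_ipf sf (sW i))) (spoly_dff x (scg i)))).
  congr (_ + _).
    apply: (etrans (grad_ipf x i sf (sW i))); congr (_ + _); apply: eq_ip => a _; first by [].
    exact: grad_Gam.
  apply: (etrans (gradM i (dff_crd i x) (spoly_dff x (spoly_ipf sf sg)))).
  by congr (_ * _ + _ * _); [exact: grad_ipf|rewrite grad_crd eqxx].
apply: (etrans (sum3 _)); apply: (etrans (congr2 +%R (congr2 +%R (gE _) (gE _)) (gE _))).
apply: (flux_sum (sum_crd2 x) _ _ _ _) => [b|b||].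
- by have := grad_radial (spoly_dff x (sf b)); rewrite sum3.
- by have := grad_radial (spoly_dff x (sg b)); rewrite sum3.
- have ipD r s s' : ip r (fun a => s a + s' a) = ip r s + ip r s' by clear; rewrite /ip; ring.
  by apply: etrans (esym (etrans (ipD _ _ _) (congr2 +%R (ipD _ _ _) erefl))) _; apply: eq_ip => // a a4; exact: AR_GX.
- exact: ip_gamma.
Qed.

Lemma dirac_symmetric f g : spt f -> spt g ->
  \int[@dv R]_x ipf f (DR g) x = \int[@dv R]_x ipf (DR f) g x.
Proof.
move=> sf sg.
have i1 : (@dv R).-integrable setT (EFin \o ipf f (DR g)) by exact/Ck0_integrable/spoly_Ck/spoly_ipf/spt_DR.
have i2 : (@dv R).-integrable setT (EFin \o ipf (DR f) g) by apply/Ck0_integrable/spoly_Ck/spoly_ipf => //; exact: spt_DR.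
apply/eqP; rewrite -subr_eq0 -(RintegralB measurableT i1 i2).
rewrite -(eq_RI (fun x => div_dirac_flux x sf sg)) divergence_theorem // => [x|i].
  rewrite /dot sum3 !mxE /ipf /crd /= /GX /Gamv.
  rewrite /ip /=; ring.
rewrite (_ : (fun y => _) = (fun y => ipf f (fun a y => Gam (i == 0)%:R (i == 1)%:R (i == 2%:R)%:R (fun c => GX g c y) a) y + crd i y * ipf f g y));
  last by apply/funext => y; rewrite mxE.
apply/spoly_Ck/spolyD; first by apply: spoly_ipf => // a; exact/spt_Gam/spt_GX.
exact: spolyM (spoly_crd _ i) (spoly_ipf sf sg).
Qed.

Lemma dirac_orthogonal f g (l m : R) : spt f -> spt g -> l != m ->
  (forall a x, (a < 4)%N -> DR f a x = l * f a x) -> (forall a x, (a < 4)%N -> DR g a x = m * g a x) ->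
  \int[@dv R]_x ipf f g x = 0.
Proof.
move=> sf sg lm ef eg; have i0 : (@dv R).-integrable setT (EFin \o ipf f g) by exact/Ck0_integrable/spoly_Ck/spoly_ipf.
have := dirac_symmetric sf sg.
rewrite (eq_RI (g := fun x => m * ipf f g x)) => [|x]; last by rewrite /ipf /ip !eg //; ring.
rewrite [in RHS](eq_RI (g := fun x => l * ipf f g x)) => [|x]; last by rewrite /ipf /ip !ef //; ring.
rewrite !(RintegralZl _ measurableT i0) => /eqP; rewrite -subr_eq0 -mulrBl mulf_eq0 subr_eq0 [m == l]eq_sym (negbTE lm) /=.
by move/eqP.
Qed.

End dirac_symmetry.

(** * Estimate of |D|^{1/2} psi *)

Section absdirac.
Local Open Scope complex_scope.
Variable R : realType.
Implicit Types (x : S2 R) (f g E F Psi : nat -> S2 R -> R) (psi eta : spinor R).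
Local Notation mu := (@dv R).
Local Notation meas f := (measurable_fun [set: S2 R] f).

Definition mk (r : nat -> R) : 'cV[R[i]]_2 :=
  \col_a (if a == 0 then r 0%N +i* r 1%N else r 2%N +i* r 3%N).

Lemma cmp_mk (r : nat -> R) a : (a < 4)%N -> cmp (mk r) a = r a.
Proof. by case: a => [|[|[|[|//]]]] _; rewrite /cmp /mk mxE. Qed.

Lemma Re_herm (z w : 'cV[R[i]]_2) : complex.Re (herm z w) = ip (cmp z) (cmp w).
Proof.
rewrite /herm sum2 /ip /cmp; case: (z 0 0) => a b; case: (w 0 0) => c d.
by case: (z 1 0) => a' b'; case: (w 1 0) => c' d' /=; ring.
Qed.

Lemma snorm2 (z : 'cV[R[i]]_2) : snorm z ^+ 2 = ip (cmp z) (cmp z).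
Proof. by rewrite /snorm Re_herm sqr_sqrtr // /ip !addr_ge0 // -expr2 sqr_ge0. Qed.

Lemma dirac_mk f (l : R) : spt f -> (forall a x, (a < 4)%N -> DR f a x = l * f a x) ->
  smooth_spinor (fun x => mk (fun a => f a x)) /\
  forall x, Defs.dirac (fun y => mk (fun a => f a y)) x = l%:C *: mk (fun a => f a x).
Proof.
move=> sf ef; have E b : (b < 4)%N -> (fun y => cmp (mk (fun a => f a y)) b) = f b.
  by move=> b4; apply/funext => y; exact: cmp_mk.
have sm b : smooth (f b) by move=> k; exact: spoly_Ck.
split.
  move=> a; have [->|->] : a = 0 \/ a = 1 by case: a => [[|[|//]] ?]; [left|right]; exact: val_inj.
    have := E 0%N isT; have := E 1%N isT; rewrite /cmp => -> ->; split; exact: sm.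
  have := E 2%N isT; have := E 3%N isT; rewrite /cmp => -> ->; split; exact: sm.
move=> x; apply: cmp_inj => a a4; rewrite cmpZ cmp_mk // -ef // cmp_dirac //.
  by apply: eq_DR => // b b4 y; rewrite cmp_mk.
by move=> b y b4; rewrite (E b b4); exact: spoly_dff.
Qed.

Definition L2t f := forall a, meas (f a) /\ mu.-integrable setT (EFin \o (fun x => f a x ^+ 2)).

Lemma spt_L2t f : spt f -> L2t f.
Proof.
move=> sf a; split; first exact: spoly_meas.
apply/Ck0_integrable/(spoly_Ck 0); under eq_fun do rewrite expr2; exact: spolyM.
Qed.

Lemma L2t_ipf f g : L2t f -> L2t g -> mu.-integrable setT (EFin \o ipf f g).
Proof.
move=> lf lg; have h a : mu.-integrable setT (EFin \o (fun x => f a x * g a x)).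
  by have [mf f2] := lf a; have [mg g2] := lg a; exact: integrable_sq_mul.
exact: (integrableD measurableT (integrableD measurableT (integrableD measurableT (h 0%N) (h 1%N)) (h 2%N)) (h 3%N)).
Qed.

Definition I2 f g : R := \int[mu]_x ipf f g x.

Lemma I2C f g : I2 f g = I2 g f.
Proof. by apply: eq_RI => x; rewrite /ipf /ip; ring. Qed.

Lemma I2_ge0 f : 0 <= I2 f f.
Proof. by apply: Rintegral_ge0 => x _; rewrite /ipf /ip !addr_ge0 // -expr2 sqr_ge0. Qed.

Lemma I2_lin (c : R) f g h : L2t f -> L2t g -> L2t h ->
  I2 h (fun a x => c * f a x + g a x) = c * I2 h f + I2 h g.
Proof.
move=> lf lg lh; have i1 := L2t_ipf lh lf; have i2 := L2t_ipf lh lg.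
rewrite /I2 (eq_RI (g := fun x => c * ipf h f x + ipf h g x)) => [|x]; last by rewrite /ipf /ip; ring.
by rewrite (RintegralD measurableT (integrableZl measurableT c i1) i2) (RintegralZl _ measurableT i1).
Qed.

Lemma I2_sum n (c : nat -> R) (G : nat -> nat -> S2 R -> R) h : (forall i, spt (G i)) -> L2t h ->
  I2 h (fun a x => \sum_(i < n) c i * G i a x) = \sum_(i < n) c i * I2 h (G i).
Proof.
move=> sG lh; elim: n => [|n IH].
  rewrite big_ord0 /I2 (eq_RI (g := cst 0)) ?Rintegral_cst ?mul0r // => x.
  by rewrite /ipf /ip !big_ord0 !mulr0 !addr0.
rewrite big_ord_recr /= -IH addrC -I2_lin //; last 2 first.
- exact/spt_L2t.
- by apply: spt_L2t => a; apply: spoly_sum => i; exact/spolyZ/sG.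
by apply: eq_RI => x; rewrite /ipf; apply: eq_ip => // a _; rewrite big_ord_recr /= addrC.
Qed.

Lemma L2t_lin c f g : L2t f -> L2t g -> L2t (fun a x => c * f a x + g a x).
Proof.
move=> lf lg a; have [mf f2] := lf a; have [mg g2] := lg a.
have mfg : meas (fun x => c * f a x + g a x) by apply: measurable_funD => //; exact: measurable_funM.
split => //; apply: (le_integrable measurableT _ _ (integrableD measurableT (integrableZl measurableT (2 * c ^+ 2) f2) (integrableZl measurableT 2 g2))).
  by apply/measurable_EFinP; exact: measurable_funX.
move=> x _ /=; rewrite lee_fin ger0_norm ?sqr_ge0 // [leRHS]ger0_norm; first by have := sqr_ge0 (c * f a x - g a x); nra.
by have := sqr_ge0 (c * f a x); have := sqr_ge0 (g a x); rewrite exprMn; lra.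
Qed.

Lemma I2_sqB f g : L2t f -> L2t g ->
  I2 (fun a x => -1 * f a x + g a x) (fun a x => -1 * f a x + g a x) = I2 f f - 2 * I2 g f + I2 g g.
Proof.
move=> lf lg; have lh := L2t_lin (-1) lf lg.
rewrite (I2_lin (-1) lf lg lh) (I2C _ f) (I2C _ g) (I2_lin (-1) lf lg lf) (I2_lin (-1) lf lg lg) (I2C f g); ring.
Qed.

Lemma Rintegral_le_EFin (f : S2 R -> R) (c : R) : mu.-integrable setT (EFin \o f) ->
  (\int[mu]_x (f x)%:E <= c%:E)%E -> \int[mu]_x f x <= c.
Proof. by move=> fi fc; rewrite -lee_fin /Rintegral fineK //; exact: integrable_fin_num. Qed.

Lemma lam_inj i j : lam R i = lam R j -> i = j.
Proof.
move=> h; have [oij hij] : odd i = odd j /\ i./2 = j./2; last by rewrite -(odd_double_half i) oij hij odd_double_half.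
have pi : 0 < i./2.+1%:R :> R by rewrite ltr0n.
have pj : 0 < j./2.+1%:R :> R by rewrite ltr0n.
move: h pi pj; rewrite /lam; case: (odd i); case: (odd j).
- by move/eqP; rewrite eqr_nat => /eqP[->].
- by move: (i./2.+1%:R : R) (j./2.+1%:R : R) => u v E u0 v0; exfalso; lra.
- by move: (i./2.+1%:R : R) (j./2.+1%:R : R) => u v E u0 v0; exfalso; lra.
- by move/oppr_inj/eqP; rewrite eqr_nat => /eqP[->].
Qed.

(* [|D|^{1/2} / D] is a contraction because every eigenvalue of [D] has absolute value at least 1. *)
Lemma contraction E F Psi : L2t E -> L2t F -> L2t Psi ->
  (forall f (l : R), spt f -> (forall a x, (a < 4)%N -> DR f a x = l * f a x) ->
     I2 E f = Num.sqrt `|l| * I2 Psi f /\ l * I2 Psi f = I2 F f) ->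
  I2 E E <= I2 F F.
Proof.
move=> lE lF lPsi H; apply/ler_addgt0Pr => e e0.
have e4 : 0 < e / 4 by rewrite divr_gt0.
(* E is only approximated in L^2 by a polynomial p, and the finite decomposition of p is used; no
   eigenfunction expansion of E is formed. *)
have ap a : exists2 p, spoly p & (\int[mu]_x ((E a x - p x) ^+ 2)%:E <= (e / 4)%:E)%E.
  by have [mE E2] := lE a; have [_ /(_ _ e4)] := L2appr_L2 mE E2.
pose p a := projT1 (cid2 (ap a)).
have sp : spt p by move=> a; rewrite /p; case: cid2.
have Ep a : (\int[mu]_x ((E a x - p a x) ^+ 2)%:E <= (e / 4)%:E)%E by rewrite /p; case: cid2.
have lp := spt_L2t sp.
have [n [G [sG eG pG]]] := spt_dec sp.
(* The hypothesis gives <E, G_i> = s_i <F, G_i>, so q satisfies <E, p> = <F, q>, and |s_i| <= 1 with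
   orthogonality gives |q| <= |p|. Then |E|^2 <= e + 2 <E, p> - |p|^2 <= e + 2 <F, q> - |q|^2 <= e +
   |F|^2. *)
pose s i := Num.sqrt `|lam R i| / lam R i.
have l1 i : 1 <= `|lam R i|.
  by rewrite /lam; case: ifP => _; rewrite ?normrN ger0_norm // ler1n.
have s1 i : s i ^+ 2 <= 1.
  have l0 : 0 < `|lam R i| by apply: lt_le_trans (l1 i).
  rewrite /s expr_div_n sqr_sqrtr // -[lam R i ^+ 2]real_normK ?num_real //.
  by rewrite ler_pdivrMr ?exprn_gt0 // mul1r expr2 ler_peMl // ltW.
pose q a x := \sum_(i < n) s i * G i a x.
have sq : spt q by move=> a; apply: spoly_sum => i; exact/spolyZ/sG.
have lq := spt_L2t sq.
have lG i := spt_L2t (sG i).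
have pE h : L2t h -> I2 h p = \sum_(i < n) I2 h (G i).
  move=> lh; have := I2_sum n (fun=> 1) sG lh; under [X in _ = X]eq_bigr do rewrite mul1r.
  move=> <-; apply: eq_RI => x; rewrite /ipf; apply: eq_ip => // a a4.
  by rewrite pG //; apply: eq_bigr => i _; rewrite mul1r.
have E1 : I2 E p = I2 F q.
  rewrite pE // (I2_sum n s sG lF); apply: eq_bigr => i _.
  have [-> <-] := H (G i) (lam R i) (sG i) (eG i).
  by rewrite mulrA /s mulfVK // -normr_gt0 (lt_le_trans _ (l1 i)).
have ort i j : i != j -> I2 (G i) (G j) = 0.
  move=> ij; apply: (dirac_orthogonal (sG i) (sG j) _ (eG i) (eG j)).
  by apply: contra_neq ij; exact: lam_inj.
have E2 : I2 q q <= I2 p p.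
  rewrite (pE p lp) (I2_sum n s sG lq); apply: ler_sum => i _.
  rewrite (I2C q) (I2C p) (pE _ (lG i)) (I2_sum n s sG (lG i)).
  rewrite (bigD1 i) //= [in leRHS](bigD1 i) //= !big1 ?addr0 => [|j ji|j ji]; last 2 first.
  - by rewrite ort // eq_sym.
  - by rewrite ort ?mulr0 // eq_sym.
  by rewrite mulrA -expr2 ler_piMl // I2_ge0.
have lEp := L2t_lin (-1) lp lE; have lFq := L2t_lin (-1) lq lF.
have E3 : I2 (fun a x => -1 * p a x + E a x) (fun a x => -1 * p a x + E a x) <= e.
  have h a : mu.-integrable setT (EFin \o (fun x => (-1 * p a x + E a x) * (-1 * p a x + E a x))).
    by have [m1 i1] := lEp a; exact: integrable_sq_mul.
  have hl a : \int[mu]_x ((-1 * p a x + E a x) * (-1 * p a x + E a x)) <= e / 4.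
    apply: Rintegral_le_EFin (h a) _; apply: le_trans (Ep a); rewrite le_eqVlt; apply/orP; left; apply/eqP.
    by apply: eq_integral => x _; congr EFin; ring.
  have h01 := integrableD measurableT (h 0%N) (h 1%N); have h012 := integrableD measurableT h01 (h 2%N).
  rewrite /I2 /ipf /ip (RintegralD measurableT h012 (h 3%N)) (RintegralD measurableT h01 (h 2%N)) (RintegralD measurableT (h 0%N) (h 1%N)).
  by have := hl 0%N; have := hl 1%N; have := hl 2%N; have := hl 3%N; lra.
have E4 := I2_sqB lp lE; rewrite E4 in E3.
have E5 := I2_ge0 (fun a x => -1 * q a x + F a x); rewrite (I2_sqB lq lF) in E5.
move: E3 E5 E1 E2; move: (I2 _ _) (I2 _ _) (I2 _ _) => *; lra.
Qed.

Definition cpt psi (a : nat) x : R := cmp (psi x) a.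

Lemma measurable_snorm psi : measurable_spinor psi -> meas (fun x => snorm (psi x)).
Proof.
move=> mpsi; have mc a : meas (cpt psi a).
  by move: a => [|[|[|a]]]; rewrite /cpt /cmp; have [] := mpsi 0; have [] := mpsi 1.
rewrite /snorm; apply: (@measurableT_comp _ _ _ _ _ _ (@Num.sqrt R)).
  by apply: continuous_measurable_fun; exact: sqrt_continuous.
under eq_fun do rewrite Re_herm /ip; have mm a := measurable_funM (mc a) (mc a).
exact: (measurable_funD (measurable_funD (measurable_funD (mm 0%N) (mm 1%N)) (mm 2%N)) (mm 3%N)).
Qed.

Lemma L2_snorm psi : L2_spinor psi -> L2 (fun x => snorm (psi x)).
Proof. by move=> [mpsi lpsi]; split => //; exact: measurable_snorm. Qed.

Lemma L2_spinor_cpt psi : L2_spinor psi -> L2t (cpt psi).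
Proof.
move=> lpsi a; have mpsi := lpsi.1; have i2 := L2_integrable_sq (L2_snorm lpsi).
have mc : meas (cpt psi a).
  by move: a => [|[|[|a]]]; rewrite /cpt /cmp; have [] := mpsi 0; have [] := mpsi 1.
split => //; apply: (le_integrable measurableT _ _ i2).
  by apply/measurable_EFinP; exact: measurable_funX.
move=> x _ /=; rewrite lee_fin !ger0_norm ?sqr_ge0 // snorm2 /ip /cpt.
have := sqr_ge0 (cmp (psi x) 0); have := sqr_ge0 (cmp (psi x) 1).
have := sqr_ge0 (cmp (psi x) 2); have := sqr_ge0 (cmp (psi x) 3); rewrite !expr2.
by case: a mc => [|[|[|a]]] _ /=; lra.
Qed.

Lemma I2_cpt psi : I2 (cpt psi) (cpt psi) = \int[mu]_x snorm (psi x) ^+ 2.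
Proof. by apply: eq_RI => x; rewrite snorm2. Qed.

Lemma Re_scale (c : R) (z : R[i]) : complex.Re (c%:C * z) = c * complex.Re z.
Proof. by case: z => a b /=; ring. Qed.

(** The weak equation says D psi = w psi, so [contraction] applies with F = w psi. Real parts of the
    pairings suffice, since the four real components carry the whole L^2 norm. *)
Lemma absdirac_half_bound psi eta (w : S2 R -> R) (M : R) : meas w -> (forall x, `|w x| <= M) ->
  L2_spinor psi -> is_absdirac_half psi eta ->
  (forall phi, smooth_spinor phi -> \int[mu]_x complex.Re (herm (psi x) (Defs.dirac phi x)) =
     \int[mu]_x complex.Re ((w x)%:C * herm (psi x) (phi x))) ->
  \int[mu]_x snorm (eta x) ^+ 2 <= M ^+ 2 * \int[mu]_x snorm (psi x) ^+ 2.
Proof.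
move=> mw wM lpsi [leta Heta] weak; rewrite -!I2_cpt.
have lE := L2_spinor_cpt leta; have lP := L2_spinor_cpt lpsi.
have w2 x : w x ^+ 2 <= M ^+ 2.
  by rewrite -[w x ^+ 2]real_normK ?num_real // ler_pXn2r // ?nnegrE // (le_trans _ (wM x)).
pose F a x := w x * cpt psi a x.
have lF : L2t F.
  move=> a; have [mp ip2] := lP a; have mF : meas (F a) by exact: measurable_funM.
  split => //; apply: (le_integrable measurableT _ _ (integrableZl measurableT (M ^+ 2) ip2)).
    by apply/measurable_EFinP; exact: measurable_funX.
  move=> x _ /=; rewrite lee_fin ger0_norm ?sqr_ge0 // [leRHS]ger0_norm; last by rewrite mulr_ge0 ?sqr_ge0.
  by rewrite /F exprMn ler_wpM2r ?sqr_ge0 // w2.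
apply: (@le_trans _ _ (I2 F F)).
  apply: (contraction lE lF lP) => f l sf ef.
  have [sm dm] := dirac_mk sf ef; set phi := (fun x => mk (fun a => f a x)) in sm dm.
  have ipE z x : complex.Re (herm z (phi x)) = ip (cmp z) (fun a => f a x).
    by rewrite Re_herm; apply: eq_ip => // a a4; rewrite cmp_mk.
  split.
    have /(congr1 (@complex.Re R)) := Heta l phi sm dm; rewrite Re_scale /=.
    by rewrite (eq_RI (fun x => ipE _ x)) (eq_RI (fun x => ipE _ x)).
  have := weak phi sm.
  rewrite (eq_RI (g := fun x => l * ipf (cpt psi) f x)) => [|x]; last first.
    rewrite dm Re_herm /ipf /ip !cmpZ !cmp_mk //; rewrite /cpt; ring.
  rewrite (RintegralZl _ measurableT (L2t_ipf lP (spt_L2t sf))) => ->.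
  by apply: eq_RI => x; rewrite Re_scale ipE /ipf /ip /F /cpt; ring.
rewrite -(RintegralZl _ measurableT (L2t_ipf lP lP)).
apply: le_Rintegral => //; first exact: L2t_ipf.
- exact: (integrableZl measurableT (M ^+ 2) (L2t_ipf lP lP)).
move=> x _; rewrite [leLHS](_ : _ = w x ^+ 2 * ipf (cpt psi) (cpt psi) x); last by rewrite /ipf /ip /F; ring.
rewrite ler_wpM2r //; first by rewrite /ipf /ip !addr_ge0 // -expr2 sqr_ge0.
Qed.

End absdirac.

(** * From weak solutions to uniform estimates *)

Section uniform_bound.
Local Open Scope complex_scope.
Variable R : realType.
Implicit Types (x y : S2 R) (f g u h : S2 R -> R) (psi phi : spinor R).
Local Notation mu := (@dv R).
Local Notation meas f := (measurable_fun [set: S2 R] f).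

Lemma poweR2 (z : \bar R) : (0 <= z)%E -> (z `^ 2 = z ^+ 2)%E.
Proof.
case: z => [r r0||//]; last by rewrite poweRyr // expe2 mulyy.
by rewrite poweR_EFin powR_mulrn -?lee_fin // EFin_expe.
Qed.

Lemma L2norm_expe f : (L2norm f ^+ 2 = \int[mu]_x (f x ^+ 2)%:E)%E.
Proof. by rewrite -L2norm_sq poweR2 // Lnorm_ge0. Qed.

Lemma sqrt_norm_le (a b : \bar R) (N : R) : (a <= N%:E -> b <= N%:E -> 0 <= a -> 0 <= b ->
  (a + b) `^ 2^-1 <= ((2 * N) `^ 2^-1)%:E)%E.
Proof.
move=> aN bN a0 b0; rewrite -poweR_EFin; apply: gt0_ler_poweR.
- by rewrite invr_ge0.
- by rewrite in_itv /= leey andbT adde_ge0.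
- by rewrite in_itv /= leey andbT lee_fin mulr_ge0 // -lee_fin (le_trans a0).
- by rewrite mulrDl !mul1r EFinD leeD.
Qed.

Lemma EFin_le_Rintegral f (c : R) : mu.-integrable setT (EFin \o f) -> \int[mu]_x f x <= c ->
  (\int[mu]_x (f x)%:E <= c%:E)%E.
Proof. by move=> fi; rewrite -lee_fin /Rintegral fineK //; exact: integrable_fin_num. Qed.

Lemma int_le_EFin f g : mu.-integrable setT (EFin \o g) -> meas f -> (forall x, 0 <= f x <= g x) ->
  (\int[mu]_x (f x)%:E <= (\int[mu]_x g x)%:E)%E.
Proof.
move=> ig mf fg; rewrite /Rintegral fineK; last exact: integrable_fin_num.
apply: ge0_le_integral => //.
- by move=> x _; rewrite lee_fin; have /andP[] := fg x.
- exact/measurable_EFinP.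
- exact: measurable_int ig.
- by move=> x _; rewrite lee_fin; have /andP[] := fg x.
Qed.

Lemma ae_eq_RI f g : meas f -> meas g -> {ae mu, forall x, f x = g x} ->
  \int[mu]_x f x = \int[mu]_x g x.
Proof.
move=> mf mg fg; congr fine; apply: ae_eq_integral => //; try exact/measurable_EFinP.
by apply: filterS fg => x /= -> _.
Qed.

Lemma ae_eq_integrable f g : meas f -> meas g -> {ae mu, forall x, f x = g x} ->
  mu.-integrable setT (EFin \o f) -> mu.-integrable setT (EFin \o g).
Proof.
move=> mf mg fg /integrableP[_ fy]; apply/integrableP; split; first exact/measurable_EFinP.
have <- // : (\int[mu]_x `|(EFin \o f) x| = \int[mu]_x `|(EFin \o g) x|)%E.
apply: ae_eq_integral => //.
- by apply/measurable_EFinP; apply: measurableT_comp.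
- by apply/measurable_EFinP; apply: measurableT_comp.
- by apply: filterS fg => x /= -> _.
Qed.

(* With [s = t^{4/7}]: [t^4 = s^7 <= theta^-7 + theta s^8]. *)
Lemma pow4_interp (t theta : R) : 0 <= t -> 0 < theta -> t ^+ 4 <= theta^-1 ^+ 7 + theta * t `^ (32 / 7).
Proof.
move=> t0 th0; set s := t `^ (4 / 7); have s0 : 0 <= s by exact: powR_ge0.
have -> : t ^+ 4 = s ^+ 7.
  by rewrite -powR_mulrn // -[in RHS]powR_mulrn // -powRrM; congr (_ `^ _); field.
have -> : t `^ (32 / 7) = s ^+ 8 by rewrite -powR_mulrn // -powRrM; congr (_ `^ _); field.
have [h|h] := leP 1 (theta * s).
  have -> : theta * s ^+ 8 = (theta * s) * s ^+ 7 by rewrite exprS mulrA.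
  rewrite -[leLHS]add0r; apply: lerD; first by rewrite exprn_ge0 // invr_ge0 ltW.
  by rewrite ler_peMl // exprn_ge0.
rewrite -[leLHS]addr0 lerD ?mulr_ge0 ?exprn_ge0 ?(ltW th0) // ler_pXn2r // ?nnegrE ?invr_ge0 ?(ltW th0) //.
by rewrite -[theta^-1]mul1r ler_pdivlMr // mulrC ltW.
Qed.

Lemma integral_spinor_power psi (K : R) : measurable_spinor psi -> (Lpnorm_spinor (32 / 7) psi <= K%:E)%E ->
  (\int[mu]_x (snorm (psi x) `^ (32 / 7))%:E <= (K `^ (32 / 7))%:E)%E.
Proof.
move=> mpsi lK; have p0 : 32 / 7 != 0 :> R by rewrite gt_eqF // divr_gt0.
have <- : (Lpnorm_spinor (32 / 7) psi `^ (32 / 7) = \int[mu]_x (snorm (psi x) `^ (32 / 7))%:E)%E.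
  rewrite /Lpnorm_spinor (poweR_Lnorm _ _ p0); apply: eq_integral => x _.
  by rewrite -poweR_EFin; congr (_ `^ _)%E; rewrite /= ger0_norm // sqrtr_ge0.
have L0 : (0 <= Lpnorm_spinor (32 / 7) psi)%E by exact: Lnorm_ge0.
rewrite -poweR_EFin; apply: gt0_ler_poweR => //.
- by rewrite in_itv /= leey andbT.
- by rewrite in_itv /= leey andbT (le_trans L0).
Qed.

Lemma smooth_spinor_measurable phi : smooth_spinor phi -> measurable_spinor phi.
Proof. by move=> sm a; have [h1 h2] := sm a; split; exact: Ck0_measurable. Qed.

Lemma measurable_herm psi phi : measurable_spinor psi -> measurable_spinor phi ->
  meas (fun x => complex.Re (herm (psi x) (phi x))).
Proof.
move=> mpsi mphi; under eq_fun do rewrite Re_herm.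
have mm a : meas (fun x => cmp (psi x) a * cmp (phi x) a).
  by apply: measurable_funM; move: a => [|[|[|a]]]; rewrite /cmp;
    have [? ?] := mpsi 0; have [? ?] := mpsi 1; have [? ?] := mphi 0; have [? ?] := mphi 1.
exact: (measurable_funD (measurable_funD (measurable_funD (mm 0%N) (mm 1%N)) (mm 2%N)) (mm 3%N)).
Qed.

Section solution.
Variables (m1 M1 m2 M2 K : R) (h1 h2 u : S2 R -> R) (psi : spinor R).
Hypotheses (m10 : 0 < m1) (m20 : 0 < m2) (ch1 : Ck 1 h1) (ch2 : Ck 1 h2)
  (h1b : forall x, m1 <= h1 x <= M1) (h2b : forall x, m2 <= h2 x <= M2)
  (uH1 : H1 u) (psiH : H12 psi) (sol : weak_solution h1 h2 u psi) (uc : centered u)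
  (psiK : (Lpnorm_spinor (32 / 7) psi <= K%:E)%E).

Definition density : S2 R -> R := fun x => snorm (psi x) ^+ 2.
Definition source (v : S2 R -> R) : S2 R -> R := fun x => h1 x * expR (2 * v x) + h2 x * expR (v x) * density x.
Definition Kp : R := K `^ (32 / 7) + 1.
(** [pow4_interp] with theta = e / Kp, so that the remainder theta |psi|^(32/7) has integral at most
    e; the 1 added in [Kp] keeps theta finite. The absolute value makes the function nonnegative for
    every e. *)
Definition LamK (e : R) : R := `|Kp / e| ^+ 7.

Let Kp0 : 0 < Kp. Proof. by rewrite ltr_wpDl // powR_ge0. Qed.
Let mpsi := psiH.1.1.
Let mh1 : meas h1. Proof. exact: Ck0_measurable (CkW ch1). Qed.
Let mh2 : meas h2. Proof. exact: Ck0_measurable (CkW ch2). Qed.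
Let mt : meas (fun x => snorm (psi x)). Proof. exact: measurable_snorm. Qed.
Let mg : meas density. Proof. by rewrite /density; exact: measurable_funX. Qed.
Let mexp (v : S2 R -> R) : meas v -> meas (fun x => expR (v x)). Proof. exact: measurableT_comp. Qed.
Let mu_ : meas u. Proof. exact: uH1.1.1. Qed.
Let iu := L2_integrable uH1.1.
Let i1 := Ck0_integrable (Ck_cst 0 (1 : R)).
Let g0 x : 0 <= density x. Proof. exact: sqr_ge0. Qed.
Let h10 x : 0 < h1 x. Proof. by have /andP[+ _] := h1b x; exact: lt_le_trans. Qed.
Let h20 x : 0 < h2 x. Proof. by have /andP[+ _] := h2b x; exact: lt_le_trans. Qed.
Let h1M x : h1 x <= M1. Proof. by have /andP[] := h1b x. Qed.
Let h2M x : h2 x <= M2. Proof. by have /andP[] := h2b x. Qed.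

Lemma wgrad_spec : is_weak_grad u (wgrad u).
Proof. by have [_ [G wG]] := uH1; exact: (xgetPex _ (ex_intro _ G wG)). Qed.

Lemma measurable_source (v : S2 R -> R) : meas v -> meas (source v).
Proof.
move=> mv; apply: measurable_funD; apply: measurable_funM => //.
  by apply: mexp; exact: measurable_funM.
by apply: measurable_funM => //; exact: mexp.
Qed.

Lemma source_ge0 (v : S2 R -> R) x : 0 <= source v x.
Proof.
apply: addr_ge0; first exact: mulr_ge0 (ltW (h10 x)) (expR_ge0 _).
exact: mulr_ge0 (mulr_ge0 (ltW (h20 x)) (expR_ge0 _)) (g0 x).
Qed.

Lemma source_weak (phi : S2 R -> R) : smooth phi ->
  \int[mu]_x dot (wgrad u x) (grad phi x) = \int[mu]_x ((source u x - 1) * phi x).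
Proof. by move=> sphi; rewrite (sol.1 phi sphi); apply: eq_RI => x; congr (_ * _); rewrite /source /density; ring. Qed.

Lemma density_integrable : mu.-integrable setT (EFin \o density).
Proof. exact: L2_integrable_sq (L2_snorm psiH.1). Qed.

Lemma source_integrable_bdd (v : S2 R -> R) (C : R) : meas v -> (forall x, `|v x| <= C) -> mu.-integrable setT (EFin \o source v) /\
  forall x, source v x <= M1 * expR (2 * C) + M2 * expR C * density x.
Proof.
move=> mv vC; have H x : source v x <= M1 * expR (2 * C) + M2 * expR C * density x.
  have vx := le_trans (ler_norm _) (vC x).
  have h10' := ltW (h10 x); have h20' := ltW (h20 x).
  apply: lerD; first by apply: ler_pM; rewrite ?expR_ge0 // ler_expR ler_pM2l.
  by apply: ler_wpM2r => //; apply: ler_pM; rewrite ?expR_ge0 // ler_expR.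
split=> //; apply: (le_integrable measurableT _ _ (integrableD measurableT (integrableZl measurableT (M1 * expR (2 * C)) i1)
  (integrableZl measurableT (M2 * expR C) density_integrable))).
  by apply/measurable_EFinP; exact: measurable_source.
move=> x _ /=; rewrite lee_fin ger0_norm ?source_ge0 // mulr1.
by apply: le_trans (H x) (ler_norm _).
Qed.

Lemma source_u_integrable : mu.-integrable setT (EFin \o source u).
Proof.
apply: (source_integrable iu wgrad_spec (measurable_source mu_) (source_ge0 u) source_weak) => c uEc.
have [ic _] := source_integrable_bdd (v := cst c) (C := `|c|) (measurable_cst _) (fun x => lexx _).
apply: ae_eq_integrable ic; try exact: measurable_source.
by apply: filterS uEc => x /= ux; rewrite /source ux.
Qed.

Lemma density_sq (e : R) : 0 < e -> exists r : S2 R -> R,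
  [/\ mu.-integrable setT (EFin \o r), forall x, 0 <= r x, \int[mu]_x r x <= e &
      forall x, density x ^+ 2 <= LamK e + r x].
Proof.
move=> e0; pose th := e / Kp; have th0 : 0 < th by rewrite divr_gt0.
have ip := integral_spinor_power mpsi psiK.
have mp : meas (fun x => snorm (psi x) `^ (32 / 7)).
  by apply: (@measurableT_comp _ _ _ _ _ _ (fun t : R => t `^ (32 / 7))) => //; exact: measurable_powR.
have iq : mu.-integrable setT (EFin \o (fun x => snorm (psi x) `^ (32 / 7))).
  apply/integrableP; split; first exact/measurable_EFinP.
  under eq_integral do rewrite /= ger0_norm ?powR_ge0 //.
  by apply: le_lt_trans ip _; rewrite ltry.
exists (fun x => th * snorm (psi x) `^ (32 / 7)); split.
- exact: (integrableZl measurableT th iq).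
- by move=> x; rewrite mulr_ge0 ?powR_ge0 // ltW.
- rewrite (RintegralZl _ measurableT iq) /th -mulrA ger_pMr // mulrC ler_pdivrMr // mul1r.
  by apply: le_trans (Rintegral_le_EFin iq ip) _; rewrite lerDl.
- move=> x; have := pow4_interp (sqrtr_ge0 _ : 0 <= snorm (psi x)) th0.
  by rewrite /density -exprM /LamK ger0_norm ?divr_ge0 ?(ltW Kp0) ?(ltW e0) // /th invf_div.
Qed.

(** Uniform integrability of |psi|^4 is available because 32/7 > 4, and the centring condition
    extends from the coordinates to every direction y by linearity. *)
Lemma solution_sys : exists c, sys m1 M1 M2 LamK u (source u) density c.
Proof.
have [P4 [c rep]] := representation_pos iu wgrad_spec source_u_integrable source_weak.
have lo x : m1 * expR (2 * u x) <= source u x.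
  rewrite /source -[leLHS]addr0; apply: lerD; last exact: mulr_ge0 (mulr_ge0 (ltW (h20 x)) (expR_ge0 _)) (g0 x).
  by rewrite ler_wpM2r ?expR_ge0 //; have /andP[] := h1b x.
have W2 : mu.-integrable setT (EFin \o (fun x => expR (2 * u x))).
  apply: (le_integrable measurableT _ _ (integrableZl measurableT m1^-1 source_u_integrable)).
    by apply/measurable_EFinP; apply: mexp; exact: measurable_funM.
  move=> x _ /=; rewrite lee_fin ger0_norm ?expR_ge0 // ger0_norm ?mulr_ge0 ?invr_ge0 ?(ltW m10) ?source_ge0 //.
  by rewrite ler_pdivlMl.
have hi x : source u x <= M1 * expR (2 * u x) + M2 * (expR (u x) * density x).
  rewrite /source -mulrA; apply: lerD; first by rewrite ler_wpM2r ?expR_ge0.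
  by rewrite ler_wpM2r //; exact: mulr_ge0 (expR_ge0 _) (g0 x).
exists c; apply: Sys mu_ mg g0 source_u_integrable (source_ge0 u) P4 lo hi rep _ density_sq.
move=> y; have ic i : mu.-integrable setT (EFin \o (fun x => expR (2 * u x) * crd i x)).
    apply: (integrable_mul_bdd (M := 1) W2 (measurable_crd i)) => x.
    by rewrite ler_norml; exact: crd_bound.
  have c0 i : \int[mu]_x (expR (2 * u x) * crd i x) = 0.
    have /eqP := uc.2 i; rewrite mulf_eq0 invr_eq0 mulf_eq0 pnatr_eq0 (gt_eqF (pi_gt0 R)) /= => /eqP //.
  rewrite (eq_RI (g := fun x => pt y 0 0 * (expR (2 * u x) * crd 0 x) + pt y 0 1 * (expR (2 * u x) * crd 1 x)
     + pt y 0 2%:R * (expR (2 * u x) * crd 2%:R x))) => [|x]; last by rewrite sdotE sum3; ring.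
  have iz i := integrableZl measurableT (pt y 0 i) (ic i).
  rewrite (RintegralD measurableT (integrableD measurableT (iz 0) (iz 1)) (iz 2%:R)) (RintegralD measurableT (iz 0) (iz 1)).
  by rewrite !(RintegralZl _ measurableT (ic _)) !c0; ring.
Qed.

Section bounds.
Variable C : R.
Hypothesis uC : {ae mu, forall x, `|u x| <= C}.
Let A := M1 * expR (2 * C).
Let B := M2 * expR C.
Let G := G2 LamK.

(** u is bounded only almost everywhere. This modification is bounded everywhere and may replace u
    in every integral. *)
Let v x := if `|u x| <= C then u x else 0.

Lemma C_ge0 : 0 <= C.
Proof.
rewrite leNgt; apply/negP => C0; have [N [_ mN0 sN]] := uC.
have NT : N = setT by rewrite -subTset => x _; apply: sN => /= h; have := le_lt_trans (le_trans (normr_ge0 _) h) C0; rewrite ltxx.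
have : ((4 * pi)%:E = 0%E :> \bar R) by rewrite -dv_setT -NT.
by move=> []/eqP; rewrite gt_eqF // mulr_gt0 // pi_gt0.
Qed.

Let C0 := C_ge0.
Let M10 : 0 < M1. Proof. exact: lt_le_trans (h10 (pole R)) (h1M _). Qed.
Let M20 : 0 < M2. Proof. exact: lt_le_trans (h20 (pole R)) (h2M _). Qed.
Let A0 : 0 <= A. Proof. exact: mulr_ge0 (ltW M10) (expR_ge0 _). Qed.
Let B0 : 0 <= B. Proof. exact: mulr_ge0 (ltW M20) (expR_ge0 _). Qed.

Let vC x : `|v x| <= C. Proof. by rewrite /v; case: ifP => //; rewrite normr0. Qed.

Let mv : meas v.
Proof.
by apply: measurable_fun_ifT => //; apply: measurable_fun_ler => //; exact: measurableT_comp.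
Qed.

Let uv : {ae mu, forall x, u x = v x}. Proof. by apply: filterS uC => x h; rewrite /v h. Qed.

Let cstI (k : R) : \int[mu]_x k = k * (4 * pi).
Proof. by rewrite Rintegral_cst //= dv_setT. Qed.

Lemma Lam_ge0 e : 0 <= LamK e. Proof. exact: exprn_ge0. Qed.

Lemma density_sq_int : mu.-integrable setT (EFin \o (fun x => density x ^+ 2)) /\ \int[mu]_x density x ^+ 2 <= G.
Proof. by have [c S] := solution_sys; have gG := int_g2_le Lam_ge0 S; split; [exact: ig2 S|]. Qed.

Lemma u_L2_bound : (\int[mu]_x (u x ^+ 2)%:E <= (C ^+ 2 * (4 * pi))%:E)%E.
Proof.
have msq (w : S2 R -> R) : meas w -> measurable_fun setT (fun x => (w x ^+ 2)%:E).
  by move=> mw; apply/measurable_EFinP; exact: measurable_funX.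
have -> : (\int[mu]_x (u x ^+ 2)%:E = \int[mu]_x (v x ^+ 2)%:E)%E.
  by apply: ae_eq_integral => //; [exact: msq|exact: msq|apply: filterS uv => x /= -> _].
rewrite -cstI; apply: int_le_EFin => [||x]; first exact: (Ck0_integrable (Ck_cst 0 (C ^+ 2))).
  by apply/measurable_EFinP; exact: msq.
apply/andP; split; first exact: sqr_ge0.
by rewrite -[v x ^+ 2]real_normK ?num_real // ler_pXn2r // ?nnegrE.
Qed.

Lemma psi_L2_bound : \int[mu]_x density x <= 4 * pi + G.
Proof.
have [ig gG] := density_sq_int; have id := density_integrable.
apply: (@le_trans _ _ (\int[mu]_x (1 + density x ^+ 2))).
  apply: le_Rintegral => //; first exact: (integrableD measurableT i1 ig).
  by move=> x _; have := g0 x; have := sqr_ge0 (density x - 1); nra.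
by rewrite (RintegralD measurableT i1 ig) cstI mul1r lerD.
Qed.

(** From Q = P - 1 with |Q| <= (1 + A) + B |psi|^2, hence Q^2 <= 2 (1 + A)^2 + 2 B^2 |psi|^4,
    inserted in [energy_bound]. *)
Definition energy_const : R := 2 * (halfpow R / (4 * pi)) ^+ 2 * (2 * (1 + A) ^+ 2 * (4 * pi) + 2 * B ^+ 2 * G).

Lemma grad_bound : (\int[mu]_x (vnorm (wgrad u x) ^+ 2)%:E <= energy_const%:E)%E.
Proof.
have [wL wT _] := wgrad_spec.
have sq i : mu.-integrable setT (EFin \o (fun x => wgrad u x 0 i * wgrad u x 0 i)).
  by have := L2_integrable_sq (wL i); apply: eq_integrable => // x _; rewrite /= expr2.
have id : mu.-integrable setT (EFin \o (fun x => dot (wgrad u x) (wgrad u x))).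
  rewrite (_ : (fun x => _) = (fun x => wgrad u x 0 0 * wgrad u x 0 0 + wgrad u x 0 1 * wgrad u x 0 1 + wgrad u x 0 2%:R * wgrad u x 0 2%:R)).
    exact: (integrableD measurableT (integrableD measurableT (sq 0) (sq 1)) (sq 2%:R)).
  by apply/funext => x; rewrite /dot sum3.
have d0 x : 0 <= dot (wgrad u x) (wgrad u x) by apply: sumr_ge0 => i _; rewrite -expr2 sqr_ge0.
under eq_integral do rewrite /vnorm sqr_sqrtr //.
rewrite -(fineK (integrable_fin_num measurableT id)) lee_fin -/(Rintegral mu setT _).
have [iP' P'le] := source_integrable_bdd mv vC; rewrite -/A -/B in P'le.
have [ig gG] := density_sq_int.
have iQ : mu.-integrable setT (EFin \o (fun x => source v x - 1)) by exact: (integrableB measurableT iP' i1).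
have mQ : meas (fun x => source v x - 1) by apply/measurable_EFinP; exact: measurable_int iQ.
have Qle x : (source v x - 1) ^+ 2 <= 2 * (1 + A) ^+ 2 + 2 * B ^+ 2 * density x ^+ 2.
  have Q1 : `|source v x - 1| <= (1 + A) + B * density x.
    have := source_ge0 v x; have := P'le x; have := mulr_ge0 B0 (g0 x); rewrite ler_norml; move: A0; move: (A) (B * _) => a b *; lra.
  apply: (@le_trans _ _ (((1 + A) + B * density x) ^+ 2)).
    by rewrite -real_normK ?num_real // ler_pXn2r // nnegrE (le_trans _ Q1).
  have := sqr_ge0 ((1 + A) - B * density x); rewrite -mulrA -exprMn; move: (1 + A) (B * density x) => a b; nra.
have ib := integrableD measurableT (integrableZl measurableT (2 * (1 + A) ^+ 2) i1) (integrableZl measurableT (2 * B ^+ 2) ig).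
have iQ2 : mu.-integrable setT (EFin \o (fun x => (source v x - 1) ^+ 2)).
  apply: (le_integrable measurableT _ _ ib); first by apply/measurable_EFinP; exact: measurable_funX.
  by move=> x _ /=; rewrite lee_fin ger0_norm ?sqr_ge0 // mulr1; apply: le_trans (Qle x) (ler_norm _).
have weak (phi : S2 R -> R) : smooth phi -> \int[mu]_x dot (wgrad u x) (grad phi x) = \int[mu]_x ((source v x - 1) * phi x).
  move=> sphi; have mphi := Ck0_measurable (sphi 0%N); rewrite (source_weak sphi); apply: ae_eq_RI.
  - apply: measurable_funM => //; apply: measurable_funB => //; exact: measurable_source.
  - exact: measurable_funM.
  - by apply: filterS uv => x ux; rewrite /source ux.
apply: le_trans (energy_bound iu wgrad_spec iQ iQ2 weak) _.
rewrite /energy_const; apply: ler_wpM2l; first by rewrite mulr_ge0 ?sqr_ge0.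
apply: (@le_trans _ _ (\int[mu]_x (2 * (1 + A) ^+ 2 * 1 + 2 * B ^+ 2 * density x ^+ 2))).
  by apply: le_Rintegral => // x _; rewrite mulr1; exact: Qle.
rewrite (RintegralD measurableT (integrableZl measurableT _ i1) (integrableZl measurableT _ ig)).
rewrite (RintegralZl _ measurableT i1) (RintegralZl _ measurableT ig) cstI mul1r.
by apply: lerD => //; apply: ler_wpM2l => //; rewrite mulr_ge0 ?sqr_ge0.
Qed.

Lemma absdirac_spec : is_absdirac_half psi (absdirac_half psi).
Proof. by have [_ [eta heta]] := psiH; exact: (xgetPex _ (ex_intro _ eta heta)). Qed.

Lemma eta_bound : \int[mu]_x snorm (absdirac_half psi x) ^+ 2 <= B ^+ 2 * (4 * pi + G).
Proof.
have mw (w : S2 R -> R) : meas w -> meas (fun x => h2 x * expR (w x)) by move=> mw; apply: measurable_funM => //; exact: mexp.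
have wB x : `|h2 x * expR (v x)| <= B.
  rewrite ger0_norm; last exact: mulr_ge0 (ltW (h20 x)) (expR_ge0 _).
  apply: ler_pM; rewrite ?expR_ge0 ?(ltW (h20 x)) // ler_expR.
  exact: le_trans (ler_norm _) (vC x).
apply: (le_trans (absdirac_half_bound (mw _ mv) wB psiH.1 absdirac_spec _)).
  move=> phi sphi; have mphi := smooth_spinor_measurable sphi.
  have /(congr1 (@complex.Re R)) := sol.2 phi sphi => /= ->; apply: ae_eq_RI.
  - under eq_fun do rewrite Re_scale; apply: measurable_funM (mw _ mu_) _; exact: measurable_herm.
  - under eq_fun do rewrite Re_scale; apply: measurable_funM (mw _ mv) _; exact: measurable_herm.
  - by apply: filterS uv => x ->.
by rewrite ler_wpM2l ?sqr_ge0 //; exact: psi_L2_bound.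
Qed.

End bounds.

End solution.
End uniform_bound.

Theorem proposition1p10 (R : realType)
    (h1_ h2_ : nat -> S2 R -> R) (h1 h2 : S2 R -> R) (m1 M1 m2 M2 : R)
    (u : nat -> S2 R -> R) (psi : nat -> spinor R)
    (h1_cvg : cvg_C1 h1_ h1) (h2_cvg : cvg_C1 h2_ h2)
    (m1_gt0 : 0 < m1) (m2_gt0 : 0 < m2)
    (h1_bound : forall n x, m1 <= h1_ n x <= M1)
    (h2_bound : forall n x, m2 <= h2_ n x <= M2)
    (u_H1 : forall n, H1 (u n)) (psi_H12 : forall n, H12 (psi n))
    (sol : forall n, weak_solution (h1_ n) (h2_ n) (u n) (psi n))
    (u_centered : forall n, centered (u n))
    (psi_bound : exists K : R, forall n,
       (Lpnorm_spinor (32 / 7) (psi n) <= K%:E)%E) :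
  exists C : R, forall n,
    [/\ (H1norm (u n) + H12norm (psi n) <= C%:E)%E,
        {ae @dv R, forall x, - C <= u n x} &
        (\int[@dv R]_x (vnorm (wgrad (u n) x) ^+ 2)%:E <= C%:E)%E].
Proof.
have [K HK] := psi_bound.
have M10 : 0 < M1 by have /andP[+ /(lt_le_trans _)] := h1_bound 0 (pole R) => /(lt_le_trans m1_gt0) h; apply.
have M20 : 0 < M2 by have /andP[+ /(lt_le_trans _)] := h2_bound 0 (pole R) => /(lt_le_trans m2_gt0) h; apply.
have [C HC] := sys_bounded m1_gt0 M10 M20 (Lam_ge0 K).
have uC n : {ae @dv R, forall x, `|u n x| <= C}.
  have [c S] := solution_sys m1_gt0 m2_gt0 (h1_cvg.1 n) (h2_cvg.1 n) (h1_bound n) (h2_bound n) (u_H1 n) (psi_H12 n)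
    (sol n) (u_centered n) (HK n).
  exact: HC S.
have uL n := u_L2_bound (u_H1 n) (uC n).
have gL n := grad_bound m1_gt0 m2_gt0 (h1_cvg.1 n) (h2_cvg.1 n) (h1_bound n) (h2_bound n) (u_H1 n) (psi_H12 n)
    (sol n) (u_centered n) (HK n) (uC n).
have pL n := psi_L2_bound m1_gt0 m2_gt0 (h1_cvg.1 n) (h2_cvg.1 n) (h1_bound n) (h2_bound n) (u_H1 n) (psi_H12 n)
    (sol n) (u_centered n) (HK n).
have eL n := eta_bound m1_gt0 m2_gt0 (h1_cvg.1 n) (h2_cvg.1 n) (h1_bound n) (h2_bound n) (u_H1 n) (psi_H12 n)
    (sol n) (u_centered n) (HK n) (uC n).
set UC : R := C ^+ 2 * (4 * pi) in uL; set EC : R := energy_const M1 M2 K C in gL.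
set PC : R := 4 * pi + G2 (LamK K) in pL eL; set BC : R := _ * PC in eL.
pose N1 := Num.max UC EC; pose N2 := Num.max PC BC.
have C0 : 0 <= C := C_ge0 (uC 0%N).
have EC0 : 0 <= EC.
  by rewrite -lee_fin; apply: le_trans (gL 0%N); apply: integral_ge0 => x _; rewrite lee_fin sqr_ge0.
(* The four summands are nonnegative, so one constant dominates the sum of the norms, the bound from
   below and the energy. *)
exists ((2 * N1) `^ 2^-1 + (2 * N2) `^ 2^-1 + C + EC) => n.
have S1 : (H1norm (u n) <= ((2 * N1) `^ 2^-1)%:E)%E.
  apply: sqrt_norm_le; rewrite L2norm_expe.
  - by apply: le_trans (uL n) _; rewrite lee_fin le_max lexx.
  - by apply: le_trans (gL n) _; rewrite lee_fin le_max lexx orbT.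
  - by apply: integral_ge0 => x _; rewrite lee_fin sqr_ge0.
  - by apply: integral_ge0 => x _; rewrite lee_fin sqr_ge0.
have Lp2 phi : Lpnorm_spinor 2 phi = L2norm (fun x => snorm (phi x)) by [].
have S2 : (H12norm (psi n) <= ((2 * N2) `^ 2^-1)%:E)%E.
  apply: sqrt_norm_le; rewrite Lp2 L2norm_expe.
  - apply: le_trans (EFin_le_Rintegral (L2_integrable_sq (L2_snorm (psi_H12 n).1)) (pL n)) _.
    by rewrite lee_fin le_max lexx.
  - apply: le_trans (EFin_le_Rintegral (L2_integrable_sq (L2_snorm (absdirac_spec (psi_H12 n)).1)) (eL n)) _.
    by rewrite lee_fin le_max lexx orbT.
  - by apply: integral_ge0 => x _; rewrite lee_fin sqr_ge0.
  - by apply: integral_ge0 => x _; rewrite lee_fin sqr_ge0.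
have R1 : 0 <= (2 * N1) `^ 2^-1 by exact: powR_ge0.
have R2 : 0 <= (2 * N2) `^ 2^-1 by exact: powR_ge0.
split.
- by apply: le_trans (leeD S1 S2) _; rewrite -EFinD lee_fin; lra.
- apply: filterS (uC n) => x; rewrite ler_norml => /andP[h _]; apply: le_trans h; lra.
- by apply: le_trans (gL n) _; rewrite lee_fin; lra.
Qed.
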